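(* Let $f\in L^2(\Omega)$. Let $u\in \mathring{H}^1_L(\mathcal C_T,y^a)$ satisfy $$\int_{\mathcal C_T} B(x)\nabla u\cdot\nabla\psi\, y^a\,d\mathbf x=\int_\Omega c_s f(x)\psi(x,0)\,dx\quad\text{for all }\psi\in \mathring{H}^1_L(\mathcal C_T,y^a),$$ and let $u_H^{ms}\in V_H^{ms}$ satisfy $$\int_{\mathcal C_T} B(x)\nabla u_H^{ms}\cdot\nabla v\, y^a\,d\mathbf x=\int_\Omega c_s f(x)v(x,0)\,dx\quad\text{for all }v\in V_H^{ms}.$$ Then $$\|\nabla u-\nabla u_H^{ms}\|_{L^2(\mathcal C_T,y^a)}\lesssim H^{s}\,\|f\|_{L^2(\Omega)}.$$
   Context: Setting. $\Omega\subset\mathbb R^d$ ($d\ge1$) is a bounded, open, connected Lipschitz domain, $s\in(0,1)$, $a=1-2s\in(-1,1)$, $c_s=2^{1-2s}\Gamma(1-s)/\Gamma(s)$. $A\in (L^\infty(\Omega))^{d\times d}$ is symmetric with $\alpha|\xi|^2\le A(x)\xi\cdot\xi\le\beta|\xi|^2$ for all $x\in\Omega$, $\xi\in\mathbb R^d$ ($\alpha,\beta>0$), and $B(x)=\begin{pmatrix}A(x)&0\\0&1\end{pmatrix}\in\mathbb R^{(d+1)\times(d+1)}$. For $T>0$ put $\mathcal C_T=\Omega\times(0,T)$, with points $\mathbf x=(x,y)$, and $\partial_L\mathcal C_T=(\partial\Omega\times[0,T])\cup(\Omega\times\{T\})$; $\Omega$ is identified with $\Omega\times\{0\}$. $\|u\|_{L^2(\omega,y^a)}^2=\int_\omega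 u^2y^a\,d\mathbf x$, $\|u\|_{H^1(\omega,y^a)}^2=\|u\|^2_{L^2(\omega,y^a)}+\|\nabla u\|^2_{L^2(\omega,y^a)}$, with $\nabla=(\nabla_x,\partial_y)$, and $\mathring H^1_L(\mathcal C_T,y^a)=\{u\in H^1(\mathcal C_T,y^a):u=0\text{ on }\partial_L\mathcal C_T\}$. Values $u(x,0)$ are understood as traces. Mesh. $\mathcal T_{\mathcal C_T}$ is a quasi-uniform, shape-regular simplicial mesh of $\mathcal C_T$ with characteristic mesh size $H$. Its set of nodes $\mathcal N$ splits into the Dirichlet nodes (those on $\partial_L\mathcal C_T$), the free nodes $\mathcal N_\Omega$ on $\Omega$, and the remaining interior nodes $\mathcal N_{int}$. $S_H$ is the space of continuous piecewise $\mathbb P_1$ functions on $\mathcal T_{\mathcal C_T}$, with nodal basis functions $\lambda_{\mathbf v}$ ($\mathbf v\in\mathcal N$), and $V_H=S_H\cap\mathring H^1_L(\mathcal C_T,y^a)$. $\omega_{\mathbf v}$ is the union of elements containing $\mathbf v$ (the support of $\lambda_{\mathbf v}$), and for $\mathbf v\in\mathcal N_\Omega$, $\partial\omega_{\mathbf v}=\operatorname{supp}(\lambda_{\mathbf v}(\cdot,0))\cap\Omega$. $V_H|_\omega$ denotes restrictions (traces) of $V_H$ to $\omega$. Quasi-interpolation. For $\mathbf v\in\mathcal N_{int}$, $\mathcal P_{\mathbf v}u\in V_H|_{\omega_{\mathbf v}}$ is defined by $\int_{\omega_{\mathbf v}}(\mathcal P_{\mathbf v}u)v_Hy^a\,d\mathbf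 x=\int_{\omega_{\mathbf v}}u\,v_Hy^a\,d\mathbf x$ for all $v_H\in V_H|_{\omega_{\mathbf v}}$; for $\mathbf v\in\mathcal N_\Omega$, $\mathcal P^\Omega_{\mathbf v}u\in V_H|_{\partial\omega_{\mathbf v}}$ is defined by $\int_{\partial\omega_{\mathbf v}}(\mathcal P^\Omega_{\mathbf v}u)v_H\,dx=\int_{\partial\omega_{\mathbf v}}u\,v_H\,dx$ for all $v_H\in V_H|_{\partial\omega_{\mathbf v}}$. Then $\mathcal I_H:\mathring H^1_L(\mathcal C_T,y^a)\to V_H$, $\mathcal I_Hu=\sum_{\mathbf v\in\mathcal N_{int}}(\mathcal P_{\mathbf v}u)(\mathbf v)\lambda_{\mathbf v}+\sum_{\mathbf v\in\mathcal N_\Omega}(\mathcal P^\Omega_{\mathbf v}u)(\mathbf v)\lambda_{\mathbf v}$. Ideal multiscale space. $V^f=\{v\in\mathring H^1_L(\mathcal C_T,y^a):\mathcal I_Hv=0\}$. For $v_H\in V_H$, $Q_{\mathcal C_T}(v_H)\in V^f$ is defined by $\int_{\mathcal C_T}B\nabla Q_{\mathcal C_T}(v_H)\cdot\nabla w\,y^a\,d\mathbf x=\int_{\mathcal C_T}B\nabla v_H\cdot\nabla w\,y^a\,d\mathbf x$ for all $w\in V^f$. $V_H^{ms}=\{v_H-Q_{\mathcal C_T}(v_H):v_H\in V_H\}$. Convention. $b\lesssim c$ means $b\le Cc$ with $C>0$ independent of the mesh parameters (in particular of $H$) and of the functions involved, but possibly depending on the domain, the dimension, $s$, $\alpha$,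 $\beta$ (but not on variations of $A$) and on the shape-regularity/quasi-uniformity of the mesh. *)

(* Defs.v *)
From HB Require Import structures.
From mathcomp Require Import all_boot all_order all_algebra.
From mathcomp Require Import all_classical all_reals all_analysis.

Set Implicit Arguments.
Unset Strict Implicit.
Unset Printing Implicit Defensive.

Import Order.TTheory GRing.Theory Num.Theory.
Import numFieldNormedType.Exports.

Local Open Scope classical_set_scope.
Local Open Scope ring_scope.

(* Row vectors carry the product sigma-algebra, generated by the coordinates;
   for real coordinates it is the Borel sigma-algebra. *)
Section measurable_rV.
Context {disp} {T : sigmaRingType disp} (n : nat).

Let coord (i : 'I_n) (x : 'rV[T]_n) : T := x ord0 i.

Let rV_set0 : g_sigma_preimage coord set0.
Proof. exact: sigma_algebra0. Qed.

Let rV_setC A : g_sigma_preimage coord A -> g_sigma_preimage coord (~` A).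
Proof. exact: sigma_algebraC. Qed.

Let rV_bigcup (F : (set 'rV[T]_n)^nat) :
  (forall i, g_sigma_preimage coord (F i)) ->
  g_sigma_preimage coord (\bigcup_i (F i)).
Proof. exact: sigma_algebra_bigcup. Qed.

HB.instance Definition _ := @isMeasurable.Build (measure_tuple_display disp)
  ('rV[T]_n) (g_sigma_preimage coord) rV_set0 rV_setC rV_bigcup.

End measurable_rV.

Section lebesgue_rV.
Context {R : realType}.

Definition cons_rV n (p : 'rV[R]_n * R) : 'rV[R]_n.+1 :=
  row_mx (p.2%:M : 'rV_1) p.1.

Lemma measurable_cons_rV n : measurable_fun [set: 'rV[R]_n * R] (@cons_rV n).
Proof.
pose G := \big[setU/set0]_(i < n.+1)
  preimage_set_system [set: 'rV[R]_n.+1] (fun x => x ord0 i) measurable.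
apply: (@measurability _ _ _ _ _ _ G) => //.
rewrite /G -bigcup_seq => _ [_ [i /= _ [B mB <-]] <-].
rewrite !setTI -comp_preimage -[X in measurable X]setTI.
suff : measurable_fun [set: 'rV[R]_n * R] (fun p => cons_rV p ord0 i) by exact.
case: (split_ordP (i : 'I_(1 + n))) => j ij.
  suff -> : (fun p : 'rV[R]_n * R => cons_rV p ord0 i) = snd by [].
  apply/funext => p; rewrite ij; apply: etrans (row_mxEl _ _ _ _) _.
  by rewrite mxE !ord1.
have -> : (fun p : 'rV[R]_n * R => cons_rV p ord0 i) =
    (fun x : 'rV[R]_n => x ord0 j) \o fst.
  by apply/funext => p; rewrite ij; exact: row_mxEr.
apply: measurableT_comp => //.
move=> _ Y mY; rewrite setTI; apply: sub_sigma_algebra => /=.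
rewrite -bigcup_seq/=; exists j => /=; first by rewrite mem_index_enum.
by exists Y => //; rewrite setTI.
Qed.

(* Lebesgue measure on R^n, by iterated products. *)
Fixpoint leb n : set 'rV[R]_n -> \bar R :=
  match n with
  | 0 => \d_(0 : 'rV[R]_0)
  | m.+1 => pushforward (@leb m \x lebesgue_measure)%E (@cons_rV m)
  end.
Arguments leb n _ : clear implicits.

Let leb_measure n :
  [/\ leb n set0 = 0%E, forall A, (0 <= leb n A)%E & semi_sigma_additive (leb n)].
Proof.
elim: n => [|n [l0 lge0 lsig]] /=.
  split; [exact: measure0|exact: measure_ge0|exact: measure_semi_sigma_additive].
pose l := HB.pack_for {measure set 'rV[R]_n -> \bar R} (leb n)
  (isMeasure.Build _ _ _ (leb n) l0 lge0 lsig).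
have ml : measurable_fun [set: 'rV[R]_n * R] (@cons_rV n).
  exact: measurable_cons_rV.

pose p := measure_function_pushforward__canonical__measure_function_Measure
  (l \x (@lebesgue_measure R))%E ml.
split; first exact: (measure0 p).
- exact: (measure_ge0 p).
- exact: (@measure_semi_sigma_additive _ _ _ p).
Qed.

HB.instance Definition _ n := isMeasure.Build _ _ _ (leb n)
  (let: And3 h _ _ := leb_measure n in h)
  (let: And3 _ h _ := leb_measure n in h)
  (let: And3 _ _ h := leb_measure n in h).

End lebesgue_rV.
Arguments leb {R} n _.


(* The library's norm on row vectors and on products is the sup norm; the
   Euclidean one is introduced here. *)
Section euclidean.
Context {R : realType} (d : nat).

(* [measurableTypeR R] is R, as the library types its Lebesgue measure. *)
Definition vol : {measure set ('rV[R]_d * measurableTypeR R) -> \bar R} :=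
  (leb d \x lebesgue_measure)%E.

Definition dotv (x y : 'rV[R]_d) : R := \sum_i x ord0 i * y ord0 i.
Definition normv (x : 'rV[R]_d) : R := Num.sqrt (dotv x x).

Definition dotp (p q : 'rV[R]_d * R) : R := dotv p.1 q.1 + p.2 * q.2.
Definition normp (p : 'rV[R]_d * R) : R := Num.sqrt (dotp p p).

End euclidean.
Arguments vol {R} d.

Section domains.
Context {R : realType} (d : nat).
Local Notation E := ('rV[R]_d * R)%type.
Implicit Type Omega : set 'rV[R]_d.

(* [x - dotv x e *: e] is the component of x orthogonal to e, so [zeta] is a
   function of the d - 1 coordinates orthogonal to the direction e. *)
Definition lipschitz_domain Omega : Prop :=
  [/\ bounded_set Omega, open Omega, connected Omega, Omega !=set0 &
   forall x0, (closure Omega `\` Omega) x0 ->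
   exists (e : 'rV[R]_d) (r : R) (zeta : 'rV[R]_d -> R^o),
   [/\ dotv e e = 1, 0 < r, lipschitz zeta &
     forall x, normv (x - x0) < r ->
       (Omega x <-> zeta (x - dotv x e *: e) < dotv x e)]].

Definition cylinder Omega (T : R) : set E :=
  [set z | Omega z.1 /\ 0 < z.2 < T].

Definition lateral_boundary Omega (T : R) : set E :=
  [set z | ((closure Omega `\` Omega) z.1 /\ 0 <= z.2 <= T) \/
           (Omega z.1 /\ z.2 = T)].

Definition elliptic Omega (alpha beta : R) (A : 'rV[R]_d -> 'M[R]_d) : Prop :=
  [/\ forall i j, measurable_fun Omega (fun x => A x i j),
      forall i j, exists M : R, {ae leb d, forall x, Omega x -> `|A x i j| <= M},
      forall x, Omega x -> (A x)^T = A x &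
      forall x, Omega x -> forall xi : 'rV[R]_d,
        alpha * dotv xi xi <= dotv (xi *m (A x)^T) xi <= beta * dotv xi xi].

End domains.

Section sobolev.
Context {R : realType} (d : nat).
Local Notation E := ('rV[R]_d * R)%type.
Implicit Types (D : set E) (u w : E -> R).

Definition smooth (phi : E -> R) : Prop := forall (vs : seq E) (z : E),
  differentiable (foldr (fun v g => 'D_v g) (phi : E -> R^o) vs) z.

Definition test_function D (phi : E -> R) : Prop :=
  [/\ smooth phi, compact (closure [set z | phi z != 0]) &
      closure [set z | phi z != 0] `<=` D].

Definition locally_integrable_on D u : Prop :=
  forall K, compact K -> K `<=` D -> (vol d).-integrable K (EFin \o u).

Definition is_weak_gradient D u (g : E -> E) : Prop :=
  locally_integrable_on D u /\
  forall v : E, locally_integrable_on D (fun z => dotp (g z) v) /\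
  forall phi, test_function D phi ->
    \int[vol d]_(z in D) (u z * 'D_v (phi : E -> R^o) z) =
    - \int[vol d]_(z in D) (dotp (g z) v * phi z).

(* A representative of the weak gradient, when there is one. *)
Definition wgrad D u : E -> E :=
  xget (cst (0, 0)) [set g | is_weak_gradient D u g].

Section weighted.
Variable (a : R).

Definition L2w D u : Prop := measurable_fun D u /\
  (vol d).-integrable D (EFin \o (fun z => u z ^+ 2 * z.2 `^ a)).

Definition L2w_norm D u : R :=
  Num.sqrt (\int[vol d]_(z in D) (u z ^+ 2 * z.2 `^ a)).

Definition L2w_vnorm D (g : E -> E) : R :=
  Num.sqrt (\int[vol d]_(z in D) (dotp (g z) (g z) * z.2 `^ a)).

Definition H1w D u : Prop :=
  [/\ L2w D u, exists g, is_weak_gradient D u g &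
      forall v, L2w D (fun z => dotp (wgrad D u z) v)].

Definition H1w_norm D u : R :=
  Num.sqrt (L2w_norm D u ^+ 2 + L2w_vnorm D (wgrad D u) ^+ 2).

End weighted.

Definition L2 (Om : set 'rV[R]_d) (f : 'rV[R]_d -> R) : Prop :=
  measurable_fun Om f /\ (leb d).-integrable Om (EFin \o (fun x => f x ^+ 2)).

Definition L2_norm (Om : set 'rV[R]_d) (f : 'rV[R]_d -> R) : R :=
  Num.sqrt (\int[leb d]_(x in Om) (f x ^+ 2)).

End sobolev.

Section cylinder_space.
Context {R : realType} (d : nat) (Omega : set 'rV[R]_d) (T a : R).
Local Notation E := ('rV[R]_d * R)%type.
Local Notation CT := (cylinder Omega T).
Implicit Types (u w : E -> R).

(* Boundary values are taken in the sense of traces, i.e. as limits of the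
   boundary values of functions smooth up to the boundary. *)
Definition smooth_approx (phi : nat -> E -> R) u : Prop :=
  (forall n, smooth (phi n)) /\
  (H1w_norm a CT (phi n \- u) @[n --> \oo] --> (0 : R)).

Definition H1L u : Prop := H1w a CT u /\
  exists phi, smooth_approx phi u /\
    forall n z, lateral_boundary Omega T z -> phi n z = 0.

Definition is_trace u (g : 'rV[R]_d -> R) : Prop := L2 Omega g /\
  exists phi, smooth_approx phi u /\
    (L2_norm Omega (fun x => phi n (x, 0) - g x) @[n --> \oo] --> (0 : R)).

Definition trace u : 'rV[R]_d -> R := xget (cst 0) [set g | is_trace u g].

(* [Bmul A] is multiplication by the block-diagonal matrix diag(A, 1). *)
Definition Bmul (A : 'M[R]_d) (p : E) : E := (p.1 *m A^T, p.2).

Definition bform (A : 'rV[R]_d -> 'M[R]_d) u w : R :=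
  \int[vol d]_(z in CT)
    (dotp (Bmul (A z.1) (wgrad CT u z)) (wgrad CT w z) * z.2 `^ a).

Definition load (c : R) (f : 'rV[R]_d -> R) w : R :=
  \int[leb d]_(x in Omega) (c * f x * trace w x).

End cylinder_space.

Section constants.
Context {R : realType}.

Definition Gamma (x : R) : R :=
  \int[lebesgue_measure]_(t in `]0, +oo[) (t `^ (x - 1) * expR (- t)).

Definition c_frac (s : R) : R := 2 `^ (1 - 2 * s) * Gamma (1 - s) / Gamma s.

End constants.

Section mesh.
Context {R : realType} (d : nat).
Local Notation E := ('rV[R]_d * R)%type.

(* A (d+1)-simplex is given by its d + 2 vertices, a mesh by a finite list of
   simplices. *)
Definition simplex := {ffun 'I_d.+2 -> E}.
Implicit Types (K L : simplex) (M : seq simplex).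

Definition nondegenerate K : Prop := forall c : 'I_d.+2 -> R,
  \sum_i c i = 0 -> \sum_i c i *: K i = 0 -> forall i, c i = 0.

Definition face K (S : pred 'I_d.+2) : set E :=
  [set z | exists t : 'I_d.+2 -> R,
    [/\ forall i, 0 <= t i, forall i, ~~ S i -> t i = 0,
        \sum_i t i = 1 & z = \sum_i t i *: K i]].

Definition hull K : set E := face K xpredT.

Definition triangulates M (D : set E) : Prop :=
  [/\ forall K, K \in M -> nondegenerate K,
      closure D = \bigcup_(K in [set` M]) hull K &
      forall K L, K \in M -> L \in M ->
        hull K `&` hull L = face K [pred i | K i \in codom L]].

Definition diam (S : set E) : R := sup [set normp (x - y) | x in S & y in S].

Definition mesh_size M : R := \big[Num.max/0]_(K <- M) diam (hull K).

Definition shape_regular (gamma : R) M : Prop := forall K, K \in M ->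
  exists (c : E) (r : R), [/\ 0 < r,
    [set z | normp (z - c) <= r] `<=` hull K & diam (hull K) <= gamma * r].

Definition quasi_uniform (sigma : R) M : Prop :=
  forall K, K \in M -> mesh_size M <= sigma * diam (hull K).

Definition nodes M : seq E := undup [seq K i | K <- M, i <- enum 'I_d.+2].

End mesh.

Section multiscale.
Context {R : realType} (d : nat) (Omega : set 'rV[R]_d) (T a : R)
  (M : seq (simplex (R := R) d)).
Local Notation E := ('rV[R]_d * R)%type.
Local Notation CT := (cylinder Omega T).
Implicit Types (u v w p : E -> R) (z : E).

(* Finite element functions live on the closure of the cylinder; they are
   extended by 0 to the whole space. *)
Definition SH v : Prop :=
  [/\ {within closure CT, continuous (v : E -> R^o)},
      forall K, K \in M -> exists (g : E) (c : R),
        forall z, hull K z -> v z = dotp g z + c &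
      forall z, ~ closure CT z -> v z = 0].

Definition VH v : Prop := SH v /\ H1L Omega T a v.

Definition hat z0 : E -> R := xget (cst 0) [set l | [/\ SH l, l z0 = 1 &
  forall z, z \in nodes M -> z != z0 -> l z = 0]].

Definition node_Omega z : Prop := Omega z.1 /\ z.2 = 0.
Definition node_int z : Prop :=
  ~ lateral_boundary Omega T z /\ ~ node_Omega z.

(* The part in the open cylinder of the union of the elements having z0 as a
   vertex; the rest of that union is a null set. *)
Definition patch z0 : set E :=
  CT `&` \bigcup_(K in [set K | K \in M /\ z0 \in codom K]) hull K.

Definition patch_Omega z0 : set 'rV[R]_d :=
  closure [set x | hat z0 (x, 0) != 0] `&` Omega.

Definition VH_on (D : set E) p : Prop :=
  exists2 v, VH v & forall z, D z -> p z = v z.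
Definition VH_trace_on (D : set 'rV[R]_d) (p : 'rV[R]_d -> R) : Prop :=
  exists2 v, VH v & forall x, D x -> p x = v (x, 0).

Definition proj_int z0 u : E -> R := xget (cst 0) [set p |
  VH_on (patch z0) p /\ forall v, VH_on (patch z0) v ->
    \int[vol d]_(z in patch z0) (p z * v z * z.2 `^ a) =
    \int[vol d]_(z in patch z0) (u z * v z * z.2 `^ a)].

Definition proj_Omega z0 u : 'rV[R]_d -> R := xget (cst 0) [set p |
  VH_trace_on (patch_Omega z0) p /\ forall q, VH_trace_on (patch_Omega z0) q ->
    \int[leb d]_(x in patch_Omega z0) (p x * q x) =
    \int[leb d]_(x in patch_Omega z0) (trace Omega T a u x * q x)].

Definition IH u : E -> R := fun z =>
  \sum_(z0 <- nodes M | `[< node_int z0 >]) proj_int z0 u z0 * hat z0 z +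
  \sum_(z0 <- nodes M | `[< node_Omega z0 >]) proj_Omega z0 u z0.1 * hat z0 z.

Definition Vf w : Prop := H1L Omega T a w /\ IH w = cst 0.

Definition is_corrector (A : 'rV[R]_d -> 'M[R]_d) v q : Prop :=
  Vf q /\ forall w, Vf w ->
    bform Omega T a A q w = bform Omega T a A v w.

Definition Vms (A : 'rV[R]_d -> 'M[R]_d) u : Prop :=
  exists v q, [/\ VH v, is_corrector A v q & u = v \- q].

End multiscale.

(* Main.v *)
(* Put [v = IH u - Q (IH u)] with [Q] the corrector, and [w = u - v]. Since the
   quasi-interpolant is a projection, [w] lies in the fine space V^f, which is
   orthogonal to V_H^ms for the energy form; hence the error of the multiscale
   solution has the same energy as [w], and that energy is [load w]. Everything
   therefore reduces to the bound |tr w|_{L2(Omega)} <= C H^s |grad w| on V^f.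

   The trace of [w], extended by 0 outside [Omega], satisfies
   |g(. + h) - g|^2 <= C H^{2s} |grad w|^2 for |h| <= C H: compare both sides with
   the values of [w] on the layer 0 < y < c H. To pass from differences to [g]
   itself, fix a point x. If a point outside [Omega] lies within distance 3 H of
   x, then the Lipschitz condition makes g(x + h) vanish for a proportion of the
   |h| <= 6 H. Otherwise x is close to a free node z on the base, and the Riesz
   kernel k of the evaluation at z on the trace space of its patch satisfies
   int k = 1, int k g = 0 and int k^2 <= C H^{-d}, so that g(x)^2 is at most
   C H^{-d} int |g(x + h) - g(x)|^2 dh.

   The hat functions of free nodes must be shown to lie in H1L. They are
   approximated by a smooth quasi-interpolant that reproduces affine functions,
   so that its gradient is exact away from the faces of the mesh. *)

Require Import Defs.
From HB Require Import structures.
From mathcomp Require Import all_boot all_order all_algebra.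
From mathcomp Require Import all_classical all_reals all_analysis.
From mathcomp Require Import measurable_realfun.
From mathcomp Require Import ring lra.
Set Implicit Arguments.
Unset Strict Implicit.
Unset Printing Implicit Defensive.
Import Order.TTheory GRing.Theory Num.Theory.
Import numFieldNormedType.Exports.
Local Open Scope classical_set_scope.
Local Open Scope ring_scope.

(** * Lebesgue measure on row vectors *)

Section measure_rV.
Context {R : realType}.

(** The exponent comes from scaling. On a layer of height q the weighted Cauchy-Schwarz inequality
    gives q^2 |grad w|^2 for the vertical comparison and |h|^2 |grad w|^2 for the horizontal one,
    while a fibre of the layer has weight of order q^(1+a); with q and |h| of order H the quotient
    is H^(1-a) = H^(2s). The bound on the kernel is elementary: its squared norm is a nodal value at
    z, and a finite element function is recovered at z by linear extrapolation from the patch. Near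
    the lateral wall this argument fails, since the functions of [VH] vanish there and none equals 1
    on the patch. The Lipschitz condition replaces it at the scale of the mesh, with constants made
    uniform by compactness of the boundary and by an a priori bound on the mesh size. Functions are
    not identified almost everywhere, and gradients, traces and projections are chosen by [xget].
    Hence the forms are only positive semidefinite, the Riesz theorems are stated for such forms,
    and chosen gradients and traces need existence together with uniqueness up to null sets. *)

Lemma measurable_coord n (i : 'I_n) :
  measurable_fun [set: 'rV[R]_n] (fun x : 'rV[R]_n => x ord0 i).
Proof.
move=> _ Y mY; rewrite setTI; apply: sub_sigma_algebra => /=.
rewrite -bigcup_seq/=; exists i => /=; first by rewrite mem_index_enum.
by exists Y => //; rewrite setTI.
Qed.

Lemma measurable_fun_rV d (T : measurableType d) n (D : set T) (f : T -> 'rV[R]_n) :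
  measurable D ->
  (forall i, measurable_fun D (fun x => f x ord0 i)) -> measurable_fun D f.
Proof.
move=> mD mf.
pose G := \big[setU/set0]_(i < n)
  preimage_set_system [set: 'rV[R]_n] (fun x => x ord0 i) measurable.
apply: (@measurability _ _ _ _ _ _ G) => //.
rewrite /G -bigcup_seq => _ [_ [i /= _ [B mB <-]] <-].
by rewrite setTI -comp_preimage; apply: mf.
Qed.

Lemma cons_rV0 n (p : 'rV[R]_n * R) : cons_rV p ord0 ord0 = p.2.
Proof.
have -> : ord0 = lshift n (ord0 : 'I_1) :> 'I_(1 + n) by exact: val_inj.
by apply: etrans (row_mxEl _ _ _ _) _; rewrite mxE.
Qed.

Lemma cons_rVS n (p : 'rV[R]_n * R) i : cons_rV p ord0 (lift ord0 i) = p.1 ord0 i.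
Proof. by rewrite -rshift1; exact: row_mxEr. Qed.

Definition uncons_rV n (x : 'rV[R]_n.+1) : 'rV[R]_n * R :=
  (\row_i x ord0 (lift ord0 i), x ord0 ord0).

Lemma cons_rVK n : cancel (@cons_rV R n) (@uncons_rV n).
Proof.
move=> [x y]; rewrite /uncons_rV cons_rV0/=; congr (_, _).
by apply/rowP => i; rewrite mxE cons_rVS.
Qed.

Lemma uncons_rVK n : cancel (@uncons_rV n) (@cons_rV R n).
Proof.
move=> x; apply/rowP => i; case: (unliftP ord0 i) => [j|] ->.
  by rewrite cons_rVS mxE.
by rewrite cons_rV0.
Qed.

(** Sections of the preimage are preimages of sections: the inner measure contributes [k2]
    pointwise, and the outer integral becomes one against the image measure of [m1], which is [k1]
    times [m1]. *)
Lemma measure_prod_preimage d1 d2 (T1 : measurableType d1) (T2 : measurableType d2)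
   (m1 : {measure set T1 -> \bar R}) (m2 : {sigma_finite_measure set T2 -> \bar R})
   (f : T1 -> T1) (g : T2 -> T2) (k1 k2 : {nonneg R}) (B : set (T1 * T2)) :
  measurable_fun setT f -> measurable_fun setT g ->
  (forall A, measurable A -> m1 (f @^-1` A) = (k1%:num)%:E * m1 A)%E ->
  (forall A, measurable A -> m2 (g @^-1` A) = (k2%:num)%:E * m2 A)%E ->
  measurable B ->
  ((m1 \x m2) ((fun z => (f z.1, g z.2)) @^-1` B) =
    (k1%:num * k2%:num)%:E * (m1 \x m2) B)%E.
Proof.
move=> mf mg hf hg mB; rewrite /product_measure1 /=.
have -> : (fun x => m2 (xsection ((fun z => (f z.1, g z.2)) @^-1` B) x)) =
  (fun x => (k2%:num)%:E * (m2 \o xsection B) (f x))%E.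
  apply/funext => x /=; rewrite -hg; last exact: measurable_xsection.
  by congr (m2 _); apply/seteqP; split => y; rewrite /xsection /= !inE.
rewrite ge0_integralZl//; last first.
  by apply: (measurable_comp _ _ (measurable_fun_xsection m2 mB) mf).
have -> : (\int[m1]_x (m2 \o xsection B) (f x) =
  \int[pushforward m1 f]_x (m2 \o xsection B) x)%E.
  rewrite ge0_integral_pushforward ?preimage_setT//.
  exact: measurable_fun_xsection.
have -> : (\int[pushforward m1 f]_x (m2 \o xsection B) x =
    \int[mscale k1 m1]_x (m2 \o xsection B) x)%E.
  by apply: eq_measure_integral => A mA _; exact: hf.
rewrite ge0_integral_mscale//; last exact: measurable_fun_xsection.
by rewrite muleA -EFinM mulrC.
Qed.

(** Both sides are measures in [A]; by uniqueness of Lebesgue measure it is enough to compare them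
    on half-open intervals. *)
Lemma lebesgue_affine (c t : R) (A : set R) : 0 < c -> measurable A ->
  (lebesgue_measure ((fun x : measurableTypeR R => (c * x + t)%R : measurableTypeR R) @^-1` A) =
    (c^-1)%:E * lebesgue_measure A)%E.
Proof.
move=> c0 mA.
have mf : measurable_fun [set: measurableTypeR R] (fun x : measurableTypeR R => c * x + t : measurableTypeR R).
  by apply: measurable_funD => //; exact: mulrl_measurable.
pose m := mscale (NngNum (ltW c0))
  (measure_function_pushforward__canonical__measure_function_Measure (@lebesgue_measure R) mf).
have mm : forall X, ocitv X -> lebesgue_measure X = m X.
  move=> _ [[a b] _ <-]; rewrite /m/mscale/=.
  rewrite [pushforward _ _]/pushforward/=.
  have -> : (fun x : measurableTypeR R => c * x + t)%R @^-1` `]a, b] = `](a - t) / c, (b - t)/ c]%classic.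
    apply/seteqP; split => x /=; rewrite !in_itv/= ltr_pdivrMr// ler_pdivlMr// [x * c]mulrC.
      by move=> /andP[? ?]; apply/andP; split; lra.
    by move=> /andP[? ?]; apply/andP; split; lra.
  rewrite !lebesgue_measure_itv/= !lte_fin ltr_pM2r ?invr_gt0//.
  rewrite ltrD2r; case: ifP => ab; last by rewrite mule0.
  by rewrite -!EFinD -EFinM; congr EFin; field; rewrite lt0r_neq0.
have := @lebesgue_measure_unique R m mm A mA; rewrite /m /mscale /= => ->.
by rewrite muleA -EFinM mulVf ?lt0r_neq0// mul1e.
Qed.

Lemma sigma_finite_product d1 d2 (T1 : measurableType d1) (T2 : measurableType d2)
  (m1 : {sigma_finite_measure set T1 -> \bar R})
  (m2 : {sigma_finite_measure set T2 -> \bar R}) : sigma_finite setT (m1 \x m2)%E.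
Proof.
have /sigma_finiteP[F [TF ndF Foo]] := sigma_finiteT m1.
have /sigma_finiteP[G [TG ndG Goo]] := sigma_finiteT m2.
exists (fun n => F n `*` G n).
  apply/esym/seteqP; split=> // -[x y] _.
  have [n _ Fnx] : (\bigcup_i F i) x by rewrite -TF.
  have [k _ Gky] : (\bigcup_i G i) y by rewrite -TG.
  exists (maxn n k) => //; split => /=.
    by move: x Fnx; exact/subsetPset/ndF/leq_maxl.
  by move: y Gky; exact/subsetPset/ndG/leq_maxr.
move=> k; have [mF Fk] := Foo k; have [mG Gk] := Goo k.
split; first exact: measurableX.
by rewrite product_measure1E// lte_mul_pinfty// ge0_fin_numE.
Qed.

(** Tonelli's theorem needs this in every dimension. The exhausting sets of the product are pulled
    back along [uncons_rV], the inverse of the map that defines the measure. *)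
Lemma leb_sigma_finite n : sigma_finite setT (@leb R n).
Proof.
elim: n => [|n IH].
  have := @sigma_finiteT _ _ _ (@dirac _ _ (0 : 'rV[R]_0) R).
  by [].
pose l := HB.pack_for {sigma_finite_measure set 'rV[R]_n -> \bar R} (@leb R n)
  (Measure_isSigmaFinite.Build _ _ _ (@leb R n) IH).
have := sigma_finite_product l (@lebesgue_measure R).
move=> /sigma_finiteP[F [TF ndF Foo]].
have mun : measurable_fun [set: 'rV[R]_n.+1] (@uncons_rV n).
  apply/measurable_fun_pair => /=; last exact: measurable_coord.
  apply: measurable_fun_rV => // i.
  under eq_fun do rewrite mxE.
  exact: measurable_coord.
exists (fun k => @uncons_rV n @^-1` F k).
  by rewrite -preimage_bigcup -TF preimage_setT.
move=> k; have [mF Fk] := Foo k; split.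
  by rewrite -[_ @^-1` _]setTI; apply: mun.
rewrite /= /pushforward -comp_preimage (_ : (@uncons_rV n) \o _ = id) ?preimage_id//.
by apply/funext => p /=; rewrite cons_rVK.
Qed.

HB.instance Definition _ n := Measure_isSigmaFinite.Build _ _ _ (@leb R n)
  (@leb_sigma_finite n).

Lemma leb_affine n (c : R) (v : 'rV[R]_n) (A : set 'rV[R]_n) : 0 < c -> measurable A ->
  (leb n ((fun x => c *: x + v)%R @^-1` A) = ((c^-1) ^+ n)%:E * leb n A)%E.
Proof.
move=> c0; elim: n v A => [|n IH] v A mA.
  rewrite expr0 mul1e /=; congr (_ _); apply/seteqP; split => x /=; by rewrite [_ + _]thinmx0 [x]thinmx0.
rewrite /= /pushforward -comp_preimage.
have ci : 0 <= c^-1 by rewrite invr_ge0 ltW.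
have cin : 0 <= (c^-1)^+n by rewrite exprn_ge0.
have mc : measurable (@cons_rV R n @^-1` A).
  by rewrite -[_ @^-1` _]setTI; apply: measurable_cons_rV.
pose v' : 'rV[R]_n := \row_i v ord0 (lift ord0 i).
have := @measure_prod_preimage _ _ _ _ (leb n) (@lebesgue_measure R)
  (fun x => c *: x + v') (fun x => c * x + v ord0 ord0) (NngNum cin) (NngNum ci) _ _ _ _ _ mc.
rewrite /= exprSr => <-; last 4 first.
- apply: measurable_fun_rV => // i; under eq_fun do rewrite !mxE.
  apply: measurable_funD => //; apply: measurable_funM => //; exact: measurable_coord.
- by apply: measurable_funD => //; exact: mulrl_measurable.
- by move=> B mB; exact: IH.
- by move=> B mB; exact: lebesgue_affine.
rewrite -comp_preimage.
suff -> : (fun x => c *: x + v) \o @cons_rV R n =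
  @cons_rV R n \o (fun z => (c *: z.1 + v', c * z.2 + v ord0 ord0)) by [].
apply/funext => -[x y] /=.
apply/rowP => i; case: (unliftP ord0 i) => [j|] ->.
  by rewrite [LHS]mxE [X in X + _]mxE !cons_rVS /= !mxE.
by rewrite [LHS]mxE [X in X + _]mxE !cons_rV0.
Qed.

End measure_rV.

(** * Measurability of open sets and continuous functions *)

Section open_measurable.
Context {R : realType}.

(** A dense sequence of centres and the radii 1/(k+1) give countably many balls, and every open set
    is the union of those it contains. The map [f] only mediates between the measurable and the
    topological carrier; it is the identity in both uses. *)
Lemma dense_open_measurable d (T : measurableType d) (P : pseudoMetricType R)
    (f : T -> P) (c : nat -> P) :
  (forall x e, 0 < e -> exists n, ball x e (c n)) ->
  (forall x e, measurable (f @^-1` (ball x e))) ->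
  forall U : set P, open U -> measurable (f @^-1` U).
Proof.
move=> cd mb U oU.
have -> : U = \bigcup_(p in [set p : nat * nat | ball (c p.1) (p.2.+1%:R^-1) `<=` U])
    ball (c p.1) (p.2.+1%:R^-1 : R).
  apply/seteqP; split=> [x Ux|x [p /= pU]]; last exact: pU.
  have /nbhs_ballP[e /= e0 eU] : nbhs x U by exact: open_nbhs_nbhs.
  have {}e0 : (0 : R) < e := e0.
  have [N Ne] : exists N : nat, N.+1%:R^-1 + N.+1%:R^-1 < e :> R.
    have [N hN] := ltr_add_invr (y := 0 : R) (x := e / 2) ltac:(lra).
    by exists N; move: hN; set t := (N.+1%:R^-1 : R) => hN; lra.
  have N0 : (0 : R) < N.+1%:R^-1 by rewrite invr_gt0.
  have [n xn] := cd x _ N0.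
  exists (n, N) => /=; last exact: ball_sym.
  move=> y ny; apply: eU; apply: le_ball (ltW Ne) _ _.
  exact: ball_triangle xn ny.
rewrite preimage_bigcup bigcup_mkcond.
apply: countable_bigcupT_measurable => [|p]; first exact: countableP.
by case: ifP => _; [exact: mb|exact: measurable0].
Qed.

Lemma rat_dense_ball (x e : R) : 0 < e -> exists q : rat, ball x e (ratr q).
Proof.
move=> e0; have [q] := @rat_in_itvoo R (x - e) (x + e) ltac:(lra).
by rewrite in_itv/= => /andP[h1 h2]; exists q; rewrite /ball/= ltr_norml; lra.
Qed.

Lemma ball_rVP n (x y : 'rV[R]_n) (e : R) : 0 < e ->
  (ball x e y <-> forall i, ball (x ord0 i) e (y ord0 i)).
Proof.
move=> e0; split => [[_ h] i|h]; first exact: h.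
by split => // i j; rewrite ord1.
Qed.

Definition ratrV n (k : nat) : 'rV[R]_n :=
  if unpickle k is Some q then map_mx ratr (q : 'rV[rat]_n) else 0.

Lemma ratrV_dense n (x : 'rV[R]_n) (e : R) : 0 < e -> exists k, ball x e (ratrV n k).
Proof.
move=> e0.
have /choice[q hq] : forall i, exists q : rat, ball (x ord0 i) e (ratr q).
  by move=> i; exact: rat_dense_ball.
exists (pickle (\row_i q i : 'rV[rat]_n)).
by rewrite /ratrV pickleK; apply/ball_rVP => // i; rewrite !mxE.
Qed.

Definition ratE n (k : nat) : 'rV[R]_n * R :=
  if unpickle k is Some q then
    (map_mx ratr (q.1 : 'rV[rat]_n), ratr (q.2 : rat)) else 0.

Lemma ratE_dense n (x : 'rV[R]_n * R) (e : R) : 0 < e -> exists k, ball x e (ratE n k).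
Proof.
move=> e0.
have /choice[q hq] : forall i, exists q : rat, ball (x.1 ord0 i) e (ratr q).
  by move=> i; exact: rat_dense_ball.
have [q2 hq2] := rat_dense_ball x.2 e0.
exists (pickle (\row_i q i : 'rV[rat]_n, q2)).
by rewrite /ratE pickleK; split => //=; apply/ball_rVP => // i; rewrite !mxE.
Qed.

Lemma measurable_ball_rV n (x : 'rV[R]_n) (e : R) : measurable (ball x e).
Proof.
have [e0|e0] := ltP 0 e; last first.
  rewrite (_ : ball x e = set0)//; apply/seteqP; split => // y [+ _].
  by rewrite ltNge e0.
have -> : ball x e = \bigcap_(i in [set: 'I_n]) (fun y : 'rV[R]_n => y ord0 i) @^-1` ball (x ord0 i) e.
  apply/seteqP; split => y; rewrite ball_rVP// => xy i; [move=> _|]; exact: xy.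
apply: fin_bigcap_measurable => // i _.
by rewrite -[X in measurable X]setTI; apply: measurable_coord => //; exact: measurable_ball.
Qed.

Lemma open_measurable_rV n (U : set 'rV[R]_n) : open U -> measurable U.
Proof.
move=> oU.
exact: (@dense_open_measurable _ 'rV[R]_n 'rV[R]_n id _ (@ratrV_dense n)
  (@measurable_ball_rV n) U oU).
Qed.

Lemma measurable_ball_E n (x : 'rV[R]_n * R) (e : R) :
  @measurable _ ('rV[R]_n * measurableTypeR R)%type (ball x e).
Proof.
have -> : ball x e = ball x.1 e `*` ball x.2 e by [].
by apply: measurableX; [exact: measurable_ball_rV|exact: measurable_ball].
Qed.

Lemma open_measurable_E n (U : set ('rV[R]_n * R)) : open U ->
  @measurable _ ('rV[R]_n * measurableTypeR R)%type U.
Proof.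
move=> oU.
exact: (@dense_open_measurable _ ('rV[R]_n * measurableTypeR R)%type ('rV[R]_n * R)%type id _ (@ratE_dense n)
  (@measurable_ball_E n) U oU).
Qed.

Lemma closed_measurable_E n (U : set ('rV[R]_n * R)) : closed U ->
  @measurable _ ('rV[R]_n * measurableTypeR R)%type U.
Proof. by move=> cU; rewrite -[U]setCK; apply: measurableC; apply: open_measurable_E; exact: closed_openC. Qed.

Lemma closed_measurable_rV n (U : set ('rV[R]_n)) : closed U -> measurable U.
Proof. by move=> cU; rewrite -[U]setCK; apply: measurableC; apply: open_measurable_rV; exact: closed_openC. Qed.

Lemma continuous_measurable_E n (f : 'rV[R]_n * R -> R) : continuous f ->
  @measurable_fun _ _ ('rV[R]_n * measurableTypeR R)%type _ setT f.
Proof.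
move=> cf; apply: (measurability _ (RGenOpens.measurableE R)) => //.
move=> _ [_ [a [b ->] <-]]; rewrite setTI; apply: open_measurable_E.
by apply: open_comp => // x _; exact: cf.
Qed.

Lemma continuous_measurable_rV n (f : 'rV[R]_n -> R) : continuous f ->
  measurable_fun setT f.
Proof.
move=> cf; apply: (measurability _ (RGenOpens.measurableE R)) => //.
move=> _ [_ [a [b ->] <-]]; rewrite setTI; apply: open_measurable_rV.
by apply: open_comp => // x _; exact: cf.
Qed.

End open_measurable.

(** * Volumes of balls and affine changes of variables *)

Section leb_theory.
Context {R : realType}.

Lemma lebesgue_ball (x r : R) : 0 <= r -> lebesgue_measure (ball x r) = (2 * r)%:E.
Proof. by move=> r0; rewrite lebesgue_measure_ball// mulr_natl. Qed.

(** Balls of row vectors are cubes, the norm being the sup norm, so their volumes are exact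
    powers. *)
Lemma leb_ball n (x : 'rV[R]_n) (r : R) : 0 < r -> leb n (ball x r) = ((2 * r) ^+ n)%:E.
Proof.
move=> r0; elim: n x => [|n IH] x.
  by rewrite expr0 /= diracE mem_set//=; apply/ball_rVP => // i; case: i.
rewrite /= /pushforward.
have -> : @cons_rV R n @^-1` ball x r = ball (uncons_rV x).1 r `*` ball (uncons_rV x).2 r.
  apply/seteqP; split => [p /ball_rVP-/(_ r0) px|p [/ball_rVP-/(_ r0) p1 p2]].
    split => /=; last by have := px ord0; rewrite cons_rV0.
    by apply/ball_rVP => // i; rewrite mxE -cons_rVS; exact: px.
  apply/ball_rVP => // i; case: (unliftP ord0 i) => [k|] ->.
    by rewrite cons_rVS; have := p1 k; rewrite mxE.
  by rewrite cons_rV0; exact: p2.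
rewrite product_measure1E; [|exact: measurable_ball_rV|exact: measurable_ball].
by rewrite exprSr EFinM -(IH (uncons_rV x).1) -(lebesgue_ball (uncons_rV x).2 (ltW r0)).
Qed.

Lemma vol_ball d (z : 'rV[R]_d * R) (r : R) : 0 < r ->
  vol d (ball z r) = ((2 * r) ^+ d.+1)%:E.
Proof.
move=> r0; have -> : ball z r = ball z.1 r `*` ball z.2 r by [].
rewrite [vol d _]product_measure1E; [|exact: measurable_ball_rV|exact: measurable_ball].
by rewrite exprSr EFinM -(leb_ball z.1 r0) -(lebesgue_ball z.2 (ltW r0)).
Qed.

Lemma ge0_integral_leb_affine n (c : R) (v : 'rV[R]_n) (f : 'rV[R]_n -> \bar R) :
  0 < c -> measurable_fun setT f -> (forall x, (0 <= f x)%E) ->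
  (\int[leb n]_x f (c *: x + v)%R = ((c^-1) ^+ n)%:E * \int[leb n]_x f x)%E.
Proof.
move=> c0 mf f0.
have ci : 0 <= c^-1 by rewrite invr_ge0 ltW.
have cin : 0 <= (c^-1)^+n by rewrite exprn_ge0.
have ma : measurable_fun [set: 'rV[R]_n] (fun x : 'rV[R]_n => c *: x + v).
  apply: measurable_fun_rV => // i; under eq_fun do rewrite !mxE.
  apply: measurable_funD => //; apply: measurable_funM => //; exact: measurable_coord.
have := @ge0_integral_pushforward _ _ _ _ R _ ma (leb n) setT f measurableT mf (fun y _ => f0 y).
rewrite preimage_setT => /= <-.
have -> : (\int[pushforward (leb n) (fun x => (c *: x + v)%R)]_y f y =
    \int[mscale (NngNum cin) (leb n)]_x f x)%E.
  by apply: eq_measure_integral => A mA _; exact: leb_affine.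
by rewrite ge0_integral_mscale.
Qed.

Lemma vol_translate d (w : 'rV[R]_d * R) (A : set ('rV[R]_d * measurableTypeR R)) :
  measurable A -> vol d ((fun z => (z.1 + w.1, z.2 + w.2)) @^-1` A) = vol d A.
Proof.
move=> mA.
have h01 : 0 <= (1 : R) by [].
have := @measure_prod_preimage R _ _ _ _ (leb d) (@lebesgue_measure R)
  (fun x => x + w.1) (fun x => x + w.2) (NngNum h01) (NngNum h01) A _ _ _ _ mA.
rewrite /= mulr1 mul1e => -> //.
- by apply: measurable_fun_rV => // i; under eq_fun do rewrite !mxE;
    apply: measurable_funD => //; exact: measurable_coord.
- exact: measurable_funD.
- move=> B mB; have := @leb_affine R d 1 w.1 B ltr01 mB.
  by rewrite invr1 expr1n; under eq_fun do rewrite scale1r.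
- move=> B mB; have := @lebesgue_affine R 1 w.2 B ltr01 mB.
  by rewrite invr1; under eq_fun do rewrite mul1r.
Qed.

Lemma measurable_translate d (w : 'rV[R]_d * R) :
  measurable_fun [set: 'rV[R]_d * measurableTypeR R]
    (fun z : 'rV[R]_d * measurableTypeR R =>
      (z.1 + w.1, z.2 + w.2) : 'rV[R]_d * measurableTypeR R).
Proof.
apply/measurable_fun_pair; last first.
  by apply: measurable_funD => //; exact: measurable_snd.
apply: measurable_fun_rV => // i /=; under eq_fun do rewrite !mxE.
apply: measurable_funD => //.
by apply: (measurable_comp _ _ (measurable_coord i)) => //; exact: measurable_fst.
Qed.

Lemma ge0_integral_vol_translate d (w : 'rV[R]_d * R) (f : 'rV[R]_d * R -> \bar R) :
  @measurable_fun _ _ ('rV[R]_d * measurableTypeR R)%type _ setT f ->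
  (forall x, (0 <= f x)%E) ->
  (\int[vol d]_z f (z.1 + w.1, z.2 + w.2)%R = \int[vol d]_z f z)%E.
Proof.
move=> mf f0.
have := @ge0_integral_pushforward _ _ _ _ R _ (measurable_translate w) (vol d) setT f measurableT mf (fun y _ => f0 y).
rewrite preimage_setT => /= <-.
apply: eq_measure_integral => [|? A mA _]; first exact: measurable_translate.
exact: (vol_translate w mA).
Qed.

Lemma integral_vol_translate d (w : 'rV[R]_d * R) (f : 'rV[R]_d * R -> \bar R) :
  @measurable_fun _ _ ('rV[R]_d * measurableTypeR R)%type _ setT f ->
  (\int[vol d]_z f (z.1 + w.1, z.2 + w.2)%R = \int[vol d]_z f z)%E.
Proof.
move=> mf; rewrite [LHS]integralE [RHS]integralE; congr (_ - _)%E.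
  rewrite -(@ge0_integral_vol_translate d w (f^\+)%E (measurable_funepos mf) (funepos_ge0 f)).
  by apply: eq_integral => z _; rewrite !funeposE.
rewrite -(@ge0_integral_vol_translate d w (f^\-)%E (measurable_funeneg mf) (funeneg_ge0 f)).
by apply: eq_integral => z _; rewrite !funenegE.
Qed.

End leb_theory.

(** * Smooth functions *)

Section smooth_algebra.
Context {R : realType}.
Implicit Types V W : normedModType R.

(** The predicate [smooth] over an arbitrary normed space, so that it also covers functions of one
    real variable. *)
Definition csmooth V (f : V -> R^o) : Prop := forall (vs : seq V) (z : V),
  differentiable (foldr (fun v g => 'D_v g) f vs) z.

(** Smoothness is the largest property that implies differentiability and is stable under
    directional derivatives. The proofs below exhibit a family of functions that contains the given
    one and all its derivatives. *)
Lemma csmooth_coind V (P : (V -> R^o) -> Prop) :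
  (forall f, P f -> (forall z, differentiable f z) /\ forall v, P ('D_v f)) ->
  forall f, P f -> csmooth f.
Proof.
move=> hP f Pf vs z.
suff : P (foldr (fun v g => 'D_v g) f vs) by move=> /hP[+ _]; exact.
by elim: vs => [//|v vs IH] /=; have [_] := hP _ IH; exact.
Qed.

Lemma csmooth_differentiable V (f : V -> R^o) z : csmooth f -> differentiable f z.
Proof. by move=> /(_ [::] z). Qed.

Lemma csmooth_derivable V (f : V -> R^o) z v : csmooth f -> derivable f z v.
Proof. by move=> sf; apply: diff_derivable; exact: csmooth_differentiable. Qed.

Lemma csmooth_derive V (f : V -> R^o) v : csmooth f -> csmooth ('D_v f).
Proof. by move=> sf vs z; have := sf (rcons vs v) z; rewrite foldr_rcons. Qed.

Lemma csmooth_continuous V (f : V -> R^o) : csmooth f -> continuous f.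
Proof. by move=> sf z; apply: differentiable_continuous; exact: csmooth_differentiable. Qed.

Lemma derive_cst_fun V (c : R) v : 'D_v (cst c : V -> R^o) = cst 0.
Proof. by apply/funext => z; rewrite derive_cst. Qed.

Lemma csmooth_cst V (c : R) : csmooth (cst c : V -> R^o).
Proof.
apply: (csmooth_coind (P := fun f => exists c, f = cst c)); last by exists c.
move=> _ [k ->]; split=> [z|v]; first exact: differentiable_cst.
by exists 0; exact: derive_cst_fun.
Qed.

Lemma csmoothD V (f g : V -> R^o) : csmooth f -> csmooth g -> csmooth (fun z => f z + g z).
Proof.
move=> sf sg.
apply: (csmooth_coind (P := fun h => exists f g : V -> R^o,
  [/\ csmooth f, csmooth g & h = fun z => f z + g z])); last by exists f, g.
move=> _ [f1 [g1 [sf1 sg1 ->]]]; split => [z|v].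
  by apply: differentiableD; exact: csmooth_differentiable.
exists ('D_v f1), ('D_v g1); split; [exact: csmooth_derive..|].
by apply/funext => z; rewrite deriveD//; exact: csmooth_derivable.
Qed.

Lemma csmooth_sum V I (s : seq I) (f : I -> V -> R^o) :
  (forall i, csmooth (f i)) -> csmooth (fun z => \sum_(i <- s) f i z).
Proof.
move=> sf; elim: s => [|i s IH].
  under eq_fun do rewrite big_nil; exact: csmooth_cst.
under eq_fun do rewrite big_cons; exact: csmoothD.
Qed.

Lemma csmoothM V (f g : V -> R^o) : csmooth f -> csmooth g -> csmooth (fun z => f z * g z).
Proof.
move=> sf sg.
(* Products alone are not stable under derivation, by the Leibniz rule; finite sums of products
   are. *)
apply: (csmooth_coind (P := fun h => exists s : seq ((V -> R^o) * (V -> R^o)),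
   (forall p, p \in s -> csmooth p.1 /\ csmooth p.2) /\
   h = fun z => \sum_(p <- s) p.1 z * p.2 z)); last first.
  exists [:: (f, g)]; split; last by apply/funext => z; rewrite big_seq1.
  by move=> p; rewrite inE => /eqP ->.
move=> _ [s [hs ->]]; split => [z|v].
  elim: s hs => [|p s IH] hs.
    under eq_fun do rewrite big_nil; exact: differentiable_cst.
  under eq_fun do rewrite big_cons.
  have [s1 s2] := hs p (mem_head _ _).
  apply: differentiableD; first by apply: differentiableM; exact: csmooth_differentiable.
  by apply: IH => q qs; apply: hs; rewrite inE qs orbT.
exists (flatten [seq [:: ('D_v p.1, p.2); (p.1, 'D_v p.2)] | p <- s]); split.
  move=> p /flatten_mapP[q qs]; have [s1 s2] := hs q qs.
  by rewrite !inE => /orP[|] /eqP -> /=; split => //; exact: csmooth_derive.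
apply/funext => z.
suff : is_derive z v (fun z => \sum_(p <- s) p.1 z * p.2 z)
   (\sum_(j <- flatten [seq [:: ('D_v p.1, p.2); (p.1, 'D_v p.2)] | p <- s]) j.1 z * j.2 z).
  by move=> h; rewrite derive_val.
elim: s hs => [|p s IH] hs.
  under eq_fun do rewrite big_nil.
  by rewrite /= big_nil; exact: is_derive_cst.
under eq_fun do rewrite big_cons.
have [s1 s2] := hs p (mem_head _ _).
rewrite /= !big_cons /= addrA.
apply: is_deriveD; last by apply: IH => q qs; apply: hs; rewrite inE qs orbT.
have h1 : is_derive z v p.1 ('D_v p.1 z) by apply: derivableP; exact: csmooth_derivable.
have h2 : is_derive z v p.2 ('D_v p.2 z) by apply: derivableP; exact: csmooth_derivable.
apply: is_derive_eq; rewrite addrC; congr (_ + _).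
by rewrite /GRing.scale/= mulrC.
Qed.

Lemma csmoothZ V (c : R) (f : V -> R^o) : csmooth f -> csmooth (fun z => c * f z).
Proof. by move=> sf; apply: csmoothM => //; exact: (@csmooth_cst V c). Qed.

Lemma csmoothN V (f : V -> R^o) : csmooth f -> csmooth (fun z => - f z).
Proof.
move=> sf; under eq_fun do rewrite -mulN1r; exact: csmoothZ.
Qed.

Lemma csmoothB V (f g : V -> R^o) : csmooth f -> csmooth g -> csmooth (fun z => f z - g z).
Proof. by move=> sf sg; apply: csmoothD => //; exact: csmoothN. Qed.

Lemma csmooth_prod V I (s : seq I) (f : I -> V -> R^o) :
  (forall i, csmooth (f i)) -> csmooth (fun z => \prod_(i <- s) f i z).
Proof.
move=> sf; elim: s => [|i s IH].
  under eq_fun do rewrite big_nil; exact: csmooth_cst.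
under eq_fun do rewrite big_cons; exact: csmoothM.
Qed.

Lemma derive_comp_affine V W (f : W -> R^o) (l : V -> W) (l0 : V -> W) z v :
  (forall z v (h : R), l (z + h *: v) = l z + h *: l0 v) ->
  'D_v (f \o l) z = 'D_(l0 v) f (l z).
Proof.
move=> hl; rewrite /derive.
suff -> : (fun h : R => h^-1 *: ((f \o l \o shift z) (h *: v) - (f \o l) z)) =
  (fun h : R => h^-1 *: ((f \o shift (l z)) (h *: l0 v) - f (l z))) by [].
apply/funext => h /=; congr (_ *: (f _ - _)); by rewrite addrC hl addrC.
Qed.

Lemma csmooth_comp_affine V W (f : W -> R^o) (l : V -> W) (l0 : V -> W) :
  (forall z v (h : R), l (z + h *: v) = l z + h *: l0 v) ->
  (forall z, differentiable l z) -> csmooth f -> csmooth (f \o l).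
Proof.
move=> hl dl sf.
apply: (csmooth_coind (P := fun h => exists f : W -> R^o, csmooth f /\ h = f \o l)); last by exists f.
move=> _ [g [sg ->]]; split => [z|v].
  by apply: differentiable_comp => //; exact: csmooth_differentiable.
exists ('D_(l0 v) g); split; first exact: csmooth_derive.
by apply/funext => z; rewrite (derive_comp_affine g z v hl).
Qed.

Lemma differentiable_expr V (u : V -> R^o) n z :
  differentiable u z -> differentiable (fun x => u x ^+ n : R^o) z.
Proof.
move=> du; elim: n => [|n IH].
  under eq_fun do rewrite expr0; exact: differentiable_cst.
by under eq_fun do rewrite exprS; exact: differentiableM.
Qed.

Lemma is_derive_expr V (u : V -> R^o) n z v du :
  is_derive z v u du -> is_derive z v (fun x => u x ^+ n : R^o) (n%:R * u z ^+ n.-1 * du).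
Proof.
move=> hu; elim: n => [|n IH].
  under eq_fun do rewrite expr0.
  by rewrite !mul0r; exact: is_derive_cst.
under eq_fun do rewrite exprS.
apply: is_derive_eq; rewrite /GRing.scale/=.
case: n {IH} => [|n]; first by rewrite !mul0r mulr0 add0r expr0 !mulr1 mul1r.
by rewrite /= exprS -[n.+2]addn1 natrD; ring.
Qed.

Lemma csmoothV V (f : V -> R^o) : csmooth f -> (forall z, f z != 0) ->
  csmooth (fun z => (f z)^-1).
Proof.
move=> sf f0.
(* The derivative of g f^(-n) is (g' f - n g f') f^(-n-1), so the family of such quotients is
   stable. *)
apply: (csmooth_coind (P := fun h => exists (g : V -> R^o) n,
   csmooth g /\ h = fun z => g z * (f z)^-1 ^+ n)); last first.
  exists (cst 1), 1%N; split; first exact: csmooth_cst.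
  by apply/funext => z; rewrite mul1r expr1.
move=> _ [g [n [sg ->]]]; split => [z|v].
  apply: differentiableM; first exact: csmooth_differentiable.
  apply: differentiable_expr; apply: differentiableV => //; exact: csmooth_differentiable.
exists (fun z => 'D_v g z * f z - n%:R * (g z * 'D_v f z)), n.+1; split.
  apply: csmoothB; first by apply: csmoothM => //; exact: csmooth_derive.
  by apply: csmoothZ; apply: csmoothM => //; exact: csmooth_derive.
apply/funext => z.
have h1 : is_derive z v g ('D_v g z) by apply: derivableP; exact: csmooth_derivable.
have h2 : is_derive z v f ('D_v f z) by apply: derivableP; exact: csmooth_derivable.
have h3 : is_derive z v (fun z => (f z)^-1 : R^o) (- (f z)^-2 *: 'D_v f z).
  by apply: DeriveDef; [apply: derivableV => //; exact: csmooth_derivable|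
     rewrite deriveV//; exact: csmooth_derivable].
have h4 := is_derive_expr n h3.
rewrite derive_val /GRing.scale /=; case: n {h4} => [|n].
  by rewrite !expr0 expr1 !mul0r mulr0 add0r subr0 -mulrA mulfV// mulr1 mul1r.
rewrite /= !exprS !exprVn; field.
by rewrite f0 expf_neq0.
Qed.

End smooth_algebra.

(** * Flat functions, smooth steps and a B-spline *)

Section smooth_step.
Context {R : realType}.
Implicit Types (p : {poly R}) (x t : R).

(** Raise t / n <= exp (t / n) to the n-th power. *)
Lemma expr_expRN_bounded n : exists C : R, forall t, 0 < t -> t ^+ n * expR (- t) <= C.
Proof.
case: n => [|n].
  exists 1 => t t0; rewrite expr0 mul1r -[leRHS]expR0 ler_expR; lra.
exists (n.+1%:R ^+ n.+1) => t t0.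
have n0 : (0 : R) < n.+1%:R by [].
have h : t / n.+1%:R <= expR (t / n.+1%:R).
  by move: (t / _) => u; have := expR_ge1Dx u; lra.
have : (t / n.+1%:R) ^+ n.+1 <= expR t.
  have -> : expR t = expR (t / n.+1%:R) ^+ n.+1.
    by rewrite -expRM_natl mulrC divfK// gt_eqF.
  by rewrite lerXn2r// nnegrE ?expR_ge0// divr_ge0// ltW.
rewrite expr_div_n ler_pdivrMr ?exprn_gt0// => h2.
by rewrite expRN ler_pdivrMr ?expR_gt0// mulrC.
Qed.

Lemma poly_expRN_bounded p : exists2 C : R, 0 <= C &
  forall t, 0 < t -> `|p.[t]| * expR (- t) <= C.
Proof.
have /choice[B hB] := expr_expRN_bounded.
have B0 i : 0 <= B i.
  by apply: le_trans (hB i 1 ltr01); rewrite expr1n mul1r expR_ge0.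
exists (\sum_(i < size p) `|p`_i| * B i).
  by apply: sumr_ge0 => i _; rewrite mulr_ge0.
move=> t t0; rewrite horner_coef.
apply: (@le_trans _ _ ((\sum_(i < size p) `|p`_i| * t ^+ i) * expR (- t))).
  rewrite ler_wpM2r ?expR_ge0//; apply: le_trans (ler_norm_sum _ _ _) _.
  by apply: ler_sum => i _; rewrite normrM [`|t ^+ i|]ger0_norm// exprn_ge0// ltW.
rewrite mulr_suml; apply: ler_sum => i _.
by rewrite -mulrA; apply: ler_wpM2l => //; exact: hB.
Qed.

(** The functions p(1/x) exp(-1/x), extended by 0. The polynomial factor makes the family stable
    under differentiation, which replaces p by X^2 (p - p'). *)
Definition flat p : R -> R^o := fun x => if 0 < x then p.[x^-1] * expR (- x^-1) else 0.

(** The quadratic bound makes the difference quotient at 0 tend to 0. It follows from the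
    boundedness of p(t) t^2 exp(-t), taken at t = 1/x. *)
Lemma flat_near0 p : exists2 C : R, 0 <= C & forall x, `|flat p x| <= C * x ^+ 2.
Proof.
have [C C0 hC] := poly_expRN_bounded (p * 'X^2).
exists C => // x; rewrite /flat; case: ifPn => [x0|_]; last by rewrite normr0 mulr_ge0// sqr_ge0.
have := hC x^-1; rewrite invr_gt0 => /(_ x0).
have -> : `|(p * 'X^2).[x^-1]| = `|p.[x^-1]| * x^-1 ^+ 2.
  rewrite hornerM hornerXn normrM; congr (_ * _).
  by rewrite ger0_norm// exprn_ge0// invr_ge0 ltW.
rewrite [X in _ -> X <= _]normrM (ger0_norm (expR_ge0 _)).
by rewrite mulrAC exprVn ler_pdivrMr ?exprn_gt0.
Qed.

Lemma is_derive_flat p x :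
  is_derive x (1 : R) (flat p) (flat ('X^2 * (p - p^`())) x).
Proof.
have [x0|x0|x0] := ltgtP x 0.
- rewrite /flat ltNge (ltW x0)/=.
  apply: near_eq_is_derive (is_derive_cst 0 x 1).
  near=> y => /=; have y0 : y < 0 by near: y; exact: lt_nbhsl.
  by rewrite ltNge (ltW y0).
- have h1 : is_derive x (1 : R) (fun y : R => y^-1 : R^o) (- x^-2 *: 1).
    by apply: is_deriveV; rewrite gt_eqF.
  have h2 : is_derive x (1 : R) (fun y : R => expR (- y^-1) : R^o) (expR (- x^-1) * x^-2).
    have h3 : is_derive x (1:R) (fun y : R => - y^-1 : R^o) (x^-2).
      by apply: is_derive_eq; rewrite /GRing.scale/= mulr1 opprK.
    exact: (@is_derive1_comp _ expR (fun y : R => - y^-1) x _ _ (is_derive_expR (- x^-1)) h3).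
  have h4 : is_derive x (1 : R) (fun y : R => p.[y^-1] : R^o) (p^`().[x^-1] * (- x^-2)).
    have := @is_derive1_comp _ (horner p) (fun y : R => y^-1) x _ _ (is_derive_poly p (x^-1)) h1.
    by rewrite /GRing.scale/= mulr1.
  have h5 := is_deriveM h4 h2.
  have h6 : \near x, (fun y : R => p.[y^-1] * expR (- y^-1) : R^o) x = flat p x.
    near=> y; rewrite /flat ifT//.
    by near: y; exact: lt_nbhsr.
  apply: (is_derive_eq (near_eq_is_derive h6 h5)).
  rewrite /flat x0 /GRing.scale/=.
  rewrite hornerM hornerXn hornerD hornerN exprVn.
  by move: (x ^- 2) => y; ring.
- rewrite x0 {2}/flat ltxx.
  have [C C0 hC] := flat_near0 p.
  have key : h^-1 *: ((flat p \o shift 0) (h *: (1 : R)) - flat p 0) @[h --> 0^'] --> (0 : R^o).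
    rewrite {2}/flat ltxx.
    apply/cvgr0Pnorm_le => e e0; near=> h.
    rewrite /= addr0 subr0 /GRing.scale/= mulr1 normrM normrV ?unitfE; last by near: h; exact: nbhs_dnbhs_neq.
    have h0 : 0 < `|h| by rewrite normr_gt0; near: h; exact: nbhs_dnbhs_neq.
    rewrite mulrC ler_pdivrMr//; apply: le_trans (hC h) _.
    rewrite -real_normK ?num_real// expr2 mulrA ler_wpM2r//.
    have : (C + 1) * `|h| <= e.
      rewrite -ler_pdivlMl; last lra.
      near: h; apply: dnbhs0_le; rewrite mulr_gt0// invr_gt0; lra.
    by move=> h5; apply: le_trans h5; rewrite ler_wpM2r//; lra.
  by apply: DeriveDef; [apply/cvg_ex; exists 0|exact/cvg_lim].
Unshelve. all: by end_near. Qed.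

Lemma is_derive_linear_dir (f : R -> R^o) x (df v : R) :
  is_derive x (1 : R) f df -> is_derive x (v : R^o) (f : R^o -> R^o) (v * df).
Proof.
move=> [dfx dfE]; have /derivable1_diffP dd := dfx.
apply: DeriveDef; first exact: diff_derivable.
rewrite deriveE// (_ : v = v *: (1 : R^o)); last by rewrite /GRing.scale/= mulr1.
by rewrite linearZ /= -deriveE// dfE /GRing.scale/= mulr1.
Qed.

Lemma csmooth_flat p : @csmooth R R^o (flat p).
Proof.
(* The factor [c] absorbs the direction [v]: directional derivatives on the line are multiples of
   the ordinary derivative. *)
apply: (csmooth_coind (P := fun f : R^o -> R^o => exists (q : {poly R}) (c : R), f = fun x => c * flat q x)); last first.
  by exists p, 1; apply/funext => x; rewrite mul1r.
move=> _ [q [c ->]]; split => [x|v].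
  apply: differentiableM; first exact: differentiable_cst.
  by apply/derivable1_diffP; have [] := is_derive_flat q x.
exists ('X^2 * (q - q^`())), (c * v); apply/funext => x.
have h := is_derive_linear_dir v (is_derive_flat q x).
have h2 : is_derive x (v : R^o) (fun x => c * flat q x : R^o) (c *: (v * flat ('X^2 * (q - q^`())) x)).
  exact: (is_deriveZ c h).
by rewrite derive_val /GRing.scale/= mulrA.
Qed.

Lemma flat1_eq0 x : x <= 0 -> flat 1 x = 0.
Proof. by rewrite /flat leNgt => /negbTE ->. Qed.

Lemma flat1_gt0 x : 0 < x -> 0 < flat 1 x.
Proof. by move=> x0; rewrite /flat x0 hornerC mul1r expR_gt0. Qed.

Lemma flat1_ge0 x : 0 <= flat 1 x.
Proof. by have [x0|x0] := leP x 0; [rewrite flat1_eq0|rewrite ltW// flat1_gt0]. Qed.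

Lemma flat1_sum_gt0 x : 0 < flat 1 x + flat 1 (1 - x).
Proof.
have [x0|x0] := ltP 0 x; first by rewrite ltr_wpDr ?flat1_ge0 ?flat1_gt0.
by rewrite ltr_wpDl ?flat1_ge0// flat1_gt0//; lra.
Qed.

Definition smooth_step x : R^o := flat 1 x / (flat 1 x + flat 1 (1 - x)).

Lemma differentiable_idR x : differentiable (id : R^o -> R^o) (x : R^o).
Proof. by apply/derivable1_diffP; exact: derivable_id. Qed.

Lemma csmooth_comp_affine1 (f : R^o -> R^o) (a b : R) :
  csmooth f -> @csmooth R R^o (fun x : R => f (a * x + b)).
Proof.
move=> sf; apply: (@csmooth_comp_affine R R^o R^o f (fun x : R^o => a * x + b : R^o) (fun v : R^o => a * v : R^o)) => // z v h.
by rewrite /GRing.scale/=; ring.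
Qed.

Lemma csmooth_step : @csmooth R R^o smooth_step.
Proof.
have h1 : @csmooth R R^o (fun x => flat 1 (1 - x)).
  rewrite (_ : (fun x : R^o => _) = fun x : R^o => flat 1 (-1 * x + 1)).
    exact/csmooth_comp_affine1/csmooth_flat.
  by apply/funext => x; congr flat; ring.
apply: csmoothM; first exact: csmooth_flat.
apply: csmoothV; first by apply: csmoothD => //; exact: csmooth_flat.
by move=> x; rewrite gt_eqF// flat1_sum_gt0.
Qed.

Lemma smooth_step_le0 x : x <= 0 -> smooth_step x = 0.
Proof. by move=> x0; rewrite /smooth_step flat1_eq0// mul0r. Qed.

Lemma smooth_step_ge1 x : 1 <= x -> smooth_step x = 1.
Proof.
move=> x1; rewrite /smooth_step (@flat1_eq0 (1 - x)); last by lra.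
by rewrite addr0 mulfV// gt_eqF// flat1_gt0//; lra.
Qed.

Lemma smooth_step_ge0 x : 0 <= smooth_step x.
Proof. by rewrite divr_ge0 ?flat1_ge0// ltW// flat1_sum_gt0. Qed.

Lemma smooth_step_le1 x : smooth_step x <= 1.
Proof. by rewrite ler_pdivrMr ?flat1_sum_gt0// mul1r lerDl flat1_ge0. Qed.

(** A smooth version of the positive part, exact outside ]-1, 1[. *)
Definition smooth_ramp x : R^o := x * smooth_step (2^-1 * x + 2^-1).

Lemma csmooth_id : @csmooth R R^o (fun x => x).
Proof.
apply: (csmooth_coind (P := fun f : R^o -> R^o => f = id \/ exists c : R, f = cst c)); last by left.
move=> _ [->|[c ->]]; split => [x|v].
- exact: differentiable_idR.
- by right; exists v; apply/funext => x; rewrite derive_id.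
- exact: differentiable_cst.
- by right; exists 0; exact: derive_cst_fun.
Qed.

Lemma csmooth_ramp : @csmooth R R^o smooth_ramp.
Proof.
apply: csmoothM; first exact: csmooth_id.
exact/csmooth_comp_affine1/csmooth_step.
Qed.

Lemma smooth_ramp_leN1 x : x <= -1 -> smooth_ramp x = 0.
Proof. by move=> x1; rewrite /smooth_ramp smooth_step_le0 ?mulr0//; lra. Qed.

Lemma smooth_ramp_ge1 x : 1 <= x -> smooth_ramp x = x.
Proof. by move=> x1; rewrite /smooth_ramp smooth_step_ge1 ?mulr1//; lra. Qed.

(* The second difference of the ramp: its integer translates reproduce affine functions. *)
Definition bspline x : R^o := smooth_ramp (x + 1) - 2 * smooth_ramp x + smooth_ramp (x - 1).

Lemma csmooth_bspline : @csmooth R R^o bspline.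
Proof.
have h (c : R) : @csmooth R R^o (fun x => smooth_ramp (x + c)).
  under eq_fun do rewrite -[X in X + c]mul1r.
  exact/csmooth_comp_affine1/csmooth_ramp.
by apply: csmoothD => //; apply: csmoothB => //; apply: csmoothZ; exact: csmooth_ramp.
Qed.

Lemma bspline_eq0 x : 2 <= `|x| -> bspline x = 0.
Proof.
rewrite ler_normr => /orP[h|h]; rewrite /bspline.
  by rewrite !smooth_ramp_ge1; lra.
by rewrite !smooth_ramp_leN1; lra.
Qed.

(** Second differences telescope. The hypotheses place the near end where the ramp is the identity
    and the far end where it vanishes. *)
Lemma sum_bspline n (y : R) : 1 <= y -> y <= n%:R - 2 -> \sum_(k < n) bspline (y - k%:R) = 1.
Proof.
move=> y1 yn.
have H m : \sum_(k < m) bspline (y - k%:R) = smooth_ramp (y + 1) - smooth_ramp y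
    - (smooth_ramp (y - m%:R + 1) - smooth_ramp (y - m%:R)).
  elim: m => [|m IH]; first by rewrite big_ord0 subr0; ring.
  rewrite big_ord_recr /= IH /bspline -(natr1 m).
  rewrite (_ : y - (m%:R + 1) + 1 = y - m%:R); last by ring.
  rewrite (_ : y - (m%:R + 1) = y - m%:R - 1); last by ring.
  by move: (y - _) => t; ring.
rewrite H (@smooth_ramp_ge1 (y + 1)); last lra.
rewrite (@smooth_ramp_ge1 y)//.
by rewrite !smooth_ramp_leN1; lra.
Qed.

Lemma sum_nat_bspline n (y : R) : 1 <= y -> y <= n%:R - 2 -> \sum_(k < n) k%:R * bspline (y - k%:R) = y.
Proof.
move=> y1 yn.
have H m : \sum_(k < m) k%:R * bspline (y - k%:R) = smooth_ramp y
    - m%:R * smooth_ramp (y - m%:R + 1) + (m%:R - 1) * smooth_ramp (y - m%:R).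
  elim: m => [|m IH]; first by rewrite big_ord0 subr0; ring.
  rewrite big_ord_recr /= IH /bspline -(natr1 m).
  rewrite (_ : y - (m%:R + 1) + 1 = y - m%:R); last by ring.
  rewrite (_ : y - (m%:R + 1) = y - m%:R - 1); last by ring.
  by move: (y - _) => t; ring.
rewrite H (@smooth_ramp_ge1 y)//.
by rewrite !smooth_ramp_leN1; lra.
Qed.

Lemma count_near_nat n (y : R) : \sum_(k < n) (if `|y - k%:R| <= 2 then 1 else 0) <= 5 :> R.
Proof.
(* The second bound is the induction invariant: when the term of index n counts, n - y <= 2, so that
   the earlier terms sum to at most 4. *)
suff [] : \sum_(k < n) (if `|y - k%:R| <= 2 then 1 else 0) <= 5 :> R /\
  \sum_(k < n) (if `|y - k%:R| <= 2 then 1 else 0) <= Num.max 0 (n%:R - y + 2) by [].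
elim: n => [|n [IH1 IH2]]; first by rewrite big_ord0; split => //; rewrite le_max lexx.
rewrite big_ord_recr /= -(natr1 n); move: IH1 IH2; set s := \sum_(k < n) _ => IH1 IH2.
case: ifPn => [/ler_normlP[h1 h2]|h]; last first.
  rewrite addr0; split => //; apply: le_trans IH2 _.
  rewrite ge_max le_max lexx/= le_max; apply/orP; right; lra.
have {}IH2 : s <= n%:R - y + 2 by move: IH2; rewrite le_max => /orP[h|//]; lra.
by split; [|rewrite le_max; apply/orP; right]; lra.
Qed.

End smooth_step.

(** * Dominated convergence for real-valued integrals *)

Section Rintegral_dominated.
Context {R : realType} dd (T : measurableType dd) (mu : {measure set T -> \bar R}).

Lemma cvg_EFin_real (u : nat -> R) (l : R) : u n @[n --> \oo] --> l ->
  (EFin (u n)) @[n --> \oo] --> l%:E.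
Proof. by move=> ul; apply: cvg_EFin => //; exact: nearW. Qed.

Lemma Rintegral_dominated_cvg (D : set T) (f_ : nat -> T -> R) (f g : T -> R) :
  measurable D -> (forall n, measurable_fun D (f_ n)) -> measurable_fun D f ->
  {ae mu, forall x, D x -> f_ n x @[n --> \oo] --> f x} ->
  mu.-integrable D (EFin \o g) -> (forall n x, D x -> `|f_ n x| <= g x) ->
  mu.-integrable D (EFin \o f) /\
  \int[mu]_(x in D) f_ n x @[n --> \oo] --> \int[mu]_(x in D) f x.
Proof.
move=> mD mf_ mf f_f ig fg.
have [ifn _ cvgI] := @dominated_convergence _ _ R mu D mD (fun n => EFin \o f_ n) (EFin \o f) (EFin \o g)
   (fun n => (measurable_EFinP _ _).2 (mf_ n)) ((measurable_EFinP _ _).2 mf)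
   (@filterS _ _ (ae_filter_ringOfSetsType mu) _ _ (fun x h Dx => cvg_EFin_real (h Dx)) f_f)
   ig (aeW _ (fun x n Dx => fg n x Dx)).
split => //; apply: fine_cvg; rewrite fineK//; exact: integrable_fin_num.
Qed.

Lemma Rintegral_dominated_cvg_pointwise (D : set T) (f_ : nat -> T -> R) (f g : T -> R) :
  measurable D -> (forall n, measurable_fun D (f_ n)) -> measurable_fun D f ->
  (forall x, D x -> f_ n x @[n --> \oo] --> f x) ->
  mu.-integrable D (EFin \o g) -> (forall n x, D x -> `|f_ n x| <= g x) ->
  mu.-integrable D (EFin \o f) /\
  \int[mu]_(x in D) f_ n x @[n --> \oo] --> \int[mu]_(x in D) f x.
Proof. by move=> mD mf_ mf f_f; apply: Rintegral_dominated_cvg => //; exact: aeW. Qed.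

End Rintegral_dominated.

(** * Coordinates of R^d x R *)

Section coordinates.
Context {R : realType} (d : nat).
Local Notation E := ('rV[R]_d * R)%type.
Implicit Types (z w : E).

(** Following [cons_rV], index 0 is the vertical variable y and the other indices are the
    coordinates of the base. *)
Definition crd (i : 'I_d.+1) (z : E) : R := cons_rV z ord0 i.
Definition ebas (i : 'I_d.+1) : E := uncons_rV (delta_mx 0 i).

Lemma crd0 z : crd ord0 z = z.2. Proof. exact: cons_rV0. Qed.
Lemma crdS z (j : 'I_d) : crd (lift ord0 j) z = z.1 ord0 j. Proof. exact: cons_rVS. Qed.

Lemma crd_inj z w : (forall i, crd i z = crd i w) -> z = w.
Proof.
move=> h; rewrite -[z](@cons_rVK R) -[w](@cons_rVK R); congr uncons_rV.
by apply/rowP => i; exact: h.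
Qed.

Lemma crdD i z w : crd i (z + w) = crd i z + crd i w.
Proof. by case: (unliftP ord0 i) => [j|] ->; rewrite ?crdS ?crd0// mxE. Qed.

Lemma crdZ i (c : R) z : crd i (c *: z) = c * crd i z.
Proof. by case: (unliftP ord0 i) => [j|] ->; rewrite ?crdS ?crd0// mxE. Qed.

Lemma crdN i z : crd i (- z) = - crd i z.
Proof. by case: (unliftP ord0 i) => [j|] ->; rewrite ?crdS ?crd0// mxE. Qed.

Lemma crdB i z w : crd i (z - w) = crd i z - crd i w.
Proof. by rewrite crdD crdN. Qed.

Lemma crd_is_linear i : linear (crd i : E -> R^o).
Proof. by move=> c z w; rewrite crdD crdZ. Qed.

HB.instance Definition _ i := GRing.isLinear.Build R E R^o _ (crd i) (crd_is_linear i).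

Lemma crd_sum i (I : Type) (s : seq I) (P : pred I) (F : I -> E) :
  crd i (\sum_(j <- s | P j) F j) = \sum_(j <- s | P j) crd i (F j).
Proof. exact: linear_sum. Qed.

Lemma crd_uncons i (x : 'rV[R]_d.+1) : crd i (uncons_rV x) = x ord0 i.
Proof. by rewrite /crd uncons_rVK. Qed.

Lemma crd_ebas i j : crd i (ebas j) = (i == j)%:R.
Proof. by rewrite crd_uncons mxE eqxx. Qed.

Lemma crd_basis z : z = \sum_i crd i z *: ebas i.
Proof.
apply: crd_inj => i; rewrite crd_sum (bigD1 i)//= crdZ crd_ebas eqxx mulr1.
rewrite big1 ?addr0// => j ji; by rewrite crdZ crd_ebas eq_sym (negbTE ji) mulr0.
Qed.

Lemma dotpE z w : dotp z w = \sum_i crd i z * crd i w.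
Proof.
rewrite /dotp /dotv big_ord_recl !crd0 addrC; congr (_ + _).
by apply: eq_bigr => i _; rewrite !crdS.
Qed.

Lemma crd_continuous i : continuous (crd i : E -> R^o).
Proof.
case: (unliftP ord0 i) => [j|] ->.
  rewrite (_ : crd _ = (fun x : 'rV[R]_d => x ord0 j) \o fst); last by apply/funext => z /=; rewrite crdS.
  by move=> z; apply: continuous_comp; [exact: cvg_fst|exact: coord_continuous].
rewrite (_ : crd _ = snd); last by apply/funext => z; rewrite crd0.
by move=> z; exact: cvg_snd.
Qed.

Lemma crd_differentiable i z : differentiable (crd i : E -> R^o) z.
Proof. by apply: linear_differentiable; exact: crd_continuous. Qed.

Lemma normE_lt z (r : R) : 0 < r -> `|z| < r <-> forall i, `|crd i z| < r.
Proof.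
move=> r0.
have -> : (`|z| < r) = (`|z.1| < r) && (`|z.2| < r).
  by rewrite prod_normE gt_max.
have b1 : `|z.1| < r <-> forall i, `|z.1 ord0 i| < r.
  have := @ball_rVP R d 0 z.1 r r0; rewrite mx_norm_ball /ball_ /= sub0r normrN => ->.
  by split => h i; have := h i; rewrite /ball/= mxE sub0r normrN.
split.
  move=> /andP[/b1 h1 h2] i; case: (unliftP ord0 i) => [j|] ->; rewrite ?crdS ?crd0//.
move=> h; apply/andP; split; last by rewrite -crd0.
by apply/b1 => i; rewrite -crdS.
Qed.

Lemma crd_le_norm z i : `|crd i z| <= `|z|.
Proof.
apply/ler_addgt0Pr => e e0.
have h : `|z| < `|z| + e by rewrite ltrDl.
have r0 : 0 < `|z| + e by rewrite ltr_wpDl.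
by have /(normE_lt _ r0)/(_ i)/ltW := h.
Qed.

Lemma normE_le z (r : R) : 0 <= r -> (forall i, `|crd i z| <= r) -> `|z| <= r.
Proof.
move=> r0 h; apply/ler_addgt0Pr => e e0; apply/ltW/normE_lt => [|i]; first by rewrite ltr_wpDl.
by apply: le_lt_trans (h i) _; rewrite ltrDl.
Qed.

Definition grad (phi : E -> R) (z : E) : E :=
  uncons_rV (\row_i 'D_(ebas i) (phi : E -> R^o) z).

Lemma crd_grad phi z i : crd i (grad phi z) = 'D_(ebas i) (phi : E -> R^o) z.
Proof. by rewrite crd_uncons mxE. Qed.

Lemma derive_dotp (phi : E -> R^o) z v : differentiable phi z -> 'D_v phi z = dotp (grad phi z) v.
Proof.
move=> dp; rewrite deriveE// {1}(crd_basis v) linear_sum dotpE.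
by apply: eq_bigr => i _; rewrite linearZ /= -deriveE// crd_grad mulrC.
Qed.

Lemma dotpC z w : dotp z w = dotp w z.
Proof. by rewrite !dotpE; apply: eq_bigr => i _; rewrite mulrC. Qed.
Lemma dotpDl z w v : dotp (z + w) v = dotp z v + dotp w v.
Proof. by rewrite !dotpE -big_split; apply: eq_bigr => i _; rewrite crdD mulrDl. Qed.
Lemma dotpZl c z v : dotp (c *: z) v = c * dotp z v.
Proof. by rewrite !dotpE mulr_sumr; apply: eq_bigr => i _; rewrite crdZ mulrA. Qed.
Lemma dotpNl z v : dotp (- z) v = - dotp z v.
Proof. by rewrite -scaleN1r dotpZl mulN1r. Qed.
Lemma dotpBl z w v : dotp (z - w) v = dotp z v - dotp w v.
Proof. by rewrite dotpDl dotpNl. Qed.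
Lemma dotp_ge0 z : 0 <= dotp z z.
Proof. by rewrite dotpE; apply: sumr_ge0 => i _; rewrite -expr2 sqr_ge0. Qed.
Lemma dotp_ebas z i : dotp z (ebas i) = crd i z.
Proof.
rewrite dotpE (bigD1 i)//= crd_ebas eqxx mulr1 big1 ?addr0// => j ji.
by rewrite crd_ebas (negbTE ji) mulr0.
Qed.
Lemma dotp_sqr z : dotp z z = \sum_i crd i z ^+ 2.
Proof. by rewrite dotpE; apply: eq_bigr => i _; rewrite expr2. Qed.
Lemma crd_sqr_le z i : crd i z ^+ 2 <= dotp z z.
Proof.
by rewrite dotp_sqr (bigD1 i)//= lerDl sumr_ge0// => j _; rewrite sqr_ge0.
Qed.

End coordinates.

(** * Functions of bounded support *)

Section compact_support.
Context {R : realType} (d : nat).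
Local Notation E := ('rV[R]_d * R)%type.
Local Notation Em := ('rV[R]_d * measurableTypeR R)%type.
Implicit Types (f g phi psi : E -> R).

Lemma compact_normball (r : R) : compact [set z : E | `|z| <= r].
Proof.
have -> : [set z : E | `|z| <= r] = [set x : 'rV[R]_d | `|x| <= r] `*` [set y : R | `|y| <= r].
  by apply/seteqP; split => z /=; rewrite prod_normE ge_max => /andP.
apply: compact_setX; last first.
  rewrite (_ : [set y : R | _] = `[(- r), r]%classic); first exact: segment_compact.
  by apply/seteqP; split => y /=; rewrite in_itv/= ler_norml.
apply: bounded_closed_compact.
  by exists r; split; [exact: num_real|move=> M rM x /= h; rewrite (le_trans h)// ltW].
rewrite (_ : [set x : 'rV[R]_d | _] = Num.norm @^-1` [set y : R | y <= r])//.
by apply: closed_comp; [move=> x _; exact: norm_continuous|exact: closed_le].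
Qed.

Lemma continuous_bounded f (r : R) : continuous f ->
  exists2 C : R, 0 <= C & forall z, `|z| <= r -> `|f z| <= C.
Proof.
move=> cf.
have /compact_bounded[M [_ hM]] : compact (f @` [set z : E | `|z| <= r]).
  by apply: continuous_compact; [exact: continuous_subspaceT|exact: compact_normball].
exists (`|M| + 1); first by rewrite addr_ge0.
move=> z zr; apply: (hM (`|M| + 1)); last by exists z.
by rewrite ltr_pwDr// ler_norm.
Qed.

Lemma compact_norm_le (K : set E) : compact K -> exists2 r : R, 0 < r & forall z, K z -> `|z| <= r.
Proof.
move=> /compact_bounded[M [_ hM]]; exists (`|M| + 1); first by rewrite ltr_wpDl.
by move=> z Kz; apply: (hM (`|M| + 1)) => //; rewrite ltr_pwDr// ler_norm.
Qed.

Lemma vol_bounded_fin (D : set E) (r : R) : @measurable _ Em D ->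
  (forall z, D z -> `|z| <= r) -> (vol d D < +oo)%E.
Proof.
move=> mD hr.
have r1 : 0 < `|r| + 1 by rewrite ltr_wpDl.
apply: (@le_lt_trans _ _ (vol d (ball (0 : E) (`|r| + 1)))).
  apply: le_measure; rewrite ?inE//; first exact: measurable_ball_E.
  move=> z /hr zr; rewrite -[ball _ _]/(@ball _ E 0 (`|r| + 1)) prod_norm_ball /ball_ /= sub0r normrN.
  by apply: le_lt_trans zr _; rewrite ltr_pwDr// ler_norm.
by rewrite (@vol_ball R d 0 _ r1) ltry.
Qed.

Definition bsupp f := exists r, forall z : E, r < `|z| -> f z = 0.

Lemma measurable_normle (r : R) : @measurable _ Em [set z : E | `|z| <= r].
Proof.
apply: closed_measurable_E.
rewrite (_ : [set x : E | _] = Num.norm @^-1` [set y : R | y <= r])//.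
by apply: closed_comp; [move=> x _; exact: norm_continuous|exact: closed_le].
Qed.

Lemma integrable_bounded (D : set E) f (r C : R) : @measurable _ Em D ->
  @measurable_fun _ _ Em _ D f ->
  (forall z, D z -> `|z| <= r) -> (forall z, D z -> `|f z| <= C) ->
  (vol d).-integrable D (EFin \o f).
Proof.
move=> mD mf Dr fC; apply: measurable_bounded_integrable => //.
  exact: vol_bounded_fin Dr.
by exists C; split; [exact: num_real|move=> M CM z /= Dz; rewrite (le_trans (fC _ Dz))// ltW].
Qed.

Lemma integrable_bsupp f : continuous f -> bsupp f -> (vol d).-integrable setT (EFin \o f).
Proof.
move=> cf [r fr].
have [C C0 hC] := continuous_bounded r cf.
have -> : EFin \o f = (EFin \o f) \_ [set z : E | `|z| <= r].
  apply/funext => z; rewrite /= patchE; case: ifPn => //; rewrite notin_setE /= => /negP.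
  by rewrite -ltNge => /fr ->.
apply/(integrable_mkcond _ (measurable_normle r)).
apply: (@integrable_bounded _ _ r C) => //; first exact: measurable_normle.
by apply: measurable_funTS; exact: continuous_measurable_E.
Qed.

Lemma derive_line phi (z v : E) (t : R) : csmooth (phi : E -> R^o) ->
  is_derive t (1 : R) (fun s : R => phi (z + s *: v) : R^o) ('D_v (phi : E -> R^o) (z + t *: v)).
Proof.
move=> sphi.
have hd : derivable (phi : E -> R^o) (z + t *: v) v by exact: csmooth_derivable.
have e : (fun h : R => h^-1 *: (((fun s : R => phi (z + s *: v) : R^o) \o shift t) (h *: (1:R)) - phi (z + t *: v))) =
  (fun h : R => h^-1 *: (((phi : E -> R^o) \o shift (z + t *: v)) (h *: v) - phi (z + t *: v))).
  apply/funext => h /=; congr (_ *: (phi _ - _)).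
  by rewrite [h%:A]mulr1 scalerDl addrCA.
apply: DeriveDef; first by rewrite /derivable e.
by rewrite /derive e.
Qed.

Lemma mvt_line phi (z v : E) (h C : R) : csmooth (phi : E -> R^o) ->
  (forall w, `|'D_v (phi : E -> R^o) w| <= C) -> `|phi (z + h *: v) - phi z| <= C * `|h|.
Proof.
move=> sphi hC.
have C0 : 0 <= C by apply: le_trans (hC z).
wlog : h z v hC / 0 <= h => [H|h0].
  have [h0|h0] := leP 0 h; first exact: H.
  have -> : z + h *: v = z + (- h) *: (- v) by rewrite scalerN scaleNr opprK.
  rewrite -[X in _ * X]normrN; apply: H; last by rewrite oppr_ge0 ltW.
  move=> w; rewrite derive_dotp; last exact: csmooth_differentiable.
  rewrite dotpC dotpNl normrN dotpC -derive_dotp//; exact: csmooth_differentiable.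
move: h0; rewrite le_eqVlt => /orP[/eqP <-|h0].
  by rewrite scale0r addr0 subrr normr0 mulr0.
have [||c _] := @MVT R (fun s : R => phi (z + s *: v)) (fun s => 'D_v (phi : E -> R^o) (z + s *: v)) 0 h h0.
- by move=> x _; exact: derive_line.
- apply: continuous_subspaceT => t; apply: differentiable_continuous.
  by apply/derivable1_diffP; have [] := derive_line z v t sphi.
rewrite scale0r addr0 subr0 => ->.
by rewrite normrM ler_wpM2r.
Qed.

Lemma bsupp_derive phi v : bsupp phi -> bsupp ('D_v (phi : E -> R^o)).
Proof.
move=> [r hr]; exists r => z zr.
rewrite (_ : 'D_v _ z = 'D_v (cst 0 : E -> R^o) z); first by rewrite derive_cst.
apply: near_eq_derive; near=> w; rewrite hr//.
near: w; have : open [set w : E | r < `|w|].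
  rewrite (_ : [set w : E | _] = Num.norm @^-1` [set y : R | r < y])//.
  by apply: open_comp; [move=> x _; exact: norm_continuous|exact: open_gt].
by move=> h; exact: (open_nbhs_nbhs (conj h zr)).
Unshelve. all: by end_near. Qed.

Lemma bsupp_bounded f : continuous f -> bsupp f -> exists2 C : R, 0 <= C & forall z, `|f z| <= C.
Proof.
move=> cf [r fr]; have [C C0 hC] := continuous_bounded r cf; exists C => // z.
by have [/hC//|/fr ->] := leP `|z| r; rewrite normr0.
Qed.

Lemma Rintegral_vol_translate (w : E) f : @measurable_fun _ _ Em _ setT f ->
  \int[vol d]_z f (z + w) = \int[vol d]_z f z.
Proof.
move=> mf; congr fine; rewrite -(@integral_vol_translate R d w (EFin \o f))//.
exact/measurable_EFinP.
Qed.

(** Translation invariance makes every difference quotient of [psi] integrate to 0, and the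
    quotients converge to the derivative under a common integrable bound. *)
Lemma integral_derive0 psi (v : E) : csmooth (psi : E -> R^o) -> bsupp psi ->
  \int[vol d]_z 'D_v (psi : E -> R^o) z = 0.
Proof.
move=> sp bp.
have cp : continuous psi by exact: csmooth_continuous.
have sd := csmooth_derive v sp.
have cd : continuous ('D_v (psi : E -> R^o)) by exact: csmooth_continuous.
have [C C0 hC] := bsupp_bounded cd (bsupp_derive v bp).
have [r hr] := bp.
(* The steps of the quotients are at most 1, so their supports lie within distance |v| of that of
   [psi]. *)
pose B := [set z : E | `|z| <= `|r| + `|v|].
pose q (n : nat) (z : E) := n.+1%:R * (psi (z + n.+1%:R^-1 *: v) - psi z).
pose G := EFin \o (cst C \_ B).
have cq n : continuous (q n).
  move=> z; apply: cvgM; first exact: cvg_cst.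
  apply: cvgB; last exact: cp.
  apply: (continuous_comp (f := fun z : E => z + n.+1%:R^-1 *: v) (g := psi)); last exact: cp.
  by apply: cvgD; [exact: cvg_id|exact: cvg_cst].
have mB : @measurable _ Em B by exact: measurable_normle.
have iG : (vol d).-integrable setT G.
  rewrite /G -restrict_EFin; apply/(integrable_mkcond _ mB).
  by apply: (@integrable_bounded _ _ (`|r| + `|v|) C) => // z _; rewrite ger0_norm.
have qG n z : (`|(EFin \o q n) z| <= G z)%E.
  rewrite /G /= lee_fin patchE; case: ifPn => [_|].
    rewrite /q normrM ger0_norm// mulrC -ler_pdivlMr//.
    by apply: le_trans (mvt_line _ _ sp hC) _; rewrite ger0_norm// invr_ge0.
  rewrite notin_setE /B /= => /negP; rewrite -ltNge => zr.
  have rz : r < `|z|.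
    by apply: le_lt_trans zr; rewrite (le_trans (ler_norm _))// lerDl.
  rewrite /q (hr z)// (hr (z + _)) ?subrr ?mulr0 ?normr0//.
  apply: le_lt_trans (ler_norm r) _.
  have : `|n.+1%:R^-1 *: v| <= `|v|.
    rewrite normrZ ler_piMl// ger0_norm ?invr_ge0// invf_le1// ler1n//.
  have := ler_normD (z + n.+1%:R^-1 *: v) (- (n.+1%:R^-1 *: v)).
  by rewrite addrK normrN => h1 h2; lra.
have qD z : (q n z) @[n --> \oo] --> 'D_v (psi : E -> R^o) z.
  have hd : derivable (psi : E -> R^o) z v by exact: csmooth_derivable.
  have hc : (fun n : nat => n.+1%:R^-1 : R) @ \oo --> (0 : R)^'.
    move=> P nP; have : \forall n \near \oo, (n.+1%:R^-1 : R) != 0 -> P n.+1%:R^-1 by exact: (cvg_harmonic nP).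
    by apply: filterS => n; apply; rewrite invr_eq0.
  rewrite (_ : (fun n => q n z) = (fun h : R => h^-1 *: (((psi : E -> R^o) \o shift z) (h *: v) - psi z)) \o
     (fun n : nat => n.+1%:R^-1 : R)); last first.
    by apply/funext => n; rewrite /q /= invrK [X in psi X - _]addrC.
  exact: (cvg_comp _ _ hc hd).
have [_ ] := @Rintegral_dominated_cvg_pointwise R _ Em (vol d) setT q ('D_v (psi : E -> R^o))
  (cst C \_ B) measurableT (fun n => continuous_measurable_E (cq n))
  (continuous_measurable_E cd) (fun z _ => qD z) iG (fun n z _ => qG n z).
have mp := continuous_measurable_E cp.
have ip := integrable_bsupp cp bp.
have i0 n : \int[vol d]_z q n z = 0.
  pose w := n.+1%:R^-1 *: v.
  have ip' : (vol d).-integrable setT (EFin \o (fun z : E => psi (z + w))).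
    apply: integrable_bsupp.
      move=> z; apply: (continuous_comp (f := fun z : E => z + w) (g := psi)); last exact: cp.
      by apply: cvgD; [exact: cvg_id|exact: cvg_cst].
    exists (`|r| + `|w|) => z zr; apply: hr.
    have := ler_normD (z + w) (- w); rewrite addrK normrN => h1.
    by have := ler_norm r; lra.
  rewrite /q RintegralZl//; last exact: (integrableB _ ip' ip).
  by rewrite RintegralB// Rintegral_vol_translate// subrr mulr0.
under eq_fun do rewrite i0.
by move=> /(cvg_lim (@Rhausdorff R)); rewrite lim_cst.
Qed.

End compact_support.

(** * Uniqueness of weak gradients *)

Section weak_gradient_uniqueness.
Context {R : realType} (d : nat).
Local Notation E := ('rV[R]_d * R)%type.
Local Notation Em := ('rV[R]_d * measurableTypeR R)%type.
Implicit Types (a b : 'I_d.+1 -> R) (D : set E) (h : E -> R).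

Definition box a b : set E := [set z | forall i, a i < crd i z < b i].
Definition cbox a b : set E := [set z | forall i, a i <= crd i z <= b i].

Lemma cbox_closed a b : closed (cbox a b).
Proof.
rewrite (_ : cbox a b = \bigcap_(i in [set: 'I_d.+1]) (crd i @^-1` [set y : R | a i <= y] `&` crd i @^-1` [set y : R | y <= b i])).
  apply: closed_bigI => i _; apply: closedI; apply: closed_comp; [|exact: closed_ge| |exact: closed_le];
  by move=> x _; exact: crd_continuous.
by apply/seteqP; split => z h i; [move=> _; apply/andP; exact: h|apply/andP; exact: h].
Qed.

Lemma box_open a b : open (box a b).
Proof.
rewrite openE => z hz.
suff : nbhs z [set w | forall i, a i < crd i w < b i] by [].
apply: (@filter_forall E 'I_d.+1 (fun i w => a i < crd i w < b i) (nbhs z)) => i; have /andP[h1 h2] := hz i.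
near=> w; apply/andP; split; near: w.
  by apply: (cvgr_gt (crd i z)) => //; exact: crd_continuous.
by apply: (cvgr_lt (crd i z)) => //; exact: crd_continuous.
Unshelve. all: by end_near. Qed.

Lemma measurable_box a b : @measurable _ Em (box a b).
Proof. by apply: open_measurable_E; exact: box_open. Qed.

Lemma measurable_cbox a b : @measurable _ Em (cbox a b).
Proof. by apply: closed_measurable_E; exact: cbox_closed. Qed.

Lemma cbox_bounded a b : exists r : R, forall z, cbox a b z -> `|z| <= r.
Proof.
exists (\sum_i (`|a i| + `|b i|)) => z h.
apply: normE_le; first by apply: sumr_ge0 => i _; rewrite addr_ge0.
move=> i; rewrite (bigD1 i)//=.
have s0 : 0 <= \sum_(j < d.+1 | j != i) (`|a j| + `|b j|) by apply: sumr_ge0 => j _; rewrite addr_ge0.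
have /andP[h1 h2] := h i.
have := ler_norm (b i); have := ler_norm (- a i); rewrite normrN => h3 h4.
by have := normr_ge0 (a i); have := normr_ge0 (b i); rewrite ler_norml; lra.
Qed.

Lemma closed_bounded_compact_E (K : set E) (r : R) : closed K -> (forall z, K z -> `|z| <= r) -> compact K.
Proof. by move=> cK hK; exact: (subclosed_compact cK (@compact_normball R d r) hK). Qed.

Lemma cbox_compact a b : compact (cbox a b).
Proof.
have [r hr] := cbox_bounded a b.
by apply: (@closed_bounded_compact_E _ r) => //; exact: cbox_closed.
Qed.

Lemma compact_measurable_E (K : set E) : compact K -> @measurable _ Em K.
Proof. by move=> cK; apply: closed_measurable_E; apply: compact_closed => //; exact: norm_hausdorff. Qed.

Lemma Rintegral_supp (D K : set Em) (f : E -> R) : K `<=` D ->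
  (forall z, D z -> ~ K z -> f z = 0) ->
  \int[vol d]_(z in D) f z = \int[vol d]_(z in K) f z.
Proof.
move=> KD h; rewrite Rintegral_mkcond [RHS]Rintegral_mkcond; congr Rintegral.
apply/funext => z; rewrite !patchE.
have [zK|zK] := boolP (z \in K).
  by rewrite (mem_set (KD _ (set_mem zK))).
case: ifPn => // zD; apply: h; first exact: set_mem.
by move/mem_set; exact/negP.
Qed.

(** Smooth functions with values in [0, 1], supported in the box shrunk by [n.+1%:R^-1] on each
    side, that converge pointwise to the indicator of the open box. *)
Definition box_bump a b (n : nat) : E -> R := fun z =>
  \prod_(i < d.+1) (smooth_step (n.+1%:R * (crd i z - a i) - 1) * smooth_step (n.+1%:R * (b i - crd i z) - 1)).

Lemma csmooth_crd_comp (th : R -> R^o) (i : 'I_d.+1) (c e : R) : @csmooth R R^o th ->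
  csmooth (fun z : E => th (c * crd i z + e) : R^o).
Proof.
move=> sth.
apply: (@csmooth_comp_affine R E R^o th (fun z => c * crd i z + e) (fun v => c * crd i v)) => //.
  by move=> z v h; rewrite crdD crdZ /GRing.scale/=; ring.
move=> z; apply: differentiableD; last exact: differentiable_cst.
by apply: differentiableM; [exact: differentiable_cst|exact: crd_differentiable].
Qed.

Lemma csmooth_box_bump a b n : csmooth (box_bump a b n : E -> R^o).
Proof.
apply: csmooth_prod => i; apply: csmoothM.
  rewrite (_ : (fun z : E => _) = fun z : E => smooth_step (n.+1%:R * crd i z + (- n.+1%:R * a i - 1))).
    exact: csmooth_crd_comp (@csmooth_step R).
  by apply/funext => z; congr smooth_step; ring.
rewrite (_ : (fun z : E => _) = fun z : E => smooth_step (- n.+1%:R * crd i z + (n.+1%:R * b i - 1))).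
  exact: csmooth_crd_comp (@csmooth_step R).
by apply/funext => z; congr smooth_step; ring.
Qed.

Lemma box_bump_ge0 a b n z : 0 <= box_bump a b n z.
Proof. by apply: prodr_ge0 => i _; rewrite mulr_ge0// smooth_step_ge0. Qed.

Lemma box_bump_le1 a b n z : box_bump a b n z <= 1.
Proof.
have -> : 1 = \prod_(i < d.+1) 1 :> R by rewrite big1.
apply: ler_prod => i _.
by rewrite mulr_ge0 ?smooth_step_ge0//= mulr_ile1 ?smooth_step_ge0 ?smooth_step_le1.
Qed.

Lemma box_bump_supp a b n z : box_bump a b n z != 0 ->
  cbox (fun i => a i + n.+1%:R^-1) (fun i => b i - n.+1%:R^-1) z.
Proof.
move=> h i; move: h; rewrite /box_bump (bigD1 i)//= mulf_eq0 negb_or => /andP[+ _].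
rewrite mulf_eq0 negb_or => /andP[h1 h2].
have n0 : (0 : R) < n.+1%:R by [].
have hh (x : R) : smooth_step (n.+1%:R * x - 1) != 0 -> n.+1%:R^-1 <= x.
  move=> h; rewrite -[X in X <= _]mulr1 ler_pdivrMl// leNgt; apply/negP => h3.
  by move: h; rewrite smooth_step_le0 ?eqxx//; lra.
move: (hh _ h1) (hh _ h2); move: (n.+1%:R^-1) => t; lra.
Qed.

Lemma box_bump_eq0 a b n z : ~ box a b z -> box_bump a b n z = 0.
Proof.
move=> h; apply/eqP; apply: contra_notT h => /box_bump_supp h i.
have := h i; have : (0 : R) < n.+1%:R^-1 by rewrite invr_gt0.
by move: (n.+1%:R^-1) => t; lra.
Qed.

Lemma box_bump_cvg a b z : box a b z -> box_bump a b n z @[n --> \oo] --> (1 : R).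
Proof.
move=> h; apply: cvg_near_cst.
have hi (x : R) : 0 < x -> \forall n \near \oo, smooth_step (n.+1%:R * x - 1) = 1.
  move=> x0; near=> n; apply: smooth_step_ge1.
  have : 2 / x <= n.+1%:R.
    apply: (@le_trans _ _ n%:R); last by rewrite ler_nat.
    near: n; exact: nbhs_infty_ger.
  by rewrite ler_pdivrMr//; lra.
have : \forall n \near \oo, forall i, smooth_step (n.+1%:R * (crd i z - a i) - 1) = 1 /\ smooth_step (n.+1%:R * (b i - crd i z) - 1) = 1.
  apply: filter_forall => i; have /andP[h1 h2] := h i.
  by apply: filterI; apply: hi; rewrite subr_gt0.
apply: filterS => n hn; rewrite /box_bump big1// => i _.
by have [-> ->] := hn i; rewrite mulr1.
Unshelve. all: by end_near. Qed.

Lemma test_box_bump D a b n : cbox a b `<=` D -> test_function D (box_bump a b n).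
Proof.
move=> abD.
have sub : closure [set z | box_bump a b n z != 0] `<=` cbox a b.
  apply: (@subset_trans _ (closure (cbox a b))).
    apply: closure_subset => z /box_bump_supp h i; have := h i.
    have : (0 : R) < n.+1%:R^-1 by rewrite invr_gt0.
    by move: (n.+1%:R^-1) => t; lra.
  by have /closure_id <- := @cbox_closed a b.
split; first exact: csmooth_box_bump.
  exact: (subclosed_compact (@closed_closure _ _) (@cbox_compact a b) sub).
exact: subset_trans sub abD.
Qed.

Lemma integral_box_eq0 D h a b : @measurable _ Em D -> locally_integrable_on D h ->
  (forall phi, test_function D phi -> \int[vol d]_(z in D) (h z * phi z) = 0) ->
  cbox a b `<=` D -> \int[vol d]_(z in box a b) h z = 0.
Proof.
move=> mD lh h0 abD.
have ih : (vol d).-integrable (cbox a b) (EFin \o h) by apply: lh => //; exact: cbox_compact.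
have mh : @measurable_fun _ _ Em _ (cbox a b) h by apply/measurable_EFinP; exact: measurable_int ih.
have bc : box a b `<=` cbox a b.
  by move=> z hz i; have /andP[h1 h2] := hz i; rewrite !ltW.
have mB := measurable_box a b.
have mC := measurable_cbox a b.
have I0 n : \int[vol d]_(z in cbox a b) (h z * box_bump a b n z) = 0.
  rewrite -(@Rintegral_supp D)//; first by apply: h0; exact: test_box_bump.
  move=> z _ hz; rewrite box_bump_eq0 ?mulr0//; by move/bc.
have mbump n : @measurable_fun _ _ Em _ (cbox a b) (box_bump a b n).
  by apply: measurable_funTS; apply: continuous_measurable_E; exact/csmooth_continuous/csmooth_box_bump.
have H1 : @measurable_fun _ _ Em _ (cbox a b) (h \_ (box a b)).
  by apply: (measurable_restrict _ mB mC).1; apply: measurable_funS mh => // z [].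
have H2 z : cbox a b z -> h z * box_bump a b n z @[n --> \oo] --> (h \_ (box a b)) z.
  move=> hz; rewrite patchE; case: ifPn => [/set_mem zb|/negP zb].
    rewrite -[X in _ --> X]mulr1; apply: cvgM; first exact: cvg_cst.
    exact: box_bump_cvg.
  rewrite (_ : (fun n => _) = fun=> 0); first exact: cvg_cst.
  by apply/funext => n; rewrite box_bump_eq0 ?mulr0// => /mem_set.
have H3 : (vol d).-integrable (cbox a b) (EFin \o (fun z => `|h z|)) by exact: integrable_norm.
have H4 n z : cbox a b z -> `|h z * box_bump a b n z| <= `|h z|.
  by move=> _; rewrite normrM ler_piMr// ger0_norm ?box_bump_ge0 ?box_bump_le1.
have [_] := @Rintegral_dominated_cvg_pointwise R _ Em (vol d) (cbox a b)
  (fun n z => h z * box_bump a b n z) (h \_ (box a b)) (fun z => `|h z|) mC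
  (fun n => measurable_funM mh (mbump n)) H1 H2 H3 H4.
under eq_fun do rewrite I0.
rewrite -Rintegral_mkcondr setIidr// => /(cvg_lim (@Rhausdorff R)).
by rewrite lim_cst.
Qed.

Lemma measurable_E_generated :
  @measurable _ Em = <<s [set A | exists a b, A = box a b] >>.
Proof.
pose G : set (set E) := [set A | exists a b, A = box a b].
apply/seteqP; split => [A mA|]; last first.
  apply: smallest_sub; first exact: sigma_algebra_measurable.
  by move=> _ [a [b ->]]; exact: measurable_box.
pose T' := g_sigma_algebraType G.
have mcrd (i : 'I_d.+1) : @measurable_fun _ _ T' (measurableTypeR R) setT (crd i : E -> R).
  apply: (measurability _ (RGenOpens.measurableE R)) => //.
  move=> _ [_ [a [b ->] <-]]; rewrite setTI.
  (* A slab in one coordinate is the countable union of boxes that grow in the other coordinates. *)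
  rewrite (_ : crd i @^-1` _ = \bigcup_n (box (fun j => if j == i then a else - n%:R)
     (fun j => if j == i then b else n%:R))).
    by apply: bigcup_measurable => n _; apply: sub_sigma_algebra; do 2 eexists.
  apply/seteqP; split => z /=; rewrite in_itv/=; last first.
    by move=> [n _ /(_ i)]; rewrite eqxx.
  move=> h; exists (Num.truncn `|z|).+1 => //= j; case: ifPn => [/eqP -> //|_].
  rewrite -ltr_norml; apply: le_lt_trans (crd_le_norm _ _) _.
  exact: truncnS_gt.
have mid : @measurable_fun _ _ T' Em setT (fun z : E => (z.1, z.2)).
  apply/measurable_fun_pair; last first.
    by have := mcrd ord0; congr measurable_fun; apply/funext => z; rewrite crd0.
  apply: measurable_fun_rV => // i.
  by have := mcrd (lift ord0 i); congr measurable_fun; apply/funext => z; rewrite crdS.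
have := mid measurableT A mA; rewrite setTI.
by rewrite (_ : _ @^-1` A = A)//; apply/seteqP; split => -[].
Qed.

Lemma ball_box (c : E) (r : R) : 0 < r ->
  ball c r = box (fun i => crd i c - r) (fun i => crd i c + r).
Proof.
move=> r0; rewrite prod_norm_ball /ball_; apply/seteqP; split => z /=.
  move=> /(normE_lt _ r0) h i; have := h i; rewrite crdB ltr_norml; lra.
by move=> h; apply/(normE_lt _ r0) => i; rewrite crdB ltr_norml; have := h i; lra.
Qed.

(** The sets whose intersection with the box has integral 0 form a Dynkin system. It contains the
    open boxes, which are stable under intersection and generate the sigma-algebra, so [h]
    integrates to 0 over every measurable part of the box. *)
Lemma integral_ball_eq0 D h (c : E) (r : R) : @measurable _ Em D -> locally_integrable_on D h ->
  (forall phi, test_function D phi -> \int[vol d]_(z in D) (h z * phi z) = 0) ->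
  0 < r -> cbox (fun i => crd i c - r) (fun i => crd i c + r) `<=` D ->
  {ae vol d, forall z, ball c r z -> h z = 0}.
Proof.
move=> mD lh h0 r0 cD.
set a0 := (fun i => crd i c - r) in cD *; set b0 := (fun i => crd i c + r) in cD *.
have ihc : (vol d).-integrable (cbox a0 b0) (EFin \o h) by apply: lh => //; exact: cbox_compact.
have sub : box a0 b0 `<=` cbox a0 b0 by move=> z hz i; have /andP[? ?] := hz i; rewrite !ltW.
have mB := measurable_box a0 b0.
have ih : (vol d).-integrable (box a0 b0) (EFin \o h).
  by apply: integrableS ihc => //; exact: measurable_cbox.
have ihA A : @measurable _ Em A -> (vol d).-integrable (A `&` box a0 b0) (EFin \o h).
  by move=> mA; apply: integrableS ih => //; exact: measurableI.
have box0 a b : cbox a b `<=` D -> (\int[vol d]_(z in box a b) (h z)%:E)%E = 0%E.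
  move=> abD; have := integral_box_eq0 mD lh h0 abD.
  rewrite /Rintegral => e.
  have ab' : (vol d).-integrable (box a b) (EFin \o h).
    apply: (@integrableS _ _ R (vol d) (cbox a b)) => //; [exact: measurable_cbox|exact: measurable_box| |].
      by move=> z hz i; have /andP[? ?] := hz i; rewrite !ltW.
    by apply: lh => //; exact: cbox_compact.
  by rewrite -[LHS]fineK ?e//; apply: integrable_fin_num => //; exact: measurable_box.
have key A : <<s [set A | exists a b, A = box a b] >> A ->
    (\int[vol d]_(z in A `&` box a0 b0) (h z)%:E)%E = 0%E.
  apply: (@dynkin_induction _ Em _ (fun A => (\int[vol d]_(z in A `&` box a0 b0) (h z)%:E)%E = 0%E) measurable_E_generated).
  - move=> _ _ [a1 [b1 ->]] [a2 [b2 ->]].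
    exists (fun i => Num.max (a1 i) (a2 i)), (fun i => Num.min (b1 i) (b2 i)).
    apply/seteqP; split => z /=.
      by move=> [h1 h2] i; have := h1 i; have := h2 i; rewrite gt_max lt_min; lra.
    by move=> h1; split => i; have := h1 i; rewrite gt_max lt_min; lra.
  - by rewrite setTI box0.
  - move=> _ [a [b ->]].
    rewrite (_ : _ `&` _ = box (fun i => Num.max (a i) (a0 i)) (fun i => Num.min (b i) (b0 i))).
      apply: box0; apply: subset_trans cD => z hz i; have := hz i.
      by rewrite ge_max le_min; lra.
    apply/seteqP; split => z /=.
      by move=> [h1 h2] i; have := h1 i; have := h2 i; rewrite gt_max lt_min; lra.
    by move=> h1; split => i; have := h1 i; rewrite gt_max lt_min; lra.
  - move=> S mS S0.
    have e : (\int[vol d]_(z in box a0 b0) (h z)%:E =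
      \int[vol d]_(z in S `&` box a0 b0) (h z)%:E + \int[vol d]_(z in ~` S `&` box a0 b0) (h z)%:E)%E.
      rewrite -integral_setU//.
      + by congr (integral _ _ _); rewrite -setIUl setUv setTI.
      + exact: measurableI.
      + by apply: measurableI => //; exact: measurableC.
      + rewrite -setIUl setUv setTI; exact: measurable_int ih.
      + by apply/disj_setPS => z [[? _] []].
    by move: e; rewrite S0 add0e box0// => <-.
  - move=> F mF tF F0; rewrite setI_bigcupl integral_bigcup//.
    + by apply: eseries0 => i _ _; exact: F0.
    + exact: trivIset_setIr.
    + by move=> i; exact: measurableI.
    + by rewrite -setI_bigcupl; apply: ihA; exact: bigcup_measurable.
have : ae_eq (vol d) (box a0 b0) (EFin \o h) (cst 0%E).
  apply: integral_ae_eq => // A AB mA; rewrite integral0.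
  rewrite -[in LHS](setIidl AB); apply: key.
  by rewrite -measurable_E_generated.
rewrite ball_box//; apply: filterS => z hz /hz /=; by move=> [].
Qed.

(** The fundamental lemma of the calculus of variations. Countably many balls with rational centres,
    whose closed boxes lie in [D], cover [D], so that the null sets given by [integral_ball_eq0] can
    be united. *)
Lemma weak_zero_ae D h : open D -> locally_integrable_on D h ->
  (forall phi, test_function D phi -> \int[vol d]_(z in D) (h z * phi z) = 0) ->
  {ae vol d, forall z, D z -> h z = 0}.
Proof.
move=> oD lh h0.
have mD : @measurable _ Em D by exact: open_measurable_E.
pose I := [set p : nat * nat | cbox (fun i => crd i (ratE d p.1) - p.2.+1%:R^-1)
   (fun i => crd i (ratE d p.1) + p.2.+1%:R^-1) `<=` D].
have hN (p : nat * nat) : exists N : set Em, [/\ measurable N, vol d N = 0 &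
   I p -> forall z, ball (ratE d p.1 : E) (p.2.+1%:R^-1 : R) z -> ~ N z -> h z = 0].
  have [Ip|Ip] := pselect (I p); last by exists set0; split => //; exact: measure0.
  have p0 : (0 : R) < p.2.+1%:R^-1 by rewrite invr_gt0.
  have [N [mN N0 sN]] := integral_ball_eq0 mD lh h0 p0 Ip.
  exists N; split => // _ z bz Nz; apply: contrapT => hz; apply: Nz; apply: sN => /= H.
  by apply: hz; exact: H.
have [N hN'] := choice hN.
pose F n := N (odflt (0%N, 0%N) (unpickle n)).
exists (\bigcup_n F n); split.
- by apply: bigcup_measurable => n _; have [] := hN' (odflt (0%N, 0%N) (unpickle n)).
- apply/eqP; rewrite eq_le measure_ge0 andbT.
  apply: le_trans (measure_sigma_subadditive (vol d) (A := \bigcup_n F n) (F := F) _ _ _) _ => //.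
  + by move=> n; have [] := hN' (odflt (0%N, 0%N) (unpickle n)).
  + by apply: bigcup_measurable => n _; have [] := hN' (odflt (0%N, 0%N) (unpickle n)).
  + by rewrite eseries0// => n _ _; have [] := hN' (odflt (0%N, 0%N) (unpickle n)).
move=> z /= /not_implyP[Dz hz].
have /nbhs_ballP[e /= e0 eD] : nbhs z D by exact: open_nbhs_nbhs.
have [k hk] := ltr_add_invr (y := 0 : R) (x := e / 4) ltac:(by rewrite divr_gt0).
have k0 : (0 : R) < k.+1%:R^-1 by rewrite invr_gt0.
have [n zn] := ratE_dense z k0.
have Ip : I (n, k).
  move=> w hw; apply: eD; rewrite -[ball _ _]/(@ball _ E z e) ball_box// => i.
  have := hw i; rewrite /=.
  have := zn; rewrite -[ball _ _]/(@ball _ E z (k.+1%:R^-1 : R)) ball_box// => /(_ i).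
  by move: hk k0; move: (k.+1%:R^-1 : R) => t; lra.
exists (pickle (n, k)) => //; rewrite /F pickleK /=.
have [_ _ H] := hN' (n, k).
apply: contrapT => Nz; apply: hz; apply: (H Ip z) => //=.
exact: ball_sym.
Qed.

End weak_gradient_uniqueness.

(** * Positive forms and weighted L2 spaces *)

Section hilbert.
Context {R : realType} (V : lmodType R) (W : set V) (b : V -> V -> R).
Hypothesis W0 : W 0.
Hypothesis WL : forall c u v, W u -> W v -> W (c *: u + v).
Hypothesis bC : forall u v, W u -> W v -> b u v = b v u.
Hypothesis bL : forall c u v w, W u -> W v -> W w -> b (c *: u + v) w = c * b u w + b v w.
Hypothesis b_ge0 : forall u, W u -> 0 <= b u u.

Lemma form_closedD u v : W u -> W v -> W (u + v).
Proof. by move=> Wu Wv; rewrite -[u]scale1r; exact: WL. Qed.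

Lemma form_closedZ c u : W u -> W (c *: u).
Proof. by move=> Wu; rewrite -[_ *: _]addr0; exact: WL. Qed.

Lemma form_closedB u v : W u -> W v -> W (u - v).
Proof. by move=> Wu Wv; rewrite addrC -scaleN1r; exact: WL. Qed.

Lemma form_zerol w : W w -> b 0 w = 0.
Proof.
by move=> Ww; have := bL 1 W0 W0 Ww; rewrite scale1r addr0 mul1r => h; lra.
Qed.

Lemma form_scalel c u w : W u -> W w -> b (c *: u) w = c * b u w.
Proof. by move=> Wu Ww; have := bL c Wu W0 Ww; rewrite addr0 form_zerol// addr0. Qed.

Lemma formBl u v w : W u -> W v -> W w -> b (u - v) w = b u w - b v w.
Proof.
move=> Wu Wv Ww; rewrite addrC -scaleN1r bL// mulN1r addrC//.
Qed.

Lemma form_sqrD c u v : W u -> W v ->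
  b (c *: u + v) (c *: u + v) = c ^+ 2 * b u u + 2 * c * b u v + b v v.
Proof.
move=> Wu Wv; have Ww := WL c Wu Wv.
rewrite bL// (bC Wu Ww) (bC Wv Ww) !bL// (bC Wv Wu); ring.
Qed.

Lemma form_sqrB u v : W u -> W v ->
  b (u - v) (u - v) = b u u - 2 * b u v + b v v.
Proof.
by move=> Wu Wv; rewrite addrC -scaleN1r form_sqrD// (bC Wv Wu); ring.
Qed.

Lemma ler_of_sqr (y z : R) : 0 <= z -> y ^+ 2 <= z ^+ 2 -> y <= z.
Proof. by move=> z0 yz; rewrite leNgt; apply/negP => h; nra. Qed.

Lemma quadratic_discr (p q r : R) : 0 <= p -> 0 <= r ->
  (forall t, 0 <= t ^+ 2 * p + 2 * t * q + r) -> q ^+ 2 <= p * r.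
Proof.
move=> p0 r0 h.
have [p00|pn0] := eqVneq p 0.
  have [->|q0] := eqVneq q 0; first by rewrite expr0n p00 mul0r.
  (* For p = 0 and q nonzero the expression is affine in t, and it takes the value -1 here. *)
  have := h (- (r + 1) / (2 * q)); rewrite p00 mulr0 add0r.
  have -> : 2 * (- (r + 1) / (2 * q)) * q + r = - 1 by field.
  lra.
have {}p0 : 0 < p by rewrite lt_def pn0.
have := h (- q / p).
have -> : (- q / p) ^+ 2 * p + 2 * (- q / p) * q + r = r - q ^+ 2 / p by field.
by rewrite subr_ge0 ler_pdivrMr// mulrC.
Qed.

Lemma form_cauchy_schwarz u v : W u -> W v -> b u v ^+ 2 <= b u u * b v v.
Proof.
move=> Wu Wv; apply: quadratic_discr; [exact: b_ge0..|].
by move=> t; rewrite -form_sqrD//; apply: b_ge0; exact: WL.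
Qed.

Lemma form_le2 u v : W u -> W v -> b (u + v) (u + v) <= 2 * b u u + 2 * b v v.
Proof.
move=> Wu Wv; rewrite -[u in b (u + _)]scale1r -[u in X in b _ (X + _)]scale1r.
have := b_ge0 (form_closedB Wu Wv); rewrite form_sqrB// scale1r.
by have := @form_sqrD 1 u v Wu Wv; rewrite scale1r => ->; lra.
Qed.

(** Stated with the squared seminorm, so that no square roots enter. *)
Definition form_cauchy (u : nat -> V) := forall e, 0 < e -> exists N, forall n m,
  (N <= n)%N -> (N <= m)%N -> b (u n - u m) (u n - u m) <= e.

Definition form_cvg (u : nat -> V) (l : V) := forall e, 0 < e -> exists N, forall n,
  (N <= n)%N -> b (u n - l) (u n - l) <= e.

Lemma form_riesz (l : V -> R) (K : R) :
  (forall u, (forall n, W (u n)) -> form_cauchy u -> exists2 p, W p & form_cvg u p) ->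
  (forall c u v, W u -> W v -> l (c *: u + v) = c * l u + l v) ->
  (forall u, W u -> l u ^+ 2 <= K * b u u) ->
  exists2 p, W p & forall w, W w -> b p w = l w.
Proof.
move=> cplt lL lK.
wlog K0 : K lK / 0 <= K.
  move=> H; apply: (H `|K|) => // u Wu; apply: le_trans (lK _ Wu) _.
  by rewrite ler_wpM2r ?b_ge0// ler_norm.
pose J u := b u u - 2 * l u.
have JK u : W u -> - K <= J u.
  move=> Wu; rewrite /J; have := lK _ Wu; have := b_ge0 Wu; move: (l u) (b u u) => x y y0 h.
  (* The inequality of means: (2 x)^2 <= 4 K y <= (K + y)^2. *)
  suff : 2 * x <= K + y by lra.
  apply: ler_of_sqr; first lra.
  rewrite (_ : (2 * x) ^+ 2 = 4 * x ^+ 2); last ring.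
  rewrite (_ : (K + y) ^+ 2 = (K - y) ^+ 2 + 4 * (K * y)); last ring.
  by have := sqr_ge0 (K - y); lra.
pose S := [set J u | u in W].
have Sinf : has_inf S.
  by split; [exists (J 0), 0|exists (- K) => _ [u Wu <-]; exact: JK].
pose I := inf S.
have IJ u : W u -> I <= J u.
  by move=> Wu; apply: ge_inf; [exact: Sinf.2|exists u].
have /choice[u hu] : forall n : nat, exists u, W u /\ J u < I + n.+1%:R^-1.
  move=> n; have [] := @inf_adherent R S n.+1%:R^-1 _ Sinf; first by rewrite invr_gt0.
  by move=> _ [u Wu <-] h; exists u.
have Wu n : W (u n) by have [] := hu n.
have Ju n : J (u n) < I + n.+1%:R^-1 by have [] := hu n.
have inv_small (e : R) : 0 < e -> exists N, forall n, (N <= n)%N -> n.+1%:R^-1 <= e.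
  move=> e0; have [N hN] := ltr_add_invr (y := 0 : R) (x := e) e0.
  exists N => n Nn; rewrite add0r in hN; apply: le_trans (ltW hN).
  by rewrite lef_pV2 ?posrE// ler_nat.
have cu : form_cauchy u.
  (* By the parallelogram law the squared distance of u n and u m is 2 J (u n) + 2 J (u m) - 4 J
     (midpoint), which is at most 2/(n+1) + 2/(m+1). *)
  move=> e e0; have [N hN] := inv_small (e / 4) ltac:(lra).
  exists N => n m Nn Nm.
  have Wm : W (2^-1 *: (u n + u m)) by apply: form_closedZ; exact: form_closedD.
  have := IJ _ Wm; rewrite /J.
  have -> : b (2^-1 *: (u n + u m)) (2^-1 *: (u n + u m)) =
     4^-1 * (b (u n) (u n) + 2 * b (u n) (u m) + b (u m) (u m)).
    have Wd := form_closedD (Wu n) (Wu m).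
    rewrite form_scalel// (bC Wd Wm) form_scalel//.
    by have := @form_sqrD 1 (u n) (u m) (Wu n) (Wu m); rewrite scale1r => ->; field.
  have -> : l (2^-1 *: (u n + u m)) = 2^-1 * (l (u n) + l (u m)).
    have h0 : l 0 = 0 by have := lL 1 _ _ W0 W0; rewrite scale1r addr0 mul1r => h; lra.
    have := lL 2^-1 _ _ (form_closedD (Wu n) (Wu m)) W0; rewrite addr0 h0 addr0 => ->.
    by have := lL 1 _ _ (Wu n) (Wu m); rewrite scale1r mul1r => ->.
  rewrite form_sqrB//.
  have := Ju n; have := Ju m; rewrite /J.
  have := hN _ Nn; have := hN _ Nm.
  move: (n.+1%:R^-1) (m.+1%:R^-1) => x y; lra.
have [p Wp up] := cplt _ Wu cu.
exists p => // w Ww.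
(* The first variation in the direction t w, with an error e: half of it because J (u n) exceeds the
   infimum by at most e/2, half because u n is replaced by its limit p in the linear term. *)
have key (t e : R) : 0 < e -> 0 <= t ^+ 2 * b w w + 2 * t * (b p w - l w) + e.
  move=> e0; pose B := b w w; have B0 : 0 <= B by exact: b_ge0.
  have den : 0 < 16 * (t ^+ 2 * B + 1).
    by have := mulr_ge0 (sqr_ge0 t) B0; lra.
  have eta0 : 0 < e ^+ 2 / (16 * (t ^+ 2 * B + 1)) by rewrite divr_gt0// exprn_gt0.
  have [N1 hN1] := up _ eta0.
  have [N2 hN2] := inv_small (e / 2) ltac:(lra).
  pose n := maxn N1 N2.
  have ys := hN1 n (leq_maxl _ _); have s2 := hN2 n (leq_maxr _ _).
  set x := b (u n - p) w; have Wd := form_closedB (Wu n) Wp.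
  have xB : x ^+ 2 <= b (u n - p) (u n - p) * B by exact: form_cauchy_schwarz.
  have ex : b (u n) w = b p w + x by rewrite /x formBl//; ring.
  have Jn : J (u n) < J (t *: w + u n) + n.+1%:R^-1.
    by apply: lt_le_trans (Ju n) _; rewrite lerD2r; apply: IJ; exact: WL.
  move: Jn; rewrite /J form_sqrD// lL// (bC Ww (Wu n)) ex.
  have y0 : 0 <= b (u n - p) (u n - p) by exact: b_ge0.
  rewrite ler_pdivlMr// in ys.
  move: (b (u n - p) (u n - p)) xB y0 ys => y xB y0 ys.
  have -> : b w w = B by [].
  move: (n.+1%:R^-1) s2 => s s2 Jn.
  have h1 : (2 * t * x) ^+ 2 <= (e / 2) ^+ 2.
    have h2 : t ^+ 2 * x ^+ 2 <= t ^+ 2 * (y * B) by rewrite ler_wpM2l// sqr_ge0.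
    rewrite (_ : (2 * t * x) ^+ 2 = 4 * (t ^+ 2 * x ^+ 2)); last ring.
    rewrite (_ : (e / 2) ^+ 2 = 4^-1 * e ^+ 2); last by field.
    rewrite (_ : y * (16 * (t ^+ 2 * B + 1)) = 16 * (t ^+ 2 * (y * B)) + 16 * y) in ys; last ring.
    lra.
  have e20 : 0 <= e / 2 by lra.
  have := ler_of_sqr e20 h1.
  by move: Jn; lra.
have key2 t : 0 <= t ^+ 2 * b w w + 2 * t * (b p w - l w) + 0.
  by rewrite addr0; apply/ler_addgt0Pr => e e0; exact: key.
(* A nonnegative quadratic polynomial without constant term has no linear term. *)
have := quadratic_discr (b_ge0 Ww) (lexx 0) key2; rewrite mulr0 => h.
apply/eqP; rewrite -subr_eq0 -sqrf_eq0; apply/eqP; apply/le_anti.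
by rewrite h sqr_ge0.
Qed.

End hilbert.

Section Rintegral_linear.
Context {R : realType} dd (T : measurableType dd) (mu : {measure set T -> \bar R}).
Variables (D : set T) (mD : measurable D).
Implicit Types f g : T -> R.

Lemma integrable_lin c f g : mu.-integrable D (EFin \o f) -> mu.-integrable D (EFin \o g) ->
  mu.-integrable D (EFin \o (fun x => c * f x + g x)).
Proof.
move=> fi gi.
rewrite (_ : _ \o _ = (fun z => (c%:E * (EFin \o f) z) + (EFin \o g) z)%E); last first.
  by apply/funext => z /=; rewrite -EFinM -EFinD.
by apply: integrableD => //; exact: integrableZl.
Qed.

Lemma Rintegral_lin c f g : mu.-integrable D (EFin \o f) -> mu.-integrable D (EFin \o g) ->
  \int[mu]_(x in D) (c * f x + g x) = c * \int[mu]_(x in D) f x + \int[mu]_(x in D) g x.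
Proof.
move=> fi gi; rewrite -RintegralZl// -RintegralD//.
rewrite (_ : _ \o _ = (fun z => c%:E * (EFin \o f) z)%E); last by apply/funext => z /=; rewrite EFinM.
exact: integrableZl.
Qed.

End Rintegral_linear.

(** * Weighted L2 spaces and their completeness *)

Section weighted_L2.
Context {R : realType} dd (T : measurableType dd) (mu : {measure set T -> \bar R}).
Variables (D : set T) (mD : measurable D) (w : T -> R).
Hypothesis mw : measurable_fun D w.
Hypothesis w_gt0 : forall z, D z -> 0 < w z.
Implicit Types u v : T -> R^o.

Definition l2 u := measurable_fun D u /\
  mu.-integrable D (EFin \o (fun z => u z ^+ 2 * w z)).
Definition ip u v : R := \int[mu]_(z in D) (u z * v z * w z).

Lemma measurable_l2_prod u v : measurable_fun D u -> measurable_fun D v ->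
  measurable_fun D (fun z => u z * v z * w z).
Proof. by move=> mu0 mv; do 2 apply: measurable_funM => //. Qed.

Lemma l2_prod u v : l2 u -> l2 v -> mu.-integrable D (EFin \o (fun z => u z * v z * w z)).
Proof.
move=> [mu1 iu] [mv iv].
apply: (le_integrable mD _ _ (integrableD mD iu iv)).
  by apply/measurable_EFinP; exact: measurable_l2_prod.
move=> z Dz; rewrite [X in (_ <= `|X|)%E]/= -EFinD /= lee_fin.
have w0 := w_gt0 Dz.
rewrite normrM (ger0_norm (ltW w0)) [leRHS]ger0_norm; last first.
  by rewrite addr_ge0// mulr_ge0 ?sqr_ge0 ?ltW.
rewrite -mulrDl; apply: ler_wpM2r; first exact: ltW.
rewrite normrM.
rewrite -(real_normK (num_real (u z))) -(real_normK (num_real (v z))).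
by have := sqr_ge0 (`|u z| - `|v z|); have := normr_ge0 (u z); have := normr_ge0 (v z); nra.
Qed.

Lemma l2_lin c u v : l2 u -> l2 v -> l2 (c *: u + v).
Proof.
move=> lu lv; have [mu1 iu] := lu; have [mv iv] := lv.
split.
  by apply: measurable_funD => //; apply: measurable_funM.
have := integrable_lin mD (2 * c) (l2_prod lu lv) (integrable_lin mD (c ^+ 2) iu iv).
congr (mu.-integrable D); apply/funext => z /=; congr EFin.
by rewrite -[(c *: u + v) z]/(c * u z + v z); ring.
Qed.

Lemma l20 : l2 0.
Proof.
split; first exact: measurable_cst.
rewrite (_ : _ \o _ = cst 0%E); first exact: integrable0.
by apply/funext => z /=; rewrite -[(0 : T -> R^o) z]/(0 : R) expr0n mul0r.
Qed.

Lemma ipC u v : ip u v = ip v u.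
Proof. by apply: eq_Rintegral => z _; rewrite (mulrC (u z)). Qed.

Lemma ipL c u v v' : l2 u -> l2 v -> l2 v' -> ip (c *: u + v) v' = c * ip u v' + ip v v'.
Proof.
move=> lu lv lv'; have i1 := l2_prod lu lv'; have i2 := l2_prod lv lv'.
rewrite /ip -Rintegral_lin//.
by apply: eq_Rintegral => z _; rewrite -[(c *: u + v) z]/(c * u z + v z); ring.
Qed.

Lemma ip_ge0 u : 0 <= ip u u.
Proof. by apply: Rintegral_ge0 => z Dz; rewrite mulr_ge0 ?(ltW (w_gt0 Dz))// -expr2 sqr_ge0. Qed.

Lemma ipE u : l2 u -> (ip u u)%:E = (\int[mu]_(z in D) (u z ^+ 2 * w z)%:E)%E.
Proof.
move=> [mu1 iu]; rewrite /ip /Rintegral.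
under eq_integral do rewrite -expr2.
by rewrite fineK//; exact: integrable_fin_num.
Qed.

Lemma ip_eq0 u : l2 u -> ip u u = 0 -> {ae mu, forall z, D z -> u z = 0}.
Proof.
move=> lu h; have [mu1 iu] := lu.
have h0 : (\int[mu]_(z in D) `|(u z ^+ 2 * w z)%:E|)%E = 0%E.
  rewrite -[RHS](_ : (ip u u)%:E = _); last by rewrite h.
  rewrite ipE//; apply: eq_integral => z /set_mem Dz.
  by rewrite gee0_abs// lee_fin mulr_ge0 ?sqr_ge0// ltW// w_gt0.
have mf : measurable_fun D (fun z => (u z ^+ 2 * w z)%:E).
  by have := measurable_int _ iu.
have /(ae_eq_integral_abs mu mD mf) := h0.
apply: filterS => z hz Dz; have /= := hz Dz => -[] /eqP.
by rewrite mulf_eq0 sqrf_eq0 (gt_eqF (w_gt0 Dz)) orbF => /eqP.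
Qed.

Lemma ip_le2 u v : l2 u -> l2 v -> ip (u + v) (u + v) <= 2 * ip u u + 2 * ip v v.
Proof.
apply: (@form_le2 R (T -> R^o) l2 ip) => //.
- exact: l2_lin.
- by move=> u1 v1 _ _; exact: ipC.
- exact: ipL.
- by move=> u1 _; exact: ip_ge0.
Qed.

Lemma ip_cauchy_schwarz u v : l2 u -> l2 v -> ip u v ^+ 2 <= ip u u * ip v v.
Proof.
apply: (@form_cauchy_schwarz R (T -> R^o) l2 ip) => //.
- exact: l2_lin.
- by move=> u1 v1 _ _; exact: ipC.
- exact: ipL.
- by move=> u1 _; exact: ip_ge0.
Qed.

Lemma geometric_increments_cvg (a : nat -> R^o) (K : R) :
  (forall k, `|a k.+1 - a k| <= K * 2^-1 ^+ k) -> cvgn a.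
Proof.
move=> h.
have cs : cvgn (series (fun k => a k.+1 - a k)).
  apply: normed_cvg.
  apply: (@series_le_cvg _ _ (geometric K 2^-1)) => [n|n|n|].
  - exact: normr_ge0.
  - exact: le_trans (h n).
  - exact: h.
  - apply: is_cvg_geometric_series; rewrite ger0_norm; lra.
have -> : a = (fun n => series (fun k => a k.+1 - a k) n + a 0%N).
  by apply/funext => n; rewrite /series/= telescope_sumr// subrK.
by apply: is_cvgD => //; exact: is_cvg_cst.
Qed.

(** Riesz-Fischer: a fast subsequence converges almost everywhere because its weighted squared
    increments have summable integrals, and Fatou's lemma turns the pointwise limit into a limit in
    the seminorm. *)
Lemma l2_complete (u : nat -> T -> R^o) : (forall n, l2 (u n)) ->
  form_cauchy ip u -> exists2 p, l2 p & form_cvg ip u p.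
Proof.
move=> lu cu.
have lB n m : l2 (u n - u m).
  by rewrite addrC -scaleN1r; exact: l2_lin.
(* The rate 8^-k splits as 4^-k 2^-k: the factor 4^k is put in front of the squared increments to
   make them decay geometrically at each point, and 2^-k keeps the integrals summable. *)
have /choice[N hN] : forall k : nat, exists N, forall n m, (N <= n)%N -> (N <= m)%N ->
    ip (u n - u m) (u n - u m) <= 8^-1 ^+ k.
  by move=> k; apply: cu; rewrite exprn_gt0.
(* The partial sums make the indices increasing and at least [N k]; the summand [k] makes them
   unbounded. *)
pose nk k := (\sum_(i < k.+1) N i + k)%N.
have Nnk k : (N k <= nk k)%N by rewrite /nk big_ord_recr/= -addnA addnCA leq_addr.
have nkS k : (nk k <= nk k.+1)%N.
  by rewrite /nk [X in (_ <= X + _)%N]big_ord_recr/= leq_add// leq_addr.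
have nk_mono i j : (i <= j)%N -> (nk i <= nk j)%N by elim: j => [|j IH]; [rewrite leqn0 => /eqP ->|rewrite leq_eqVlt => /orP[/eqP -> //|]; rewrite ltnS => /IH h; exact: leq_trans h (nkS j)].
pose v k := u (nk k).
have hv i j : (i <= j)%N -> ip (v j - v i) (v j - v i) <= 8^-1 ^+ i.
  by move=> ij; apply: hN => //; apply: leq_trans (nk_mono _ _ ij).
have mv k : measurable_fun D (v k) by have [] := lu (nk k).
pose F (k : nat) (z : T) : \bar R := (4 ^+ k * ((v k.+1 z - v k z) ^+ 2 * w z))%:E.
have mF k : measurable_fun D (F k).
  apply/measurable_EFinP; apply: measurable_funM => //; apply: measurable_funM => //.
  by apply: measurable_funX; exact: measurable_funB.
have F0 k z : D z -> (0 <= F k z)%E.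
  by move=> Dz; rewrite lee_fin mulr_ge0// mulr_ge0 ?sqr_ge0 ?ltW ?w_gt0.
have IF k : (\int[mu]_(z in D) F k z <= (2^-1 ^+ k)%:E)%E.
  have -> : (2^-1 ^+ k : R) = 4 ^+ k * 8^-1 ^+ k by rewrite -exprMn; congr (_ ^+ _); field.
  rewrite EFinM /F; under eq_integral do rewrite EFinM.
  rewrite ge0_integralZl//; last 2 first.
  - by apply/measurable_EFinP; apply: measurable_funM => //; apply: measurable_funX; exact: measurable_funB.
  - by move=> z Dz; rewrite lee_fin mulr_ge0 ?sqr_ge0 ?ltW ?w_gt0.
  apply: lee_wpmul2l; first by rewrite lee_fin exprn_ge0.
  by have := ipE (lB (nk k.+1) (nk k)) => <-; rewrite lee_fin; exact: hv.
have mS : measurable_fun D (fun z => \sum_(k <oo) F k z)%E.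
  by apply: ge0_emeasurable_sum => // k z Dz _; exact: F0.
have iS : mu.-integrable D (fun z => \sum_(k <oo) F k z)%E.
  apply/integrableP; split => //.
  under eq_integral => z /set_mem Dz.
    rewrite gee0_abs; last by apply: nneseries_ge0 => k _ _; exact: F0.
    over.
  rewrite integral_nneseries//.
  apply: (@le_lt_trans _ _ (\sum_(k <oo) (2^-1 ^+ k)%:E)%E).
    by apply: lee_nneseries => [k _ _|k _]; [apply: integral_ge0 => z; exact: F0|exact: IF].
  apply: (@le_lt_trans _ _ 2%:E); last exact: ltry.
  apply: lime_le; first by apply: is_cvg_nneseries => k _ _; rewrite lee_fin exprn_ge0.
  apply: nearW => n; rewrite sumEFin lee_fin.
  suff -> : \sum_(0 <= i < n) (2^-1 ^+ i : R) = 2 - 2 * 2^-1 ^+ n.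
    by have : 0 <= (2^-1 ^+ n : R) by []; lra.
  elim: n => [|n IH]; first by rewrite big_nil expr0; ring.
  by rewrite big_nat_recr//= IH exprS; field.
have [Nn [mN N0 sN]] := integrable_ae mD iS.
pose D' := D `\` Nn; have mD' : measurable D' by exact: measurableD.
have cv z : D' z -> cvgn (fun k => v k z : R^o).
  move=> [Dz Nz].
  have Ffin : (\sum_(k <oo) F k z)%E \is a fin_num.
    by apply: contrapT => h; apply: Nz; apply: sN => H; apply: h; exact: H.
  set S := fine (\sum_(k <oo) F k z)%E.
  have w0 := w_gt0 Dz.
  apply: (@geometric_increments_cvg _ (Num.sqrt (S / w z))) => k.
  have : (F k z <= \sum_(k <oo) F k z)%E.
    apply: (@le_trans _ _ (\sum_(0 <= i < k.+1) F i z)%E).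
      by rewrite big_nat_recr//= leeDr// sume_ge0// => i _; exact: F0.
    by apply: nneseries_lim_ge => i _ _; exact: F0.
  rewrite -(fineK Ffin) lee_fin -/S => h.
  have S0 : 0 <= S by apply: le_trans h; rewrite mulr_ge0// mulr_ge0 ?sqr_ge0// ltW.
  have Sw0 : 0 <= S / w z by rewrite divr_ge0// ltW.
  apply: ler_of_sqr; first by rewrite mulr_ge0// sqrtr_ge0.
  rewrite real_normK ?num_real// exprMn sqr_sqrtr//.
  have -> : (2^-1 ^+ k) ^+ 2 = (4 ^+ k)^-1 :> R.
    by rewrite -exprM mulnC exprM -exprVn; congr (_ ^+ _); field.
  rewrite ler_pdivlMr ?exprn_gt0// ler_pdivlMr//.
  by apply: le_trans h; rewrite le_eqVlt; apply/orP; left; apply/eqP; ring.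
pose p : T -> R^o := (fun z => lim (v k z @[k --> \oo])) \_ D'.
have vp z : D' z -> v k z @[k --> \oo] --> p z.
  by move=> D'z; rewrite /p patchE mem_set//; exact: cv.
have mp : measurable_fun D p.
  apply: (measurable_restrict _ mD' mD).1; rewrite setIidr; last by move=> z [].
  apply: (@measurable_fun_cvg _ _ _ _ v) => [k|z D'z]; last exact: cv.
  by apply: measurable_funS (mv k) => // z [].
(* Fatou's lemma for v (k + j) - v k as j grows, off the exceptional null set. *)
have fat k : (\int[mu]_(z in D) ((v k z - p z) ^+ 2 * w z)%:E <= (8^-1 ^+ k)%:E)%E.
  rewrite (ge0_negligible_integral mN)//; last 2 first.
  - apply/measurable_EFinP; apply: measurable_funM => //; apply: measurable_funX; exact: measurable_funB.
  - by move=> z Dz; rewrite lee_fin mulr_ge0 ?sqr_ge0// ltW ?w_gt0.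
  pose f j z := (((v (k + j)%N z - v k z) ^+ 2 * w z)%:E : \bar R).
  have mf j : measurable_fun D (f j).
    apply/measurable_EFinP; apply: measurable_funM => //; apply: measurable_funX; exact: measurable_funB.
  have f0 j z : D z -> (0 <= f j z)%E.
    by move=> Dz; rewrite lee_fin mulr_ge0 ?sqr_ge0// ltW ?w_gt0.
  have -> : (\int[mu]_(z in D') ((v k z - p z) ^+ 2 * w z)%:E = \int[mu]_(z in D') limn_einf (f^~ z))%E.
    apply: eq_integral => z /set_mem D'z; apply/esym.
    have hc : f ^~ z @ \oo --> ((v k z - p z) ^+ 2 * w z)%:E.
      apply: cvg_EFin_real; apply: cvgM; last exact: cvg_cst.
      rewrite (_ : (v k z - p z) ^+ 2 = (p z - v k z) * (p z - v k z)); last by ring.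
      have hv1 : v (k + j)%N z - v k z @[j --> \oo] --> p z - v k z.
        apply: cvgB; last exact: cvg_cst.
        rewrite (_ : (fun j => v (k + j)%N z) = (fun j => v (j + k)%N z)); last by apply/funext => j; rewrite addnC.
        by have := vp z D'z; rewrite -(cvg_shiftn k).
      by rewrite (_ : (fun j => _) = (fun j => (v (k + j)%N z - v k z) * (v (k + j)%N z - v k z)));
        [exact: cvgM|apply/funext => j; rewrite expr2].
    by have [] := cvg_limn_einf_sup hc.
  have D'D : D' `<=` D by move=> z [].
  apply: le_trans (fatou mu mD' (fun j => measurable_funS mD D'D (mf j)) (fun j z D'z => f0 j z (D'D _ D'z))) _.
  rewrite limn_einf_lim; apply: lime_le; first exact: is_cvg_einfs.
  apply: nearW => n; apply: (@le_trans _ _ (\int[mu]_(z in D') f n z)%E).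
    by apply: ereal_inf_lbound; exists n => //=.
  apply: (@le_trans _ _ (\int[mu]_(z in D) f n z)%E).
    by apply: ge0_subset_integral => // z Dz; exact: f0.
  have := ipE (lB (nk (k + n)%N) (nk k)) => <-; rewrite lee_fin; apply: hv; exact: leq_addr.
have l2vp k : l2 (v k - p).
  split; first exact: measurable_funB.
  apply/integrableP; split.
    by apply/measurable_EFinP; apply: measurable_funM => //; apply: measurable_funX; exact: measurable_funB.
  under eq_integral => z /set_mem Dz.
    rewrite gee0_abs; last by rewrite lee_fin mulr_ge0 ?sqr_ge0// ltW ?w_gt0.
    over.
  by apply: le_lt_trans (fat k) (ltry _).
have l2p : l2 p.
  have -> : p = -1 *: (v 0%N - p) + v 0%N by rewrite scaleN1r opprB subrK.
  by apply: l2_lin => //; exact: lu.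
exists p => // e e0.
have [N1 hN1] := cu (e / 4) ltac:(by rewrite divr_gt0).
have [k hk] : exists k : nat, (8^-1 ^+ k : R) <= e / 4.
  have [k hk] := ltr_add_invr (y := 0 : R) (x := e / 4) ltac:(by rewrite divr_gt0).
  exists k; rewrite add0r in hk; apply: le_trans (ltW hk).
  by rewrite exprVn lef_pV2 ?posrE ?exprn_gt0// -natrX ler_nat ltn_expl.
exists N1 => n N1n; pose K := maxn N1 k.
have -> : u n - p = (u n - v K) + (v K - p) by rewrite addrA subrK.
apply: le_trans (ip_le2 (lB _ _) (l2vp K)) _.
have h1 : ip (u n - v K) (u n - v K) <= e / 4.
  by apply: hN1 => //; rewrite /nk; apply: leq_trans (leq_addl _ _); exact: leq_maxl.
have h2 : ip (v K - p) (v K - p) <= e / 4.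
  rewrite -lee_fin ipE//; apply: le_trans (fat K) _; rewrite lee_fin.
  apply: le_trans hk; apply: ler_wiXn2l; [lra|lra|exact: leq_maxr].
lra.
Qed.

End weighted_L2.

(** * Weak gradients: existence for smooth functions, linearity, uniqueness *)

Section weak_gradient.
Context {R : realType} (d : nat).
Local Notation E := ('rV[R]_d * R)%type.
Local Notation Em := ('rV[R]_d * measurableTypeR R)%type.
Implicit Types (D : set E) (u h phi psi : E -> R) (g : E -> E).

Lemma ae_volS (P Q : E -> Prop) : (forall z, P z -> Q z) ->
  {ae vol d, forall z, P z} -> {ae vol d, forall z, Q z}.
Proof. by move=> PQ; apply: (@filterS _ _ (ae_filter_ringOfSetsType (vol d))). Qed.

Lemma ae_volI (P Q : E -> Prop) : {ae vol d, forall z, P z} -> {ae vol d, forall z, Q z} ->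
  {ae vol d, forall z, P z /\ Q z}.
Proof. exact: (@filterI _ _ (ae_filter_ringOfSetsType (vol d))). Qed.

Lemma ae_vol_all (I : finType) (P : I -> E -> Prop) : (forall i, {ae vol d, forall z, P i z}) ->
  {ae vol d, forall z, forall i, P i z}.
Proof. exact: (@filter_forall _ I P _ (ae_filter_ringOfSetsType (vol d))). Qed.

Lemma test_csmooth D phi : test_function D phi -> csmooth (phi : E -> R^o).
Proof. by case. Qed.

Lemma test_bsupp D phi : test_function D phi -> bsupp phi.
Proof.
move=> [_ /compact_norm_le[r _ hr] _]; exists r => z zr; apply/eqP; apply: contraTT zr => hz.
by rewrite -leNgt; apply: hr; exact: subset_closure.
Qed.

Lemma derive_eq0_out phi v (z : E) : ~ closure [set z | phi z != 0] z ->
  phi z = 0 /\ 'D_v (phi : E -> R^o) z = 0.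
Proof.
move=> hz; split.
  by apply/eqP; apply: contra_notT hz => h; exact: subset_closure.
rewrite (_ : 'D_v _ z = 'D_v (cst 0 : E -> R^o) z); first by rewrite derive_cst.
apply: near_eq_derive.
have oC : open (~` closure [set z | phi z != 0]) by apply: closed_openC; exact: closed_closure.
have := open_nbhs_nbhs (conj oC hz); apply: filterS => y /= hy.
by apply/eqP; apply: contra_notT hy => h; exact: subset_closure.
Qed.

(** The factor [th] is kept apart from the test function [phi] so that the statement covers both
    [phi] and its derivatives. *)
Lemma integrable_loc_test D h phi (th : E -> R) : @measurable _ Em D -> locally_integrable_on D h ->
  test_function D phi -> continuous th ->
  (forall z, ~ closure [set z | phi z != 0] z -> th z = 0) ->
  (vol d).-integrable D (EFin \o (fun z => h z * th z)).
Proof.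
move=> mD lh [_ cK KD] cth th0.
set K := closure _ in cK KD th0.
have mK : @measurable _ Em K by exact: compact_measurable_E.
have ihK : (vol d).-integrable K (EFin \o h) by exact: lh.
have [r _ hr] := compact_norm_le cK.
have [C C0 hC] := continuous_bounded r cth.
have i1 : (vol d).-integrable K (EFin \o (fun z => h z * th z)).
  rewrite (_ : _ \o _ = (EFin \o h) \* (EFin \o th))%E; last first.
    by apply/funext => z /=; rewrite EFinM.
  apply: integrableMl => //.
    by apply: measurable_funTS; exact: continuous_measurable_E.
  by exists C; split; [exact: num_real|move=> M CM z /= Kz; rewrite (le_trans (hC z (hr z Kz)))// ltW].
have e : (EFin \o (fun z => h z * th z)) \_ K = (EFin \o (fun z => h z * th z)).
  apply/funext => z; rewrite patchE; case: ifPn => // /negP zK /=.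
  by rewrite th0 ?mulr0//; move/mem_set.
have := (integrable_mkcond (mu := vol d) (EFin \o (fun z => h z * th z)) mK).1 i1.
rewrite e => i2; exact: integrableS i2.
Qed.

Lemma locally_integrable_continuous D h : continuous h -> locally_integrable_on D h.
Proof.
move=> ch K cK KD; have [r _ hr] := compact_norm_le cK.
have [C C0 hC] := continuous_bounded r ch.
apply: (@integrable_bounded _ _ K h r C) => //.
- exact: compact_measurable_E.
- by apply: measurable_funTS; exact: continuous_measurable_E.
- by move=> z Kz; apply: hC; exact: hr.
Qed.

Lemma locally_integrable_lin D c h1 h2 : locally_integrable_on D h1 -> locally_integrable_on D h2 ->
  locally_integrable_on D (fun z => c * h1 z + h2 z).
Proof.
move=> l1 l2 K cK KD.
have mK := compact_measurable_E cK.
rewrite (_ : _ \o _ = (fun z => (c%:E * (EFin \o h1) z) + (EFin \o h2) z)%E); last first.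
  by apply/funext => z /=; rewrite -EFinM -EFinD.
by apply: integrableD => //; [apply: integrableZl => //; exact: l1|exact: l2].
Qed.

(** Integration by parts: the product with a test function has bounded support inside [D], and the
    integral of its derivative over the whole space is 0. *)
Lemma weak_gradient_smooth D phi : open D -> csmooth (phi : E -> R^o) ->
  is_weak_gradient D phi (grad phi).
Proof.
move=> oD sphi; have mD := open_measurable_E oD.
have cphi : continuous phi := csmooth_continuous sphi.
have gv v : (fun z => dotp (grad phi z) v) = 'D_v (phi : E -> R^o).
  by apply/funext => z; rewrite derive_dotp//; exact: csmooth_differentiable.
split; first exact: locally_integrable_continuous.
move=> v; have sdphi := csmooth_derive v sphi; have cdphi := csmooth_continuous sdphi.
split; first by rewrite gv; exact: locally_integrable_continuous.
move=> psi tpsi.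
have spsi : csmooth (psi : E -> R^o) := test_csmooth tpsi.
have sdpsi := csmooth_derive v spsi.
have i1 : (vol d).-integrable D (EFin \o (fun z => phi z * 'D_v (psi : E -> R^o) z)).
  apply: (integrable_loc_test mD _ tpsi (csmooth_continuous sdpsi)).
    exact: locally_integrable_continuous.
  by move=> z /(derive_eq0_out v)[].
have i2 : (vol d).-integrable D (EFin \o (fun z => dotp (grad phi z) v * psi z)).
  apply: (integrable_loc_test mD _ tpsi (csmooth_continuous spsi)).
    by rewrite gv; exact: locally_integrable_continuous.
  by move=> z /(derive_eq0_out v)[].
apply/eqP; rewrite -addr_eq0; apply/eqP; rewrite -RintegralD//.
rewrite -[RHS](@integral_derive0 R d (fun z => phi z * psi z) v); last 2 first.
- exact: csmoothM.
- by have [r hr] := test_bsupp tpsi; exists r => z /hr ->; rewrite mulr0.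
have De z : 'D_v ((fun z => phi z * psi z) : E -> R^o) z =
    phi z * 'D_v (psi : E -> R^o) z + dotp (grad phi z) v * psi z.
  rewrite [LHS](@deriveM _ _ phi psi); [|exact: csmooth_derivable..].
  rewrite -derive_dotp; last exact: csmooth_differentiable.
  by rewrite /GRing.scale/= [psi z * _]mulrC.
under [RHS]eq_Rintegral do rewrite De.
rewrite -(@Rintegral_supp R d setT D)// => z _ Dz.
have nz : ~ closure [set z | psi z != 0] z by have [_ _ KD] := tpsi; move=> /KD.
by have [-> ->] := derive_eq0_out v nz; rewrite !mulr0 addr0.
Qed.

Lemma weak_gradient_lin D c u1 u2 g1 g2 : open D -> is_weak_gradient D u1 g1 -> is_weak_gradient D u2 g2 ->
  is_weak_gradient D (fun z => c * u1 z + u2 z) (fun z => c *: g1 z + g2 z).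
Proof.
move=> oD [l1 h1] [l2 h2]; have mD := open_measurable_E oD.
split; first exact: locally_integrable_lin.
move=> v; have [lg1 e1] := h1 v; have [lg2 e2] := h2 v.
have gE : (fun z => dotp (c *: g1 z + g2 z) v) = (fun z => c * dotp (g1 z) v + dotp (g2 z) v).
  by apply/funext => z; rewrite dotpDl dotpZl.
split; first by rewrite gE; exact: locally_integrable_lin.
move=> psi tpsi.
have spsi : csmooth (psi : E -> R^o) := test_csmooth tpsi.
have sdpsi := csmooth_derive v spsi.
have iD h : locally_integrable_on D h -> (vol d).-integrable D (EFin \o (fun z => h z * 'D_v (psi : E -> R^o) z)).
  move=> lh; apply: (integrable_loc_test mD lh tpsi (csmooth_continuous sdpsi)).
  by move=> z /(derive_eq0_out v)[].
have iP h : locally_integrable_on D h -> (vol d).-integrable D (EFin \o (fun z => h z * psi z)).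
  move=> lh; apply: (integrable_loc_test mD lh tpsi (csmooth_continuous spsi)).
  by move=> z /(derive_eq0_out v)[].
transitivity (c * \int[vol d]_(z in D) (u1 z * 'D_v (psi : E -> R^o) z) + \int[vol d]_(z in D) (u2 z * 'D_v (psi : E -> R^o) z)).
  rewrite -Rintegral_lin//; [|exact: iD..].
  by apply: eq_Rintegral => z _; rewrite mulrDl mulrA.
rewrite e1// e2// mulrN -opprD; congr (- _).
rewrite -Rintegral_lin//; [|exact: iP..].
by apply: eq_Rintegral => z _; rewrite dotpDl dotpZl; ring.
Qed.

(** This makes the representative chosen by [wgrad] usable: it agrees almost everywhere with any
    weak gradient that is known explicitly. *)
Lemma weak_gradient_unique D u g1 g2 : open D -> is_weak_gradient D u g1 -> is_weak_gradient D u g2 ->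
  {ae vol d, forall z, D z -> g1 z = g2 z}.
Proof.
move=> oD h1 h2; have mD := open_measurable_E oD.
have key (i : 'I_d.+1) : {ae vol d, forall z, D z -> crd i (g1 z) = crd i (g2 z)}.
  have [_ /(_ (ebas i))[l1 e1]] := h1; have [_ /(_ (ebas i))[l2 e2]] := h2.
  have l12 := locally_integrable_lin (-1) l1 l2.
  have := @weak_zero_ae R d D _ oD l12.
  have H : forall phi, test_function D phi ->
    \int[vol d]_(z in D) ((-1 * dotp (g1 z) (ebas i) + dotp (g2 z) (ebas i)) * phi z) = 0.
    move=> psi tpsi.
    have spsi : csmooth (psi : E -> R^o) := test_csmooth tpsi.
    have iP h : locally_integrable_on D h -> (vol d).-integrable D (EFin \o (fun z => h z * psi z)).
      move=> lh; apply: (integrable_loc_test mD lh tpsi (csmooth_continuous spsi)).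
      by move=> z /(derive_eq0_out 0)[].
    transitivity (-1 * \int[vol d]_(z in D) (dotp (g1 z) (ebas i) * psi z) + \int[vol d]_(z in D) (dotp (g2 z) (ebas i) * psi z)).
      rewrite -Rintegral_lin//; [|exact: iP..].
      by apply: eq_Rintegral => z _; rewrite mulrDl mulrA.
    have := e1 _ tpsi; have := e2 _ tpsi => -> /eqP; rewrite eqr_opp => /eqP ->.
    by rewrite mulN1r addrC subrr.
  move=> /(_ H); apply: ae_volS => z hz Dz.
  by have := hz Dz; rewrite !dotp_ebas; lra.
have := ae_vol_all key.
by apply: ae_volS => z hz Dz; apply: crd_inj => i; exact: hz.
Qed.

Lemma wgradP D u : (exists g, is_weak_gradient D u g) -> is_weak_gradient D u (wgrad D u).
Proof. by move=> h; exact: (xgetPex _ h). Qed.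

End weak_gradient.

(** * Integrals of powers and a weighted fundamental theorem of calculus *)

Section powR_integrals.
Context {R : realType}.
Local Notation leb1 := (@lebesgue_measure R).
Implicit Types (b p q t : R).

Lemma powR_continuous_gt0 b t : 0 < t -> {for t, continuous (@powR R ^~ b)}.
Proof.
move=> t0; apply: differentiable_continuous; apply/derivable1_diffP.
by have [] := is_derive1_powR b t0.
Qed.

Lemma measurable_powRl b (D : set R) : measurable_fun D (fun t => t `^ b).
Proof. by apply: measurable_funTS; exact: measurable_powR. Qed.

Lemma integral_powR b p q : -1 < b -> 0 < p -> p < q ->
  (\int[leb1]_(t in `[p, q]) (t `^ b)%:E = ((q `^ (b + 1) - p `^ (b + 1)) / (b + 1))%:E)%E.
Proof.
move=> b1 p0 pq; have b0 : b + 1 != 0 by lra.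
pose F t := t `^ (b + 1) / (b + 1).
have dF t : 0 < t -> is_derive t (1 : R) F (t `^ b).
  move=> t0; have h := is_derive1_powR (b + 1) t0.
  have h2 : is_derive t (1 : R) (fun t => t `^ (b + 1) * (b + 1)^-1) (((b + 1)^-1) *: ((b + 1) * t `^ (b + 1 - 1))).
    by apply: is_derive_eq; rewrite /GRing.scale/=; ring.
  by apply: (is_derive_eq h2); rewrite addrK /GRing.scale/= mulrA mulVf// mul1r.
have cF t : 0 < t -> {for t, continuous F}.
  by move=> t0; apply: differentiable_continuous; apply/derivable1_diffP; have [] := dF t t0.
rewrite (@continuous_FTC2 R (fun t => t `^ b) F p q pq).
- by rewrite /F -EFinB -mulrBl.
- apply: continuous_in_subspaceT => t /set_mem/=; rewrite in_itv/= => /andP[pt _].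
  by apply: powR_continuous_gt0; lra.
- split.
  + by move=> t; rewrite in_itv/= => /andP[pt _]; have [] := dF t (lt_trans p0 pt).
  + by apply: cvg_at_right_filter; exact: cF.
  + by apply: cvg_at_left_filter; apply: cF; exact: lt_trans pq.
- move=> t; rewrite in_itv/= => /andP[pt _]; rewrite derive1E.
  by have [_ ->] := dF t (lt_trans p0 pt).
Qed.

(** The fundamental theorem of calculus applies on [q/(n+2), q], away from the singularity at 0;
    these intervals exhaust ]0, q[. *)
Lemma integral_powR0_le b q : -1 < b -> 0 < q ->
  (\int[leb1]_(t in `]0%R, q[) (t `^ b)%:E <= (q `^ (b + 1) / (b + 1))%:E)%E.
Proof.
move=> b1 q0.
pose G (n : nat) := `[q / n.+2%:R, q]%classic : set R.
have qn n : 0 < q / n.+2%:R < q.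
  by rewrite divr_gt0//= ltr_pdivrMr// ltr_pMr// ltr1n.
have hG n : (\int[leb1]_(t in G n) (t `^ b)%:E <= (q `^ (b + 1) / (b + 1))%:E)%E.
  have /andP[h1 h2] := qn n; rewrite /G integral_powR// lee_fin ler_wpM2r ?invr_ge0//; first lra.
  by rewrite gerBl powR_ge0.
have mG i : measurable (G i) by exact: measurable_itv.
have nG : nondecreasing_seq G.
  move=> i j ij; apply/subsetPset => t; rewrite /G /= !in_itv/= => /andP[h1 ->]; rewrite andbT.
  apply: le_trans h1; rewrite ler_pM2l// lef_pV2 ?posrE//.
  by rewrite ler_nat !ltnS.
have sub : `]0%R, q[%classic `<=` \bigcup_i G i.
  move=> t /=; rewrite in_itv/= => /andP[t0 tq].
  have [N hN] := ltr_add_invr (y := 0 : R) (x := t / q) ltac:(by rewrite divr_gt0).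
  exists N => //; rewrite /G /= in_itv/= (ltW tq) andbT.
  rewrite add0r ltr_pdivlMr// in hN; apply: le_trans (ltW hN); rewrite mulrC ler_pM2r//.
  by rewrite lef_pV2 ?posrE// ler_nat.
apply: (@le_trans _ _ (\int[leb1]_(t in \bigcup_i G i) (t `^ b)%:E)%E).
  apply: ge0_subset_integral => //.
  - by apply: bigcup_measurable => i _; exact: mG.
  - by apply/measurable_EFinP; exact: measurable_powRl.
  - by move=> t _; rewrite lee_fin powR_ge0.
have H := @ge0_nondecreasing_set_cvg_integral _ (measurableTypeR R) R G (fun t : R => (t `^ b)%:E) leb1 nG mG
  (fun i => (measurable_EFinP _ _).2 (measurable_powRl b (D := G i))) (fun i t _ => powR_ge0 t b).
have <- := cvg_lim (@ereal_hausdorff R) H.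
by apply: lime_le; [apply/cvg_ex; eexists; exact: H|apply: nearW].
Qed.

(** Only the upper half of the interval is kept: this costs a constant factor and avoids the
    singularity at 0. *)
Lemma integral_powR0_ge b q : -1 < b -> 0 < q ->
  (((1 - 2^-1 `^ (b + 1)) / (b + 1) * q `^ (b + 1))%:E <= \int[leb1]_(t in `]0%R, q[) (t `^ b)%:E)%E.
Proof.
move=> b1 q0.
have h : 0 < q / 2 by rewrite divr_gt0.
have h2 : q / 2 < q by lra.
apply: (@le_trans _ _ (\int[leb1]_(t in `[(q / 2)%R, q[) (t `^ b)%:E)%E); last first.
  apply: ge0_subset_integral => //.
  - by apply/measurable_EFinP; exact: measurable_powRl.
  - by move=> t _; rewrite lee_fin powR_ge0.
  - by move=> t /=; rewrite !in_itv/= => /andP[h3 ->]; rewrite andbT (lt_le_trans h).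
rewrite (@integral_itv_bndo_bndc R (BLeft (q / 2)) q (fun t => (t `^ b)%:E)); last first.
  by apply/measurable_EFinP; exact: measurable_powRl.
rewrite integral_powR// lee_fin powRM ?invr_ge0//; last exact: ltW.
by rewrite le_eqVlt; apply/orP; left; apply/eqP; ring.
Qed.

Lemma powR_half_lt1 b : 0 < b -> 2^-1 `^ b < 1 :> R.
Proof.
move=> b0; rewrite -[X in _ < X](_ : 1 `^ b = 1); last by rewrite powR1.
by apply: gt0_ltr_powR => //; rewrite ?nnegrE; lra.
Qed.

Lemma integrable_powR b q : -1 < b -> 0 < q -> leb1.-integrable `]0%R, q[ (fun t => (t `^ b)%:E).
Proof.
move=> b1 q0; apply/integrableP; split; first by apply/measurable_EFinP; exact: measurable_powRl.
under eq_integral do rewrite gee0_abs ?lee_fin ?powR_ge0//.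
exact: le_lt_trans (integral_powR0_le b1 q0) (ltry _).
Qed.

(** Cauchy-Schwarz in the space with weight t^b for the pair th' and t^(-b), whose product times the
    weight is th'. The integral of t^(-b) is enlarged to ]0, q[, which makes the factor independent
    of the end points. *)
Lemma ftc_sqr_le (th th' : R -> R^o) b (t1 t2 q : R) : -1 < b < 1 -> 0 <= t1 -> t1 < t2 -> t2 <= q ->
  (forall t : R, is_derive t (1 : R) th (th' t)) -> continuous th' ->
  (((th t2 - th t1) ^+ 2)%:E <= (q `^ (1 - b) / (1 - b))%:E *
     \int[leb1]_(t in `]t1, t2[) ((th' t) ^+ 2 * t `^ b)%:E)%E.
Proof.
move=> /andP[bN1 b1] t10 t12 t2q dth cth'.
have nb1 : -1 < - b by rewrite ltrN2.
have cth : continuous th.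
  by move=> t; apply: differentiable_continuous; apply/derivable1_diffP; have [] := dth t.
have q0 : 0 < q by lra.
pose D := `]t1, t2[%classic : set R.
have mD : @measurable _ (measurableTypeR R) D by exact: measurable_itv.
have w0 t : D t -> 0 < t `^ b.
  by rewrite /D/= in_itv/= => /andP[h _]; rewrite powR_gt0//; lra.
have mw : @measurable_fun _ _ (measurableTypeR R) R D (@powR R ^~ b) := measurable_powRl b (D := D).
have subD : D `<=` `]0%R, q[%classic.
  by move=> t; rewrite /D/= !in_itv/= => /andP[h1 h2]; apply/andP; split; lra.
have iw c : -1 < c -> leb1.-integrable D (fun t => (t `^ c)%:E).
  by move=> c1; apply: integrableS (integrable_powR c1 q0).
have [M M0 hM] : exists2 M : R, 0 <= M & forall t, D t -> `|th' t| <= M.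
  have /compact_bounded[M [_ hM]] : compact (th' @` `[t1, t2]%classic).
    by apply: continuous_compact; [exact: continuous_subspaceT|exact: segment_compact].
  exists (`|M| + 1); first by rewrite addr_ge0.
  move=> t; rewrite /D/= in_itv/= => /andP[h1 h2]; apply: (hM (`|M| + 1)).
    by rewrite ltr_pwDr// ler_norm.
  by exists t => //=; rewrite in_itv/= !ltW.
have mth' : @measurable_fun _ _ (measurableTypeR R) R D th'.
  by apply: measurable_funTS; exact: continuous_measurable_fun.
have l2u : l2 leb1 D (@powR R ^~ b) th'.
  split => //; have := iw b bN1 => i1.
  have i2 := integrableZl mD (M ^+ 2) i1.
  apply: le_integrable i2 => //.
    apply/measurable_EFinP; apply: measurable_funM => //; exact: measurable_funX.
  move=> t Dt /=; rewrite lee_fin !normrM; apply: ler_wpM2r => //.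
  by apply: ler_pM => //; apply: le_trans (hM _ Dt) (ler_norm _).
have l2v : l2 leb1 D (@powR R ^~ b) (fun t => t `^ (- b)).
  split; first exact: measurable_powRl.
  have := iw (- b) nb1; apply: eq_integrable => // t /set_mem Dt.
  have t0 : 0 < t by have := subD t Dt; rewrite /= in_itv/= => /andP[].
  rewrite /= expr2 -!powRD ?(gt_eqF t0) ?implybT//; congr EFin; congr (_ `^ _); ring.
have cs := ip_cauchy_schwarz mD mw w0 l2u l2v.
have e1 : ip leb1 D (@powR R ^~ b) th' (fun t => t `^ (- b)) = th t2 - th t1.
  rewrite /ip /Rintegral.
  have -> : (\int[leb1]_(t in D) (th' t * t `^ (- b) * t `^ b)%:E = \int[leb1]_(t in D) (th' t)%:E)%E.
    apply: eq_integral => t /set_mem Dt.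
    have t0 : 0 < t by have := subD t Dt; rewrite /= in_itv/= => /andP[].
    by rewrite -mulrA -powRD ?(gt_eqF t0) ?implybT// addNr powRr0 mulr1.
  have -> : (\int[leb1]_(t in D) (th' t)%:E = \int[leb1]_(t in `[t1, t2]) (th' t)%:E)%E.
    apply/esym; apply: (@integral_itv_bndoo R t1 t2 (fun t => (th' t)%:E) true false).
    by apply/measurable_EFinP; exact: mth'.
  rewrite (@continuous_FTC2 R th' th t1 t2 t12)//.
  - exact: continuous_subspaceT.
  - split.
    + by move=> t _; have [] := dth t.
    + by apply: cvg_at_right_filter; exact: cth.
    + by apply: cvg_at_left_filter; exact: cth.
  - by move=> t _; rewrite derive1E; have [_ ->] := dth t.
have e2 := ipE mD l2u.
have e3 : ip leb1 D (@powR R ^~ b) (fun t => t `^ (- b)) (fun t => t `^ (- b)) <= q `^ (1 - b) / (1 - b).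
  rewrite -lee_fin ipE//.
  apply: (@le_trans _ _ (\int[leb1]_(t in `]0%R, q[) (t `^ (- b))%:E)%E); last first.
    have := @integral_powR0_le (- b) q nb1 q0.
    by rewrite addrC.
  have -> : (\int[leb1]_(z in D) ((z `^ (- b)) ^+ 2 * z `^ b)%:E = \int[leb1]_(z in D) (z `^ (- b))%:E)%E.
    apply: eq_integral => t /set_mem Dt.
    have t0 : 0 < t by have := subD t Dt; rewrite /= in_itv/= => /andP[].
    rewrite expr2 -!powRD ?(gt_eqF t0) ?implybT//; congr EFin; congr (_ `^ _); ring.
  apply: ge0_subset_integral => //.
  - by apply/measurable_EFinP; exact: measurable_powRl.
  - by move=> t _; rewrite lee_fin powR_ge0.
rewrite -e2 -EFinM lee_fin -e1; apply: le_trans cs _.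
by rewrite mulrC ler_wpM2r// ip_ge0.
Qed.

End powR_integrals.

(** * The weighted Sobolev space *)

Section weighted_space.
Context {R : realType} (d : nat) (Omega : set 'rV[R]_d) (T a : R).
Hypotheses (oO : open Omega) (bO : bounded_set Omega) (T0 : 0 < T) (ha : -1 < a < 1).
Local Notation E := ('rV[R]_d * R)%type.
Local Notation Em := ('rV[R]_d * measurableTypeR R)%type.
Local Notation CT := (cylinder Omega T).
Local Notation nu := (vol d).
Local Notation leb1 := (@lebesgue_measure R).
Implicit Types (u v : E -> R^o) (F G : E -> E) (phi psi : E -> R^o).

Definition wt (z : E) : R := z.2 `^ a.

Lemma aN1 : -1 < a. Proof. by case/andP: ha. Qed.
Lemma a1 : a < 1. Proof. by case/andP: ha. Qed.
Lemma aNN1 : -1 < - a. Proof. by rewrite ltrN2 a1. Qed.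

Lemma cylinder_open : open CT.
Proof.
rewrite (_ : CT = fst @^-1` Omega `&` (snd @^-1` [set y : R | 0 < y] `&` snd @^-1` [set y : R | y < T])).
  apply: openI; first by apply: open_comp => // z _; exact: cvg_fst.
  apply: openI; apply: open_comp; [by move=> z _; exact: cvg_snd|exact: open_gt|by move=> z _; exact: cvg_snd|exact: open_lt].
by apply/seteqP; split => z /=; [move=> [h /andP[h1 h2]]|move=> [h [h1 h2]]; split => //; apply/andP].
Qed.

Lemma measurable_cylinder : @measurable _ Em CT.
Proof. exact: open_measurable_E cylinder_open. Qed.
Local Notation mCT := measurable_cylinder.

Lemma Omega_bounded : exists2 r : R, 0 < r & forall x, Omega x -> `|x| <= r.
Proof.
have [M [_ hM]] := bO; exists (`|M| + 1); first by rewrite ltr_wpDl.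
by move=> x Ox; apply: (hM (`|M| + 1)) => //; rewrite ltr_pwDr// ler_norm.
Qed.

Lemma cylinder_bounded : exists2 r : R, 0 < r & forall z, CT z -> `|z| <= r.
Proof.
have [r r0 hr] := Omega_bounded; exists (r + T); first by rewrite addr_gt0.
move=> z [Oz /andP[z0 zT]]; rewrite prod_normE ge_max; apply/andP; split.
  by apply: le_trans (hr _ Oz) _; rewrite lerDl ltW.
by rewrite ger0_norm ?ltW// (lt_le_trans zT)// lerDr ltW.
Qed.

Lemma leb_Omega_fin : (leb d Omega < +oo)%E.
Proof.
have [r r0 hr] := Omega_bounded.
have r1 : 0 < r + 1 by rewrite addr_gt0.
apply: (@le_lt_trans _ _ (leb d (ball (0 : 'rV[R]_d) (r + 1)))).
  apply: le_measure; rewrite ?inE; [exact: open_measurable_rV|exact: measurable_ball_rV|].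
  move=> x /hr xr; rewrite mx_norm_ball /ball_ /= sub0r normrN; lra.
by rewrite leb_ball// ltry.
Qed.

Lemma tonelli_cylinder (f : E -> \bar R) :
  @measurable_fun _ _ Em _ setT f -> (forall z, (0 <= f z)%E) ->
  (\int[nu]_(z in CT) f z = \int[leb d]_(x in Omega) \int[leb1]_(t in `]0%R, T[) f (x, t))%E.
Proof.
move=> mf f0.
have mfC : @measurable_fun _ _ Em _ setT (f \_ CT).
  by apply: (measurable_restrictT f mCT).1; exact: (measurable_funS measurableT (@subsetT _ _) mf).
have f0C z : (0 <= (f \_ CT) z)%E by rewrite patchE; case: ifPn.
rewrite integral_mkcond [RHS]integral_mkcond.
rewrite [LHS](@fubini_tonelli1 _ _ 'rV[R]_d (measurableTypeR R) R (leb d) leb1 (f \_ CT) mfC f0C).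
apply: eq_integral => x _; rewrite /fubini_F patchE; case: ifPn => [/set_mem xO|/negP xO].
  rewrite [RHS]integral_mkcond; apply: eq_integral => t _; rewrite !patchE.
  congr (if _ then _ else _); apply/idP/idP => /set_mem h; apply/mem_set.
    by have [_] := h; rewrite /= in_itv.
  by split => //; move: h; rewrite /= in_itv.
apply: integral0_eq => t _; rewrite patchE; case: ifPn => // /set_mem[h _].
by exfalso; apply: xO; apply/mem_set.
Qed.

Lemma measurable_snd_powR b (D : set E) : @measurable_fun _ _ Em R D (fun z : E => z.2 `^ b).
Proof.
apply: measurable_funTS.
by apply: (@measurableT_comp _ _ _ Em (measurableTypeR R) R (@powR R ^~ b) _ snd); [exact: measurable_powR|exact: measurable_snd].
Qed.

Lemma wt_gt0 z : CT z -> 0 < wt z.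
Proof. by move=> [_ /andP[h _]]; exact: powR_gt0. Qed.

Lemma measurable_wt : @measurable_fun _ _ Em R CT wt.
Proof. exact: measurable_snd_powR. Qed.
Local Notation mwt := measurable_wt.

Lemma integrable_powR_cylinder b : -1 < b -> nu.-integrable CT (fun z => (z.2 `^ b)%:E).
Proof.
move=> b1; apply/integrableP; split; first by apply/measurable_EFinP; exact: measurable_snd_powR.
under eq_integral do rewrite gee0_abs ?lee_fin ?powR_ge0//.
rewrite (tonelli_cylinder (f := fun z => (z.2 `^ b)%:E)); last 2 first.
- by apply/measurable_EFinP; exact: measurable_snd_powR.
- by move=> z; rewrite lee_fin powR_ge0.
have mO : measurable Omega by exact: open_measurable_rV.
apply: (@le_lt_trans _ _ (\int[leb d]_(x in Omega) (T `^ (b + 1) / (b + 1))%:E)%E).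
  apply: ge0_le_integral => //.
  - by move=> x _; apply: integral_ge0 => t _; rewrite lee_fin powR_ge0.
  - exact: (@measurable_cst _ _ 'rV[R]_d _ Omega (\int[leb1]_(t in `]0%R, T[) (t `^ b)%:E)%E).
  - by move=> x _; exact: integral_powR0_le.
by rewrite (_ : (fun x => _) = cst (T `^ (b + 1) / (b + 1))%:E)// integral_cst// lte_mul_pinfty ?leb_Omega_fin// lee_fin divr_ge0 ?powR_ge0//; lra.
Qed.

Local Notation L2C := (@l2 R _ Em nu CT wt).
Local Notation ipC_ := (@ip R _ Em nu CT wt).

Lemma l2_dom u v : L2C v -> @measurable_fun _ _ Em R CT u -> (forall z, CT z -> `|u z| <= `|v z|) -> L2C u.
Proof.
move=> [mv iv] mu h; split => //; apply: le_integrable iv => //; first exact: mCT.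
  apply/measurable_EFinP; apply: measurable_funM; [exact: measurable_funX|exact: mwt].
move=> z Cz; rewrite /= lee_fin !normrM; apply: ler_wpM2r => //.
by apply: ler_pM => //; exact: h.
Qed.

Lemma l2_bounded (f : E -> R) (C : R) : @measurable_fun _ _ Em R CT f ->
  (forall z, CT z -> `|f z| <= C) -> L2C f.
Proof.
move=> mf hC; apply: (@l2_dom f (cst C)) => //; last first.
  by move=> z Cz; rewrite (le_trans (hC _ Cz))// ler_norm.
split; first exact: measurable_cst.
have := integrableZl mCT (C ^+ 2) (integrable_powR_cylinder aN1).
by apply: (@eq_integrable _ Em _ nu CT mCT) => z _; rewrite /= EFinM.
Qed.

Lemma l2_continuous (f : E -> R) : continuous f -> L2C f.
Proof.
move=> cf; have [r r0 hr] := cylinder_bounded.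
have [C C0 hC] := continuous_bounded r cf.
apply: (@l2_bounded f C); last by move=> z /hr; exact: hC.
by apply: measurable_funTS; exact: continuous_measurable_E.
Qed.

(** Pointwise |u| <= u^2 y^a + y^(-a), and y^(-a) is integrable on the cylinder because a < 1. *)
Lemma l2_integrable u : L2C u -> nu.-integrable CT (EFin \o u).
Proof.
move=> [mu iu].
have i2 := integrableD mCT iu (integrable_powR_cylinder aNN1).
apply: le_integrable i2; [exact: mCT|exact/measurable_EFinP|].
move=> z Cz; rewrite -EFinD lee_fin.
have w0 := wt_gt0 Cz.
have -> : z.2 `^ (- a) = (wt z)^-1 by rewrite powRN.
rewrite [leRHS]ger0_norm; last first.
  by apply: addr_ge0; [apply: mulr_ge0; [exact: sqr_ge0|exact: ltW]|rewrite invr_ge0; exact: ltW].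
rewrite -(real_normK (num_real (u z))).
have := normr_ge0 (u z); move: (`|u z|) => y y0.
have [h|h] := leP (y * wt z) 1.
  apply: (@le_trans _ _ (wt z)^-1); first by rewrite -[X in _ <= X]mul1r ler_pdivlMr.
  by rewrite lerDr mulr_ge0 ?sqr_ge0// ltW.
apply: (@le_trans _ _ (y ^+ 2 * wt z)); last by rewrite lerDl invr_ge0 ltW.
by rewrite expr2 -mulrA ler_peMr// ltW.
Qed.

(** Writes an unweighted integral against a bounded function as a weighted inner product, so that
    limits in the weighted space pass to the identity that defines weak gradients. *)
Lemma l2_dual (f : E -> R) (C : R) : @measurable_fun _ _ Em R CT f -> (forall z, CT z -> `|f z| <= C) ->
  L2C (fun z => f z * z.2 `^ (- a)) /\
  forall u, ipC_ u (fun z => f z * z.2 `^ (- a)) = \int[nu]_(z in CT) (u z * f z).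
Proof.
move=> mf hC.
have e z : CT z -> z.2 `^ (- a) * z.2 `^ a = 1.
  move=> [_ /andP[z0 _]]; rewrite -powRD; last by rewrite (gt_eqF z0) implybT.
  by rewrite addNr powRr0.
split.
  split; first by apply: measurable_funM => //; exact: measurable_snd_powR.
  have i2 := integrableZl mCT (C ^+ 2) (integrable_powR_cylinder aNN1).
  apply: le_integrable i2; first exact: mCT.
    apply/measurable_EFinP; apply: measurable_funM; last exact: mwt.
    by apply: measurable_funX; apply: measurable_funM => //; exact: measurable_snd_powR.
  move=> z Cz; rewrite /= lee_fin.
  rewrite (_ : (f z * z.2 `^ (- a)) ^+ 2 * wt z = f z ^+ 2 * z.2 `^ (- a) * (z.2 `^ (- a) * z.2 `^ a)); last by rewrite /wt; ring.
  rewrite e// mulr1 !normrM; apply: ler_wpM2r => //.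
  by apply: ler_pM => //; apply: le_trans (hC _ Cz) (ler_norm _).
move=> u; apply: eq_Rintegral => z /set_mem Cz.
by rewrite -!mulrA e// mulr1.
Qed.

Definition V2 F := forall i, L2C (fun z => crd i (F z)).
Definition vip F G : R := \sum_i ipC_ (fun z => crd i (F z)) (fun z => crd i (G z)).

Lemma V2_lin c F G : V2 F -> V2 G -> V2 (c *: F + G).
Proof.
move=> hF hG i.
have := l2_lin mCT mwt wt_gt0 c (hF i) (hG i); congr l2; apply/funext => z.
by rewrite -[(c *: F + G) z]/(c *: F z + G z) crdD crdZ.
Qed.

Lemma vipC F G : vip F G = vip G F.
Proof. by apply: eq_bigr => i _; exact: ipC. Qed.

Lemma vipL c F G H : V2 F -> V2 G -> V2 H -> vip (c *: F + G) H = c * vip F H + vip G H.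
Proof.
move=> hF hG hH; rewrite /vip mulr_sumr -big_split; apply: eq_bigr => i _ /=.
rewrite -(ipL mCT mwt wt_gt0)//; apply: eq_Rintegral => z _.
by rewrite -[(c *: F + G) z]/(c *: F z + G z) crdD crdZ.
Qed.

Lemma vip_ge0 F : 0 <= vip F F.
Proof. by apply: sumr_ge0 => i _; exact: (@ip_ge0 _ _ Em nu CT wt wt_gt0). Qed.

Lemma V20 : V2 0.
Proof.
move=> i; have := @l20 R _ Em nu CT wt; congr l2; apply/funext => z.
by have := crdZ i 0 (0 : E); rewrite scale0r mul0r => ->.
Qed.

Lemma vip_le2 F G : V2 F -> V2 G -> vip (F + G) (F + G) <= 2 * vip F F + 2 * vip G G.
Proof.
apply: (@form_le2 R (E -> E) V2 vip) => //.
- exact: V2_lin.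
- by move=> F1 G1 _ _; exact: vipC.
- exact: vipL.
- by move=> F1 _; exact: vip_ge0.
Qed.

Lemma ip_crd_le_vip F i : ipC_ (fun z => crd i (F z)) (fun z => crd i (F z)) <= vip F F.
Proof.
by rewrite /vip (bigD1 i)//= lerDl; apply: sumr_ge0 => j _; exact: (@ip_ge0 _ _ Em nu CT wt wt_gt0).
Qed.

Lemma vipE F G : V2 F -> V2 G ->
  nu.-integrable CT (EFin \o (fun z => dotp (F z) (G z) * wt z)) /\
  vip F G = \int[nu]_(z in CT) (dotp (F z) (G z) * wt z).
Proof.
move=> hF hG.
have hi i := l2_prod mCT mwt wt_gt0 (hF i) (hG i).
have e : (fun z => dotp (F z) (G z) * wt z) = (fun z => \sum_i (crd i (F z) * crd i (G z) * wt z)).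
  by apply/funext => z; rewrite dotpE mulr_suml.
rewrite e; split.
  rewrite (_ : _ \o _ = (fun z => (\sum_i (crd i (F z) * crd i (G z) * wt z)%:E)%E)); last first.
    by apply/funext => z /=; rewrite sumEFin.
  by apply: (@integrable_sum _ Em _ nu _ mCT) => i _; exact: hi.
rewrite /vip /ip /Rintegral.
under [in RHS]eq_integral do rewrite -sumEFin.
rewrite integral_sum//; last exact: mCT.
rewrite (_ : (\sum_(i <- _) _)%E = \sum_i ((\int[nu]_(z in CT) (crd i (F z) * crd i (G z) * wt z))%:E)); last first.
  apply: eq_bigr => i _; rewrite /Rintegral fineK//; apply: integrable_fin_num; [exact: mCT|exact: hi].
by rewrite sumEFin.
Qed.

Lemma vip_complete (F : nat -> E -> E) : (forall n, V2 (F n)) -> form_cauchy vip F ->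
  exists2 G, V2 G & form_cvg vip F G.
Proof.
move=> hF cF.
have hi (i : 'I_d.+1) : exists2 g, L2C g & form_cvg ipC_ (fun n z => crd i (F n z)) g.
  apply: (l2_complete mCT mwt wt_gt0 (fun n => hF n i)) => e e0.
  have [N hN] := cF _ e0; exists N => n m Nn Nm.
  apply: le_trans (hN n m Nn Nm); apply: le_trans (ip_crd_le_vip _ i).
  rewrite le_eqVlt; apply/orP; left; apply/eqP; apply: eq_Rintegral => z _.
  by rewrite -[(F n - F m) z]/(F n z - F m z) crdB.
have /choice[g hg] : forall i : 'I_d.+1, exists g : E -> R^o, L2C g /\ form_cvg ipC_ (fun n z => crd i (F n z)) g.
  by move=> i; have [g h1 h2] := hi i; exists g.
pose G z : E := uncons_rV (\row_i g i z).
have cG i : (fun z => crd i (G z)) = g i by apply/funext => z; rewrite crd_uncons mxE.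
have V2G : V2 G by move=> i; rewrite cG; have [] := hg i.
exists G => // e e0.
have e1 : 0 < e / d.+1%:R by rewrite divr_gt0.
have /choice[N hN] : forall i : 'I_d.+1, exists N, forall n, (N <= n)%N ->
   ipC_ ((fun z => crd i (F n z)) - g i) ((fun z => crd i (F n z)) - g i) <= e / d.+1%:R.
  by move=> i; have [_ h] := hg i; have [N hN] := h _ e1; exists N.
exists (\max_i N i)%N => n Nn.
rewrite /vip; apply: (@le_trans _ _ (\sum_(i < d.+1) (e / d.+1%:R))); last first.
  by rewrite sumr_const card_ord -[X in X <= _]mulr_natr divfK.
apply: ler_sum => i _; apply: le_trans (hN i n _); last first.
  by apply: leq_trans Nn; exact: leq_bigmax.
rewrite le_eqVlt; apply/orP; left; apply/eqP; apply: eq_Rintegral => z _.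
by rewrite -[(F n - G) z]/(F n z - G z) crdB -(cG i).
Qed.

End weighted_space.

(** * Limits for positive semidefinite forms *)

Section hilbert_limits.
Context {R : realType} (V : lmodType R) (W : set V) (b : V -> V -> R).
Hypothesis WL : forall (c : R) (u v : V), W u -> W v -> W (c *: u + v).
Hypothesis bC : forall u v : V, W u -> W v -> b u v = b v u.
Hypothesis bL : forall (c : R) (u v w : V),
  W u -> W v -> W w -> b (c *: u + v) w = c * b u w + b v w.
Hypothesis b_ge0 : forall u : V, W u -> 0 <= b u u.
Local Notation WB := (form_closedB WL).

Lemma form_zero_mem u : W u -> W 0.
Proof. by move=> Wu; rewrite -(subrr u); exact: WB. Qed.

Lemma form_scale_sqr c u : W u -> b (c *: u) (c *: u) = c ^+ 2 * b u u.
Proof.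
move=> Wu; have W0 := form_zero_mem Wu; have Wc := form_closedZ W0 WL c Wu.
by rewrite (form_scalel W0 bL)// bC// (form_scalel W0 bL)//; ring.
Qed.

Lemma form_BC u v : W u -> W v -> b (u - v) (u - v) = b (v - u) (v - u).
Proof.
move=> Wu Wv; have -> : u - v = (-1) *: (v - u) by rewrite scaleN1r opprB.
rewrite form_scale_sqr; last exact: WB.
by rewrite sqrrN expr1n mul1r.
Qed.

Lemma form_cvg_cauchy (u : nat -> V) l : (forall n, W (u n)) -> W l ->
  form_cvg b u l -> form_cauchy b u.
Proof.
move=> Wu Wl h e e0.
have [N hN] := h (e / 4) (divr_gt0 e0 (ltr0n _ 4)).
exists N => n m Nn Nm.
rewrite (_ : u n - u m = (u n - l) + (l - u m)); last by rewrite addrA subrK.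
apply: le_trans (form_le2 WL bC bL b_ge0 (WB (Wu n) Wl) (WB Wl (Wu m))) _.
rewrite (form_BC Wl (Wu m)).
have h1 := hN _ Nn; have h2 := hN _ Nm; lra.
Qed.

Lemma form_cvg_lin c (u v : nat -> V) l m : (forall n, W (u n)) -> (forall n, W (v n)) -> W l -> W m ->
  form_cvg b u l -> form_cvg b v m -> form_cvg b (fun n => c *: u n + v n) (c *: l + m).
Proof.
move=> Wu Wv Wl Wm hu hv e e0.
pose K : R := 2 * (c ^+ 2 + 1).
have K0 : 0 < K by rewrite /K; have := sqr_ge0 c; lra.
have [N1 h1] := hu (e / 2 / K) (divr_gt0 (divr_gt0 e0 (ltr0n _ 2)) K0).
have [N2 h2] := hv (e / 2 / 2) (divr_gt0 (divr_gt0 e0 (ltr0n _ 2)) (ltr0n _ 2)).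
exists (maxn N1 N2) => n; rewrite geq_max => /andP[n1 n2].
have {}h1 := h1 _ n1; have {}h2 := h2 _ n2.
rewrite (_ : _ - _ = c *: (u n - l) + (v n - m)); last first.
  by rewrite scalerBr opprD !addrA; congr (_ - _); rewrite -!addrA; congr (_ + _); rewrite addrC.
have Wul := WB (Wu n) Wl; have Wvm := WB (Wv n) Wm.
have W0 := form_zero_mem Wl.
have cs := form_le2 WL bC bL b_ge0 (form_closedZ W0 WL c Wul) Wvm.
rewrite form_scale_sqr// in cs.
apply: le_trans cs _.
move: h1; rewrite ler_pdivlMr// /K => h1.
have := b_ge0 Wul; have := sqr_ge0 c; nra.
Qed.

Lemma form_cvg_ip (u : nat -> V) l p : (forall n, W (u n)) -> W l -> W p -> form_cvg b u l ->
  forall e, 0 < e -> exists N, forall n, (N <= n)%N -> `|b (u n) p - b l p| <= e.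
Proof.
move=> Wu Wl Wp h e e0.
have p0 := b_ge0 Wp.
have K0 : 0 < b p p + 1 by lra.
have [N hN] := h (e ^+ 2 / (b p p + 1)) (divr_gt0 (exprn_gt0 _ e0) K0).
exists N => n /hN; rewrite ler_pdivlMr// => hn.
rewrite -(formBl bL)//.
apply: ler_of_sqr; first exact: ltW.
rewrite real_normK ?num_real//.
have Wd := WB (Wu n) Wl.
apply: le_trans (form_cauchy_schwarz WL bC bL b_ge0 Wd Wp) _.
have := b_ge0 Wd; nra.
Qed.

Lemma form_cvg_unique (u : nat -> V) l m : (forall n, W (u n)) -> W l -> W m ->
  form_cvg b u l -> form_cvg b u m -> b (l - m) (l - m) = 0.
Proof.
move=> Wu Wl Wm h1 h2; apply/eqP; rewrite eq_le b_ge0 ?andbT; last exact: WB.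
apply/ler_addgt0Pr => e e0; rewrite add0r.
have [N1 h3] := h1 (e / 4) (divr_gt0 e0 (ltr0n _ 4)).
have [N2 h4] := h2 (e / 4) (divr_gt0 e0 (ltr0n _ 4)).
have {}h3 := h3 _ (leq_maxl N1 N2); have {}h4 := h4 _ (leq_maxr N1 N2).
move: h3 h4; set n := maxn _ _ => h3 h4.
rewrite (_ : l - m = (l - u n) + (u n - m)); last by rewrite addrA subrK.
apply: le_trans (form_le2 WL bC bL b_ge0 (WB Wl (Wu n)) (WB (Wu n) Wm)) _.
rewrite (form_BC Wl (Wu n)); lra.
Qed.

Lemma form_null_ip l p : W l -> W p -> b l l = 0 -> b l p = 0.
Proof.
move=> Wl Wp h; apply/eqP; rewrite -sqrf_eq0 eq_le sqr_ge0 andbT.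
by apply: le_trans (form_cauchy_schwarz WL bC bL b_ge0 Wl Wp) _; rewrite h mul0r.
Qed.

End hilbert_limits.

(** * The space H1 on the cylinder and smooth approximation *)

Section sobolev_space.
Context {R : realType} (d : nat) (Omega : set 'rV[R]_d) (T a : R).
Hypotheses (oO : open Omega) (bO : bounded_set Omega) (T0 : 0 < T) (ha : -1 < a < 1).
Local Notation E := ('rV[R]_d * R)%type.
Local Notation Em := ('rV[R]_d * measurableTypeR R)%type.
Local Notation CT := (cylinder Omega T).
Local Notation nu := (vol d).
Local Notation wt := (@wt R d a).
Local Notation L2C := (@l2 R _ Em nu CT wt).
Local Notation ipC_ := (@ip R _ Em nu CT wt).
Local Notation V2 := (V2 Omega T a).
Local Notation vip := (vip Omega T a).
Local Notation mCT := (measurable_cylinder T oO).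
Local Notation oCT := (@cylinder_open R d Omega T oO).
Local Notation mwt := (@measurable_wt R d Omega T a).
Local Notation wt_gt0 := (@wt_gt0 R d Omega T a).
Local Notation wg := (wgrad CT).
Local Notation W := (H1w a CT).
Implicit Types (u v : E -> R^o) (F G H : E -> E) (phi psi : E -> R^o).

(** Local integrability gives measurability on compact subsets. Those formed by the points of norm
    at most n and at distance at least 1/(n+1) from the complement exhaust the open set. *)
Lemma locally_integrable_measurable (D : set E) (h : E -> R) : open D ->
  locally_integrable_on D h -> @measurable_fun _ _ Em R D h.
Proof.
move=> oD hh.
pose K (n : nat) := [set z : E | `|z| <= n%:R /\ forall w, ~ D w -> n.+1%:R^-1 <= `|z - w|].
have cK n : compact (K n).
  apply: (@closed_bounded_compact_E _ _ _ n%:R); last by move=> z [].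
  rewrite (_ : K n = [set z : E | `|z| <= n%:R] `&` \bigcap_(w in ~` D) [set z : E | n.+1%:R^-1 <= `|z - w|]).
    apply: closedI.
      apply: (@closed_comp E R Num.norm [set r | r <= n%:R]); last exact: closed_le.
      by move=> z _; exact: norm_continuous.
    apply: closed_bigI => w _.
    apply: (@closed_comp E R (fun z => `|z - w|) [set r | n.+1%:R^-1 <= r]); last exact: closed_ge.
    move=> z _; apply: (@continuous_comp _ _ _ (fun z : E => z - w) Num.norm); last exact: norm_continuous.
    by apply: cvgB; [exact: cvg_id|exact: cvg_cst].
  by apply/seteqP; split => z [h1 h2]; split => // w; exact: h2.
have KD n : K n `<=` D.
  move=> z [_ hz]; apply: contrapT => nz; have := hz _ nz.
  by rewrite subrr normr0 leNgt invr_gt0 ltr0n.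
have -> : D = \bigcup_n K n.
  apply/seteqP; split => [z Dz|z [n _ /KD]//].
  have [e /= e0 he] : exists2 e : R, 0 < e & ball z e `<=` D.
    by have /nbhs_ballP[e e0 he] : nbhs z D by [exact: open_nbhs_nbhs]; exists e.
  have [k] := ltr_add_invr (y := 0) (x := e) e0; rewrite add0r => hk.
  exists (maxn k (Num.truncn `|z|).+1) => //; split.
    by apply: le_trans (ltW (truncnS_gt _)) _; rewrite ler_nat leq_maxr.
  move=> w nDw; apply: (@le_trans _ _ k.+1%:R^-1).
    by rewrite lef_pV2 ?posrE ?ltr0n// ler_nat ltnS leq_maxl.
  apply: le_trans (ltW hk) _; rewrite leNgt; apply/negP => hzw; apply: nDw; apply: he.
  by rewrite -ball_normE.
apply/measurable_fun_bigcup; first by move=> n; exact: compact_measurable_E.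
move=> n; apply/measurable_EFinP.
by have /integrableP[] := hh _ (@cK n) (@KD n).
Qed.

Lemma l2_sum (I : Type) (s : seq I) (c : I -> R) (f : I -> E -> R^o) :
  (forall i, L2C (f i)) -> L2C (fun z => \sum_(i <- s) c i * f i z).
Proof.
move=> hf; elim: s => [|i s ih].
  have := @l20 R _ Em nu CT wt; congr l2; apply/funext => z; by rewrite big_nil.
have := l2_lin mCT mwt wt_gt0 (c i) (hf i) ih; congr l2; apply/funext => z.
by rewrite big_cons.
Qed.

Lemma V2_dotp F (v : E) : V2 F -> L2C (fun z => dotp (F z) v).
Proof.
move=> hF; have := l2_sum (index_enum _) (fun i => crd i v) hF; congr l2; apply/funext => z.
by rewrite dotpE; apply: eq_bigr => i _; rewrite mulrC.
Qed.

Lemma H1wP u : W u <-> [/\ L2C u, is_weak_gradient CT u (wg u) & V2 (wg u)].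
Proof.
split=> [[h1 h2 h3]|[h1 h2 h3]]; split => //.
- exact: wgradP.
- by move=> i; have := h3 (ebas i); congr (L2w a CT); apply/funext => z; rewrite dotp_ebas.
- by exists (wg u).
- by move=> v; exact: V2_dotp.
Qed.

Lemma l2_locally_integrable u : L2C u -> locally_integrable_on CT u.
Proof.
move=> hu K cK KC; apply: (integrableS mCT) => //; first exact: compact_measurable_E.
exact: (l2_integrable oO bO T0 ha).
Qed.

Lemma V2_ae F G : V2 F -> (forall i, @measurable_fun _ _ Em R CT (fun z => crd i (G z))) ->
  {ae nu, forall z, CT z -> G z = F z} -> V2 G.
Proof.
move=> hF mG h i; have [mF /integrableP[mF2 iF]] := hF i; split; first exact: mG.
have mG2 : @measurable_fun _ _ Em _ CT (EFin \o (fun z => crd i (G z) ^+ 2 * wt z)).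
  apply/measurable_EFinP; apply: measurable_funM; last exact: measurable_wt.
  by apply: measurable_funX; exact: mG.
apply/integrableP; split => //; move: iF; congr (_ < _)%E.
apply: ge0_ae_eq_integral => //; [exact: mCT|exact: measurableT_comp|exact: measurableT_comp|].
by apply: ae_volS h => z h Cz; rewrite /= h.
Qed.

Lemma ip_ae u u' v : L2C u -> L2C u' -> L2C v ->
  {ae nu, forall z, CT z -> u z = u' z} -> ipC_ u v = ipC_ u' v.
Proof.
move=> [mu _] [mu' _] [mv _] h; rewrite /ip /Rintegral; congr fine.
apply: ae_eq_integral; [exact: mCT| | |].
- by apply/measurable_EFinP; exact: (measurable_l2_prod mwt).
- by apply/measurable_EFinP; exact: (measurable_l2_prod mwt).
- by apply: ae_volS h => z h Cz; rewrite /= h.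
Qed.

Lemma vip_ae F F' G : V2 F -> V2 F' -> V2 G ->
  {ae nu, forall z, CT z -> F z = F' z} -> vip F G = vip F' G.
Proof.
move=> h1 h2 h3 h; apply: eq_bigr => i _; apply: ip_ae => //.
by apply: ae_volS h => z h Cz; rewrite h.
Qed.

Lemma vip_ae2 F F' : V2 F -> V2 F' ->
  {ae nu, forall z, CT z -> F z = F' z} -> vip F F = vip F' F'.
Proof. by move=> h1 h2 h; rewrite (vip_ae h1 h2 h1 h) vipC (vip_ae h1 h2 h2 h). Qed.

(** The chosen gradient is known up to a null set: its measurability comes from local integrability,
    and its square integrability is transported from [G] along the almost everywhere equality. *)
Lemma weak_gradient_wg u G : is_weak_gradient CT u G -> V2 G ->
  V2 (wg u) /\ {ae nu, forall z, CT z -> wg u z = G z}.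
Proof.
move=> h hG.
have hw : is_weak_gradient CT u (wg u) by apply: wgradP; exists G.
have hae := weak_gradient_unique oCT hw h.
split => //; apply: V2_ae hG _ hae => i.
have [_ /(_ (ebas i))[h1 _]] := hw.
have := locally_integrable_measurable oCT h1; congr measurable_fun.
by apply/funext => z; rewrite dotp_ebas.
Qed.

Lemma H1w_of_weak_gradient u G : L2C u -> is_weak_gradient CT u G -> V2 G -> W u.
Proof.
move=> h1 h2 h3; have [h4 _] := weak_gradient_wg h2 h3.
by apply/H1wP; split => //; apply: wgradP; exists G.
Qed.

Lemma V2_grad phi : csmooth phi -> V2 (grad phi).
Proof.
move=> s i; have : L2C ('D_(ebas i) phi).
  by apply: (l2_continuous oO bO T0 ha); exact: csmooth_continuous (csmooth_derive _ s).
by congr l2; apply/funext => z; rewrite crd_grad.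
Qed.

Lemma l2_csmooth phi : csmooth phi -> L2C phi.
Proof. by move=> s; apply: (l2_continuous oO bO T0 ha); exact: csmooth_continuous s. Qed.

Lemma weak_gradient_csmooth phi : csmooth phi ->
  V2 (wg phi) /\ {ae nu, forall z, CT z -> wg phi z = grad phi z}.
Proof.
by move=> s; apply: weak_gradient_wg (V2_grad s); exact: (weak_gradient_smooth oCT s).
Qed.

Lemma H1w_csmooth phi : csmooth phi -> W phi.
Proof.
move=> s; apply: (H1w_of_weak_gradient (l2_csmooth s) _ (V2_grad s)).
exact: (weak_gradient_smooth oCT s).
Qed.

Lemma wg_lin c u v : W u -> W v -> [/\ W (c *: u + v), V2 (wg (c *: u + v)) &
  {ae nu, forall z, CT z -> wg (c *: u + v) z = (c *: wg u + wg v) z}].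
Proof.
move=> /H1wP[u1 u2 u3] /H1wP[v1 v2 v3].
have h := weak_gradient_lin c oCT u2 v2.
have h2 : V2 (c *: wg u + wg v) by exact: V2_lin.
have [h3 h4] := weak_gradient_wg h h2.
split => //; apply: H1w_of_weak_gradient h h2; exact: (l2_lin mCT mwt wt_gt0 c u1 v1).
Qed.

Lemma H1w0 : W 0.
Proof. exact: (H1w_csmooth (csmooth_cst 0)). Qed.

Definition eip u v : R := vip (wg u) (wg v).

Lemma H1w_lin c u v : W u -> W v -> W (c *: u + v).
Proof. by move=> hu hv; have [] := wg_lin c hu hv. Qed.

Lemma H1w_V2 u : W u -> V2 (wg u). Proof. by case/H1wP. Qed.
Lemma H1w_l2 u : W u -> L2C u. Proof. by case/H1wP. Qed.

Lemma eip_ge0 u : 0 <= eip u u. Proof. exact: vip_ge0. Qed.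

Lemma H1wB u v : W u -> W v -> W (u - v).
Proof. exact: (form_closedB H1w_lin). Qed.

Lemma wg_sub_smooth phi u : csmooth phi -> W u ->
  eip (phi - u) (phi - u) = vip (grad phi - wg u) (grad phi - wg u).
Proof.
move=> s hu; have hp := H1w_csmooth s.
have [_ h0] := weak_gradient_csmooth s.
have e : phi - u = -1 *: u + phi by rewrite scaleN1r addrC.
rewrite e /eip; have [h1 h2 h3] := wg_lin (-1) hu hp.
have V : V2 (grad phi - wg u).
  have := V2_lin oO (-1) (H1w_V2 hu) (V2_grad s); by rewrite scaleN1r addrC.
apply: vip_ae2 => //; apply: ae_volS (ae_volI h0 h3) => z [e0 e3] Cz.
rewrite e3// -[LHS]/(-1 *: wg u z + wg phi z) e0// scaleN1r addrC.
by [].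
Qed.

Lemma H1w_norm_sqr u : W u -> H1w_norm a CT u ^+ 2 = ipC_ u u + eip u u.
Proof.
move=> hu; have hV := H1w_V2 hu.
rewrite /H1w_norm sqr_sqrtr; last by rewrite addr_ge0// sqr_ge0.
rewrite /L2w_norm /L2w_vnorm !sqr_sqrtr //.
- by rewrite /eip; have [_ ->] := vipE oO hV hV.
- by have := vip_ge0 Omega T a (wg u); have [_ ->] := vipE oO hV hV.
- exact: (@ip_ge0 _ _ Em nu CT wt wt_gt0 u).
Qed.

Lemma sqr_cvg0P (N : nat -> R) : (forall n, 0 <= N n) ->
  (N n @[n --> \oo] --> (0 : R)) <->
  (forall e, 0 < e -> exists K, forall n, (K <= n)%N -> N n ^+ 2 <= e).
Proof.
move=> N0; split.
  move=> /cvgrPdist_le h e e0.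
  have := h (Num.sqrt e); rewrite sqrtr_gt0 => /(_ e0) [K _ hK]; exists K => n Kn.
  have := hK n Kn; rewrite /= sub0r normrN ger0_norm// => hn.
  by rewrite -(sqr_sqrtr (ltW e0)) ler_sqr ?nnegrE// sqrtr_ge0.
move=> h; apply/cvgrPdist_le => e e0.
have [K hK] := h _ (exprn_gt0 2 e0); exists K => // n /= Kn.
by have := hK n Kn; rewrite sub0r normrN ger0_norm// ler_sqr ?nnegrE// ltW.
Qed.

(** Splits the H1 norm into its two parts and replaces the chosen weak gradient of a smooth function
    by the classical one. *)
Lemma smooth_approxP (phi : nat -> E -> R^o) u : W u ->
  smooth_approx Omega T a phi u <->
  [/\ forall n, csmooth (phi n), form_cvg ipC_ phi u &
      form_cvg vip (fun n => grad (phi n)) (wg u)].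
Proof.
move=> hu.
have key n : csmooth (phi n) -> H1w_norm a CT (phi n \- u) ^+ 2 =
    ipC_ (phi n - u) (phi n - u) + vip (grad (phi n) - wg u) (grad (phi n) - wg u).
  by move=> s; rewrite (H1w_norm_sqr (H1wB (H1w_csmooth s) hu)) wg_sub_smooth.
have ge1 v : 0 <= ipC_ v v by exact: (@ip_ge0 _ _ Em nu CT wt wt_gt0).
split.
  move=> [sm /sqr_cvg0P h]; have s n : csmooth (phi n) := sm n.
  have {}h := h (fun n => sqrtr_ge0 _).
  split => // e e0; have [K hK] := h _ e0; exists K => n /hK; rewrite key//.
    by move=> h0; apply: le_trans h0; rewrite lerDl; exact: vip_ge0.
  by move=> h0; apply: le_trans h0; rewrite lerDr; exact: ge1.
move=> [s h1 h2]; split => //; apply/sqr_cvg0P; first by move=> n; exact: sqrtr_ge0.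
move=> e e0.
have [K1 {}h1] := h1 _ (divr_gt0 e0 (ltr0n _ 2)).
have [K2 {}h2] := h2 _ (divr_gt0 e0 (ltr0n _ 2)).
exists (maxn K1 K2) => n; rewrite geq_max => /andP[/h1 {}h1 /h2 {}h2].
by rewrite key//; lra.
Qed.

(** Both sides of the integration by parts formula are weighted inner products with a fixed element,
    by [l2_dual], and these are continuous along the two convergences. *)
Lemma weak_gradient_closed (u_ : nat -> E -> R^o) u G : (forall n, W (u_ n)) -> L2C u -> V2 G ->
  form_cvg ipC_ u_ u -> form_cvg vip (fun n => wg (u_ n)) G -> is_weak_gradient CT u G.
Proof.
move=> hW hu hG c1 c2; split; first exact: l2_locally_integrable.
move=> v; split; first by apply: l2_locally_integrable; exact: V2_dotp.
move=> psi tpsi; have spsi := test_csmooth tpsi; have bpsi := test_bsupp tpsi.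
have cD : continuous ('D_v (psi : E -> R^o)) by exact: csmooth_continuous (csmooth_derive v spsi).
have cp : continuous psi by exact: csmooth_continuous spsi.
have [C1 C10 hC1] := bsupp_bounded cD (bsupp_derive v bpsi).
have [C2 C20 hC2] := bsupp_bounded cp bpsi.
have mm (f : E -> R) : continuous f -> @measurable_fun _ _ Em R CT f.
  by move=> cf; apply: measurable_funTS; exact: continuous_measurable_E.
have [l1 e1] := l2_dual oO bO T0 ha (mm _ cD) (fun z _ => hC1 z).
have [l2' e2] := l2_dual oO bO T0 ha (mm _ cp) (fun z _ => hC2 z).
set p1 := (fun z => _) in l1 e1; set p2 := (fun z => _) in l2' e2.
pose H (z : E) : E := p2 z *: v.
have hH : V2 H.
  move=> i; have := l2_lin mCT mwt wt_gt0 (crd i v) l2' (@l20 R _ Em nu CT wt); congr l2.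
  by apply/funext => z; rewrite /H crdZ mulrC -[LHS]/(crd i v * p2 z + 0) addr0 mulrC.
have eH F : V2 F -> \int[nu]_(z in CT) (dotp (F z) v * psi z) = vip F H.
  move=> hF; have [_ ->] := vipE oO hF hH; rewrite -e2; apply: eq_Rintegral => z _.
  by congr (_ * _); rewrite /H [in RHS]dotpC dotpZl [dotp v _]dotpC mulrC.
rewrite eH//; rewrite -e1.
have en n : ipC_ (u_ n) p1 = - vip (wg (u_ n)) H.
  have /H1wP[_ [_ /(_ v)[_ /(_ _ tpsi) h]] V] := hW n.
  by rewrite e1 h eH.
apply/eqP; rewrite -subr_eq0 opprK -normr_le0; apply/ler_addgt0Pr => e e0; rewrite add0r.
have e20 : 0 < e / 2 by rewrite divr_gt0.
have [N1 h1] := form_cvg_ip (@l2_lin _ _ Em nu CT mCT wt mwt wt_gt0) (fun u v _ _ => @ipC _ _ Em nu CT wt u v)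
   (@ipL _ _ Em nu CT mCT wt mwt wt_gt0) (fun u _ => @ip_ge0 _ _ Em nu CT wt wt_gt0 u)
   (fun n => H1w_l2 (hW n)) hu l1 c1 e20.
have [N2 h2] := form_cvg_ip (V2_lin oO) (fun F1 F2 _ _ => @vipC _ _ Omega T a F1 F2)
   (vipL oO) (fun F1 _ => @vip_ge0 _ _ Omega T a F1)
   (fun n => H1w_V2 (hW n)) hG hH c2 e20.
have {}h1 := h1 _ (leq_maxl N1 N2); have {}h2 := h2 _ (leq_maxr N1 N2).
move: h1 h2; set n := maxn _ _; rewrite en => h1 h2.
rewrite (_ : _ + _ = - (- vip (wg (u_ n)) H - ipC_ u p1) - (vip (wg (u_ n)) H - vip G H)); last ring.
apply: le_trans (ler_normB _ _) _; rewrite normrN; lra.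
Qed.

End sobolev_space.

(** * Inequalities and sequences in the limit *)

Section form_limits.
Context {R : realType}.

(** Only |x + y|^2 <= 2 |x|^2 + 2 |y|^2 is used, once for each form; this avoids square roots at the
    price of a factor 4 in the constant. *)
Lemma form_cvg_le_pair (V1 V2' : lmodType R) (W1 : set V1) (W2 : set V2')
  (b1 : V1 -> V1 -> R) (b2 : V2' -> V2' -> R)
  (L1 : forall c u v, W1 u -> W1 v -> W1 (c *: u + v)) (S1 : forall u v, W1 u -> W1 v -> b1 u v = b1 v u)
  (B1 : forall c u v w, W1 u -> W1 v -> W1 w -> b1 (c *: u + v) w = c * b1 u w + b1 v w)
  (P1 : forall u, W1 u -> 0 <= b1 u u)
  (L2' : forall c u v, W2 u -> W2 v -> W2 (c *: u + v)) (S2 : forall u v, W2 u -> W2 v -> b2 u v = b2 v u)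
  (B2 : forall c u v w, W2 u -> W2 v -> W2 w -> b2 (c *: u + v) w = c * b2 u w + b2 v w)
  (P2 : forall u, W2 u -> 0 <= b2 u u)
  (x : nat -> V1) (y : nat -> V2') p q C : (forall n, W1 (x n)) -> (forall n, W2 (y n)) -> W1 p -> W2 q ->
  form_cvg b1 x p -> form_cvg b2 y q -> 0 <= C -> (forall n, b1 (x n) (x n) <= C * b2 (y n) (y n)) ->
  b1 p p <= 2 * (2 * C) * b2 q q.
Proof.
move=> Wx Wy Wp Wq cx cy C0 h; apply/ler_addgt0Pr => e e0.
have K0 : 0 < 4 * (C + 1) by lra.
have [N1 h1] := cx _ (divr_gt0 e0 K0); have [N2 h2] := cy _ (divr_gt0 e0 K0).
have {}h1 := h1 _ (leq_maxl N1 N2); have {}h2 := h2 _ (leq_maxr N1 N2).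
move: h1 h2; set n := maxn _ _ => h1 h2.
have k1 := form_le2 L1 S1 B1 P1 (Wx n) (form_closedB L1 Wp (Wx n)).
have k2 := form_le2 L2' S2 B2 P2 Wq (form_closedB L2' (Wy n) Wq).
rewrite [x n + _]addrC subrK (form_BC L1 S1 B1 Wp (Wx n)) in k1.
rewrite [q + _]addrC subrK in k2.
have hn := h n; have q0 := P2 _ Wq.
move: h1 h2; rewrite !ler_pdivlMr// => h1 h2.
have y0 := P2 _ (form_closedB L2' (Wy n) Wq); have x0 := P1 _ (form_closedB L1 (Wx n) Wp).
move: k1 k2 hn h1 h2 q0 y0 x0.
move: (b1 p p) (b1 (x n) (x n)) (b2 (y n) (y n)) (b1 _ _) (b2 (y n - q) _) (b2 q q) => A1 A2 A3 A4 A5 A6.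
move=> k1 k2 hn h1 h2 q0 y0 x0.
have : C * A3 <= C * (2 * A6 + 2 * A5) by exact: ler_wpM2l.
nra.
Qed.

(** Serves to compare two approximations of one function: a Cauchy estimate for the merged sequence
    compares its even and odd terms. *)
Lemma form_cvg_interleave (V : lmodType R) (b : V -> V -> R) (f g : nat -> V) l :
  form_cvg b f l -> form_cvg b g l -> form_cvg b (fun n => if odd n then g n./2 else f n./2) l.
Proof.
move=> h1 h2 e e0; have [N1 {}h1] := h1 e e0; have [N2 {}h2] := h2 e e0.
exists (maxn N1 N2).*2 => n hn; have {}hn : (maxn N1 N2 <= n./2)%N by rewrite -(doubleK (maxn N1 N2)) half_leq.
move: hn; rewrite geq_max => /andP[n1 n2]; case: ifP => _; [exact: h2|exact: h1].
Qed.

Lemma form_cvg_diagonal (V : lmodType R) (W1 : set V) (b : V -> V -> R)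
   (L1 : forall c u v, W1 u -> W1 v -> W1 (c *: u + v)) (S1 : forall u v, W1 u -> W1 v -> b u v = b v u)
   (B1 : forall c u v w, W1 u -> W1 v -> W1 w -> b (c *: u + v) w = c * b u w + b v w)
   (P1 : forall u, W1 u -> 0 <= b u u) (x y : nat -> V) p : (forall n, W1 (x n)) -> (forall n, W1 (y n)) ->
   W1 p -> form_cvg b y p -> (forall n, b (x n - y n) (x n - y n) <= n.+1%:R^-1) -> form_cvg b x p.
Proof.
move=> Wx Wy Wp h1 h2 e e0; have e4 : 0 < e / 4 by rewrite divr_gt0.
have [N {}h1] := h1 _ e4; have [k] := ltr_add_invr (y := 0) (x := e / 4) e4; rewrite add0r => hk.
exists (maxn N k) => n; rewrite geq_max => /andP[nN nk].
have h3 : n.+1%:R^-1 <= e / 4.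
  by apply: le_trans (ltW hk); rewrite lef_pV2 ?posrE ?ltr0n// ler_nat ltnS.
rewrite (_ : x n - p = (x n - y n) + (y n - p)); last by rewrite addrA subrK.
apply: le_trans (form_le2 L1 S1 B1 P1 (form_closedB L1 (Wx n) (Wy n)) (form_closedB L1 (Wy n) Wp)) _.
have h4 := h1 _ nN; have h5 := le_trans (h2 n) h3; lra.
Qed.

End form_limits.

(** * Traces and the Poincare inequality *)

Section traces.
Context {R : realType} (d : nat) (Omega : set 'rV[R]_d) (T a : R).
Hypotheses (oO : open Omega) (bO : bounded_set Omega) (T0 : 0 < T) (ha : -1 < a < 1).
Local Notation E := ('rV[R]_d * R)%type.
Local Notation Em := ('rV[R]_d * measurableTypeR R)%type.
Local Notation CT := (cylinder Omega T).
Local Notation nu := (vol d).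
Local Notation leb1 := (@lebesgue_measure R).
Local Notation wt := (@wt R d a).
Local Notation L2C := (@l2 R _ Em nu CT wt).
Local Notation ipC_ := (@ip R _ Em nu CT wt).
Local Notation V2 := (V2 Omega T a).
Local Notation vip := (vip Omega T a).
Local Notation mCT := (measurable_cylinder T oO).
Local Notation mwt := (@measurable_wt R d Omega T a).
Local Notation wt_gt0 := (@wt_gt0 R d Omega T a).
Local Notation wg := (wgrad CT).
Local Notation W := (H1w a CT).
Local Notation L2O := (@l2 R _ 'rV[R]_d (leb d) Omega (cst 1)).
Local Notation ipO := (@ip R _ 'rV[R]_d (leb d) Omega (cst 1)).
Local Notation eip := (eip Omega T a).
Implicit Types (u v : E -> R^o) (F G H : E -> E) (phi psi : E -> R^o).

Lemma measurable_Omega : measurable Omega. Proof. exact: open_measurable_rV. Qed.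
Local Notation mO := measurable_Omega.
Lemma measurable_one : measurable_fun Omega (cst 1 : 'rV[R]_d -> R). Proof. exact: measurable_cst. Qed.
Lemma one_gt0 : forall x : 'rV[R]_d, Omega x -> 0 < (cst 1 : 'rV[R]_d -> R) x.
Proof. by move=> x _ /=; exact: ltr01. Qed.

Lemma l2C_lin c u v : L2C u -> L2C v -> L2C (c *: u + v). Proof. exact: (l2_lin mCT mwt wt_gt0). Qed.
Lemma ipC_sym u v : L2C u -> L2C v -> ipC_ u v = ipC_ v u. Proof. by move=> _ _; exact: ipC. Qed.
Lemma ipC_lin c u v w : L2C u -> L2C v -> L2C w -> ipC_ (c *: u + v) w = c * ipC_ u w + ipC_ v w.
Proof. exact: (ipL mCT mwt wt_gt0). Qed.
Lemma ipC_ge0 u : L2C u -> 0 <= ipC_ u u. Proof. by move=> _; exact: (@ip_ge0 _ _ Em nu CT wt wt_gt0). Qed.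
Lemma vip_sym F G : V2 F -> V2 G -> vip F G = vip G F. Proof. by move=> _ _; exact: vipC. Qed.
Lemma vip_pos F : V2 F -> 0 <= vip F F. Proof. by move=> _; exact: vip_ge0. Qed.
Lemma l2O_lin c (f g : 'rV[R]_d -> R^o) : L2O f -> L2O g -> L2O (c *: f + g).
Proof. exact: (l2_lin mO measurable_one one_gt0). Qed.
Lemma ipO_sym (f g : 'rV[R]_d -> R^o) : L2O f -> L2O g -> ipO f g = ipO g f.
Proof. by move=> _ _; exact: ipC. Qed.
Lemma ipO_lin c (f g h : 'rV[R]_d -> R^o) : L2O f -> L2O g -> L2O h ->
  ipO (c *: f + g) h = c * ipO f h + ipO g h.
Proof. exact: (ipL mO measurable_one one_gt0). Qed.
Lemma ipO_ge0 (f : 'rV[R]_d -> R^o) : L2O f -> 0 <= ipO f f.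
Proof. by move=> _; exact: (@ip_ge0 _ _ 'rV[R]_d (leb d) Omega (cst 1) one_gt0). Qed.
Local Notation V2lin := (@V2_lin R d Omega T a oO).
Local Notation viplin := (@vipL R d Omega T a oO).

Definition line0 (x : 'rV[R]_d) : E := (x, 0).

Lemma line0E x t : line0 x + t *: ebas ord0 = (x, t).
Proof.
apply: crd_inj => i; rewrite crdD crdZ crd_ebas.
case: (unliftP ord0 i) => [j ->|->]; first by rewrite !crdS /= mulr0 addr0.
by rewrite !crd0 /= mulr1 add0r.
Qed.

Lemma is_derive_vertical phi x t : csmooth phi ->
  is_derive t (1 : R) (fun s : R => phi (x, s) : R^o) ('D_(ebas ord0) phi (x, t)).
Proof.
move=> s; have := derive_line (line0 x) (ebas ord0) t s.
by under eq_fun do rewrite line0E; rewrite line0E.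
Qed.

Lemma continuous_vertical phi x : csmooth phi -> continuous (fun t : R => phi (x, t) : R^o).
Proof.
move=> s t; apply: differentiable_continuous; apply/derivable1_diffP.
by have := is_derive_vertical x t s => h; exact: ex_derive.
Qed.

Lemma measurable_inner (f : E -> \bar R) : @measurable_fun _ _ Em _ setT f -> (forall z, (0 <= f z)%E) ->
  measurable_fun Omega (fun x => \int[leb1]_(t in `]0%R, T[) f (x, t))%E.
Proof.
move=> mf f0.
have mC : @measurable _ Em (snd @^-1` (`]0%R, T[ : set R)).
  by rewrite -[X in measurable X]setTI; apply: (@measurable_snd _ _ 'rV[R]_d (measurableTypeR R)).
have mfC : @measurable_fun _ _ Em _ setT (f \_ (snd @^-1` (`]0%R, T[ : set R))).
  by apply: (measurable_restrictT f mC).1; exact: (measurable_funS measurableT (@subsetT _ _) mf).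
have f0C z : (0 <= (f \_ (snd @^-1` (`]0%R, T[ : set R))) z)%E by rewrite patchE; case: ifPn.
have := @measurable_fun_fubini_tonelli_F _ _ 'rV[R]_d (measurableTypeR R) R leb1 _ mfC f0C.
move=> h; apply: measurable_funTS; move: h; congr measurable_fun.
apply/funext => x; rewrite /fubini_F [RHS]integral_mkcond; apply: eq_integral => t _.
by rewrite !patchE.
Qed.

(** The slice at height [s] extended constantly in the vertical direction: the trace for s = 0, the
    Dirichlet values at the top for s = T. *)
Definition pull (phi : E -> R) (s : R) : E -> R := fun z => phi (z.1, s).

Lemma pull_continuous phi s : continuous phi -> continuous (pull phi s : E -> R^o).
Proof.
move=> c z; apply: (@continuous_comp _ _ _ (fun z : E => (z.1, s)) phi); last exact: c.
have h1 : (fun z : E => z.1) @ z --> z.1 by exact: cvg_fst.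
have h2 : (fun _ : E => s) @ z --> s by exact: cvg_cst.
exact: (cvg_pair h1 h2).
Qed.

(** The Cauchy-Schwarz factor of [ftc_sqr_le] times a bound for the weight of a vertical fibre; as a
    function of T it is a multiple of T^2. *)
Definition Kf : R := T `^ (1 - a) / (1 - a) * (T `^ (a + 1) / (a + 1)).

Lemma Kf_ge0 : 0 <= Kf.
Proof.
by case/andP: ha => h1 h2; rewrite mulr_ge0 ?divr_ge0 ?powR_ge0//; lra.
Qed.

Lemma measurable_sqr_wt (f : E -> R) : continuous f ->
  @measurable_fun _ _ Em _ setT (fun z => (f z ^+ 2 * wt z)%:E).
Proof.
move=> cf; apply/measurable_EFinP; apply: measurable_funM; last exact: measurable_snd_powR.
by apply: measurable_funX; exact: continuous_measurable_E.
Qed.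

(** On each vertical fibre [ftc_sqr_le] is applied between the current height and the end [s] of the
    fibre; the result is integrated against the weight and then over the base. *)
Lemma ftc_cylinder phi s : csmooth phi -> s = 0 \/ s = T ->
  ipC_ (phi - pull phi s) (phi - pull phi s) <= Kf * vip (grad phi) (grad phi).
Proof.
move=> sm hs; have c := csmooth_continuous sm.
have cD : continuous ('D_(ebas ord0) phi) := csmooth_continuous (csmooth_derive _ sm).
have cpl := @pull_continuous phi s c.
have cd : continuous (phi - pull phi s : E -> R^o).
  by move=> z; apply: cvgB; [exact: c|exact: cpl].
have l2d : L2C (phi - pull phi s) by exact: (l2_continuous oO bO T0 ha).
have l2D : L2C ('D_(ebas ord0) phi) by exact: (l2_continuous oO bO T0 ha).
apply: (@le_trans _ _ (Kf * ipC_ ('D_(ebas ord0) phi) ('D_(ebas ord0) phi))); last first.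
  apply: ler_wpM2l; first exact: Kf_ge0.
  apply: le_trans (ip_crd_le_vip Omega T a (grad phi) ord0).
  rewrite le_eqVlt; apply/orP; left; apply/eqP; apply: eq_Rintegral => z _.
  by rewrite !crd_grad.
rewrite -lee_fin EFinM (ipE mCT l2d) (ipE mCT l2D).
have w0 (z : E) : 0 <= wt z by exact: powR_ge0.
rewrite (@tonelli_cylinder R d Omega T oO (fun z => ((phi - pull phi s) z ^+ 2 * wt z)%:E)); last 2 first.
- exact: measurable_sqr_wt.
- by move=> z; rewrite lee_fin mulr_ge0// sqr_ge0.
rewrite (@tonelli_cylinder R d Omega T oO (fun z => ('D_(ebas ord0) phi z ^+ 2 * wt z)%:E)); last 2 first.
- exact: measurable_sqr_wt.
- by move=> z; rewrite lee_fin mulr_ge0// sqr_ge0.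
have mJ := measurable_inner (measurable_sqr_wt cD) (fun z => mulr_ge0 (sqr_ge0 _) (w0 z)).
have J0 x : (0 <= \int[leb1]_(t in `]0%R, T[) ('D_(ebas ord0) phi (x, t) ^+ 2 * wt (x, t))%:E)%E.
  by apply: integral_ge0 => t _; rewrite lee_fin mulr_ge0// sqr_ge0.
rewrite -(ge0_integralZl_EFin _ mO (fun x _ => J0 x) mJ Kf_ge0).
apply: ge0_le_integral; [exact: mO| | | |].
- by move=> x _; apply: integral_ge0 => t _; rewrite lee_fin mulr_ge0// sqr_ge0.
- exact: (measurable_inner (measurable_sqr_wt cd) (fun z => mulr_ge0 (sqr_ge0 _) (w0 z))).
- by apply: emeasurable_funM => //; exact: measurable_cst.
move=> x Ox; have J0x := J0 x; move: J0x; set J := (\int[_]_(_ in _) ('D_(ebas ord0) phi (x, _) ^+ 2 * _)%:E)%E => J0x.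
have a1 : -1 < a by case/andP: ha.
have k10 : 0 <= T `^ (1 - a) / (1 - a) by case/andP: ha => _ ?; rewrite divr_ge0 ?powR_ge0//; lra.
apply: (@le_trans _ _ (\int[leb1]_(t in `]0%R, T[) (((T `^ (1 - a) / (1 - a))%:E * J) * (t `^ a)%:E))%E); last first.
  rewrite ge0_integralZl//.
  - apply: (@le_trans _ _ (((T `^ (1 - a) / (1 - a))%:E * J) * (T `^ (a + 1) / (a + 1))%:E)%E).
      by apply: lee_wpmul2l; [exact: mule_ge0|exact: integral_powR0_le].
    by rewrite /Kf EFinM muleAC.
  - by apply/measurable_EFinP; apply: measurable_funTS; exact: measurable_powR.
  - by move=> t _; rewrite lee_fin powR_ge0.
  - exact: mule_ge0.
apply: ge0_le_integral => //.
- by move=> t _; rewrite lee_fin mulr_ge0// sqr_ge0.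
- apply/measurable_EFinP; apply: measurable_funM; last by apply: measurable_funTS; exact: measurable_powR.
  apply: measurable_funX; apply: measurable_funTS; apply: continuous_measurable_fun => t.
  apply: (@cvgB _ R^o _ _ _ (fun t : R => phi (x, t) : R^o) (cst (phi (x, s)))); [exact: continuous_vertical|exact: cvg_cst].
- apply: emeasurable_funM; first exact: measurable_cst.
  by apply/measurable_EFinP; apply: measurable_funTS; exact: measurable_powR.
move=> t; rewrite /= in_itv /= => /andP[t0 tT].
rewrite EFinM; apply: lee_wpmul2r; first by rewrite lee_fin powR_ge0.
have cth : continuous (fun t : R => 'D_(ebas ord0) phi (x, t) : R^o).
  exact: (@continuous_vertical ('D_(ebas ord0) phi) x (csmooth_derive _ sm)).
have sub (t1 t2 : R) : 0 <= t1 -> t2 <= T ->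
    (\int[leb1]_(t in `]t1, t2[) ('D_(ebas ord0) phi (x, t) ^+ 2 * t `^ a)%:E <= J)%E.
  move=> h1 h2; apply: ge0_subset_integral => //.
  - apply/measurable_EFinP; apply: measurable_funM; last by apply: measurable_funTS; exact: measurable_powR.
    by apply: measurable_funX; apply: measurable_funTS; exact: continuous_measurable_fun.
  - by move=> r _; rewrite lee_fin mulr_ge0 ?sqr_ge0 ?powR_ge0.
  - move=> r /=; rewrite !in_itv /= => /andP[r1 r2]; apply/andP; split.
      exact: le_lt_trans r1.
    exact: lt_le_trans h2.
have pE : (phi - pull phi s) (x, t) = phi (x, t) - phi (x, s) by [].
rewrite pE; case: hs => ->.
  apply: le_trans (ftc_sqr_le ha (lexx 0) t0 (ltW tT) (fun r => is_derive_vertical x r sm) cth) _.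
  by apply: lee_wpmul2l; [exact: k10|exact: sub (lexx _) (ltW tT)].
rewrite -sqrrN opprB.
apply: le_trans (ftc_sqr_le ha (ltW t0) tT (lexx _) (fun r => is_derive_vertical x r sm) cth) _.
by apply: lee_wpmul2l; [exact: k10|exact: sub (ltW t0) (lexx _)].
Qed.

Definition tr (phi : E -> R) : 'rV[R]_d -> R^o := fun x => phi (x, 0).

Lemma continuous_slice phi s : continuous phi -> continuous (fun x : 'rV[R]_d => phi (x, s) : R^o).
Proof.
move=> c x; apply: (@continuous_comp _ _ _ (fun x : 'rV[R]_d => (x, s)) phi); last exact: c.
move=> A [[A1 A2] /= [h1 h2] hA]; apply: filterS h1 => y A1y; apply: hA; split => //=.
exact: nbhs_singleton h2.
Qed.

Lemma continuous_tr phi : continuous phi -> continuous (tr phi).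
Proof. exact: continuous_slice. Qed.

Lemma l2O_bounded (f : 'rV[R]_d -> R) (C : R) : measurable_fun Omega f ->
  (forall x, Omega x -> `|f x| <= C) -> L2O f.
Proof.
move=> mf hC; split => //.
have iC : (leb d).-integrable Omega (EFin \o (cst (C ^+ 2) : 'rV[R]_d -> R)).
  apply/integrableP; split; first exact: (@measurable_cst _ _ 'rV[R]_d _ Omega (C ^+ 2)%:E).
  under eq_integral do rewrite /=.
  rewrite (_ : (fun _ => _) = cst `|(C ^+ 2)%:E|%E)// integral_cst; last exact: mO.
  by apply: lte_mul_pinfty => //; exact: leb_Omega_fin.
apply: le_integrable iC; first exact: mO.
  apply/measurable_EFinP; apply: measurable_funM => //; exact: measurable_funX.
move=> x Ox; rewrite /= lee_fin mulr1 !normrX lerXn2r ?nnegrE//.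
by apply: le_trans (hC _ Ox) (ler_norm _).
Qed.

Lemma l2O_tr phi : continuous phi -> L2O (tr phi).
Proof.
move=> c; have [r r0 hr] := Omega_bounded bO.
have [C C0 hC] := continuous_bounded r c.
apply: (@l2O_bounded _ C).
  by apply: measurable_funTS; apply: continuous_measurable_rV; exact: continuous_tr.
by move=> x /hr xr; apply: hC; rewrite prod_normE ge_max xr normr0 (ltW r0).
Qed.

(** A lower bound for the weight of a vertical fibre, from [integral_powR0_ge]; as a function of T
    it is a multiple of T^(1+a). *)
Definition c0 : R := (1 - 2^-1 `^ (a + 1)) / (a + 1) * T `^ (a + 1).

Lemma c0_gt0 : 0 < c0.
Proof.
case/andP: ha => h1 h2; rewrite mulr_gt0 ?powR_gt0// divr_gt0//; last lra.
by rewrite subr_gt0; apply: powR_half_lt1; lra.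
Qed.

Lemma ip_pull phi s : continuous phi ->
  c0 * ipO (fun x => phi (x, s)) (fun x => phi (x, s)) <= ipC_ (pull phi s) (pull phi s).
Proof.
move=> c; have cp := @pull_continuous phi s c.
have l2p : L2C (pull phi s) by exact: (l2_continuous oO bO T0 ha).
have l2t : L2O (fun x => phi (x, s)).
  exact: (l2O_tr (phi := pull phi s) cp).
have a1 : -1 < a by case/andP: ha.
rewrite -lee_fin EFinM (ipE mCT l2p) (ipE mO l2t).
have w0 (z : E) : 0 <= wt z by exact: powR_ge0.
rewrite (@tonelli_cylinder R d Omega T oO (fun z => (pull phi s z ^+ 2 * wt z)%:E)); last 2 first.
- exact: measurable_sqr_wt.
- by move=> z; rewrite lee_fin mulr_ge0// sqr_ge0.
have mf : measurable_fun Omega (fun x => (phi (x, s) ^+ 2 * cst 1 x)%:E).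
  apply/measurable_EFinP; apply: measurable_funM => //.
  by apply: measurable_funX; case: l2t.
rewrite -ge0_integralZl_EFin//; last 3 first.
- exact: mO.
- by move=> x _; rewrite lee_fin mulr_ge0// sqr_ge0.
- exact: ltW c0_gt0.
apply: ge0_le_integral; [exact: mO| | | |].
- by move=> x _; rewrite -EFinM lee_fin mulr1; apply: mulr_ge0; [exact: ltW c0_gt0|exact: sqr_ge0].
- by apply: emeasurable_funM => //; exact: measurable_cst.
- exact: (measurable_inner (measurable_sqr_wt cp) (fun z => mulr_ge0 (sqr_ge0 _) (w0 z))).
move=> x _; rewrite /pull /=.
under eq_integral do rewrite EFinM.
rewrite ge0_integralZl_EFin//; last 3 first.
- by move=> t _; rewrite lee_fin powR_ge0.
- by apply/measurable_EFinP; apply: measurable_funTS; exact: measurable_powR.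
- exact: sqr_ge0.
rewrite mulr1 muleC; apply: lee_wpmul2l; first by rewrite lee_fin sqr_ge0.
exact: integral_powR0_ge.
Qed.

Definition Ct : R := 2 * (1 + Kf) / c0.

Lemma Ct_ge0 : 0 <= Ct.
Proof.
by apply: divr_ge0; [have := Kf_ge0; lra|exact: ltW c0_gt0].
Qed.

(** The vertical extension of the trace differs from [phi] by at most a multiple of the gradient in
    the weighted norm, and it controls the trace because each fibre has weight at least [c0]. *)
Lemma ip_tr_le phi : csmooth phi ->
  ipO (tr phi) (tr phi) <= Ct * (ipC_ phi phi + vip (grad phi) (grad phi)).
Proof.
move=> sm; have c := csmooth_continuous sm.
have l2p : L2C (pull phi 0) by apply: (l2_continuous oO bO T0 ha); exact: pull_continuous.
have l2f : L2C phi by exact: (l2_continuous oO bO T0 ha).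
have h1 := ip_pull 0 c.
have h2 := ftc_cylinder sm (or_introl erefl).
have l2d : L2C (phi - pull phi 0) by exact: (form_closedB l2C_lin).
have e : (pull phi 0 : E -> R^o) = phi - (phi - pull phi 0) by rewrite opprB addrC subrK.
have h3 := form_le2 l2C_lin ipC_sym ipC_lin ipC_ge0 l2f (form_closedB l2C_lin l2p l2f).
rewrite (_ : phi + (pull phi 0 - phi) = (pull phi 0 : E -> R^o)) in h3; last by rewrite addrC subrK.
rewrite (form_BC l2C_lin ipC_sym ipC_lin l2p l2f) in h3.
rewrite /Ct mulrAC ler_pdivlMr ?c0_gt0// mulrC.
have k0 := Kf_ge0; have i0 := ipC_ge0 l2f; have v0 := vip_ge0 Omega T a (grad phi).
apply: le_trans h1 _; apply: le_trans h3 _; nra.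
Qed.

(** Each fibre is integrated downwards from the top, where [phi] vanishes. *)
Lemma poincare_csmooth phi : csmooth phi -> (forall x, Omega x -> phi (x, T) = 0) ->
  ipC_ phi phi <= Kf * vip (grad phi) (grad phi) /\
  ipO (tr phi) (tr phi) <= 2 * Ct * (1 + Kf) * vip (grad phi) (grad phi).
Proof.
move=> sm h0; have h := ftc_cylinder sm (or_intror erefl).
have h1 : ipC_ phi phi <= Kf * vip (grad phi) (grad phi).
  apply: le_trans h; rewrite le_eqVlt; apply/orP; left; apply/eqP.
  apply: eq_Rintegral => z /set_mem [Oz _].
  by rewrite -[(phi - pull phi T) z]/(phi z - phi (z.1, T)) h0// subr0.
split => //; apply: le_trans (ip_tr_le sm) _.
have C0 := Ct_ge0; have v0 := vip_ge0 Omega T a (grad phi); have k0 := Kf_ge0.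
rewrite (_ : 2 * Ct * (1 + Kf) * _ = Ct * (2 * (1 + Kf) * vip (grad phi) (grad phi))); last ring.
apply: ler_wpM2l => //.
have : 0 <= Kf * vip (grad phi) (grad phi) by exact: mulr_ge0.
move: h1 v0 k0; move: (ipC_ _ _) (vip _ _) (Kf) => q v k h1 v0 k0 p0; nra.
Qed.

Lemma L2P (f : 'rV[R]_d -> R^o) : L2 Omega f <-> L2O f.
Proof.
rewrite /L2 /l2 /=; split=> -[h1 h2]; split => //; move: h2; congr integrable;
  by apply/funext => x /=; rewrite mulr1.
Qed.

Lemma L2_norm_sqr (f : 'rV[R]_d -> R^o) : L2_norm Omega f ^+ 2 = ipO f f.
Proof.
rewrite /L2_norm sqr_sqrtr; last by apply: Rintegral_ge0 => x _; exact: sqr_ge0.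
by apply: eq_Rintegral => x _; rewrite mulr1.
Qed.

Lemma is_traceP u (g : 'rV[R]_d -> R^o) : is_trace Omega T a u g <-> L2O g /\
  exists phi : nat -> E -> R^o, smooth_approx Omega T a phi u /\ form_cvg ipO (fun n => tr (phi n)) g.
Proof.
have key (phi : nat -> E -> R) : (L2_norm Omega (fun x => phi n (x, 0) - g x) @[n --> \oo] --> (0 : R)) <->
    form_cvg ipO (fun n => tr (phi n)) g.
  split.
    move=> /sqr_cvg0P h; have {}h := h (fun n => sqrtr_ge0 _).
    by move=> e e0; have [K hK] := h _ e0; exists K => n /hK; rewrite L2_norm_sqr.
  move=> h; apply/sqr_cvg0P; first by move=> n; exact: sqrtr_ge0.
  by move=> e e0; have [K hK] := h _ e0; exists K => n /hK; rewrite L2_norm_sqr.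
split=> -[/L2P h1 [phi [h2 /key h3]]]; split => //; by exists phi.
Qed.

Lemma grad_lin c phi psi : csmooth phi -> csmooth psi ->
  grad (c *: phi + psi) = c *: grad phi + grad psi.
Proof.
move=> s1 s2; apply/funext => z; apply: crd_inj => i.
rewrite -[(c *: grad phi + grad psi) z]/(c *: grad phi z + grad psi z) crdD crdZ !crd_grad.
have d1 : derivable phi z (ebas i) by exact: csmooth_derivable.
have d2 : derivable psi z (ebas i) by exact: csmooth_derivable.
have dz : derivable (c *: phi) z (ebas i) by exact: derivableZ.
by rewrite (deriveD dz d2) (deriveZ _ d1).
Qed.

Lemma csmooth_lin c phi psi : csmooth phi -> csmooth psi -> csmooth (c *: phi + psi).
Proof. by move=> s1 s2; exact: (csmoothD (csmoothZ c s1) s2). Qed.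

Lemma ip_tr_cvg (phi : nat -> E -> R^o) : (forall n, csmooth (phi n)) ->
  form_cauchy ipC_ phi -> form_cauchy vip (fun n => grad (phi n)) -> form_cauchy ipO (fun n => tr (phi n)).
Proof.
move=> s h1 h2 e e0.
have K0 : 0 < 2 * (Ct + 1) by have := Ct_ge0; lra.
have [N1 {}h1] := h1 _ (divr_gt0 e0 K0).
have [N2 {}h2] := h2 _ (divr_gt0 e0 K0).
exists (maxn N1 N2) => n m; rewrite !geq_max => /andP[n1 n2] /andP[m1 m2].
have {}h1 := h1 _ _ n1 m1; have {}h2 := h2 _ _ n2 m2.
have eB : phi n - phi m = -1 *: phi m + phi n by rewrite scaleN1r addrC.
have sB : csmooth (phi n - phi m) by rewrite eB; exact: csmooth_lin.
have := ip_tr_le sB.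
have -> : grad (phi n - phi m) = grad (phi n) - grad (phi m).
  by rewrite eB grad_lin// scaleN1r addrC.
move=> h; apply: le_trans h _.
move: h1 h2; rewrite !ler_pdivlMr//; have := Ct_ge0.
have := ipC_ge0 (l2_csmooth oO bO T0 ha sB).
have := vip_ge0 Omega T a (grad (phi n) - grad (phi m)).
move: (ipC_ _ _) (vip _ _) (Ct) => p q r; nra.
Qed.

Lemma smooth_approx_tr_cauchy (phi : nat -> E -> R^o) u : W u -> smooth_approx Omega T a phi u ->
  form_cauchy ipO (fun n => tr (phi n)).
Proof.
move=> hu /(smooth_approxP oO bO T0 ha _ hu)[s c1 c2]; apply: ip_tr_cvg => //.
  exact: (form_cvg_cauchy l2C_lin ipC_sym ipC_lin ipC_ge0 (fun n => l2_csmooth oO bO T0 ha (s n)) (H1w_l2 oO hu) c1).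
exact: (form_cvg_cauchy V2lin vip_sym viplin vip_pos (fun n => V2_grad oO bO T0 ha (s n)) (H1w_V2 oO hu) c2).
Qed.

Lemma trace_exists (phi : nat -> E -> R^o) u : W u -> smooth_approx Omega T a phi u ->
  exists g, is_trace Omega T a u g.
Proof.
move=> hu hp; have s n : csmooth (phi n) by have [s _] := hp; exact: s.
have [g hg cg] := l2_complete mO measurable_one one_gt0
  (fun n => l2O_tr (csmooth_continuous (s n))) (smooth_approx_tr_cauchy hu hp).
by exists g; apply/is_traceP; split => //; exists phi.
Qed.

Lemma trace_is_trace (phi : nat -> E -> R^o) u : W u -> smooth_approx Omega T a phi u ->
  is_trace Omega T a u (trace Omega T a u).
Proof. by move=> hu hp; apply: xgetPex; exact: (trace_exists hu hp). Qed.

(** Interleaving the two sequences gives a third approximation of [u], whose traces are Cauchy; its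
    terms of index 2n and 2n+1 show that the two sequences of traces have the same limit. *)
Lemma smooth_approx_unique_trace (phi psi : nat -> E -> R^o) u g : W u ->
  smooth_approx Omega T a phi u -> smooth_approx Omega T a psi u -> L2O g ->
  form_cvg ipO (fun n => tr (psi n)) g -> form_cvg ipO (fun n => tr (phi n)) g.
Proof.
move=> hu /(smooth_approxP oO bO T0 ha _ hu)[s1 a1 b1] /(smooth_approxP oO bO T0 ha _ hu)[s2 a2 b2] hg cg.
pose chi (n : nat) : E -> R^o := if odd n then psi n./2 else phi n./2.
have schi n : csmooth (chi n) by rewrite /chi; case: ifP.
have c1 : form_cvg ipC_ chi u by exact: (form_cvg_interleave a1 a2).
have c2 : form_cvg vip (fun n => grad (chi n)) (wg u).
  rewrite (_ : (fun n => _) = (fun n => if odd n then grad (psi n./2) else grad (phi n./2))).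
    exact: (form_cvg_interleave b1 b2).
  by apply/funext => n; rewrite /chi; case: ifP.
have hc : smooth_approx Omega T a chi u by apply/(smooth_approxP oO bO T0 ha _ hu); split.
have cau := smooth_approx_tr_cauchy hu hc.
move=> e e0.
have [N1 h1] := cau _ (divr_gt0 e0 (ltr0n _ 4)).
have [N2 h2] := cg _ (divr_gt0 e0 (ltr0n _ 4)).
exists (maxn N1 N2) => n; rewrite geq_max => /andP[n1 n2].
have l1 : L2O (tr (phi n)) by apply: l2O_tr; exact: csmooth_continuous (s1 n).
have l3 : L2O (tr (psi n)) by apply: l2O_tr; exact: csmooth_continuous (s2 n).
have {}h2 := h2 _ n2.
have hn2 : (N1 <= n.*2)%N by apply: leq_trans n1 _; rewrite -addnn leq_addr.
have := h1 n.*2 n.*2.+1 hn2 (leqW hn2).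
rewrite /chi /= odd_double /= doubleK uphalf_double => {}h1.
rewrite (_ : tr (phi n) - g = (tr (phi n) - tr (psi n)) + (tr (psi n) - g)); last by rewrite addrA subrK.
apply: le_trans (form_le2 l2O_lin ipO_sym ipO_lin ipO_ge0 (form_closedB l2O_lin l1 l3) (form_closedB l2O_lin l3 hg)) _.
lra.
Qed.

(** Ties the chosen [trace] to every approximating sequence, and not only to the one that witnesses
    its existence. *)
Lemma trace_cvg (phi : nat -> E -> R^o) u : W u -> smooth_approx Omega T a phi u ->
  L2O (trace Omega T a u) /\ form_cvg ipO (fun n => tr (phi n)) (trace Omega T a u).
Proof.
move=> hu hp; have /is_traceP[h1 [psi [h2 h3]]] := trace_is_trace hu hp.
by split; [exact: h1|exact: (smooth_approx_unique_trace hu hp h2 h1 h3)].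
Qed.

Lemma H1LP u : H1L Omega T a u <-> W u /\ exists phi : nat -> E -> R^o,
  [/\ forall n, csmooth (phi n), form_cvg ipC_ phi u, form_cvg vip (fun n => grad (phi n)) (wg u) &
      forall n z, lateral_boundary Omega T z -> phi n z = 0].
Proof.
split=> [[hu [phi [/(smooth_approxP oO bO T0 ha _ hu)[s1 a1 b1] h]]]|[hu [phi [s1 a1 b1 h]]]]; (split; first exact: hu); exists phi.
  by split; [exact: s1|exact: a1|exact: b1|exact: h].
by split; [apply/(smooth_approxP oO bO T0 ha _ hu); split; [exact: s1|exact: a1|exact: b1]|exact: h].
Qed.

Local Notation L := (H1L Omega T a).
Local Notation tru := (trace Omega T a).

Lemma H1L_H1w u : L u -> W u. Proof. by case. Qed.

Lemma grad_cvg_lin c (phi psi : nat -> E -> R^o) u v : W u -> W v ->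
  (forall n, csmooth (phi n)) -> (forall n, csmooth (psi n)) ->
  form_cvg vip (fun n => grad (phi n)) (wg u) -> form_cvg vip (fun n => grad (psi n)) (wg v) ->
  form_cvg vip (fun n => grad (c *: phi n + psi n)) (wg (c *: u + v)).
Proof.
move=> hu hv s1 s2 b1 b2.
have gc : form_cvg vip (fun n => c *: grad (phi n) + grad (psi n)) (c *: wg u + wg v).
  exact: (form_cvg_lin V2lin vip_sym viplin vip_pos _ (fun n => V2_grad oO bO T0 ha (s1 n))
    (fun n => V2_grad oO bO T0 ha (s2 n)) (H1w_V2 oO hu) (H1w_V2 oO hv)).
have [_ Vw hae] := wg_lin oO c hu hv.
have Vl := V2lin c (H1w_V2 oO hu) (H1w_V2 oO hv).
move=> e e0; have [N hN] := gc e e0; exists N => n /hN; apply: le_trans.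
rewrite le_eqVlt; apply/orP; left; apply/eqP.
have Vg := V2_grad oO bO T0 ha (csmooth_lin c (s1 n) (s2 n)).
rewrite -(grad_lin c (s1 n) (s2 n)).
apply: (vip_ae2 oO (form_closedB V2lin Vg Vw) (form_closedB V2lin Vg Vl)).
apply: ae_volS hae => z hz Cz.
by rewrite -[LHS]/(grad _ z - wg _ z) hz.
Qed.

Lemma l2_cvg_lin c (phi psi : nat -> E -> R^o) u v : W u -> W v ->
  (forall n, csmooth (phi n)) -> (forall n, csmooth (psi n)) ->
  form_cvg ipC_ phi u -> form_cvg ipC_ psi v ->
  form_cvg ipC_ (fun n => c *: phi n + psi n) (c *: u + v).
Proof.
move=> hu hv s1 s2 a1 a2.
exact: (form_cvg_lin l2C_lin ipC_sym ipC_lin ipC_ge0 _ (fun n => l2_csmooth oO bO T0 ha (s1 n))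
    (fun n => l2_csmooth oO bO T0 ha (s2 n)) (H1w_l2 oO hu) (H1w_l2 oO hv)).
Qed.

Lemma H1L_lin c u v : L u -> L v -> L (c *: u + v).
Proof.
move=> /H1LP[hu [phi [s1 a1 b1 h1]]] /H1LP[hv [psi [s2 a2 b2 h2]]].
apply/H1LP; split; first exact: (H1w_lin oO c hu hv).
exists (fun n => c *: phi n + psi n); split.
- by move=> n; exact: (csmooth_lin c (s1 n) (s2 n)).
- exact: (l2_cvg_lin c hu hv s1 s2 a1 a2).
- exact: (grad_cvg_lin c hu hv s1 s2 b1 b2).
- by move=> n z hz; rewrite -[LHS]/(c * phi n z + psi n z) h1// h2// mulr0 addr0.
Qed.

Lemma H1L0 : L 0.
Proof.
have s : csmooth (0 : E -> R^o) by exact: csmooth_cst.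
have l0 : L2C (0 : E -> R^o) by exact: (l2_csmooth oO bO T0 ha s).
have h0 : W 0 := H1w0 oO bO T0 ha.
apply/H1LP; split; first exact: h0.
exists (fun _ => 0); split; first by [].
- by move=> e e0; exists 0 => n _; rewrite subrr (form_zerol l0 ipC_lin l0) ltW.
- have [V hae] := weak_gradient_csmooth oO bO T0 ha s.
  have Vg := V2_grad oO bO T0 ha s.
  move=> e e0; exists 0 => n _.
  have -> : vip (grad (0 : E -> R) - wg 0) (grad (0 : E -> R) - wg 0) = vip 0 0.
    apply: (vip_ae2 oO (form_closedB V2lin Vg V) (V20 Omega T a)).
    by apply: ae_volS hae => z hz Cz; rewrite -[LHS]/(grad _ z - wg _ z) hz// subrr.
  by rewrite (form_zerol (V20 Omega T a) viplin (V20 Omega T a)) ltW.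
- by [].
Qed.

(** Here and in [Cd] the outer factor 4 is the loss in [form_cvg_le_pair] when passing from smooth
    functions to limits. *)
Definition Cp : R := 2 * (2 * Kf).
Definition Cd : R := 2 * (2 * (2 * Ct * (1 + Kf))).

Lemma Cp_ge0 : 0 <= Cp. Proof. by rewrite /Cp; have := Kf_ge0; lra. Qed.
Lemma Cd_ge0 : 0 <= Cd.
Proof. by rewrite /Cd; apply: mulr_ge0 => //; apply: mulr_ge0 => //; apply: mulr_ge0; [have := Ct_ge0; lra|have := Kf_ge0; lra]. Qed.

Lemma poincare u : L u -> ipC_ u u <= Cp * eip u u.
Proof.
move=> /H1LP[hu [phi [s1 a1 b1 h1]]].
apply: (form_cvg_le_pair l2C_lin ipC_sym ipC_lin ipC_ge0 V2lin vip_sym viplin vip_pos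
  (fun n => l2_csmooth oO bO T0 ha (s1 n)) (fun n => V2_grad oO bO T0 ha (s1 n)) (H1w_l2 oO hu) (H1w_V2 oO hu) a1 b1 Kf_ge0).
move=> n; have [] // := poincare_csmooth (s1 n) _.
by move=> x Ox; apply: h1; right.
Qed.

Lemma trace_H1L u : L u -> L2O (tru u) /\ ipO (tru u) (tru u) <= Cd * eip u u.
Proof.
move=> Lu; have /H1LP[hu [phi [s1 a1 b1 h1]]] := Lu.
have hp : smooth_approx Omega T a phi u by apply/(smooth_approxP oO bO T0 ha _ hu).
have [l2t ct] := trace_cvg hu hp; split => //.
have K0 : 0 <= 2 * Ct * (1 + Kf) by apply: mulr_ge0; [have := Ct_ge0; lra|have := Kf_ge0; lra].
apply: (form_cvg_le_pair l2O_lin ipO_sym ipO_lin ipO_ge0 V2lin vip_sym viplin vip_pos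
  (fun n => l2O_tr (csmooth_continuous (s1 n))) (fun n => V2_grad oO bO T0 ha (s1 n)) l2t (H1w_V2 oO hu) ct b1 K0).
move=> n; have [] // := poincare_csmooth (s1 n) _.
by move=> x Ox; apply: h1; right.
Qed.

(** The chosen traces are linear only up to null sets, so linearity is stated after pairing with a
    square integrable function. *)
Lemma ip_trace_lin c u v k : L u -> L v -> L2O k ->
  ipO (tru (c *: u + v)) k = c * ipO (tru u) k + ipO (tru v) k.
Proof.
move=> Lu Lv hk; have Luv := H1L_lin c Lu Lv.
have [lu _] := trace_H1L Lu; have [lv _] := trace_H1L Lv; have [luv _] := trace_H1L Luv.
have [hu [phi [ap _]]] := Lu; have [hv [psi [aq _]]] := Lv; have [huv _] := Luv.
have [_ cu] := trace_cvg hu ap; have [_ cv] := trace_cvg hv aq.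
have /(smooth_approxP oO bO T0 ha _ hu)[s1 a1 b1] := ap.
have /(smooth_approxP oO bO T0 ha _ hv)[s2 a2 b2] := aq.
have ap2 : smooth_approx Omega T a (fun n => c *: (phi n : E -> R^o) + (psi n : E -> R^o)) (c *: u + v).
  apply/(smooth_approxP oO bO T0 ha _ huv); split.
  - by move=> n; exact: (csmooth_lin c (s1 n) (s2 n)).
  - exact: (l2_cvg_lin c hu hv s1 s2 a1 a2).
  - exact: (grad_cvg_lin c hu hv s1 s2 b1 b2).
have [_ cuv] := trace_cvg huv ap2.
have lt1 n : L2O (tr (phi n)) by apply: l2O_tr; exact: csmooth_continuous (s1 n).
have lt2 n : L2O (tr (psi n)) by apply: l2O_tr; exact: csmooth_continuous (s2 n).
have cl := form_cvg_lin l2O_lin ipO_sym ipO_lin ipO_ge0 c lt1 lt2 lu lv cu cv.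
have ll := l2O_lin c lu lv.
have n0 := form_cvg_unique l2O_lin ipO_sym ipO_lin ipO_ge0 (fun n => l2O_lin c (lt1 n) (lt2 n)) luv ll cuv cl.
have := form_null_ip l2O_lin ipO_sym ipO_lin ipO_ge0 (form_closedB l2O_lin luv ll) hk n0.
rewrite (formBl ipO_lin luv ll hk) (ipO_lin c lu lv hk) => /eqP; rewrite subr_eq0 => /eqP.
exact.
Qed.

(** The Poincare inequality makes an energy Cauchy sequence Cauchy in the weighted L2 space as well;
    the limits of functions and gradients fit together because weak gradients are closed. *)
Lemma H1L_complete (u_ : nat -> E -> R^o) : (forall n, L (u_ n)) -> form_cauchy eip u_ ->
  exists2 u, L u & form_cvg eip u_ u.
Proof.
move=> hL cau.
have LB u v : L u -> L v -> L (u - v) by exact: (form_closedB H1L_lin).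
have hW n := H1L_H1w (hL n).
have cC : form_cauchy ipC_ u_.
  move=> e e0; have K0 : 0 < Cp + 1 by have := Cp_ge0; lra.
  have [N hN] := cau _ (divr_gt0 e0 K0); exists N => n m Nn Nm.
  apply: le_trans (poincare (LB _ _ (hL n) (hL m))) _.
  have := hN _ _ Nn Nm; rewrite ler_pdivlMr//.
  have := eip_ge0 Omega T a (u_ n - u_ m); have := Cp_ge0; nra.
have wgB u v : W u -> W v -> eip (u - v) (u - v) = vip (wg u - wg v) (wg u - wg v).
  move=> hu hv.
  have e : u - v = -1 *: v + u by rewrite scaleN1r addrC.
  rewrite e -[LHS]/(vip _ _); have [h1 h2 h3] := wg_lin oO (-1) hv hu.
  apply: (vip_ae2 oO h2 (form_closedB V2lin (H1w_V2 oO hu) (H1w_V2 oO hv))).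
  apply: ae_volS h3 => z e3 Cz.
  by rewrite e3// -[LHS]/(-1 *: wg v z + wg u z) scaleN1r addrC.
have cV : form_cauchy vip (fun n => wg (u_ n)).
  by move=> e e0; have [N hN] := cau _ e0; exists N => n m Nn Nm; rewrite -wgB//; exact: hN.
have [u lu cu] := l2_complete mCT mwt wt_gt0 (fun n => H1w_l2 oO (hW n)) cC.
have [G hG cG] := vip_complete oO (fun n => H1w_V2 oO (hW n)) cV.
have hwg := weak_gradient_closed oO bO T0 ha hW lu hG cu cG.
have hu : W u := H1w_of_weak_gradient oO lu hwg hG.
have [Vu hae] := weak_gradient_wg oO hwg hG.
have cG' : form_cvg vip (fun n => wg (u_ n)) (wg u).
  move=> e e0; have [N hN] := cG e e0; exists N => n /hN; apply: le_trans.
  rewrite le_eqVlt; apply/orP; left; apply/eqP.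
  have Vn := H1w_V2 oO (hW n).
  apply: (vip_ae2 oO (form_closedB V2lin Vn Vu) (form_closedB V2lin Vn hG)).
  by apply: ae_volS hae => z hz Cz; rewrite -[LHS]/(wg (u_ n) z - wg u z) hz.
exists u; last by move=> e e0; have [N hN] := cG' e e0; exists N => n /hN; rewrite wgB.
(* A diagonal choice: [phi n] approximates [u_ n] up to 1/(n+1) and keeps the zero boundary values,
   so that the limit stays in the constrained space. *)
have /choice[phi hphi] : forall n, exists phi : E -> R^o, [/\ csmooth phi,
    ipC_ (phi - u_ n) (phi - u_ n) <= n.+1%:R^-1, vip (grad phi - wg (u_ n)) (grad phi - wg (u_ n)) <= n.+1%:R^-1 &
    forall z, lateral_boundary Omega T z -> phi z = 0].
  move=> n; have /H1LP[_ [f [s1 a1 b1 h1]]] := hL n.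
  have e0 : 0 < n.+1%:R^-1 :> R by rewrite invr_gt0.
  have [N1 h2] := a1 _ e0; have [N2 h3] := b1 _ e0.
  exists (f (maxn N1 N2)); split => //; [by apply: h2; rewrite leq_maxl|by apply: h3; rewrite leq_maxr|exact: h1].
have s n : csmooth (phi n) by case: (hphi n).
apply/H1LP; split; first exact: hu.
exists phi; split; first exact: s.
- apply: (form_cvg_diagonal l2C_lin ipC_sym ipC_lin ipC_ge0 (fun n => l2_csmooth oO bO T0 ha (s n)) (fun n => H1w_l2 oO (hW n)) lu cu).
  by move=> n; case: (hphi n).
- apply: (form_cvg_diagonal V2lin vip_sym viplin vip_pos (fun n => V2_grad oO bO T0 ha (s n)) (fun n => H1w_V2 oO (hW n)) Vu cG').
  by move=> n; case: (hphi n).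
- by move=> n; case: (hphi n).
Qed.

End traces.

(** * Simplicial meshes and hat functions *)

Section barycentric.
Context {R : realType} (d : nat).
Local Notation E := ('rV[R]_d * R)%type.
Local Notation smpl := (simplex (R := R) d).
Implicit Types (K L : smpl) (z w g : E) (t : 'I_d.+2 -> R).

(** Homogeneous coordinates: with a leading 1, barycentric coordinates become the solution of a
    square linear system. *)
Definition aug z : 'rV[R]_d.+2 :=
  \row_j (if unlift ord0 j is Some k then crd k z else 1).

Definition bary_mx K : 'M[R]_d.+2 := \matrix_i aug (K i).

Definition bary K z (i : 'I_d.+2) : R := (aug z *m invmx (bary_mx K)) ord0 i.

Lemma aug0 z : aug z ord0 ord0 = 1.
Proof. by rewrite mxE unlift_none. Qed.

Lemma augS z (k : 'I_d.+1) : aug z ord0 (lift ord0 k) = crd k z.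
Proof. by rewrite mxE liftK. Qed.

Lemma mul_bary_mx K t j : (\row_i t i *m bary_mx K) ord0 j =
  if unlift ord0 j is Some k then crd k (\sum_i t i *: K i) else \sum_i t i.
Proof.
rewrite mxE; case: (unliftP ord0 j) => [k ->|->].
  by rewrite crd_sum; apply: eq_bigr => i _; rewrite !mxE liftK crdZ.
by apply: eq_bigr => i _; rewrite !mxE unlift_none mulr1.
Qed.

(** A left null vector of the matrix is exactly an affine dependence between the vertices. *)
Lemma bary_mx_unit K : Defs.nondegenerate K -> bary_mx K \in unitmx.
Proof.
move=> nK; rewrite -row_free_unit; apply: inj_row_free => v hv.
have e j : (\row_i v ord0 i *m bary_mx K) ord0 j = 0.
  by rewrite (_ : \row_i v ord0 i = v) ?hv ?mxE//; apply/rowP => i; rewrite mxE.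
have h0 : \sum_i v ord0 i = 0 by have := e ord0; rewrite mul_bary_mx unlift_none.
have h1 : \sum_i v ord0 i *: K i = 0.
  apply: crd_inj => k; have := e (lift ord0 k); rewrite mul_bary_mx liftK => ->.
  by have := crdZ k 0 (0 : E); rewrite scale0r mul0r.
by apply/rowP => i; rewrite mxE (nK _ h0 h1).
Qed.

Lemma bary_unique K z t : Defs.nondegenerate K -> \sum_i t i = 1 -> z = \sum_i t i *: K i ->
  forall i, bary K z i = t i.
Proof.
move=> nK t1 zt i; rewrite /bary.
have -> : aug z = \row_i t i *m bary_mx K.
  apply/rowP => j; rewrite [RHS]mul_bary_mx mxE -zt t1.
  by case: (unlift ord0 j).
by rewrite mulmxK ?bary_mx_unit// mxE.
Qed.

Lemma sum_bary K z : Defs.nondegenerate K -> \sum_i bary K z i = 1 /\ \sum_i bary K z i *: K i = z.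
Proof.
move=> nK.
have e j : aug z ord0 j = (\row_i bary K z i *m bary_mx K) ord0 j.
  rewrite (_ : \row_i bary K z i = aug z *m invmx (bary_mx K)); last by apply/rowP => i; rewrite mxE.
  by rewrite mulmxKV ?bary_mx_unit.
split; first by have := e ord0; rewrite aug0 mul_bary_mx unlift_none.
apply: crd_inj => k; have := e (lift ord0 k).
by rewrite augS mul_bary_mx liftK.
Qed.

Definition bgrad K i : E := uncons_rV (\row_k invmx (bary_mx K) (lift ord0 k) i).
Definition bcst K i : R := invmx (bary_mx K) ord0 i.

Lemma baryE K z i : bary K z i = dotp (bgrad K i) z + bcst K i.
Proof.
rewrite /bary mxE big_ord_recl aug0 mul1r addrC; congr (_ + _).
by rewrite dotpE; apply: eq_bigr => k _; rewrite augS crd_uncons mxE mulrC.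
Qed.

Lemma dotp_continuous g : continuous (dotp g : E -> R^o).
Proof.
rewrite (_ : dotp g = fun w => \sum_i crd i g * crd i w); last first.
  by apply/funext => w; rewrite dotpE.
elim: (index_enum _) => [|i s ih] z.
  by rewrite (_ : (fun w => _) = cst 0); [exact: cvg_cst|apply/funext => w; rewrite big_nil].
rewrite (_ : (fun w => _) = (fun w => crd i g * crd i w + \sum_(j <- s) crd j g * crd j w)); last first.
  by apply/funext => w; rewrite big_cons.
apply: (@cvgD _ R^o); last exact: ih.
by apply: (@cvgM _ _ _ _ (cst (crd i g)) (crd i)); [exact: cvg_cst|exact: crd_continuous].
Qed.

Lemma affine_continuous g c : continuous (fun z : E => dotp g z + c : R^o).
Proof. by move=> z; apply: cvgD; [exact: dotp_continuous|exact: cvg_cst]. Qed.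

Lemma bary_continuous K i : continuous (bary K ^~ i : E -> R^o).
Proof.
rewrite (_ : bary K ^~ i = fun z => dotp (bgrad K i) z + bcst K i); first exact: affine_continuous.
by apply/funext => z; rewrite baryE.
Qed.

Lemma affine_sum g c t (p : 'I_d.+2 -> E) : \sum_i t i = 1 ->
  dotp g (\sum_i t i *: p i) + c = \sum_i t i * (dotp g (p i) + c).
Proof.
move=> t1; under [in RHS]eq_bigr do rewrite mulrDr.
rewrite big_split /= -mulr_suml t1 mul1r; congr (_ + _).
rewrite dotpE (eq_bigr (fun k => \sum_i t i * (crd k g * crd k (p i)))); last first.
  by move=> k _; rewrite crd_sum mulr_sumr; apply: eq_bigr => i _; rewrite crdZ mulrCA.
by rewrite exchange_big /=; apply: eq_bigr => i _; rewrite dotpE mulr_sumr.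
Qed.

Lemma affine_bary K z g c : Defs.nondegenerate K ->
  dotp g z + c = \sum_i bary K z i * (dotp g (K i) + c).
Proof.
by move=> nK; have [h1 h2] := sum_bary z nK; rewrite -affine_sum// h2.
Qed.

Lemma hullP K z : Defs.nondegenerate K -> hull K z <-> forall i, 0 <= bary K z i.
Proof.
move=> nK; split=> [[t [t0 _ t1 zt]] i|h]; first by rewrite (bary_unique nK t1 zt).
have [h1 h2] := sum_bary z nK.
by exists (bary K z); split.
Qed.

Lemma sum_delta (i : 'I_d.+2) : \sum_k ((k == i)%:R : R) = 1.
Proof. by rewrite (bigD1 i)//= eqxx big1 ?addr0// => k /negbTE ->. Qed.

Lemma sum_deltaZ (i : 'I_d.+2) (F : 'I_d.+2 -> E) : \sum_k ((k == i)%:R : R) *: F k = F i.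
Proof.
by rewrite (bigD1 i)//= eqxx scale1r big1 ?addr0// => k /negbTE ->; rewrite scale0r.
Qed.

Lemma nondegenerate_inj K : Defs.nondegenerate K -> injective K.
Proof.
move=> nK i j e; apply/eqP; apply: contraT => ij.
have := nK (fun k => (k == i)%:R - (k == j)%:R).
have h1 : \sum_k ((k == i)%:R - (k == j)%:R : R) = 0 by rewrite sumrB !sum_delta subrr.
have h2 : \sum_k ((k == i)%:R - (k == j)%:R : R) *: K k = 0.
  by under eq_bigr do rewrite scalerBl; rewrite sumrB !sum_deltaZ e subrr.
move=> /(_ h1 h2 i); rewrite eqxx (negbTE ij) subr0 => /eqP.
by rewrite oner_eq0.
Qed.

Lemma bary_vertex K i j : Defs.nondegenerate K -> bary K (K i) j = (j == i)%:R.
Proof.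
move=> nK; apply: (@bary_unique K (K i) (fun j => (j == i)%:R) nK); first exact: sum_delta.
by rewrite sum_deltaZ.
Qed.

Lemma vertex_hull K i : Defs.nondegenerate K -> hull K (K i).
Proof. by move=> nK; apply/hullP => // j; rewrite bary_vertex// ler0n. Qed.

Lemma bary_add K z w i : bary K (z + w) i = bary K z i + dotp (bgrad K i) w.
Proof. by rewrite !baryE [dotp _ (z + w)]dotpC dotpDl !(dotpC _ (bgrad _ _)) addrAC. Qed.

Lemma hull_closed K : Defs.nondegenerate K -> closed (hull K).
Proof.
move=> nK; rewrite (_ : hull K = \bigcap_(i in setT) [set z | 0 <= bary K z i]).
  apply: closed_bigI => i _.
  apply: (@closed_comp E R (bary K ^~ i) [set r | 0 <= r]); last exact: closed_ge.
  by move=> z _; exact: bary_continuous.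
by apply/seteqP; split => z; [move/hullP => h i _; exact: h|move=> h; apply/hullP => // i; exact: h].
Qed.

Lemma hull_bounded K : exists2 r : R, 0 < r & forall z, hull K z -> `|z| <= r.
Proof.
exists (1 + \sum_i `|K i|); first by rewrite ltr_pwDl// sumr_ge0.
move=> z [t [t0 _ t1 ->]]; apply: le_trans (ler_norm_sum _ _ _) _.
apply: (@le_trans _ _ (\sum_i `|K i|)); last by rewrite lerDr.
apply: ler_sum => i _; rewrite normrZ ger0_norm// ler_piMl//.
by rewrite -t1 (bigD1 i)//= lerDl sumr_ge0.
Qed.

Lemma hull_compact K : Defs.nondegenerate K -> compact (hull K).
Proof.
move=> nK; have [r _ hr] := hull_bounded K.
exact: closed_bounded_compact_E (hull_closed nK) hr.
Qed.

Lemma hull_convex K z w (s : R) : hull K z -> hull K w -> 0 <= s <= 1 ->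
  hull K ((1 - s) *: z + s *: w).
Proof.
move=> [t [t0 _ t1 ->]] [u [u0 _ u1 ->]] /andP[s0 s1].
exists (fun i => (1 - s) * t i + s * u i); split => //.
- by move=> i; rewrite addr_ge0// mulr_ge0// subr_ge0.
- by rewrite big_split /= -!mulr_sumr t1 u1 !mulr1 subrK.
- rewrite !scaler_sumr -big_split /=; apply: eq_bigr => i _.
  by rewrite !scalerA -scalerDl.
Qed.

Section conforming.
Variables (M : seq smpl) (D : set E).
Hypothesis hM : triangulates M D.

Lemma mesh_nondegenerate K : K \in M -> Defs.nondegenerate K.
Proof. by case: hM => h _ _; exact: h. Qed.
Local Notation nd := mesh_nondegenerate.

Lemma mesh_cover z : closure D z <-> exists2 K, K \in M & hull K z.
Proof. by case: hM => _ -> _; split=> [[K KM hK]|[K KM hK]]; exists K. Qed.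

(** By conformity the point is a convex combination of common vertices; by uniqueness of barycentric
    coordinates this one combination computes both sides. *)
Lemma conforming K L z (phi : E -> R) : K \in M -> L \in M -> hull K z -> hull L z ->
  \sum_i bary K z i * phi (K i) = \sum_j bary L z j * phi (L j).
Proof.
move=> KM LM hK hL; case: hM => _ _ /(_ K L KM LM) e.
have : face K [pred i | K i \in codom L] z by rewrite -e.
move=> [t [t0 tS t1 zt]].
(* The weights are moved from the vertices of [K] to the equal vertices of [L]; nothing is lost
   because [t] is carried by common vertices. *)
pose s j : R := \sum_i t i * (K i == L j)%:R.
have key (V : lmodType R) (psi : E -> V) : \sum_j s j *: psi (L j) = \sum_i t i *: psi (K i).
  under eq_bigr do rewrite scaler_suml.
  rewrite exchange_big /=; apply: eq_bigr => i _.
  under eq_bigr do rewrite -scalerA.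
  rewrite -scaler_sumr; have [/codomP[j0 ij]|ni] := boolP (K i \in codom L).
    congr (_ *: _); rewrite (bigD1 j0)//= ij eqxx scale1r big1 ?addr0// => j jj.
    rewrite (_ : (L j0 == L j) = false) ?scale0r//; apply/negbTE.
    by apply: contra jj => /eqP /(nondegenerate_inj (nd LM)) ->.
  by rewrite tS ?scale0r.
have s1 : \sum_j s j = 1.
  have := key R^o (fun _ => 1); under eq_bigr do rewrite -[_ *: _]/(_ * 1) mulr1.
  by under [in X in _ = X]eq_bigr do rewrite -[_ *: _]/(_ * 1) mulr1; rewrite t1.
have zs : z = \sum_j s j *: L j by rewrite (key E id) zt.
under eq_bigr do rewrite (bary_unique (nd KM) t1 zt).
under [in RHS]eq_bigr do rewrite (bary_unique (nd LM) s1 zs).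
by have := key R^o phi => <-.
Qed.

(** [conforming] is applied to the indicator of the vertex [K i], whose interpolated value at z is
    the barycentric coordinate. *)
Lemma conforming_vertex K L z i : K \in M -> L \in M -> hull K z -> hull L z ->
  0 < bary K z i -> exists2 j, L j = K i & bary L z j = bary K z i.
Proof.
move=> KM LM hK hL i0.
have e := conforming (fun w => (w == K i)%:R) KM LM hK hL.
rewrite (bigD1 i)//= eqxx mulr1 big1 ?addr0 in e; last first.
  move=> k ki; rewrite (_ : (K k == K i) = false) ?mulr0//; apply/negbTE.
  by apply: contra ki => /eqP /(nondegenerate_inj (nd KM)) ->.
have [/existsP[j /eqP ij]|/existsPn h] := boolP [exists j, L j == K i].
  exists j => //; rewrite e (bigD1 j)//= ij eqxx mulr1 big1 ?addr0// => k kj.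
  rewrite -ij (_ : (L k == L j) = false) ?mulr0//; apply/negbTE.
  by apply: contra kj => /eqP /(nondegenerate_inj (nd LM)) ->.
by rewrite e big1 ?ltxx// in i0 => j _; rewrite (negbTE (h j)) mulr0.
Qed.

(** The first simplex of the list that contains the point is used; by [conforming] any other gives
    the same value. *)
Definition pwaff (val : E -> R) z : R :=
  if [seq K <- M | `[< hull K z >]] is K :: _ then \sum_i bary K z i * val (K i) else 0.

Lemma pwaffE val K z : K \in M -> hull K z -> pwaff val z = \sum_i bary K z i * val (K i).
Proof.
move=> KM hK; rewrite /pwaff.
have : K \in [seq K <- M | `[< hull K z >]] by rewrite mem_filter KM andbT; apply/asboolP.
case e : [seq _ <- _ | _] => [//|L s] _.
have : L \in [seq K <- M | `[< hull K z >]] by rewrite e mem_head.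
by rewrite mem_filter => /andP[/asboolP hL LM]; exact: conforming.
Qed.

Lemma pwaff_out val z : ~ closure D z -> pwaff val z = 0.
Proof.
move=> nz; rewrite /pwaff; case e : [seq _ <- _ | _] => [//|L s].
have : L \in [seq K <- M | `[< hull K z >]] by rewrite e mem_head.
rewrite mem_filter => /andP[/asboolP hL LM]; exfalso; apply: nz.
by apply/mesh_cover; exists L.
Qed.

Lemma pwaff_affine val K : K \in M -> forall z, hull K z ->
  pwaff val z = dotp (\sum_i val (K i) *: bgrad K i) z + \sum_i val (K i) * bcst K i.
Proof.
move=> KM z hK; rewrite (pwaffE _ KM hK).
under eq_bigr do rewrite baryE mulrDl.
rewrite big_split /=; congr (_ + _); last by apply: eq_bigr => i _; rewrite mulrC.
rewrite [RHS]dotpE (eq_bigr (fun k => \sum_i val (K i) * (crd k (bgrad K i) * crd k z))); last first.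
  by move=> k _; rewrite crd_sum mulr_suml; apply: eq_bigr => i _; rewrite crdZ mulrA.
by rewrite exchange_big /=; apply: eq_bigr => i _; rewrite dotpE mulrC mulr_sumr.
Qed.

(** Gluing over a finite closed cover, by induction on the list of simplices; the pieces agree on
    intersections because [v] is a single function. *)
Lemma affine_pieces_continuous (v : E -> R) :
  (forall K, K \in M -> exists (g : E) (c : R), forall z, hull K z -> v z = dotp g z + c) ->
  {within closure D, continuous (v : E -> R^o)}.
Proof.
move=> h.
have -> : closure D = \bigcup_(K in [set` M]) hull K by case: hM.
have hn K : K \in M -> Defs.nondegenerate K := @nd K.
elim: M h hn => [|K s ih] h hn.
  rewrite (_ : \bigcup_(K in _) _ = set0); first exact: continuous_subspace0.
  by apply/seteqP; split => // z [].
rewrite (_ : \bigcup_(L in _) _ = hull K `|` \bigcup_(L in [set` s]) hull L); last first.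
  apply/seteqP; split => [z [L /=]|z [hK|[L Ls hL]]].
  - by rewrite inE => /orP[/eqP -> hL|Ls hL]; [left|right; exists L].
  - by exists K => //=; rewrite mem_head.
  - by exists L => //=; rewrite inE Ls orbT.
apply: withinU_continuous.
- by apply: hull_closed; apply: hn; rewrite mem_head.
- apply: closed_bigcup; first exact: finite_seq.
  by move=> L /= Ls; apply: hull_closed; apply: hn; rewrite inE Ls orbT.
- have [g [c hgc]] := h K (mem_head _ _).
  apply: (@subspace_eq_continuous _ _ _ (fun z => dotp g z + c : R^o)).
    by move=> z /set_mem hz; rewrite -[RHS]/(v z) hgc.
  by apply: continuous_subspaceT; exact: affine_continuous.
- by apply: ih => L Ls; [apply: h|apply: hn]; rewrite inE Ls orbT.
Qed.

Lemma mem_nodes K i : K \in M -> K i \in nodes M.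
Proof.
move=> KM; rewrite mem_undup; apply/allpairsP; exists (K, i); split => //=.
by rewrite mem_enum.
Qed.

Lemma nodesP z : z \in nodes M -> exists K i, K \in M /\ K i = z.
Proof. by rewrite mem_undup => /allpairsP[[K i] [/= KM _ ->]]; exists K, i. Qed.

End conforming.
End barycentric.

(** * Riesz representation in finite dimension *)

Section finite_riesz.
Context {R : realType} (V : lmodType R) (b : V -> V -> R).

(* Induction on the number of linear functionals whose common zeros are null. *)
Lemma finite_riesz (W : set V) (ev : seq (V -> R)) (l : V -> R) :
  W 0 -> (forall c u v, W u -> W v -> W (c *: u + v)) ->
  (forall u v, W u -> W v -> b u v = b v u) ->
  (forall c u v w, W u -> W v -> W w -> b (c *: u + v) w = c * b u w + b v w) ->
  (forall u, W u -> 0 <= b u u) ->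
  (forall c u v, W u -> W v -> l (c *: u + v) = c * l u + l v) ->
  (forall i c u v, W u -> W v -> nth (fun _ => 0) ev i (c *: u + v) = c * nth (fun _ => 0) ev i u + nth (fun _ => 0) ev i v) ->
  (forall u, W u -> (forall i, nth (fun _ => 0) ev i u = 0) -> b u u = 0) ->
  (forall u, W u -> b u u = 0 -> l u = 0) ->
  exists2 p, W p & forall w, W w -> b p w = l w.
Proof.
move=> W0 WL bC bL bp.
elim: ev W W0 WL bC bL bp l => [|e ev ih] W W0 WL bC bL bp l lL eL null lnull.
  have b0 u : W u -> b u u = 0 by move=> Wu; apply: null => // i; rewrite nth_nil.
  exists 0 => // w Ww; rewrite (form_zerol W0 bL)// lnull//; exact: b0.
have eL0 := eL 0; have eLS i := eL i.+1; rewrite /= in eL0 eLS.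
pose W' := [set u | W u /\ e u = 0].
have sub u : W' u -> W u by case.
have e00 : e 0 = 0.
  have := eL0 (-1) 0 0 W0 W0; rewrite scaler0 addr0 mulN1r => ->; by rewrite addNr.
have W'0 : W' 0 by [].
have W'L c u v : W' u -> W' v -> W' (c *: u + v).
  by move=> [Wu eu] [Wv ev']; split; [exact: WL|rewrite eL0// eu ev' mulr0 addr0].
have ih' l' : (forall c u v, W' u -> W' v -> l' (c *: u + v) = c * l' u + l' v) ->
    (forall u, W' u -> b u u = 0 -> l' u = 0) -> exists2 p, W' p & forall w, W' w -> b p w = l' w.
  move=> l'L l'n; apply: (ih W') => //.
  - by move=> u v /sub Wu /sub Wv; exact: bC.
  - by move=> c u v w /sub Wu /sub Wv /sub Ww; exact: bL.
  - by move=> u /sub; exact: bp.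
  - by move=> i c u v /sub Wu /sub Wv; exact: eLS.
  - by move=> u [Wu eu] h; apply: null => // -[|i] //=; exact: h.
have [p' Wp' hp'] := ih' l (fun c u v Wu Wv => lL c u v (sub _ Wu) (sub _ Wv)) (fun u Wu => lnull u (sub _ Wu)).
have [hall|/existsNP[v0 /not_implyP[Wv0 ev0]]] := pselect (forall v, W v -> e v = 0).
  by exists p'; [exact: sub|move=> w Ww; apply: hp'; split => //; exact: hall].
have [q Wq hq] := ih' (b v0)
  (fun c u v Wu Wv => etrans (bC _ _ Wv0 (WL c _ _ (sub _ Wu) (sub _ Wv)))
     (etrans (bL c _ _ _ (sub _ Wu) (sub _ Wv) Wv0)
        (f_equal2 +%R (f_equal ( *%R c) (bC _ _ (sub _ Wu) Wv0)) (bC _ _ (sub _ Wv) Wv0))))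
  (fun u Wu hu => etrans (bC _ _ Wv0 (sub _ Wu)) (form_null_ip WL bC bL bp (sub _ Wu) Wv0 hu)).
have WB := form_closedB WL.
have [Wq' eq0] := Wq; have Wp'' := sub _ Wp'.
(* [v1] is [v0] made orthogonal to the kernel of [e]; together with that kernel it spans [W]. *)
pose v1 := v0 - q.
have Wv1 : W v1 by apply: WB => //; exact: sub.
have ev1 : e v1 = e v0.
  by rewrite /v1 -scaleN1r addrC eL0// eq0 mulr0 add0r.
have orth w : W' w -> b v1 w = 0.
  by move=> Ww; rewrite (formBl bL Wv0 (sub _ Wq) (sub _ Ww)) hq// subrr.
have dec w : W w -> exists c w', [/\ W' w' & w = c *: v1 + w'].
  move=> Ww; exists (e w / e v0), (w - (e w / e v0) *: v1); split; last by rewrite addrC subrK.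
  have Wc : W ((e w / e v0) *: v1) by exact: (form_closedZ W0 WL).
  split; first exact: WB.
  rewrite -scaleN1r scalerA addrC eL0// ev1 mulN1r mulNr divfK ?addNr//.
  exact/eqP.
(* If [v1] is a null vector of the form, then [l] vanishes on it by hypothesis and the representer
   on the kernel of [e] already works. *)
have [b0|b0] := eqVneq (b v1 v1) 0.
  exists p' => //.
  move=> w Ww; have [c [w' [Ww' ->]]] := dec w Ww.
  have Ww'' := sub _ Ww'; rewrite lL// (lnull v1)// mulr0 add0r -hp'//.
  rewrite bC//; last exact: WL.
  by rewrite bL// orth// mulr0 add0r bC.
pose c1 := l v1 / b v1 v1.
exists (c1 *: v1 + p'); first exact: WL.
move=> w Ww; have [c [w' [Ww' ->]]] := dec w Ww.
have Ww'' := sub _ Ww'; have Wc : W (c *: v1 + w') by exact: WL.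
have e1 : b v1 (c *: v1 + w') = c * b v1 v1.
  by rewrite bC// bL// [b w' v1]bC// (orth w')// addr0.
have e2 : b p' (c *: v1 + w') = l w'.
  by rewrite bC// bL// (orth p')// mulr0 add0r bC// hp'.
rewrite bL// e1 e2 lL// /c1; congr (_ + _).
by rewrite mulrCA divfK.
Qed.

End finite_riesz.

Section hat_functions.
Context {R : realType} (d : nat) (Omega : set 'rV[R]_d) (T a : R)
  (M : seq (simplex (R := R) d)).
Local Notation E := ('rV[R]_d * R)%type.
Local Notation CT := (cylinder Omega T).
Hypothesis hM : triangulates M CT.
Local Notation nd := (mesh_nondegenerate hM).
Local Notation SHM := (SH Omega T M).
Local Notation hatM := (hat Omega T M).
Implicit Types (v w : E -> R) (z : E) (K : simplex (R := R) d).

Lemma SH_bary v K z : SHM v -> K \in M -> hull K z -> v z = \sum_i bary K z i * v (K i).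
Proof.
move=> [_ h _] KM hK; have [g [c hg]] := h K KM.
rewrite hg// (affine_bary z g c (nd KM)); apply: eq_bigr => i _.
by rewrite -hg//; exact: vertex_hull (nd KM).
Qed.

Lemma SH_nodes_eq0 v : SHM v -> (forall z, z \in nodes M -> v z = 0) -> forall z, v z = 0.
Proof.
move=> hv h z; have [Cz|nC] := pselect (closure CT z); last by case: hv => _ _; apply.
have [K KM hK] := (mesh_cover hM z).1 Cz.
rewrite (SH_bary hv KM hK) big1// => i _; rewrite h ?mulr0//; exact: mem_nodes.
Qed.

Lemma SH_lin c v w : SHM v -> SHM w -> SHM ((c *: (v : E -> R^o) + (w : E -> R^o)) : E -> R).
Proof.
move=> [c1 a1 o1] [c2 a2 o2].
have aff K : K \in M -> exists (g : E) (e : R), forall z, hull K z -> (c *: (v : E -> R^o) + (w : E -> R^o)) z = dotp g z + e.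
  move=> KM; have [g1 [e1 h1]] := a1 K KM; have [g2 [e2 h2]] := a2 K KM.
  exists (c *: g1 + g2), (c * e1 + e2) => z hz.
  by rewrite -[LHS]/(c * v z + w z) h1// h2// dotpDl dotpZl; ring.
split => //; first exact: (affine_pieces_continuous hM aff).
by move=> z nz; rewrite -[LHS]/(c * v z + w z) o1// o2// mulr0 addr0.
Qed.

Lemma SH_pwaff val : SHM (pwaff M val).
Proof.
have aff K : K \in M -> exists (g : E) (e : R), forall z, hull K z -> pwaff M val z = dotp g z + e.
  by move=> KM; do 2 eexists; exact: (pwaff_affine hM val KM).
split => //; first exact: (affine_pieces_continuous hM aff).
by move=> z; exact: (pwaff_out hM).
Qed.

Lemma pwaff_vertex val z : z \in nodes M -> pwaff M val z = val z.
Proof.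
move=> /nodesP[K [i [KM <-]]].
rewrite (pwaffE hM val KM (vertex_hull i (nd KM))) (bigD1 i)//= (bary_vertex i i (nd KM)) eqxx mul1r.
by rewrite big1 ?addr0// => j /negbTE ji; rewrite (bary_vertex i j (nd KM)) ji mul0r.
Qed.

Lemma hat_spec z0 : z0 \in nodes M ->
  [/\ SHM (hatM z0), hatM z0 z0 = 1 & forall z, z \in nodes M -> z != z0 -> hatM z0 z = 0].
Proof.
move=> zN; have := @xgetPex _ (cst 0) [set l | [/\ SHM l, l z0 = 1 &
  forall z, z \in nodes M -> z != z0 -> l z = 0]]; apply.
exists (pwaff M (fun z => (z == z0)%:R)); split; first exact: SH_pwaff.
- by rewrite pwaff_vertex// eqxx.
- by move=> z zM /negbTE e; rewrite pwaff_vertex// e.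
Qed.

Lemma hat_node z0 z : z0 \in nodes M -> z \in nodes M -> hatM z0 z = (z == z0)%:R.
Proof.
move=> zN zM; have [_ h1 h2] := hat_spec zN.
by have [->|ne] := eqVneq z z0; rewrite ?h1 ?h2.
Qed.

Lemma hat_hull z0 K z : z0 \in nodes M -> K \in M -> hull K z ->
  hatM z0 z = \sum_(i | K i == z0) bary K z i.
Proof.
move=> zN KM hK; have [h _ _] := hat_spec zN.
rewrite (SH_bary h KM hK) [RHS]big_mkcond /=; apply: eq_bigr => i _.
by rewrite hat_node ?mem_nodes//; case: ifP => _; rewrite ?mulr1 ?mulr0.
Qed.

Lemma hat_out z0 z : z0 \in nodes M -> ~ closure CT z -> hatM z0 z = 0.
Proof. by move=> zN nC; have [[_ _ h] _ _] := hat_spec zN; exact: h. Qed.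

Lemma hat_ge0 z0 z : z0 \in nodes M -> 0 <= hatM z0 z.
Proof.
move=> zN; have [Cz|nC] := pselect (closure CT z); last by rewrite hat_out.
have [K KM hK] := (mesh_cover hM z).1 Cz.
by rewrite (hat_hull zN KM hK) sumr_ge0// => i _; exact: ((hullP z (nd KM)).1 hK).
Qed.

Lemma hat_le1 z0 z : z0 \in nodes M -> hatM z0 z <= 1.
Proof.
move=> zN; have [Cz|nC] := pselect (closure CT z); last by rewrite hat_out.
have [K KM hK] := (mesh_cover hM z).1 Cz.
have b0 := (hullP z (nd KM)).1 hK; have [<- _] := sum_bary z (nd KM).
rewrite (hat_hull zN KM hK) big_mkcond /=; apply: ler_sum => i _.
by case: ifP.
Qed.

Lemma hat_neq0_hull z0 z : z0 \in nodes M -> hatM z0 z != 0 ->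
  exists K i, [/\ K \in M, hull K z, K i = z0 & 0 < bary K z i].
Proof.
move=> zN hz.
have Cz : closure CT z.
  by apply: contrapT => nC; move/eqP: hz; apply; exact: hat_out.
have [K KM hK] := (mesh_cover hM z).1 Cz.
have b0 := (hullP z (nd KM)).1 hK.
move: hz; rewrite (hat_hull zN KM hK) => hz.
have [/existsP[i /andP[/eqP Ki i0]]|/existsPn h] := boolP [exists i, (K i == z0) && (0 < bary K z i)].
  by exists K, i.
exfalso; move/eqP: hz; apply; apply: big1 => i /eqP Ki; apply/eqP.
by rewrite eq_le b0 andbT leNgt; have := h i; rewrite Ki eqxx.
Qed.

End hat_functions.

(** * Smooth quasi-interpolation *)

Section quasi_interpolation.
Context {R : realType} (d : nat).
Local Notation E := ('rV[R]_d * R)%type.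
Implicit Types (z w : E).

Definition bsp z : R^o := \prod_(i < d.+1) bspline (crd i z).

Lemma csmooth_bsp : csmooth bsp.
Proof.
apply: csmooth_prod => i.
have := @csmooth_crd_comp R d bspline i 1 0 csmooth_bspline.
by congr csmooth; apply/funext => z; rewrite mul1r addr0.
Qed.

Lemma bsp_eq0 z : 2 <= `|z| -> bsp z = 0.
Proof.
move=> h; have [/forallP hz|/forallPn[i hi]] := boolP [forall i, `|crd i z| < 2].
  have : `|z| < 2 by apply/normE_lt.
  by rewrite ltNge h.
by rewrite /bsp (bigD1 i)//= bspline_eq0 ?mul0r// leNgt.
Qed.

Lemma bsp_supp z : closure [set w | bsp w != 0] z -> `|z| <= 2.
Proof.
move=> h.
have cl : closed [set w : E | `|w| <= 2].
  by apply: (@closed_comp E R Num.norm [set r | r <= 2]) => [w _|]; [exact: norm_continuous|exact: closed_le].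
have sub : [set w | bsp w != 0] `<=` [set w : E | `|w| <= 2].
  by move=> w /= hw; rewrite leNgt; apply/negP => /ltW /bsp_eq0 e0; rewrite e0 eqxx in hw.
by have := closureS sub h; rewrite -(closure_id _).1.
Qed.

Lemma derive_bsp_eq0 z v : 2 < `|z| -> 'D_v bsp z = 0.
Proof.
move=> h; have [] := @derive_eq0_out R d bsp v z _ => //.
by move=> /bsp_supp; rewrite leNgt h.
Qed.

(** Indicator of a ball containing the support of [bsp]. Bounding [bsp] and its derivatives by
    multiples of it reduces sums over the grid to counting cells. *)
Definition near0 z : R := if `|z| <= 2 then 1 else 0.

Lemma bsp_bounded : exists2 C : R, 0 <= C & forall z,
  `|bsp z| <= C * near0 z /\ forall i, `|'D_(ebas i) bsp z| <= C * near0 z.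
Proof.
have b0 : bsupp bsp by exists 2 => z /ltW; exact: bsp_eq0.
have s := csmooth_bsp.
have [C0 C00 h0] := bsupp_bounded (csmooth_continuous s) b0.
have /choice[C hC] : forall i : 'I_d.+1, exists C : R, 0 <= C /\ forall z, `|'D_(ebas i) bsp z| <= C.
  move=> i; have [C c0 hC] := bsupp_bounded (csmooth_continuous (csmooth_derive (ebas i) s)) (bsupp_derive (ebas i) b0).
  by exists C.
have S0 : 0 <= \sum_i C i by apply: sumr_ge0 => i _; case: (hC i).
exists (C0 + \sum_i C i); first exact: addr_ge0.
move=> z; rewrite /near0; case: (leP `|z| 2) => hz; rewrite ?mulr1 ?mulr0.
  split; first by apply: le_trans (h0 z) _; rewrite lerDl.
  move=> i; apply: le_trans ((hC i).2 z) _.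
  by rewrite (bigD1 i)//= addrCA lerDl addr_ge0// sumr_ge0// => j _; case: (hC j).
split; first by rewrite bsp_eq0 ?normr0// ltW.
by move=> i; rewrite derive_bsp_eq0// normr0.
Qed.

Section scale.
Variables (e : R) (m n : nat).
Hypothesis e0 : 0 < e.
Local Notation idx := {ffun 'I_d.+1 -> 'I_n}.
Implicit Types (k : idx).

(** Cells are indexed by natural numbers below [n] in each coordinate; the shift by [m] centres the
    finite grid of step [e] at the origin. *)
Definition cell_shift k : E := uncons_rV (\row_i (m%:R - (k i)%:R)).
Definition cell_point k : E := - e *: cell_shift k.
Definition cell_loc z k : E := e^-1 *: z + cell_shift k.
Definition scaled z i : R := e^-1 * crd i z + m%:R.

Lemma crd_cell_loc z k i : crd i (cell_loc z k) = scaled z i - (k i)%:R.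
Proof. by rewrite crdD crdZ crd_uncons mxE addrA. Qed.

Lemma dist_cell_point z k : `|z - cell_point k| = e * `|cell_loc z k|.
Proof.
have -> : z - cell_point k = e *: cell_loc z k.
  by rewrite /cell_loc /cell_point scalerDr scalerA divff ?gt_eqF// scale1r scaleNr opprK.
by rewrite normrZ gtr0_norm.
Qed.

Lemma near_cell_point z k : `|cell_loc z k| <= 2 -> `|cell_point k - z| <= 2 * e.
Proof. by move=> h; rewrite distrC dist_cell_point mulrC ler_wpM2r// ltW. Qed.

(** In each coordinate at most five indices lie within distance 2 of the point. *)
Lemma cell_count z : \sum_k (near0 (cell_loc z k)) <= 5 ^+ d.+1.
Proof.
apply: (@le_trans _ _ (\prod_(i < d.+1) \sum_(j < n) (if `|scaled z i - j%:R| <= 2 then 1 else 0))).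
  rewrite bigA_distr_bigA /=; apply: ler_sum => k _.
  rewrite /near0; case: (leP `|cell_loc z k| 2) => h; last by apply: prodr_ge0 => i _; case: ifP.
  rewrite big1// => i _; rewrite -crd_cell_loc (le_trans (crd_le_norm _ _) h)//.
rewrite -[X in _ ^+ X](card_ord d.+1) -prodr_const; apply: ler_prod => i _.
by rewrite count_near_nat andbT; apply: sumr_ge0 => j _; case: ifP.
Qed.

Definition valid z := forall i, 1 <= scaled z i <= n%:R - 2.

Lemma sum_bsp z : valid z -> \sum_k bsp (cell_loc z k) = 1.
Proof.
move=> vz; under eq_bigr do rewrite /bsp; under eq_bigr do under eq_bigr do rewrite crd_cell_loc.
rewrite -(bigA_distr_bigA (fun i j => bspline (scaled z i - (j : 'I_n)%:R))) /= big1// => i _.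
by have /andP[h1 h2] := vz i; exact: sum_bspline.
Qed.

Lemma sum_nat_bsp z i : valid z -> \sum_(k : idx) (k i)%:R * bsp (cell_loc z k) = scaled z i.
Proof.
move=> vz.
have -> : \sum_(k : idx) (k i)%:R * bsp (cell_loc z k) =
    \sum_(k : idx) \prod_j ((if j == i then (k j)%:R else 1) * bspline (scaled z j - (k j)%:R)).
  apply: eq_bigr => k _; rewrite big_split /=; congr (_ * _).
    by rewrite (bigD1 i)//= eqxx big1 ?mulr1// => j /negbTE ->.
  by apply: eq_bigr => j _; rewrite crd_cell_loc.
rewrite -(bigA_distr_bigA (fun j l => (if j == i then (l : 'I_n)%:R else 1) * bspline (scaled z j - l%:R))) /=.
rewrite (bigD1 i)//= eqxx [X in _ * X]big1 ?mulr1.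
  by have /andP[h1 h2] := vz i; exact: sum_nat_bspline.
move=> j /negbTE ji; under eq_bigr do rewrite ji mul1r.
by have /andP[h1 h2] := vz j; exact: sum_bspline.
Qed.

Lemma sum_affine_bsp z g c : valid z ->
  \sum_k (dotp g (cell_point k) + c) * bsp (cell_loc z k) = dotp g z + c.
Proof.
move=> vz; under eq_bigr do rewrite mulrDl.
rewrite big_split /= -mulr_sumr sum_bsp// mulr1; congr (_ + _).
have -> : \sum_k dotp g (cell_point k) * bsp (cell_loc z k) =
   \sum_i crd i g * \sum_k crd i (cell_point k) * bsp (cell_loc z k).
  under eq_bigr do rewrite dotpE mulr_suml.
  by rewrite exchange_big /=; apply: eq_bigr => i _; rewrite mulr_sumr; apply: eq_bigr => k _; rewrite mulrA.
rewrite dotpE; apply: eq_bigr => i _; congr (_ * _).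
have -> : \sum_k crd i (cell_point k) * bsp (cell_loc z k) =
   e * (\sum_(k : idx) (k i)%:R * bsp (cell_loc z k) - m%:R * \sum_k bsp (cell_loc z k)).
  rewrite !mulr_sumr -sumrB mulr_sumr; apply: eq_bigr => k _.
  by rewrite crdZ crd_uncons mxE; ring.
by rewrite sum_nat_bsp// sum_bsp// mulr1 /scaled addrK mulrA divff ?gt_eqF// mul1r.
Qed.

Definition qi (F : E -> R) z : R^o := \sum_k F (cell_point k) * bsp (cell_loc z k).

Lemma csmooth_cell k : csmooth (fun z => bsp (cell_loc z k)).
Proof.
apply: (@csmooth_comp_affine R E E bsp (fun z => cell_loc z k) (fun v => e^-1 *: v)).
- move=> z v h; rewrite /cell_loc scalerDr addrAC; congr (_ + _).
  by rewrite !scalerA mulrC.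
- move=> z; apply: differentiableD => //; exact: differentiableZ.
- exact: csmooth_bsp.
Qed.

Lemma derive_cell k z i : 'D_(ebas i) (fun z => bsp (cell_loc z k) : R^o) z = e^-1 * 'D_(ebas i) bsp (cell_loc z k).
Proof.
rewrite (@derive_comp_affine R E E bsp (fun z => cell_loc z k) (fun v => e^-1 *: v)); last first.
  by move=> w v h; rewrite /cell_loc scalerDr addrAC; congr (_ + _); rewrite !scalerA mulrC.
rewrite !(derive_dotp _ (csmooth_differentiable _ csmooth_bsp)).
by rewrite dotpC dotpZl dotpC.
Qed.

Lemma csmooth_qi F : csmooth (qi F).
Proof.
by apply: csmooth_sum => k; apply: csmoothZ; exact: csmooth_cell.
Qed.

Lemma derive_qi F z i : 'D_(ebas i) (qi F) z =
  \sum_k F (cell_point k) * (e^-1 * 'D_(ebas i) bsp (cell_loc z k)).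
Proof.
have dk k : is_derive z (ebas i) (fun z => F (cell_point k) * bsp (cell_loc z k) : R^o)
    (F (cell_point k) * (e^-1 * 'D_(ebas i) bsp (cell_loc z k))).
  rewrite -derive_cell.
  apply: is_deriveZ; apply: DeriveDef => //; apply: csmooth_derivable; exact: csmooth_cell.
suff : is_derive z (ebas i) (qi F) (\sum_k F (cell_point k) * (e^-1 * 'D_(ebas i) bsp (cell_loc z k))).
  by move=> h; rewrite derive_val.
rewrite /qi; elim: (index_enum _) => [|k s ih].
  rewrite big_nil (_ : (fun z => _) = cst 0); first exact: is_derive_cst.
  by apply/funext => w; rewrite big_nil.
rewrite big_cons (_ : (fun z => _) = (fun z => F (cell_point k) * bsp (cell_loc z k)) \+
   (fun z => \sum_(k <- s) F (cell_point k) * bsp (cell_loc z k))); first exact: is_deriveD.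
by apply/funext => w; rewrite big_cons.
Qed.

Lemma cell_sum_le z (f G : idx -> R) A B : 0 <= A -> 0 <= B ->
  (forall k, `|cell_loc z k| <= 2 -> `|f k| <= A) ->
  (forall k, `|G k| <= B * near0 (cell_loc z k)) ->
  `|\sum_k f k * G k| <= A * B * 5 ^+ d.+1.
Proof.
move=> A0 B0 hf hG; apply: le_trans (ler_norm_sum _ _ _) _.
apply: (@le_trans _ _ (\sum_k A * B * near0 (cell_loc z k))); last first.
  by rewrite -mulr_sumr; apply: ler_wpM2l; [exact: mulr_ge0|exact: cell_count].
apply: ler_sum => k _; rewrite normrM -mulrA.
have := hG k; rewrite /near0; case: (leP `|cell_loc z k| 2) => h hk.
  by apply: ler_pM => //; [exact: hf].
have : `|G k| <= 0 by apply: le_trans hk _; rewrite mulr0.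
by rewrite normr_le0 => /eqP ->; rewrite normr0 !mulr0.
Qed.

Lemma derive_cell_sum_le F L z i C : 0 <= C ->
  (forall w, `|'D_(ebas i) bsp w| <= C * near0 w) -> 0 <= L ->
  (forall k, `|cell_loc z k| <= 2 -> `|F (cell_point k)| <= L * e) ->
  `|'D_(ebas i) (qi F) z| <= L * C * 5 ^+ d.+1.
Proof.
move=> C0 hC L0 hF; rewrite derive_qi.
have -> : L * C = (L * e) * (e^-1 * C) by rewrite -mulrA [e * _]mulrA divff ?gt_eqF// mul1r.
apply: (cell_sum_le (z := z)) => //.
- by rewrite mulr_ge0// ltW.
- by rewrite mulr_ge0// invr_ge0 ltW.
- move=> k; rewrite normrM -mulrA gtr0_norm ?invr_gt0//.
  by apply: ler_wpM2l; [rewrite invr_ge0 ltW|exact: hC].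
Qed.

Variable rho : R.
Hypotheses (hm : rho / e + 2 <= m%:R) (hn : n = m.*2).

(** The margin 2 in [hm] and the choice of [n] as twice [m] place the rescaled coordinates between 2
    and n - 2, inside the range where the translates of the B-spline reproduce affine functions. *)
Lemma valid_norm z : `|z| <= rho -> valid z.
Proof.
move=> hz i; have hi := le_trans (crd_le_norm z i) hz.
have e1 : 0 < e^-1 by rewrite invr_gt0.
have h : `|e^-1 * crd i z| <= rho / e.
  by rewrite normrM gtr0_norm// mulrC ler_wpM2r// ltW.
move: h hm; rewrite ler_norml /scaled hn -mul2n natrM.
move: (e^-1 * crd i z) (rho / e) => x y /andP[h1 h2] h3; apply/andP; split; lra.
Qed.

Lemma is_derive_crd j z v : is_derive z v (crd j : E -> R^o) (crd j v).
Proof.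
have dz := crd_differentiable j z.
apply: DeriveDef; first exact: diff_derivable.
rewrite deriveE//; have -> : 'd (crd j : E -> R^o) z = crd j :> (E -> R^o); last by [].
apply: (@diff_lin R E R^o (crd j : {linear E -> R^o})); exact: crd_continuous.
Qed.

Lemma derive_qi_affine g c z i : `|z| < rho -> 'D_(ebas i) (qi (fun w => dotp g w + c)) z = crd i g.
Proof.
move=> hz.
have da : is_derive z (ebas i) (fun w => dotp g w + c : R^o) (crd i g).
  rewrite -[X in is_derive _ _ _ X]addr0; apply: is_deriveD.
  rewrite (_ : dotp g = (fun w => \sum_j crd j g * crd j w)); last by apply/funext => w; rewrite dotpE.
  suff : is_derive z (ebas i) (fun w => \sum_(j <- index_enum _) crd j g * crd j w : R^o) (\sum_(j <- index_enum _) crd j g * crd j (ebas i)).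
    congr is_derive; rewrite (bigD1 i)//= crd_ebas eqxx mulr1 big1 ?addr0// => j /negbTE ji.
    by rewrite crd_ebas ji mulr0.
  elim: (index_enum _) => [|j s ih].
    by rewrite big_nil (_ : (fun z => _) = cst 0); [exact: is_derive_cst|apply/funext => w; rewrite big_nil].
  rewrite big_cons (_ : (fun z => _) = (fun w => crd j g * crd j w) \+ (fun w => \sum_(j <- s) crd j g * crd j w)).
    apply: is_deriveD; apply: is_deriveZ.
    exact: is_derive_crd.
  by apply/funext => w; rewrite big_cons.
have : is_derive z (ebas i) (qi (fun w => dotp g w + c)) (crd i g).
  apply: (near_eq_is_derive _ da).
  have [e1 e10 he1] : exists2 e1 : R, 0 < e1 & forall w, `|z - w| < e1 -> `|w| <= rho.
    exists (rho - `|z|); first by rewrite subr_gt0.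
    move=> w hw; rewrite -(subKr z w); apply: le_trans (ler_normB _ _) _; lra.
  apply/nbhs_ballP; exists e1 => //= w; rewrite -ball_normE /= => hw.
  by rewrite /qi sum_affine_bsp//; exact: valid_norm (he1 _ hw).
by move=> h; rewrite derive_val.
Qed.

Lemma derive_qi_local F g c z i : `|z| < rho -> (forall w, `|w - z| <= 2 * e -> F w = dotp g w + c) ->
  'D_(ebas i) (qi F) z = crd i g.
Proof.
move=> hz h; rewrite -(derive_qi_affine g c i hz) !derive_qi; apply: eq_bigr => k _.
have [hk|hk] := leP `|cell_loc z k| 2; first by rewrite h//; exact: near_cell_point.
by rewrite derive_bsp_eq0// !mulr0.
Qed.

(** Constants are reproduced, so F z may be subtracted without changing the derivative; the values
    that contribute are then at most 2 L e, which compensates the factor 1/e of the differentiated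
    cells. *)
Lemma derive_qi_le F L z i C : 0 <= C -> 0 <= L ->
  (forall w, `|'D_(ebas i) bsp w| <= C * near0 w) ->
  (forall w, `|F w - F z| <= L * `|w - z|) -> `|z| < rho ->
  `|'D_(ebas i) (qi F) z| <= 2 * L * C * 5 ^+ d.+1.
Proof.
move=> C0 L0 hC hF hz.
have -> : 'D_(ebas i) (qi F) z = 'D_(ebas i) (qi (fun w => F w - F z)) z.
  have := derive_qi_affine 0 (F z) i hz; rewrite !derive_qi => h0.
  have e00 w : dotp 0 w + F z = F z :> R by rewrite -{1}(scale0r (0 : E)) dotpZl mul0r add0r.
  under eq_bigr do rewrite -[X in X * _](subrK (F z)) mulrDl.
  rewrite big_split /= -[RHS]addr0; congr (_ + _).
  under eq_bigr => k _ do rewrite -(e00 (cell_point k)).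
  by rewrite h0 -(scale0r (0 : E)) crdZ mul0r.
apply: derive_cell_sum_le => //; first exact: mulr_ge0.
move=> k /near_cell_point hk; apply: le_trans (hF _) _.
by rewrite [2 * L]mulrC -mulrA; apply: ler_wpM2l.
Qed.

Lemma qi_dist F L z C : 0 <= C -> 0 <= L -> (forall w, `|bsp w| <= C * near0 w) ->
  (forall w, `|F w - F z| <= L * `|w - z|) -> `|z| <= rho ->
  `|qi F z - F z| <= L * (2 * e) * C * 5 ^+ d.+1.
Proof.
move=> C0 L0 hC hF hz.
have -> : qi F z - F z = \sum_k (F (cell_point k) - F z) * bsp (cell_loc z k).
  under [in RHS]eq_bigr do rewrite mulrBl.
  by rewrite sumrB -mulr_sumr sum_bsp ?mulr1//; exact: valid_norm.
apply: cell_sum_le => //; first by rewrite !mulr_ge0// ltW.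
by move=> k /near_cell_point hk; apply: le_trans (hF _) _; exact: ler_wpM2l.
Qed.

Lemma qi_eq0 F z : (forall w, `|w - z| <= 2 * e -> F w = 0) -> qi F z = 0.
Proof.
move=> h; rewrite /qi big1// => k _.
have [hk|hk] := leP `|cell_loc z k| 2; first by rewrite h ?mul0r//; exact: near_cell_point.
by rewrite bsp_eq0 ?mulr0// ltW.
Qed.

End scale.

(** The derivative bound [C * L] does not depend on the step [e], as dominated convergence requires.
    The radius [rho] is the range covered by the finite grid. *)
Lemma quasi_interpolation : exists2 C : R, 0 <= C & forall (F : E -> R) (L rho e : R),
  0 < e -> 0 < rho -> 0 <= L -> (forall z w, `|F w - F z| <= L * `|w - z|) ->
  exists phi : E -> R^o, [/\ csmooth phi,
   forall z, (forall w, `|w - z| <= 2 * e -> F w = 0) -> phi z = 0,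
   forall z, `|z| < rho -> `|phi z - F z| <= C * L * e,
   forall z i, `|z| < rho -> `|'D_(ebas i) phi z| <= C * L &
   forall z g c, `|z| < rho -> (forall w, `|w - z| <= 2 * e -> F w = dotp g w + c) ->
     forall i, 'D_(ebas i) phi z = crd i g].
Proof.
have [C C0 hC] := bsp_bounded.
have c50 : 0 <= 5 ^+ d.+1 :> R by rewrite exprn_ge0.
exists (2 * C * 5 ^+ d.+1); first by rewrite !mulr_ge0.
move=> F L rho e e0 rho0 L0 hF.
pose m := (Num.truncn (rho / e + 2)).+1.
have hm : rho / e + 2 <= m%:R by exact: ltW (truncnS_gt _).
exists (qi e m m.*2 F); split.
- exact: csmooth_qi.
- by move=> z; exact: qi_eq0.
- move=> z hz; apply: le_trans (qi_dist e0 hm (erefl _) C0 L0 (fun w => (hC w).1) (hF z) (ltW hz)) _.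
  by rewrite le_eqVlt; apply/orP; left; apply/eqP; ring.
- move=> z i hz; apply: le_trans (derive_qi_le e0 hm (erefl _) C0 L0 (fun w => (hC w).2 i) (hF z) hz) _.
  by rewrite le_eqVlt; apply/orP; left; apply/eqP; ring.
- by move=> z g c hz h i; exact: (derive_qi_local e0 hm (erefl _) i hz h).
Qed.

End quasi_interpolation.

(** * Translations of the trace *)

Section translation_estimate.
Context {R : realType} (d : nat) (Omega : set 'rV[R]_d) (T a : R).
Hypotheses (oO : open Omega) (bO : bounded_set Omega) (T0 : 0 < T) (ha : -1 < a < 1).
Local Notation E := ('rV[R]_d * R)%type.
Local Notation Em := ('rV[R]_d * measurableTypeR R)%type.
Local Notation CT := (cylinder Omega T).
Local Notation nu := (vol d).
Local Notation leb1 := (@lebesgue_measure R).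
Local Notation wt := (@wt R d a).
Local Notation mCT := (measurable_cylinder T oO).
Local Notation oCT := (@cylinder_open R d Omega T oO).
Implicit Types (phi : E -> R^o) (z v w : E).

Lemma continuous_line z v : continuous (fun s : R => z + s *: v : E).
Proof.
by move=> s; apply: cvgD; [exact: cvg_cst|apply: cvgZr_tmp; exact: cvg_id].
Qed.

Lemma first_exit (D : set E) z v : open D -> D z -> ~ D (z + v) ->
  exists s : R, [/\ 0 < s <= 1, ~ D (z + s *: v) & forall r, 0 <= r < s -> D (z + r *: v)].
Proof.
move=> oD Dz nDv.
pose S := [set s : R | 0 <= s /\ ~ D (z + s *: v)].
have hS : has_inf S.
  by split; [exists 1; split => //; rewrite scale1r|exists 0 => s []].
have lbS s : S s -> inf S <= s by move=> Ss; apply: ge_inf => //; exact: hS.2.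
have inf0 : 0 <= inf S by apply: lb_le_inf hS.1 _ => s [].
have oA : open [set s : R | D (z + s *: v)].
  by apply: (@open_comp R E (fun s => z + s *: v) D) => // s _; exact: continuous_line.
have nDi : ~ D (z + inf S *: v).
  move=> Di.
  have : nbhs (inf S) [set s : R | D (z + s *: v)] by exact: open_nbhs_nbhs.
  move=> /nbhs_ballP[e /= e0 he].
  have [s Ss sl] := inf_adherent e0 hS.
  have := lbS _ Ss => ls; case: Ss => _; apply; apply: he.
  by rewrite /ball /= ler0_norm ?subr_le0//; lra.
exists (inf S); split => //.
  rewrite lt_neqAle inf0 andbT; apply/andP; split.
    by apply/eqP => e; apply: nDi; rewrite -e scale0r addr0.
  by apply: lbS; split => //; rewrite scale1r.
move=> r /andP[r0 rs]; apply: contrapT => nr.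
by have := lbS r (conj r0 nr); rewrite leNgt rs.
Qed.

(** The segment is horizontal, so its height stays strictly between 0 and T and it can leave the
    cylinder only through the wall over the boundary of the base. *)
Lemma exit_lateral z v (s : R) : 0 < z.2 < T -> v.2 = 0 -> 0 < s ->
  ~ CT (z + s *: v) -> (forall r, 0 <= r < s -> CT (z + r *: v)) ->
  lateral_boundary Omega T (z + s *: v).
Proof.
move=> /andP[z0 zT] v0 s0 nC h.
have e2 r : (z + r *: v).2 = z.2 by rewrite /= v0 scaler0 addr0.
left; rewrite e2; split; last by rewrite !ltW.
split; last by move=> Oz; apply: nC; split => //; rewrite e2 z0 zT.
move=> B hB.
have cl : {for s, continuous (fun r : R => (z + r *: v).1)}.
  by apply: (@continuous_comp _ _ _ (fun r : R => z + r *: v) fst); [exact: continuous_line|exact: cvg_fst].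
have /nbhs_ballP[e /= e0 he] := cl _ hB.
pose r := Num.max 0 (s - e / 2).
have rs : 0 <= r < s by rewrite /r le_max lexx /= gt_max s0 /=; lra.
have [Or _] := h _ rs.
exists (z + r *: v).1; split => //.
apply: (he r); rewrite /ball /= ger0_norm ?subr_ge0; last by case/andP: rs => _ /ltW.
have : s - e / 2 <= r by rewrite /r le_max lexx orbT.
lra.
Qed.

Definition seg_energy phi v z : \bar R :=
  (\int[leb1]_(s in `]0%R, 1%R[) (\1_CT (z + s *: v) * ('D_v phi (z + s *: v)) ^+ 2)%:E)%E.

Lemma measurable_seg phi v z : csmooth phi -> measurable_fun [set: measurableTypeR R]
  (fun s : measurableTypeR R => (\1_CT (z + s *: v) * ('D_v phi (z + s *: v)) ^+ 2)%:E).
Proof.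
move=> sm; apply/measurable_EFinP; apply: measurable_funM.
  have oA : open [set s : R | CT (z + s *: v)].
    by apply: (@open_comp R E (fun s => z + s *: v) CT) => [s _|]; [exact: continuous_line|exact: oCT].
  rewrite (_ : (fun s : measurableTypeR R => _) = \1_[set s : R | CT (z + s *: v)]).
    by apply: measurable_indic; exact: open_measurable.
  by apply/funext => s; rewrite !indicE; congr (_%:R); congr nat_of_bool; apply/idP/idP => /set_mem h; apply/mem_set.
apply: measurable_funX; apply: continuous_measurable_fun => s.
apply: (@continuous_comp _ _ _ (fun s : R => z + s *: v) ('D_v phi)); first exact: continuous_line.
exact: csmooth_continuous (csmooth_derive _ sm) _.
Qed.

Lemma ftc_segment phi z v t1 t2 : csmooth phi -> 0 <= t1 < t2 -> t2 <= 1 ->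
  (forall s, t1 < s < t2 -> CT (z + s *: v)) ->
  (((phi (z + t2 *: v) - phi (z + t1 *: v)) ^+ 2)%:E <= seg_energy phi v z)%E.
Proof.
move=> sm /andP[t10 t12] t21 hC.
have cth : continuous (fun s : R => 'D_v phi (z + s *: v) : R^o).
  move=> s; apply: (@continuous_comp _ _ _ (fun s : R => z + s *: v) ('D_v phi)); first exact: continuous_line.
  exact: csmooth_continuous (csmooth_derive _ sm) _.
have h01 : -1 < (0 : R) < 1 by rewrite ltr01 ltrN10.
apply: le_trans (ftc_sqr_le h01 t10 t12 t21 (fun s => derive_line z v s sm) cth) _.
rewrite subr0 powR1 divr1 mul1e /seg_energy.
apply: (@le_trans _ _ (\int[leb1]_(s in `]t1, t2[) (\1_CT (z + s *: v) * ('D_v phi (z + s *: v)) ^+ 2)%:E)%E).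
  rewrite le_eqVlt; apply/orP; left; apply/eqP; apply: eq_integral => s.
  rewrite inE /= in_itv /= => hs; rewrite powRr0 mulr1 indicE mem_set ?mul1r//; exact: hC.
apply: ge0_subset_integral => //.
- by apply: measurable_funTS; exact: measurable_seg.
- by move=> s _; rewrite lee_fin mulr_ge0 ?sqr_ge0// indicE ler0n.
- move=> s /=; rewrite !in_itv /= => /andP[h1 h2].
  by rewrite (le_lt_trans t10 h1) (lt_le_trans h2 t21).
Qed.

Definition cut phi z : R := \1_CT z * phi z.

Lemma cut_in phi z : CT z -> cut phi z = phi z.
Proof. by move=> Cz; rewrite /cut indicE mem_set// mul1r. Qed.
Lemma cut_out phi z : ~ CT z -> cut phi z = 0.
Proof. by move=> Cz; rewrite /cut indicE memNset// mul0r. Qed.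

(** Omega need not be convex. If the segment leaves the cylinder, then each end value is either cut
    to 0 or bounded by the energy up to the first exit, seen from that end, where [phi] vanishes;
    the square of a difference then costs the factor 4. *)
Lemma segment_difference phi z v : csmooth phi -> (forall w, lateral_boundary Omega T w -> phi w = 0) ->
  0 < z.2 < T -> v.2 = 0 ->
  (((cut phi (z + v) - cut phi z) ^+ 2)%:E <= 4%:E * seg_energy phi v z)%E.
Proof.
move=> sm h0 hz v0.
have S0 : (0 <= seg_energy phi v z)%E.
  by apply: integral_ge0 => s _; rewrite lee_fin mulr_ge0 ?sqr_ge0// indicE ler0n.
have le14 (x : R) : (((x) ^+ 2)%:E <= seg_energy phi v z)%E -> (((x) ^+ 2)%:E <= 4%:E * seg_energy phi v z)%E.
  move=> h; apply: le_trans h _; rewrite -[X in (X <= _)%E]mul1e; apply: lee_wpmul2r => //.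
  by rewrite lee_fin; lra.
have start : CT z -> (exists2 s, 0 <= s <= 1 & ~ CT (z + s *: v)) -> ((phi z ^+ 2)%:E <= seg_energy phi v z)%E.
  move=> Cz [s0 /andP[s00 s01] ns].
  have [r [/andP[r0 r1] nr hr]] := first_exit oCT Cz ns.
  have e q : z + q *: (s0 *: v) = z + (q * s0) *: v by rewrite scalerA.
  have s0p : 0 < s0.
    by rewrite lt_neqAle s00 andbT; apply/eqP => h; apply: ns; rewrite -h scale0r addr0.
  have rs0 : 0 < r * s0 by exact: mulr_gt0.
  have hC q : 0 <= q < r * s0 -> CT (z + q *: v).
    move=> /andP[q0 qr]; have := hr (q / s0); rewrite e divfK ?gt_eqF//; apply.
    by apply/andP; split; [rewrite divr_ge0// ltW|rewrite ltr_pdivrMr].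
  rewrite e in nr.
  have l0 := h0 _ (exit_lateral hz v0 rs0 nr hC).
  have := @ftc_segment phi z v 0 (r * s0) sm.
  rewrite l0 scale0r addr0 sub0r sqrrN; apply.
  - by rewrite lexx.
  - by rewrite -[1]mulr1; apply: ler_pM => //; exact: ltW.
  - by move=> q /andP[q0 qr]; apply: hC; rewrite (ltW q0).
have finish : CT (z + v) -> (exists2 s, 0 <= s <= 1 & ~ CT (z + s *: v)) -> ((phi (z + v) ^+ 2)%:E <= seg_energy phi v z)%E.
  move=> Cz [s0 /andP[s00 s01] ns].
  have ns' : ~ CT ((z + v) + (1 - s0) *: (- v)).
    rewrite (_ : _ + _ = z + s0 *: v)//.
    by rewrite scalerN scalerBl scale1r opprB addrA addrAC addrK.
  have hz' : 0 < (z + v).2 < T by rewrite /= v0 addr0.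
  have v0' : (- v).2 = 0 by rewrite /= v0 oppr0.
  have [r [/andP[r0 r1] nr hr]] := first_exit oCT Cz ns'.
  have e q : (z + v) + q *: ((1 - s0) *: - v) = z + (1 - q * (1 - s0)) *: v.
    by rewrite scalerA scalerN scalerBl scale1r -addrA.
  have s0p : 0 < 1 - s0.
    rewrite lt_neqAle subr_ge0 s01 andbT; apply/eqP => h; apply: ns'.
    by rewrite -h scale0r addr0.
  have rs0 : 0 < r * (1 - s0) by exact: mulr_gt0.
  have rs1 : r * (1 - s0) <= 1.
    by apply: le_trans (ler_piMl (ltW s0p) r1) _; lra.
  have hC q : 1 - r * (1 - s0) < q <= 1 -> CT (z + q *: v).
    move=> /andP[q0 qr]; have := hr ((1 - q) / (1 - s0)); rewrite e divfK ?gt_eqF// subKr; apply.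
    by apply/andP; split; [rewrite divr_ge0 ?subr_ge0 ?(ltW s0p)|rewrite ltr_pdivrMr//; lra].
  have hC' q : 0 <= q < r * (1 - s0) -> CT ((z + v) + q *: (- v)).
    move=> /andP[q0 qr]; rewrite scalerN -addrA -[X in X - _]scale1r -scalerBl; apply: hC; lra.
  have nr' : ~ CT ((z + v) + (r * (1 - s0)) *: - v) by move: nr; rewrite scalerA.
  have l0 := h0 _ (exit_lateral hz' v0' rs0 nr' hC').
  have := @ftc_segment phi z v (1 - r * (1 - s0)) 1 sm.
  rewrite -e scalerA l0 scale1r subr0; apply => //.
  - by rewrite subr_ge0 rs1 /=; lra.
  - by move=> q /andP[q0 qr]; apply: hC; rewrite q0 (ltW qr).
have [|nall] := pselect (forall s, 0 <= s <= 1 -> CT (z + s *: v)).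
  move=> hall; apply: le14.
  have C0 : CT z by have := hall 0; rewrite scale0r addr0; apply; rewrite lexx ler01.
  have C1 : CT (z + v) by have := hall 1; rewrite scale1r; apply; rewrite lexx ler01.
  rewrite !cut_in//; have := @ftc_segment phi z v 0 1 sm.
  rewrite scale0r scale1r addr0; apply => //; first by rewrite lexx ltr01.
  by move=> s /andP[s0 s1]; apply: hall; rewrite !ltW.
have hex : exists2 s, 0 <= s <= 1 & ~ CT (z + s *: v).
  by apply: contrapT => hn; apply: nall => s hs; apply: contrapT => ns; apply: hn; exists s.
have hA : ((cut phi z ^+ 2)%:E <= seg_energy phi v z)%E.
  have [Cz|nC] := pselect (CT z); first by rewrite cut_in//; exact: start.
  by rewrite cut_out// expr0n.
have hB : ((cut phi (z + v) ^+ 2)%:E <= seg_energy phi v z)%E.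
  have [Cz|nC] := pselect (CT (z + v)); first by rewrite cut_in//; exact: finish.
  by rewrite cut_out// expr0n.
apply: (@le_trans _ _ (2 * (cut phi (z + v) ^+ 2) + 2 * (cut phi z ^+ 2))%:E).
  by rewrite lee_fin; have := sqr_ge0 (cut phi (z + v) + cut phi z); nra.
rewrite (_ : 4%:E = 2%:E + 2%:E :> \bar R)%E; last by rewrite -EFinD; congr (_%:E); ring.
rewrite ge0_muleDl// EFinD; apply: leeD; rewrite EFinM; exact: lee_wpmul2l.
Qed.

Local Notation vip := (vip Omega T a).

Definition strip (q : R) : set E := [set z | 0 < z.2 < q].

Lemma measurable_strip q : @measurable _ Em (strip q).
Proof.
rewrite (_ : strip q = snd @^-1` (`]0, q[ : set R)).
  by rewrite -[X in measurable X]setTI; apply: (@measurable_snd _ _ 'rV[R]_d (measurableTypeR R)).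
by apply/seteqP; split => z /=; rewrite in_itv.
Qed.

Lemma measurable_cut phi : continuous phi -> @measurable_fun _ _ Em R setT (cut phi).
Proof.
move=> c; apply: measurable_funM; last exact: continuous_measurable_E.
by apply: measurable_indic; exact: mCT.
Qed.

Definition lateral_energy phi v z : R := \1_CT z * (('D_v phi z) ^+ 2 * wt z).

Lemma measurable_lateral_energy phi v : csmooth phi -> @measurable_fun _ _ Em R setT (lateral_energy phi v).
Proof.
move=> sm; apply: measurable_funM; first by apply: measurable_indic; exact: mCT.
apply: measurable_funM; last exact: measurable_snd_powR.
by apply: measurable_funX; apply: continuous_measurable_E; exact: csmooth_continuous (csmooth_derive _ sm).
Qed.

Lemma lateral_energy_ge0 phi v z : 0 <= lateral_energy phi v z.
Proof. by rewrite mulr_ge0// ?indicE ?ler0n// mulr_ge0 ?sqr_ge0 ?powR_ge0. Qed.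

Lemma cauchy_dotp (x y : E) : dotp x y ^+ 2 <= dotp x x * dotp y y.
Proof.
apply: quadratic_discr; [exact: dotp_ge0|exact: dotp_ge0|move=> t].
have := dotp_ge0 (t *: x + y); rewrite dotpDl !dotpZl ![dotp _ (t *: x + y)]dotpC !dotpDl !dotpZl.
by rewrite (dotpC y x); congr (_ <= _); ring.
Qed.

Lemma integral_lateral_energy phi v : csmooth phi ->
  (\int[nu]_z (lateral_energy phi v z)%:E <= (dotp v v * vip (grad phi) (grad phi))%:E)%E.
Proof.
move=> sm; have V := V2_grad oO bO T0 ha sm.
have [iV eV] := vipE oO V V.
have -> : (\int[nu]_z (lateral_energy phi v z)%:E = \int[nu]_(z in CT) (('D_v phi z) ^+ 2 * wt z)%:E)%E.
  rewrite [RHS]integral_mkcond; apply: eq_integral => z _.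
  rewrite patchE /lateral_energy indicE; case: ifP => _; by rewrite ?mul1r ?mul0r.
have -> : (dotp v v * vip (grad phi) (grad phi))%:E =
    (\int[nu]_(z in CT) ((dotp v v)%:E * (dotp (grad phi z) (grad phi z) * wt z)%:E))%E.
  rewrite integralZl//; last exact: mCT.
  rewrite EFinM eV /Rintegral fineK//; apply: integrable_fin_num iV; exact: mCT.
apply: ge0_le_integral; [exact: mCT| | | |].
- by move=> z _; rewrite lee_fin mulr_ge0 ?sqr_ge0 ?powR_ge0.
- apply/measurable_EFinP; apply: measurable_funM; last exact: measurable_snd_powR.
  apply: measurable_funX; apply: measurable_funTS; apply: continuous_measurable_E.
  exact: csmooth_continuous (csmooth_derive _ sm).
- apply: emeasurable_funM; first exact: measurable_cst.
  by case/integrableP: iV.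
move=> z Cz; rewrite -EFinM lee_fin mulrA; apply: ler_wpM2r; first exact: powR_ge0.
rewrite (derive_dotp _ (csmooth_differentiable z sm)) mulrC; exact: cauchy_dotp.
Qed.

Lemma measurable_shift v : @measurable_fun _ _ (Em * measurableTypeR R)%type Em setT
  (fun p : E * R => p.1 + p.2 *: v).
Proof.
have m1 : @measurable_fun _ _ (Em * measurableTypeR R)%type 'rV[R]_d setT (fun p : E * R => p.1.1 + p.2 *: v.1).
  apply: (measurable_fun_rV measurableT) => i.
  rewrite (_ : (fun p => _) = (fun p : E * R => p.1.1 ord0 i + p.2 * v.1 ord0 i)); last first.
    by apply/funext => p; rewrite !mxE.
  apply: measurable_funD.
    apply: (@measurableT_comp _ _ _ (Em * measurableTypeR R)%type 'rV[R]_d R (fun x : 'rV[R]_d => x ord0 i) _ (fun p => p.1.1)).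
      exact: measurable_coord.
    by apply: (@measurableT_comp _ _ _ (Em * measurableTypeR R)%type Em 'rV[R]_d fst _ fst); [exact: measurable_fst|exact: measurable_fst].
  by apply: measurable_funM; [exact: measurable_snd|exact: measurable_cst].
have m2 : @measurable_fun _ _ (Em * measurableTypeR R)%type (measurableTypeR R) setT (fun p : E * R => p.1.2 + p.2 * v.2).
  apply: measurable_funD.
    by apply: (@measurableT_comp _ _ _ (Em * measurableTypeR R)%type Em (measurableTypeR R) snd _ fst); [exact: measurable_snd|exact: measurable_fst].
  by apply: measurable_funM; [exact: measurable_snd|exact: measurable_cst].
exact: (measurable_fun_pair m1 m2).
Qed.

(** Tonelli's theorem exchanges the integrals, and each translate has the same integral over the
    whole space, so that averaging over the unit segment changes nothing. *)
Lemma integral_segment_energy phi v : csmooth phi -> v.2 = 0 ->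
  (\int[nu]_z (\int[leb1]_(s in `]0%R, 1%R[) (lateral_energy phi v (z + s *: v))%:E) =
   \int[nu]_z (lateral_energy phi v z)%:E)%E /\
  @measurable_fun _ _ Em _ setT (fun z => \int[leb1]_(s in `]0%R, 1%R[) (lateral_energy phi v (z + s *: v))%:E)%E.
Proof.
move=> sm v0.
have mk := measurable_lateral_energy v sm.
pose G (p : E * R) : \bar R := ((lateral_energy phi v (p.1 + p.2 *: v))%:E * (\1_`]0%R, 1%R[ p.2)%:E)%E.
have mG : @measurable_fun _ _ (Em * measurableTypeR R)%type _ setT G.
  apply: emeasurable_funM; apply/measurable_EFinP.
    exact: (@measurableT_comp _ _ _ (Em * measurableTypeR R)%type Em R _ _ _ mk (measurable_shift v)).
  apply: (@measurableT_comp _ _ _ (Em * measurableTypeR R)%type (measurableTypeR R) R (\1_`]0%R, 1%R[) _ snd); last exact: measurable_snd.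
  exact: measurable_indic.
have G0 p : (0 <= G p)%E by rewrite mule_ge0// lee_fin ?lateral_energy_ge0// indicE ler0n.
have eG z : (\int[leb1]_(s in `]0%R, 1%R[) (lateral_energy phi v (z + s *: v))%:E = \int[leb1]_s G (z, s))%E.
  rewrite integral_mkcond; apply: eq_integral => s _; rewrite patchE /G /= indicE.
  by case: ifP => _; rewrite ?mule1 ?mule0.
under eq_integral do rewrite eG.
split; last first.
  rewrite (_ : (fun z => _) = (fun z => \int[leb1]_s G (z, s))%E); last by apply/funext => z; rewrite eG.
  exact: (@measurable_fun_fubini_tonelli_F _ _ Em (measurableTypeR R) R leb1 G mG G0).
pose nuS : {sigma_finite_measure set Em -> \bar R} :=
  (HB.pack_for {sigma_finite_measure set Em -> \bar R} (leb d \x leb1)%E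
  (Measure_isSigmaFinite.Build _ _ _ (leb d \x leb1)%E (sigma_finite_product (leb d) leb1))).
have e0 := @fubini_tonelli _ _ Em (measurableTypeR R) R nuS leb1 G mG G0.
have p1 (s : R) : (0 <= ((\1_`]0%R, 1%R[ s)%:E : \bar R))%E by rewrite lee_fin indicE ler0n.
have pk : (0 <= \int[nu]_z (lateral_energy phi v z)%:E)%E.
  by apply: integral_ge0 => z _; rewrite lee_fin lateral_energy_ge0.
have es s : (\int[nu]_z G (z, s) = (\int[nu]_z (lateral_energy phi v z)%:E) * (\1_`]0%R, 1%R[ s)%:E)%E.
  have mks : @measurable_fun _ _ Em _ setT (fun z => (lateral_energy phi v (z + s *: v))%:E).
    by apply/measurable_EFinP; apply: (@measurableT_comp _ _ _ Em Em R _ _ _ mk); exact: measurable_translate.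
  have p2 z : [set: Em] z -> (0 <= (lateral_energy phi v (z + s *: v))%:E)%E by rewrite lee_fin lateral_energy_ge0.
  have e2 := @ge0_integralZr _ Em R nu setT measurableT _ mks (\1_`]0%R, 1%R[ s)%:E p2 (p1 s).
  transitivity ((\int[nu]_z (lateral_energy phi v (z + s *: v))%:E) * (\1_`]0%R, 1%R[ s)%:E)%E; first exact e2.
  apply: (congr1 (fun r : \bar R => (r * (\1_`]0%R, 1%R[ s)%:E)%E)).
  apply: (@ge0_integral_vol_translate _ _ (s *: v) (fun z => (lateral_energy phi v z)%:E)).
  - exact/measurable_EFinP.
  - by move=> z; rewrite lee_fin lateral_energy_ge0.
transitivity (\int[leb1]_s \int[nu]_z G (z, s))%E; first exact e0.
transitivity (\int[leb1]_s ((\int[nu]_z (lateral_energy phi v z)%:E) * (\1_`]0%R, 1%R[ s)%:E))%E.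
  by apply: eq_integral => s _; exact: es.
have m01 : @measurable_fun _ _ (measurableTypeR R) _ setT (fun s => (\1_`]0%R, 1%R[ s)%:E : \bar R).
  by apply/measurable_EFinP; exact: measurable_indic.
rewrite (@ge0_integralZl _ (measurableTypeR R) R leb1 setT measurableT _ m01 _ (fun s _ => p1 s) pk).
have -> : (\int[leb1]_s (\1_`]0%R, 1%R[ s)%:E = 1)%E.
  rewrite integral_indic// setIT; apply: etrans (lebesgue_measure_itv _) _.
  by rewrite /= lte_fin ltr01 oppr0 adde0.
by rewrite mule1.
Qed.

(** As [v] is horizontal, the weight is constant along each segment and can be moved under the
    segment integral. *)
Lemma lateral_translation phi v q : csmooth phi -> (forall w, lateral_boundary Omega T w -> phi w = 0) ->
  v.2 = 0 -> q <= T ->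
  (\int[nu]_(z in strip q) ((cut phi (z + v) - cut phi z) ^+ 2 * wt z)%:E <=
   (4 * dotp v v * vip (grad phi) (grad phi))%:E)%E.
Proof.
move=> sm h0 v0 qT.
have c := csmooth_continuous sm.
have [e1 m1] := integral_segment_energy sm v0.
apply: (@le_trans _ _ (\int[nu]_(z in strip q) (4%:E * \int[leb1]_(s in `]0%R, 1%R[) (lateral_energy phi v (z + s *: v))%:E))%E).
  apply: ge0_le_integral; [exact: measurable_strip| | | |].
  - by move=> z _; rewrite lee_fin mulr_ge0 ?sqr_ge0 ?powR_ge0.
  - apply/measurable_EFinP; apply: measurable_funM; last exact: measurable_snd_powR.
    apply: measurable_funTS; apply: measurable_funX; apply: measurable_funB; last exact: measurable_cut.
    apply: (@measurableT_comp _ _ _ Em Em R _ _ _ (measurable_cut c)); exact: measurable_translate.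
  - by apply: emeasurable_funM; [exact: measurable_cst|exact: measurable_funTS].
  move=> z /andP[z0 zq].
  have hz : 0 < z.2 < T by rewrite z0 (lt_le_trans zq).
  rewrite EFinM muleC; apply: le_trans (lee_wpmul2l _ (segment_difference sm h0 hz v0)) _.
    by rewrite lee_fin powR_ge0.
  rewrite muleCA; apply: lee_wpmul2l; first by rewrite lee_fin.
  rewrite /seg_energy -ge0_integralZl//; last 3 first.
  - by apply: measurable_funTS; exact: measurable_seg.
  - by move=> s _; rewrite lee_fin mulr_ge0 ?sqr_ge0// indicE ler0n.
  - by rewrite lee_fin powR_ge0.
  rewrite le_eqVlt; apply/orP; left; apply/eqP; apply: eq_integral => s _.
  rewrite -EFinM /lateral_energy; congr (_%:E).
  by rewrite -[wt z]/(z.2 `^ a) -[wt (z + s *: v)]/((z + s *: v).2 `^ a) /= v0 scaler0 addr0; ring.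
rewrite ge0_integralZl//; last 3 first.
- exact: measurable_strip.
- exact: measurable_funTS.
- by move=> z _; apply: integral_ge0 => s _; rewrite lee_fin lateral_energy_ge0.
rewrite -mulrA EFinM; apply: lee_wpmul2l; first by rewrite lee_fin.
apply: le_trans (integral_lateral_energy v sm); rewrite -e1.
apply: ge0_subset_integral => //; [exact: measurable_strip|].
by move=> z _; apply: integral_ge0 => s _; rewrite lee_fin lateral_energy_ge0.
Qed.

Definition base_cut phi (x : 'rV[R]_d) : R := \1_Omega x * phi (x, 0).

Lemma continuous_base phi : continuous phi -> measurable_fun setT (base_cut phi).
Proof.
move=> c; apply: measurable_funM; last by apply: continuous_measurable_rV; exact: continuous_slice.
by apply: measurable_indic; exact: open_measurable_rV.
Qed.

Definition base_gap phi z : R := cut phi z - base_cut phi z.1.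

Lemma measurable_base_fst phi : continuous phi -> @measurable_fun _ _ Em R setT (fun z : E => base_cut phi z.1).
Proof.
move=> c; apply: (@measurableT_comp _ _ _ Em 'rV[R]_d R _ _ fst); [exact: continuous_base|exact: measurable_fst].
Qed.

Lemma subcylinder q : q <= T -> cylinder Omega q `<=` CT.
Proof. by move=> qT z [Oz /andP[z0 zq]]; split => //; rewrite z0 (lt_le_trans zq). Qed.

(** [ftc_cylinder] for the lower cylinder of height [q], whence the small constant [Kf q a]. *)
Lemma base_gap_le phi q : csmooth phi -> 0 < q -> q <= T ->
  (\int[nu]_(z in strip q) ((base_gap phi z) ^+ 2 * wt z)%:E <= (Kf q a * vip (grad phi) (grad phi))%:E)%E.
Proof.
move=> sm q0 qT; have c := csmooth_continuous sm.
have h := ftc_cylinder oO bO q0 ha sm (or_introl (erefl 0)).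
have mq := measurable_cylinder q oO.
have cd : continuous (phi - pull phi 0 : E -> R^o).
  by move=> z; apply: cvgB; [exact: c|exact: pull_continuous].
have l2d := l2_continuous oO bO q0 ha cd.
apply: (@le_trans _ _ (ip nu (cylinder Omega q) wt (phi - pull phi 0) (phi - pull phi 0))%:E).
  rewrite (ipE mq l2d) [leLHS]integral_mkcond [leRHS]integral_mkcond.
  rewrite le_eqVlt; apply/orP; left; apply/eqP; apply: eq_integral => z _.
  rewrite !patchE; have [Oz|nO] := pselect (Omega z.1).
    rewrite (_ : (z \in strip q) = (z \in cylinder Omega q)); last first.
      by apply/idP/idP => /set_mem hz; apply/mem_set; [split|case: hz].
    case: ifPn => // /set_mem Cz.
    rewrite /base_gap cut_in; last exact: subcylinder Cz.
    by rewrite /base_cut indicE mem_set// mul1r.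
  rewrite [z \in cylinder _ _](_ : _ = false); last by apply: memNset => -[].
  case: ifPn => // _; rewrite /base_gap cut_out; last by case.
  by rewrite /base_cut indicE memNset// mul0r subr0 expr0n mul0r.
rewrite lee_fin; apply: le_trans h _; apply: ler_wpM2l; first exact: Kf_ge0.
have V1 := V2_grad oO bO q0 ha sm; have V2 := V2_grad oO bO T0 ha sm.
have [i1 e1] := vipE oO V1 V1; have [i2 e2] := vipE oO V2 V2.
rewrite -lee_fin e1 e2 /Rintegral !fineK; last 2 first.
- exact: (integrable_fin_num mCT i2).
- exact: (integrable_fin_num mq i1).
apply: ge0_subset_integral; [exact: mq|exact: mCT|by case/integrableP: i2| |exact: subcylinder].
by move=> z _; rewrite lee_fin mulr_ge0 ?dotp_ge0 ?powR_ge0.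
Qed.

(** A difference on the base is a vertical gap, a lateral difference inside the strip and a second
    vertical gap: squaring a sum of three terms gives the factor 3, and the two gaps give 2
    [Kf q a]. *)
Lemma base_translation phi (h : 'rV[R]_d) q : csmooth phi ->
  (forall w, lateral_boundary Omega T w -> phi w = 0) -> 0 < q -> q <= T ->
  ((c0 q a)%:E * \int[leb d]_x ((base_cut phi (x + h) - base_cut phi x) ^+ 2)%:E <=
   (3 * (2 * Kf q a + 4 * dotv h h) * vip (grad phi) (grad phi))%:E)%E.
Proof.
move=> sm h0 q0 qT; have c := csmooth_continuous sm.
pose v : E := (h, 0).
have v0 : v.2 = 0 by [].
have dv : dotp v v = dotv h h by rewrite /dotp /= mulr0 addr0.
have a1 : -1 < a by case/andP: ha.
have mb := continuous_base c.
have mt : measurable_fun setT (fun x : 'rV[R]_d => x + h).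
  apply: (measurable_fun_rV measurableT) => i.
  rewrite (_ : (fun x => _) = (fun x : 'rV[R]_d => x ord0 i + h ord0 i)); last by apply/funext => x; rewrite mxE.
  by apply: measurable_funD; [exact: measurable_coord|exact: measurable_cst].
have md : measurable_fun setT (fun x : 'rV[R]_d => (base_cut phi (x + h) - base_cut phi x) ^+ 2).
  apply: measurable_funX; apply: measurable_funB => //.
  exact: (measurableT_comp mb mt).
pose D2 (z : E) := (base_cut phi (z.1 + h) - base_cut phi z.1) ^+ 2.
have mD2 : @measurable_fun _ _ Em R setT D2.
  by apply: (@measurableT_comp _ _ _ Em 'rV[R]_d R _ _ fst md); exact: measurable_fst.
(* A fibre of the strip has weight at least [c0 q a], which turns the integral over the base into
   one over the strip. *)
have step1 : ((c0 q a)%:E * \int[leb d]_x ((base_cut phi (x + h) - base_cut phi x) ^+ 2)%:E <=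
    \int[nu]_(z in strip q) (D2 z * wt z)%:E)%E.
  pose F (z : E) : \bar R := ((D2 z)%:E * ((\1_`]0%R, q[ z.2)%:E * (wt z)%:E))%E.
  have mF : @measurable_fun _ _ Em _ setT F.
    apply: emeasurable_funM; first exact/measurable_EFinP.
    apply: emeasurable_funM; apply/measurable_EFinP; last exact: measurable_snd_powR.
    apply: (@measurableT_comp _ _ _ Em (measurableTypeR R) R (\1_`]0%R, q[) _ snd); last exact: measurable_snd.
    exact: measurable_indic.
  have F0 z : (0 <= F z)%E by rewrite !mule_ge0// lee_fin ?sqr_ge0 ?powR_ge0// indicE ler0n.
  have -> : (\int[nu]_(z in strip q) (D2 z * wt z)%:E = \int[nu]_z F z)%E.
    rewrite integral_mkcond; apply: eq_integral => z _.
    rewrite patchE /F indicE (_ : (z \in strip q) = (z.2 \in [set` `]0%R, q[])); last first.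
      by apply/idP/idP => /set_mem hz; apply/mem_set; move: hz; rewrite /strip /= in_itv.
    by case: ifP => _; rewrite ?mul1e ?mul0e ?mule0 -?EFinM.
  rewrite [leRHS](@fubini_tonelli1 _ _ 'rV[R]_d (measurableTypeR R) R (leb d) leb1 F mF F0).
  rewrite -ge0_integralZl//; last 3 first.
  - exact/measurable_EFinP.
  - by move=> x _; rewrite lee_fin sqr_ge0.
  - by rewrite lee_fin (ltW (c0_gt0 q0 ha)).
  apply: ge0_le_integral => //.
  - by move=> x _; rewrite mule_ge0// lee_fin ?sqr_ge0// (ltW (c0_gt0 q0 ha)).
  - by apply: emeasurable_funM; [exact: measurable_cst|exact/measurable_EFinP].
  - exact: (@measurable_fun_fubini_tonelli_F _ _ 'rV[R]_d (measurableTypeR R) R leb1 F mF F0).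
  move=> x _; rewrite /fubini_F /F /D2 /= ge0_integralZl//; last 3 first.
  - apply: emeasurable_funM; apply/measurable_EFinP; last exact: measurable_powR.
    exact: measurable_indic.
  - by move=> t _; rewrite mule_ge0// lee_fin ?powR_ge0// indicE ler0n.
  - by rewrite lee_fin sqr_ge0.
  rewrite muleC; apply: lee_wpmul2l; first by rewrite lee_fin sqr_ge0.
  have -> : (\int[leb1]_t ((\1_`]0%R, q[ t)%:E * (wt (x, t))%:E) = \int[leb1]_(t in `]0%R, q[) (t `^ a)%:E)%E.
    rewrite [RHS]integral_mkcond; apply: eq_integral => t _.
    by rewrite patchE indicE; case: ifP => _; rewrite ?mul1e ?mul0e.
  exact: integral_powR0_ge.
apply: le_trans step1 _.
have mg : @measurable_fun _ _ Em R setT (base_gap phi).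
  by apply: measurable_funB; [exact: measurable_cut|exact: measurable_base_fst].
have mgv : @measurable_fun _ _ Em R setT (fun z => base_gap phi (z + v)).
  by apply: (@measurableT_comp _ _ _ Em Em R _ _ _ mg); exact: measurable_translate.
have mcv : @measurable_fun _ _ Em R setT (fun z => cut phi (z + v) - cut phi z).
  apply: measurable_funB; last exact: measurable_cut.
  by apply: (@measurableT_comp _ _ _ Em Em R _ _ _ (measurable_cut c)); exact: measurable_translate.
have mw (f : E -> R) : @measurable_fun _ _ Em R setT f -> @measurable_fun _ _ Em _ (strip q) (fun z => (f z ^+ 2 * wt z)%:E).
  move=> mf; apply/measurable_EFinP; apply: measurable_funM; last exact: measurable_snd_powR.
  by apply: measurable_funTS; exact: measurable_funX.
have w0 (f : E -> R) z : (0 <= (f z ^+ 2 * wt z)%:E)%E by rewrite lee_fin mulr_ge0 ?sqr_ge0 ?powR_ge0.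
(* The strip and the weight are invariant under the horizontal translation by [v]. *)
have gv : (\int[nu]_(z in strip q) (base_gap phi (z + v) ^+ 2 * wt z)%:E =
           \int[nu]_(z in strip q) (base_gap phi z ^+ 2 * wt z)%:E)%E.
  rewrite integral_mkcond [RHS]integral_mkcond.
  pose Hf := (fun z : E => (base_gap phi z ^+ 2 * wt z)%:E) \_ (strip q).
  rewrite -[RHS](@ge0_integral_vol_translate _ _ v Hf).
  - apply: eq_integral => z _; rewrite /Hf !patchE.
    have e2 : (z + v).2 = z.2 by rewrite /= addr0.
    rewrite -[(z.1 + v.1, z.2 + v.2)]/(z + v).
    rewrite (_ : (z + v \in strip q) = (z \in strip q)); last first.
      by apply/idP/idP => /set_mem hz; apply/mem_set; move: hz; rewrite /strip /= addr0.
    by rewrite -[wt (z + v)]/((z + v).2 `^ a) e2.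
  - by apply: (measurable_restrictT _ (measurable_strip q)).1; exact: (mw _ mg).
  - by move=> z; rewrite /Hf patchE; case: ifP.
have w1 (r : R) z : (0 <= (r ^+ 2 * wt z)%:E)%E by rewrite lee_fin mulr_ge0 ?sqr_ge0 ?powR_ge0.
pose f1 z := (base_gap phi (z + v) ^+ 2 * wt z)%:E.
pose f2 z := ((cut phi (z + v) - cut phi z) ^+ 2 * wt z)%:E.
pose f3 z := (base_gap phi z ^+ 2 * wt z)%:E.
have m1 : @measurable_fun _ _ Em _ (strip q) f1 by exact: (mw _ mgv).
have m2 : @measurable_fun _ _ Em _ (strip q) f2 by exact: (mw _ mcv).
have m3 : @measurable_fun _ _ Em _ (strip q) f3 by exact: (mw _ mg).
have m12' : @measurable_fun _ _ Em _ (strip q) (fun z => f1 z + f2 z)%E by exact: emeasurable_funD.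
have m12 : @measurable_fun _ _ Em _ (strip q) (fun z => f1 z + f2 z + f3 z)%E by exact: emeasurable_funD.
have p1 z : strip q z -> (0 <= f1 z)%E by move=> _; exact: w1.
have p2 z : strip q z -> (0 <= f2 z)%E by move=> _; exact: w1.
have p3 z : strip q z -> (0 <= f3 z)%E by move=> _; exact: w1.
have p12 z : strip q z -> (0 <= f1 z + f2 z)%E by move=> Sz; apply: adde_ge0; [exact: p1|exact: p2].
apply: (@le_trans _ _ (\int[nu]_(z in strip q) (3%:E * (f1 z + f2 z + f3 z)))%E).
  apply: ge0_le_integral; [exact: measurable_strip| | | |].
  - by move=> z _; rewrite lee_fin mulr_ge0 ?sqr_ge0 ?powR_ge0.
  - apply/measurable_EFinP; apply: measurable_funM; last exact: measurable_snd_powR.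
    exact: measurable_funTS.
  - apply: emeasurable_funM; first exact: measurable_cst.
    exact: m12.
  move=> z _; rewrite /f1 /f2 /f3 -!EFinD -EFinM lee_fin -!mulrDl mulrA; apply: ler_wpM2r; first exact: powR_ge0.
  rewrite /D2 (_ : base_cut phi (z.1 + h) - base_cut phi z.1 =
    - base_gap phi (z + v) + (cut phi (z + v) - cut phi z) + base_gap phi z); last first.
    by rewrite /base_gap /=; ring.
  move: (base_gap _ _) (_ - _) (base_gap _ _) => x1 x2 x3.
  have := sqr_ge0 (x2 + x3); have := sqr_ge0 (x1 - x2); have := sqr_ge0 (x1 + x3); nra.
rewrite (ge0_integralZl nu (measurable_strip q) m12); last 2 first.
- by move=> z Sz; apply: adde_ge0; [exact: p12|exact: p3].
- by rewrite lee_fin.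
rewrite (ge0_integralD nu (measurable_strip q) p12 m12' p3 m3) (ge0_integralD nu (measurable_strip q) p1 m1 p2 m2).
rewrite gv -mulrA EFinM; apply: lee_wpmul2l; first by rewrite lee_fin.
have g1 := base_gap_le sm q0 qT.
have g2 := lateral_translation sm h0 v0 qT.
rewrite (_ : (2 * Kf q a + _) * _ = Kf q a * vip (grad phi) (grad phi) + 4 * dotp v v * vip (grad phi) (grad phi) +
  Kf q a * vip (grad phi) (grad phi)); last by rewrite dv; ring.
by rewrite !EFinD; apply: leeD => //; exact: leeD.
Qed.

End translation_estimate.

(** * Exterior of a Lipschitz domain *)

Section exterior.
Context {R : realType} (d : nat).
Implicit Types (x y h e : 'rV[R]_d) (Om : set 'rV[R]_d).

Lemma coord_le_norm x i : `|x ord0 i| <= `|x|.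
Proof. by have := crd_le_norm (x, 0 : R) (lift ord0 i); rewrite crdS /= prod_normE /= normr0 [Num.max _ _](elimT eqP (_ : _ == `|x|)) // eq_sym; apply/eqP; rewrite max_l. Qed.

Lemma norm_rV_le x (r : R) : 0 <= r -> (forall i, `|x ord0 i| <= r) -> `|x| <= r.
Proof.
move=> r0 h; have : `|(x, 0 : R) : 'rV[R]_d * R| <= r.
  apply: normE_le => // i; case: (unliftP ord0 i) => [j ->|->]; first by rewrite crdS.
  by rewrite crd0 normr0.
by rewrite prod_normE ge_max => /andP[].
Qed.

Lemma dotvDl x y h : dotv (x + y) h = dotv x h + dotv y h.
Proof. by rewrite -big_split; apply: eq_bigr => i _; rewrite mxE mulrDl. Qed.
Lemma dotvZl c x y : dotv (c *: x) y = c * dotv x y.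
Proof. by rewrite mulr_sumr; apply: eq_bigr => i _; rewrite mxE mulrA. Qed.
Lemma dotv_ge0 x : 0 <= dotv x x.
Proof. by apply: sumr_ge0 => i _; rewrite -expr2 sqr_ge0. Qed.

Lemma dotv_abs_le x y (r s : R) : `|x| <= r -> `|y| <= s -> `|dotv x y| <= d.+1%:R * (r * s).
Proof.
move=> hx hy; apply: le_trans (ler_norm_sum _ _ _) _.
have rs : 0 <= r * s by rewrite mulr_ge0// (le_trans _ hx, le_trans _ hy).
apply: (@le_trans _ _ (\sum_(i < d) (r * s))).
  apply: ler_sum => i _; rewrite normrM; apply: ler_pM => //.
    exact: le_trans (coord_le_norm _ _) hx.
  exact: le_trans (coord_le_norm _ _) hy.
rewrite sumr_const card_ord -[X in X <= _]mulr_natl; apply: ler_wpM2r => //.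
by rewrite ler_nat leqnSn.
Qed.

Lemma normv_lt x (r : R) : `|x| * d.+1%:R < r -> normv x < r.
Proof.
move=> h; have r0 : 0 < r by apply: le_lt_trans h; rewrite mulr_ge0.
apply: (@lt_le_trans _ _ (Num.sqrt (r ^+ 2))); last by rewrite sqrtr_sqr gtr0_norm.
rewrite /normv ltr_sqrt ?exprn_gt0//.
have := dotv_abs_le (lexx `|x|) (lexx `|x|).
rewrite ger0_norm ?dotv_ge0// => h2; apply: le_lt_trans h2 _.
apply: (@le_lt_trans _ _ ((`|x| * d.+1%:R) ^+ 2)).
  rewrite exprMn [X in _ <= X]mulrC -expr2; apply: ler_wpM2r; first exact: sqr_ge0.
  by rewrite expr2 ler_peMr// ler1n.
by rewrite ltr_sqr ?nnegrE ?mulr_ge0 ?(ltW r0).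
Qed.

Lemma unit_norm_le1 e : dotv e e = 1 -> `|e| <= 1.
Proof.
move=> h; apply: norm_rV_le => // i.
have : `|e ord0 i| ^+ 2 <= 1 ^+ 2.
  rewrite real_normK ?num_real// expr1n -h /dotv (bigD1 i)//= -expr2 lerDl.
  by apply: sumr_ge0 => j _; rewrite -expr2 sqr_ge0.
by rewrite ler_sqr// nnegrE.
Qed.

(** One natural number serves both as bound on the scale [t] and as ratio of the radii, which lets a
    compactness argument make it uniform. The premise [~ Om x] allows the property to be asserted
    for all points near a boundary point. *)
Definition exterior_at Om (n : nat) x : Prop := ~ Om x -> forall t : R, 0 < t <= n.+1%:R^-1 ->
  exists y, `|y - x| <= t /\ forall h, `|h| <= n.+1%:R^-1 * t -> ~ Om (y + h).

(** Near x0 the set lies above a Lipschitz graph in the direction [e]. Descending by t from a point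
    outside leaves room below the graph for perturbations proportional to t. *)
Lemma exterior_local Om x0 : lipschitz_domain Om -> (closure Om `\` Om) x0 ->
  \forall x \near x0 & n \near \oo, exterior_at Om n x.
Proof.
move=> [_ _ _ _ hl] hx0; have [e [r [zeta [ee r0 lz hz]]]] := hl _ hx0.
have [Mz Mz0 hM] : exists2 Mz : R, 0 < Mz & forall x y, `|zeta x - zeta y| <= Mz * `|x - y|.
  move: lz => [Mz [_ hM]]; exists (`|Mz| + 1); first by rewrite ltr_wpDl.
  move=> x y; have := hM (`|Mz| + 1) _ (x, y); apply => //.
  by rewrite ltr_pwDr// ler_norm.
have e1 := unit_norm_le1 ee.
pose D : R := d.+1%:R.
have D1 : 1 <= D by rewrite ler1n.
(* [D] bounds the ratio of the Euclidean norm to the sup norm; three displacements of size [rho]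
   stay inside the Euclidean ball of radius [r]. *)
pose rho := r / (4 * D).
have rho0 : 0 < rho by rewrite divr_gt0// mulr_gt0// (lt_le_trans ltr01).
(* A perturbation h changes the height by at most D |h| and the graph by at most Mz (1 + D) |h|; for
   |h| <= kap t the two together are less than the descent t. *)
pose kap := ((Mz + 1) * (1 + D))^-1 / 2.
have K0 : 0 < (Mz + 1) * (1 + D) by rewrite mulr_gt0//; lra.
have kap0 : 0 < kap by rewrite divr_gt0// invr_gt0.
have kap1 : kap * ((Mz + 1) * (1 + D)) <= 1.
  by rewrite /kap mulrAC mulVf ?gt_eqF// mul1r; lra.
pose mn := Num.min rho kap.
have mn0 : 0 < mn by rewrite lt_min rho0 kap0.
have [N] := ltr_add_invr (y := 0) (x := mn) mn0; rewrite add0r lt_min => /andP[N1 N2].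
exists (ball x0 rho, [set n | (N <= n)%N]) => /=.
  by split; [exact: nbhsx_ballx|exists N].
move=> [x n] /= [bx Nn] nOx t /andP[t0 tn].
have dx : `|x0 - x| < rho by move: bx; rewrite mx_norm_ball.
have n1 : n.+1%:R^-1 <= N.+1%:R^-1 :> R by rewrite lef_pV2 ?posrE ?ltr0n// ler_nat ltnS.
have trho : t < rho by apply: le_lt_trans tn (le_lt_trans n1 N1).
exists (x - t *: e); split.
  rewrite addrAC subrr add0r normrN normrZ gtr0_norm// ler_piMr// ltW//.
move=> h hh.
have hk : `|h| <= kap * t by apply: le_trans hh _; apply: ler_wpM2r; [exact: ltW|exact: ltW (le_lt_trans n1 N2)].
have kl1 : kap <= 1.
  have : 1 <= (Mz + 1) * (1 + D) by nra.
  move: kap1 kap0; move: ((Mz + 1) * (1 + D)) => q; nra.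
have ht : `|h| <= t by apply: le_trans hk _; rewrite ler_piMl// ltW.
set y := x - t *: e + h.
have ye : dotv y e = dotv x e - t + dotv h e.
  by rewrite /y !dotvDl -scaleNr dotvZl ee mulr1.
have yp : y - dotv y e *: e = (x - dotv x e *: e) + (h - dotv h e *: e).
  rewrite ye /y; apply/rowP => i; rewrite !mxE; ring.
have he : `|dotv h e| <= D * `|h|.
  by apply: le_trans (dotv_abs_le (lexx `|h|) e1) _; rewrite mulr1.
have hw : normv (y - x0) < r.
  apply: normv_lt.
  have : `|y - x0| <= 3 * rho.
    rewrite /y (_ : _ - x0 = (x - x0) - t *: e + h); last by apply/rowP => i; rewrite !mxE; ring.
    apply: le_trans (ler_normD _ _) _; apply: (@le_trans _ _ ((rho + rho) + rho)); last lra.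
    apply: lerD; last by apply: le_trans ht (ltW trho).
    apply: le_trans (ler_normB _ _) _; apply: lerD; first by rewrite distrC ltW.
    by rewrite normrZ gtr0_norm//; apply: le_trans (ler_piMr (ltW t0) e1) (ltW trho).
  move=> h3; apply: (@le_lt_trans _ _ (3 * rho * D)); first by apply: ler_wpM2r => //; lra.
  rewrite /rho; have D0 : D != 0 by rewrite gt_eqF//; lra.
  have -> : 3 * (r / (4 * D)) * D = 3 / 4 * r by field.
  lra.
move=> Oy; have := (hz _ hw).1 Oy.
have dx0 : normv (x - x0) < r.
  apply: normv_lt; rewrite distrC; apply: (@lt_le_trans _ _ (rho * D)); first by rewrite ltr_pM2r//; lra.
  rewrite /rho; have D0 : D != 0 by rewrite gt_eqF//; lra.
  have -> : r / (4 * D) * D = r / 4 by field.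
  lra.
have zx : dotv x e <= zeta (x - dotv x e *: e).
  by rewrite leNgt; apply/negP => hlt; apply: nOx; exact/(hz _ dx0).
rewrite yp ye; apply/negP; rewrite -leNgt.
have hp : `|h - dotv h e *: e| <= (1 + D) * `|h|.
  apply: le_trans (ler_normB _ _) _; rewrite mulrDl mul1r lerD2l normrZ.
  by apply: le_trans (ler_piMr (normr_ge0 _) e1) he.
have hzeta := hM (x - dotv x e *: e + (h - dotv h e *: e)) (x - dotv x e *: e).
have eAB (A B : 'rV[R]_d) : A + B - A = B by rewrite addrAC subrr add0r.
rewrite eAB in hzeta.
have z1 : zeta (x - dotv x e *: e) - Mz * ((1 + D) * `|h|) <= zeta (x - dotv x e *: e + (h - dotv h e *: e)).
  have h4 : Mz * `|h - dotv h e *: e| <= Mz * ((1 + D) * `|h|) by rewrite ler_wpM2l// ltW.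
  move: (le_trans hzeta h4); rewrite ler_norml => /andP[h5 _]; lra.
have h6 : dotv h e <= D * `|h| by apply: le_trans (ler_norm _) he.
have h7 : (Mz + 1) * (1 + D) * `|h| <= t.
  apply: (@le_trans _ _ ((Mz + 1) * (1 + D) * (kap * t))); first by rewrite ler_wpM2l// ltW.
  by rewrite mulrA [_ * kap]mulrC ler_piMl// ltW.
have := normr_ge0 h; nra.
Qed.

Lemma compact_rV (K : set 'rV[R]_d) (r : R) : closed K -> (forall x, K x -> `|x| <= r) -> compact K.
Proof.
move=> cK bK.
have -> : K = fst @` [set z : 'rV[R]_d * R | K z.1 /\ z.2 = 0].
  apply/seteqP; split => [x Kx|x [z [Kz _] <-]//]; first by exists (x, 0).
apply: continuous_compact.
  by apply: continuous_subspaceT => z; exact: cvg_fst.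
apply: (@closed_bounded_compact_E _ _ _ (Num.max r 0)).
  apply: (@closedI _ (fst @^-1` K) (snd @^-1` [set 0])).
    by apply: (@closed_comp _ _ fst) => // z _; exact: cvg_fst.
  apply: (@closed_comp _ _ snd) => [z _|]; first exact: cvg_snd.
  exact: closed_eq.
move=> z [/bK Kz z2]; rewrite prod_normE z2 normr0 ge_max !le_max Kz lexx orbT.
by [].
Qed.

(** The local property holds near every boundary point for all large [n], and the boundary is
    compact. *)
Lemma exterior_uniform Om : lipschitz_domain Om ->
  exists n, forall x, (closure Om `\` Om) x -> exterior_at Om n x.
Proof.
move=> hl; have [bO oO _ _ _] := hl.
have [r r0 hr] := Omega_bounded bO.
have cK : compact (closure Om `\` Om).
  apply: (@compact_rV _ r).
    rewrite setDE; apply: closedI; first exact: closed_closure.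
    exact: open_closedC.
  move=> x [cx _].
  have cl : closed [set w : 'rV[R]_d | `|w| <= r].
    by apply: (@closed_comp _ R Num.norm [set t | t <= r]) => [w _|]; [exact: norm_continuous|exact: closed_le].
  have := closureS hr cx; by rewrite -(closure_id _).1.
have nc := (compact_near_coveringP _).1 cK.
have := @nc nat \oo (fun n x => exterior_at Om n x) _.
move=> /(_ _ (fun x hx => exterior_local hl hx)) [N _ hN].
by exists N => x hx; exact: (hN N (leqnn _) x hx).
Qed.

(** Rules out slits: a boundary point has exterior balls at every small distance, and these are
    disjoint from the closure. *)
Lemma lipschitz_interior_closure Om x : lipschitz_domain Om -> nbhs x (closure Om) -> Om x.
Proof.
move=> hl nx; apply: contrapT => nOx.
have [n hn] := exterior_uniform hl.
have cx : closure Om x by exact: nbhs_singleton nx.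
have ha := hn x (conj cx nOx) nOx.
have /nbhs_ballP[r /= r0 hr] := nx.
pose t := Num.min (n.+1%:R^-1) (r / 2).
have t0 : 0 < t by rewrite lt_min invr_gt0 ltr0n /= divr_gt0.
have := ha t; rewrite t0 ge_min lexx => /(_ isT)[y [hy hy2]].
have cy : closure Om y.
  apply: hr; rewrite mx_norm_ball /ball_ /= distrC; apply: le_lt_trans hy _.
  by rewrite gt_min [X in _ || X](_ : _ = true) ?orbT//; lra.
have nt0 : 0 < n.+1%:R^-1 * t by rewrite mulr_gt0// invr_gt0.
have [z [Oz bz]] := cy _ (nbhsx_ballx y _ nt0).
apply: (hy2 (z - y)); last by rewrite addrC subrK.
by move: bz; rewrite mx_norm_ball /ball_ /= distrC => /ltW.
Qed.

End exterior.

Lemma continuous_shift_left {R : realType} (d : nat) (p : 'rV[R]_d * R) : continuous (fun h : 'rV[R]_d * R => p + h).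
Proof. by move=> h; apply: cvgD; [exact: cvg_cst|exact: cvg_id]. Qed.

(** * Euclidean and sup norms on R^d x R *)

Section norms.
Context {R : realType} (d : nat).
Local Notation E := ('rV[R]_d * R)%type.
Implicit Types (x y z w g : E).

Lemma normp_ge0 x : 0 <= normp x. Proof. exact: sqrtr_ge0. Qed.

Lemma normp_sqr x : normp x ^+ 2 = dotp x x.
Proof. by rewrite sqr_sqrtr// dotp_ge0. Qed.

Lemma norm_le_normp x : `|x| <= normp x.
Proof.
apply: normE_le => [|i]; first exact: normp_ge0.
apply: ler_of_sqr; first exact: normp_ge0.
by rewrite normp_sqr real_normK ?num_real// crd_sqr_le.
Qed.

Lemma normp_le_norm x : normp x <= d.+1%:R * `|x|.
Proof.
have n0 : 0 <= d.+1%:R * `|x| by rewrite mulr_ge0.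
apply: ler_of_sqr => //; rewrite normp_sqr dotp_sqr.
apply: (@le_trans _ _ (\sum_(i < d.+1) `|x| ^+ 2)).
  apply: ler_sum => i _; rewrite -(real_normK (num_real (crd i x))).
  by rewrite ler_sqr ?nnegrE// crd_le_norm.
rewrite sumr_const card_ord -[X in X <= _]mulr_natl exprMn; apply: ler_wpM2r; first exact: sqr_ge0.
by rewrite expr2 ler_peMr// ler1n.
Qed.

Lemma dotp_abs_le x y : `|dotp x y| <= normp x * normp y.
Proof.
apply: ler_of_sqr; first by rewrite mulr_ge0// normp_ge0.
by rewrite real_normK ?num_real// exprMn !normp_sqr cauchy_dotp.
Qed.

Lemma normp_eq0 x : normp x = 0 -> x = 0.
Proof. by move=> h; apply/normr0_eq0/eqP; rewrite eq_le normr_ge0 -{1}h norm_le_normp. Qed.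

End norms.

(** * Lipschitz continuity of hat functions *)

Section segments.
Context {R : realType}.

Lemma closed_piece_extremum (C : set R) (s t : R) : closed C -> (exists2 r, C r & s <= r <= t) ->
  exists p q, [/\ C p, C q, s <= p, p <= q & q <= t] /\ forall r, s <= r <= t -> C r -> p <= r <= q.
Proof.
move=> cC [r0 Cr0 /andP[sr0 r0t]].
pose S := C `&` [set r | s <= r <= t].
have S0 : S r0 by split => //; apply/andP.
have cS : closed S.
  apply: closedI => //; rewrite (_ : [set r | _] = [set r | s <= r] `&` [set r | r <= t]).
    by apply: closedI; [exact: closed_ge|exact: closed_le].
  by apply/seteqP; split => r /=; [move/andP|move=> h; apply/andP].
have hs : has_sup S by split; [exists r0|exists t => r [_ /andP[]]].
have hi : has_inf S by split; [exists r0|exists s => r [_ /andP[]]].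
have Si : S (inf S).
  suff h : closure S (inf S) by rewrite -((closure_id S).1 cS) in h.
  move=> B /nbhs_ballP[e /= e0 he].
  have [r Sr rl] := inf_adherent e0 hi.
  have ir : inf S <= r by apply: ge_inf => //; exact: hi.2.
  exists r; split => //; apply: he; rewrite /ball /= ler0_norm ?subr_le0//; lra.
have Ss : S (sup S).
  suff h : closure S (sup S) by rewrite -((closure_id S).1 cS) in h.
  move=> B /nbhs_ballP[e /= e0 he].
  have [r Sr rl] := sup_adherent e0 hs.
  have ir : r <= sup S by apply: ub_le_sup => //; exact: hs.2.
  exists r; split => //; apply: he; rewrite /ball /= ger0_norm ?subr_ge0//; lra.
exists (inf S), (sup S); split.
  case: Si => [? /andP[? ?]]; case: Ss => [? /andP[? ?]]; split => //.
  by apply: le_trans (_ : r0 <= _); [apply: ge_inf => //; exact: hi.2|apply: ub_le_sup => //; exact: hs.2].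
move=> r hr Cr; have Sr : S r by split.
by apply/andP; split; [apply: ge_inf => //; exact: hi.2|apply: ub_le_sup => //; exact: hs.2].
Qed.

Lemma closed_left (A : set R) (s p : R) : closed A -> s < p -> (forall r, s <= r < p -> A r) -> A p.
Proof.
move=> cA sp h; suff hc : closure A p by rewrite -((closure_id A).1 cA) in hc.
move=> B /nbhs_ballP[e /= e0 he]; pose r := Num.max s (p - e / 2).
have rp : r < p by rewrite gt_max sp /=; lra.
have sr : s <= r by rewrite le_max lexx.
have er : p - e / 2 <= r by rewrite le_max lexx orbT.
exists r; split; first by apply: h; rewrite sr.
by apply: he; rewrite /ball /= ger0_norm ?subr_ge0 ?ltW//; lra.
Qed.

Lemma closed_right (A : set R) (q t : R) : closed A -> q < t -> (forall r, q < r <= t -> A r) -> A q.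
Proof.
move=> cA qt h; suff hc : closure A q by rewrite -((closure_id A).1 cA) in hc.
move=> B /nbhs_ballP[e /= e0 he]; pose r := Num.min t (q + e / 2).
have rp : q < r by rewrite lt_min qt /=; lra.
have sr : r <= t by rewrite ge_min lexx.
have er : r <= q + e / 2 by rewrite ge_min lexx orbT.
exists r; split; first by apply: h; rewrite sr andbT.
by apply: he; rewrite /ball /= ler0_norm ?subr_le0 ?ltW//; lra.
Qed.

(* Splitting at the first and last points of one piece leaves two segments
   covered by the remaining closed pieces. *)
Lemma piecewise_lipschitz (C : nat -> set R) (u : R -> R) (L : R) (n : nat) (s t : R) : 0 <= L ->
  (forall i, closed (C i)) -> (forall i a b, C i a -> C i b -> `|u a - u b| <= L * `|a - b|) ->
  s <= t -> (forall r, s <= r <= t -> exists2 i, (i < n)%N & C i r) -> `|u t - u s| <= L * (t - s).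
Proof.
move=> L0 cC hL; elim: n s t => [|n ih] s t st hc.
  by have [] := hc s; rewrite ?lexx.
have clU : closed (\bigcup_(i in `I_n) C i) by apply: closed_bigcup => //; exact: finite_II.
have [[r Cr hr]|hno] := pselect (exists2 r, C n r & s <= r <= t); last first.
  apply: ih => // r hr; have [i] := hc r hr; rewrite ltnS leq_eqVlt => /orP[/eqP ->|ni Ci]; last by exists i.
  by move=> Cr; exfalso; apply: hno; exists r.
have [p [q [[Cp Cq sp pq qt] hext]]] := closed_piece_extremum (cC n) (ex_intro2 _ _ r Cr hr).
have rest r' : s <= r' <= t -> ~ (p <= r' <= q) -> (\bigcup_(i in `I_n) C i) r'.
  move=> hr' npq; have [i] := hc r' hr'; rewrite ltnS leq_eqVlt => /orP[/eqP ->|ni Ci]; last by exists i.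
  by move=> Cr'; exfalso; apply: npq; exact: hext.
have left : `|u p - u s| <= L * (p - s).
  move: sp; rewrite le_eqVlt => /orP[/eqP ->|sp]; first by rewrite !subrr normr0 mulr0.
  have A r' : s <= r' < p -> (\bigcup_(i in `I_n) C i) r'.
    move=> /andP[h1 h2]; apply: rest; first by rewrite h1 (le_trans (ltW h2))// (le_trans pq).
    by rewrite (leNgt p) h2.
  apply: ih => [|r' /andP[h1]]; first exact: ltW.
  rewrite le_eqVlt => /orP[/eqP ->|h2].
    by have [i ni Ci] := closed_left clU sp A; exists i.
  by have [|i ni Ci] := A r'; [rewrite h1|exists i].
have right : `|u t - u q| <= L * (t - q).
  move: qt; rewrite le_eqVlt => /orP[/eqP ->|qt]; first by rewrite !subrr normr0 mulr0.
  have A r' : q < r' <= t -> (\bigcup_(i in `I_n) C i) r'.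
    move=> /andP[h1 h2]; apply: rest; first by rewrite h2 andbT (le_trans sp)// (le_trans pq)// ltW.
    by rewrite (leNgt r' q) h1 andbF.
  apply: ih => [|r' /andP[h1 h2]]; first exact: ltW.
  move: h1; rewrite le_eqVlt => /orP[/eqP <-|h1].
    by have [i ni Ci] := closed_right clU qt A; exists i.
  by have [|i ni Ci] := A r'; [rewrite h1|exists i].
have mid : `|u q - u p| <= L * (q - p).
  by have := hL n q p Cq Cp; rewrite [X in L * X]ger0_norm// subr_ge0.
rewrite (_ : u t - u s = (u t - u q) + (u q - u p) + (u p - u s)); last ring.
apply: le_trans (ler_normD _ _) _; apply: le_trans (lerD (ler_normD _ _) (lexx _)) _.
by apply: le_trans (lerD (lerD right mid) left) _; rewrite -!mulrDr; apply: ler_wpM2l => //; lra.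
Qed.

End segments.

(** * Quasi-uniform meshes of the cylinder *)

Section mesh_analysis.
Context {R : realType} (d : nat) (Omega : set 'rV[R]_d) (T : R) (gamma sigma : R)
  (M : seq (simplex (R := R) d)).
Local Notation E := ('rV[R]_d * R)%type.
Local Notation CT := (cylinder Omega T).
Local Notation cCT := (closure CT).
Local Notation H := (mesh_size M).
Hypotheses (lO : lipschitz_domain Omega) (T0 : 0 < T) (hM : triangulates M CT)
  (hreg : shape_regular gamma M) (hqu : quasi_uniform sigma M).
Local Notation nd := (mesh_nondegenerate hM).
Local Notation hatM := (hat Omega T M).
Implicit Types (z w p : E) (K : simplex (R := R) d).

Lemma lip_open : open Omega. Proof. by case: lO. Qed.
Lemma lip_bounded : bounded_set Omega. Proof. by case: lO. Qed.

Lemma closure_norm_le (A : set E) (r : R) : (forall z, A z -> `|z| <= r) -> forall z, closure A z -> `|z| <= r.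
Proof.
move=> h z cz.
have cl : closed [set w : E | `|w| <= r].
  by apply: (@closed_comp E R Num.norm [set t | t <= r]) => [w _|]; [exact: norm_continuous|exact: closed_le].
by have := closureS h cz; rewrite -(closure_id _).1.
Qed.

Lemma hull_closure K z : K \in M -> hull K z -> cCT z.
Proof. by move=> KM hK; apply/(mesh_cover hM); exists K. Qed.

Lemma diam_ge K z w : K \in M -> hull K z -> hull K w -> normp (z - w) <= diam (hull K).
Proof.
move=> KM hz hw; apply: ub_le_sup; last by exists z => //; exists w.
have [r r0 hr] := hull_bounded K.
exists (d.+1%:R * (r + r)) => _ [x hx [y hy <-]]; apply: le_trans (normp_le_norm _) _.
by apply: ler_wpM2l => //; apply: le_trans (ler_normB _ _) _; apply: lerD; exact: hr.
Qed.

Lemma diam_le_mesh K : K \in M -> diam (hull K) <= H.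
Proof. move=> KM; rewrite /mesh_size; elim: M KM => [//|L s ih].
rewrite inE big_cons le_max => /orP[/eqP ->|/ih ->]; by rewrite ?lexx ?orbT. Qed.

Lemma diam_gt0 K : K \in M -> 0 < diam (hull K).
Proof.
move=> KM; have := diam_ge KM (vertex_hull ord0 (nd KM)) (vertex_hull ord_max (nd KM)).
apply: lt_le_trans; rewrite lt_neqAle normp_ge0 andbT eq_sym; apply/eqP => /normp_eq0 /eqP.
by rewrite subr_eq0 => /eqP /(nondegenerate_inj (nd KM)).
Qed.

Lemma mesh_inhabited : exists K, K \in M.
Proof.
have [_ _ _ [x Ox] _] := lO.
have : cCT (x, T / 2).
  apply: subset_closure; split => //=; apply/andP; split; first by rewrite divr_gt0.
  by rewrite ltr_pdivrMr// ltr_pMr// ltr1n.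
by move=> /(mesh_cover hM)[K KM _]; exists K.
Qed.

Lemma mesh_size_gt0 : 0 < H.
Proof. by have [K KM] := mesh_inhabited; exact: lt_le_trans (diam_gt0 KM) (diam_le_mesh KM). Qed.

Lemma hull_dist K z w : K \in M -> hull K z -> hull K w -> `|z - w| <= H.
Proof.
move=> KM hz hw; apply: le_trans (norm_le_normp _) _.
exact: le_trans (diam_ge KM hz hw) (diam_le_mesh KM).
Qed.

Lemma sigma_gt0 : 0 < sigma.
Proof.
have [K KM] := mesh_inhabited.
have := lt_le_trans mesh_size_gt0 (hqu KM).
by rewrite pmulr_lgt0// diam_gt0.
Qed.

Lemma gamma_gt0 : 0 < gamma.
Proof.
have [K KM] := mesh_inhabited; have [c [r [r0 _ h]]] := hreg KM.
by have := lt_le_trans (diam_gt0 KM) h; rewrite pmulr_lgt0.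
Qed.

(** A simplex contains a ball of radius r >= H / (gamma sigma). Moving by r in the direction of the
    gradient changes the function by |g| r, while its values stay in [0, 1]. *)
Lemma affine_gradient_le K (v : E -> R) g c : K \in M -> (forall z, hull K z -> v z = dotp g z + c) ->
  (forall z, hull K z -> 0 <= v z <= 1) -> normp g <= gamma * sigma / H.
Proof.
move=> KM hv h01; have [c0 [r [r0 hr hd]]] := hreg KM.
have [->|g0] := eqVneq (normp g) 0.
  by rewrite divr_ge0 ?mulr_ge0 ?ltW// ?gamma_gt0 ?sigma_gt0 ?mesh_size_gt0.
have gp : 0 < normp g by rewrite lt_neqAle normp_ge0 eq_sym g0.
have rH : H <= gamma * sigma * r.
  apply: le_trans (hqu KM) _; rewrite [gamma * sigma]mulrC -mulrA.
  by apply: ler_wpM2l => //; exact: ltW sigma_gt0.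
rewrite ler_pdivlMr ?mesh_size_gt0//.
apply: le_trans (ler_wpM2l (ltW gp) rH) _.
suff : normp g * r <= 1.
  move=> h; rewrite mulrCA -[X in _ <= X]mulr1; apply: ler_wpM2l => //.
  by rewrite mulr_ge0 ?ltW ?gamma_gt0 ?sigma_gt0.
pose w := c0 + (r / normp g) *: g.
have hc0 : hull K c0 by apply: hr; rewrite /= subrr /normp dotpE big1 ?sqrtr0 ?ltW// => i _; rewrite (_ : crd i 0 = 0) ?mul0r// -(scale0r (0 : E)) crdZ mul0r.
have hw : hull K w.
  apply: hr; rewrite /= /w addrAC subrr add0r.
  apply: ler_of_sqr; first exact: ltW.
  rewrite normp_sqr dotpZl dotpC dotpZl -normp_sqr.
  by rewrite le_eqVlt; apply/orP; left; apply/eqP; field.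
have := h01 _ hw; have := h01 _ hc0; rewrite !hv// => /andP[a1 _] /andP[_ a2].
have e : dotp g w = dotp g c0 + normp g * r.
  rewrite /w dotpC dotpDl dotpZl -normp_sqr dotpC; congr (_ + _).
  by field.
rewrite e in a2; lra.
Qed.

(** The factor [d.+1%:R] converts the Euclidean bound on the gradient into a Lipschitz constant for
    the sup norm. *)
Definition hat_lip : R := d.+1%:R * (gamma * sigma / H).

Lemma hat_lip_ge0 : 0 <= hat_lip.
Proof.
by rewrite mulr_ge0// divr_ge0 ?mulr_ge0 ?ltW ?gamma_gt0 ?sigma_gt0 ?mesh_size_gt0.
Qed.

Lemma hat_affine z0 K : z0 \in nodes M -> K \in M -> exists g c,
  (forall z, hull K z -> hatM z0 z = dotp g z + c) /\ normp g <= gamma * sigma / H.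
Proof.
move=> zN KM; have [[_ aff _] _ _] := hat_spec hM zN.
have [g [c h]] := aff K KM; exists g, c; split => //.
by apply: (affine_gradient_le KM h) => z _; rewrite hat_ge0 ?hat_le1.
Qed.

Lemma hat_lip_hull z0 K z w : z0 \in nodes M -> K \in M -> hull K z -> hull K w ->
  `|hatM z0 z - hatM z0 w| <= hat_lip * `|z - w|.
Proof.
move=> zN KM hz hw; have [g [c [h hg]]] := hat_affine zN KM.
rewrite (h z)// (h w)// (_ : _ - _ = dotp g (z - w)); last first.
  by rewrite [dotp g (z - w)]dotpC dotpBl !(dotpC _ g); ring.
apply: le_trans (dotp_abs_le _ _) _; rewrite /hat_lip mulrAC mulrC.
by apply: ler_pM => //; [exact: normp_ge0|exact: normp_ge0|exact: normp_le_norm].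
Qed.

Lemma closure_cylinder z : cCT z -> closure Omega z.1 /\ 0 <= z.2 <= T.
Proof.
move=> cz; split.
  move=> B hB; have [w [[Ow _] Bw]] := cz (fst @^-1` B) (cvg_fst hB).
  by exists w.1.
have cl : closed [set w : E | 0 <= w.2 <= T].
  rewrite (_ : [set w | _] = snd @^-1` [set y : R | 0 <= y] `&` snd @^-1` [set y : R | y <= T]).
    apply: closedI; apply: closed_comp; [by move=> w _; exact: cvg_snd|exact: closed_ge|by move=> w _; exact: cvg_snd|exact: closed_le].
  by apply/seteqP; split => w /=; [move/andP|move=> h; apply/andP].
have sub : CT `<=` [set w : E | 0 <= w.2 <= T] by move=> w [_ /andP[h1 h2]]; rewrite /= !ltW.
by have := closureS sub cz; rewrite -(closure_id _).1.
Qed.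

Lemma base_closure x (t : R) : Omega x -> 0 <= t < T -> cCT (x, t).
Proof.
move=> Ox /andP[t0 tT] B [[B1 B2] /= [h1 /nbhs_ballP[e /= e0 h2]] hB].
pose t' := Num.min (t + e / 2) ((t + T) / 2).
have h3 : t < t' by rewrite lt_min; apply/andP; split; lra.
have h4 : t' <= t + e / 2 by rewrite ge_min lexx.
have h5 : t' <= (t + T) / 2 by rewrite ge_min lexx orbT.
exists (x, t'); split; first by split => //=; apply/andP; split; lra.
apply: hB; split => /=; first exact: nbhs_singleton h1.
by apply: h2; rewrite /ball /= ler0_norm ?subr_le0 ?ltW//; lra.
Qed.

Lemma free_node z : cCT z -> ~ lateral_boundary Omega T z -> Omega z.1 /\ 0 <= z.2 < T.
Proof.
move=> cz nl; have [c1 /andP[z0 zT]] := closure_cylinder cz.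
have Oz : Omega z.1.
  by apply: contrapT => nO; apply: nl; left; split; [split|rewrite z0].
split => //; rewrite z0 /= lt_neqAle zT andbT; apply/eqP => e.
by apply: nl; right.
Qed.

Lemma near_seq (I : eqType) (s : seq I) (F : set_system E) (P : I -> E -> Prop) : Filter F ->
  (forall i, i \in s -> \forall h \near F, P i h) -> \forall h \near F, forall i, i \in s -> P i h.
Proof.
move=> FF; elim: s => [|i s ih] h; first exact: filterE.
have h1 := h i (mem_head _ _).
have h2 := ih (fun j js => h j (mem_behead (s := i :: s) js)).
apply: filterS (filterI h1 h2) => x [x1 x2] j; rewrite inE => /orP[/eqP ->|] //.
exact: x2.
Qed.

(* By conformity every simplex containing [p] has the vertex [K i]; the other
   barycentric coordinates of [p] and [z] in it are proportional, so that both
   points lie on the same facets. *)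
Lemma hull_translation K i z (e : R) : K \in M -> hull K z -> 0 < bary K z i -> 0 < e < 1 ->
  let p := (1 - e) *: K i + e *: z in
  \forall h \near (0 : E), cCT (p + h) -> cCT (z + h).
Proof.
move=> KM hz bi /andP[e0 e1] p.
have hp : hull K p by apply: hull_convex => //; [exact: vertex_hull (nd KM)|rewrite !ltW].
have bp L j : L \in M -> bary L p j = (1 - e) * bary L (K i) j + e * bary L z j.
  move=> LM; rewrite !baryE /p dotpC dotpDl !dotpZl !(dotpC _ (bgrad _ _)); ring.
have bKp : 0 < bary K p i.
  rewrite bp// (bary_vertex i i (nd KM)) eqxx mulr1.
  by have := mulr_gt0 e0 bi; lra.
have nr : \forall h \near (0 : E), forall L, L \in M -> hull L (p + h) -> hull L (z + h).
  apply: (@near_seq _ M (nbhs (0 : E)) (fun L h => hull L (p + h) -> hull L (z + h))) => L LM; have nL := nd LM.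
  have [hLp|nLp] := pselect (hull L p); last first.
    have oL : open (~` hull L) by apply: closed_openC; exact: hull_closed.
    have : \forall h \near (0 : E), (~` hull L) (p + h).
      have o : open [set h : E | (~` hull L) (p + h)].
        by apply: (@open_comp E E (fun h => p + h) (~` hull L)) => // h _; exact: continuous_shift_left.
      by apply: open_nbhs_nbhs; split => //; rewrite /= addr0.
    by apply: filterS => h nh /nh.
  have [j0 Lj0 bj0] := conforming_vertex hM KM LM hp hLp bKp.
  have zj j : bary L p j = (1 - e) * (j == j0)%:R + e * bary L z j by rewrite bp// -Lj0 bary_vertex.
  have zj0 : 0 < bary L z j0.
    have := zj j0; rewrite bj0 bp// (bary_vertex i i (nd KM)) !eqxx => /addrI /(mulfI _).
    by rewrite gt_eqF// => /(_ isT) <-.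
  have bLz j : 0 <= bary L z j.
    have [->|jj] := eqVneq j j0; first exact: ltW.
    have := zj j; rewrite (negbTE jj) mulr0 add0r => ez.
    by have := (hullP p nL).1 hLp j; rewrite ez pmulr_rge0.
  have nj : \forall h \near (0 : E), forall j, 0 < bary L z j -> 0 <= bary L (z + h) j.
    have : \forall h \near (0 : E), forall j, j \in enum 'I_d.+2 -> 0 < bary L z j -> 0 <= bary L (z + h) j.
      apply: (@near_seq _ (enum 'I_d.+2) (nbhs (0 : E)) (fun j h => 0 < bary L z j -> 0 <= bary L (z + h) j)) => j _.
      have [bj|bj] := pselect (0 < bary L z j); last by apply: filterE => h /bj.
      have o : open [set h : E | 0 < bary L (z + h) j].
        apply: (@open_comp E R (fun h => bary L (z + h) j) [set r | 0 < r]); last exact: open_gt.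
        move=> h _; apply: (@continuous_comp _ _ _ (fun h : E => z + h) (bary L ^~ j)); first exact: continuous_shift_left.
        exact: bary_continuous.
      have : \forall h \near (0 : E), 0 < bary L (z + h) j.
        by apply: open_nbhs_nbhs; split => //; rewrite /= addr0.
      by apply: filterS => h h1 _; exact: ltW.
    by apply: filterS => h hj j; apply: hj; rewrite mem_enum.
  apply: filterS nj => h hj /(hullP _ nL) hph; apply/(hullP _ nL) => j.
  have := bLz j; rewrite le_eqVlt => /orP[/eqP ez|]; last exact: hj.
  have jj : (j == j0) = false by apply/negbTE; apply: contraTneq zj0 => <-; rewrite -ez ltxx.
  have hpj := hph j; rewrite bary_add zj jj mulr0 add0r -ez mulr0 add0r in hpj.
  by rewrite bary_add -ez add0r.
apply: filterS nr => h hL /(mesh_cover hM)[L LM hLp].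
exact: hull_closure LM (hL L LM hLp).
Qed.

(* A point of the boundary where the hat function does not vanish would, by
   [hull_translation], have a full neighbourhood in the closed cylinder. *)
Lemma hat_lateral z0 z : z0 \in nodes M -> ~ lateral_boundary Omega T z0 ->
  lateral_boundary Omega T z -> hatM z0 z = 0.
Proof.
move=> zN nl lz; apply/eqP; apply: contrapT => /negP hz.
have [K [i [KM hK Ki bi]]] := hat_neq0_hull hM zN hz.
have cz0 : cCT z0 by rewrite -Ki; exact: (hull_closure KM (vertex_hull i (nd KM))).
have [Oz0 /andP[z00 z0T]] := free_node cz0 nl.
have cz := hull_closure KM hK; have [cz1 /andP[z20 z2T]] := closure_cylinder cz.
pose p (e : R) : E := (1 - e) *: z0 + e *: z.
have cp : continuous p.
  move=> e; apply: cvgD; apply: cvgZr_tmp; last exact: cvg_id.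
  by apply: cvgB; [exact: cvg_cst|exact: cvg_id].
have p0 : p 0 = z0 by rewrite /p subr0 scale1r scale0r addr0.
have o1 : open [set e : R | Omega (p e).1 /\ (p e).2 < T].
  rewrite (_ : [set e | _] = (fun e => (p e).1) @^-1` Omega `&` (fun e => (p e).2) @^-1` [set y | y < T]).
    apply: openI; apply: open_comp.
    - move=> e _; apply: (@continuous_comp _ _ _ p fst); [exact: cp|exact: cvg_fst].
    - exact: lip_open.
    - move=> e _; apply: (@continuous_comp _ _ _ p snd); [exact: cp|exact: cvg_snd].
    - exact: open_lt.
  by [].
(* Close to the free node z0 the point p e still has its base point in Omega and its height below
   T. *)
have [e /andP[e0 e1] [Op pT]] : exists2 e : R, 0 < e < 1 & Omega (p e).1 /\ (p e).2 < T.
  have : nbhs (0 : R) [set e : R | Omega (p e).1 /\ (p e).2 < T] by apply: open_nbhs_nbhs; split; [exact: o1|change (Omega (p 0).1 /\ (p 0).2 < T); rewrite p0].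
  move=> /nbhs_ballP[r /= r0 hr]; pose e := Num.min (r / 2) (1 / 2).
  have e0 : 0 < e by rewrite lt_min; apply/andP; split; lra.
  have er : e <= r / 2 by rewrite ge_min lexx.
  have e1 : e <= 1 / 2 by rewrite ge_min lexx orbT.
  exists e; first by rewrite e0 /=; lra.
  by apply: hr; rewrite /ball /= sub0r normrN gtr0_norm//; lra.
have p2 : 0 <= (p e).2.
  have h1 : 0 <= (1 - e) * z0.2 by rewrite mulr_ge0// subr_ge0 ltW.
  have h2 : 0 <= e * z.2 by rewrite mulr_ge0// ltW.
  exact: addr_ge0 h1 h2.
have he01 : 0 < e < 1 by rewrite e0.
have ht := hull_translation KM hK bi he01; rewrite /= Ki in ht.
have {ht} [r /= r0 ht] : exists2 r : R, 0 < r & forall h : E, `|h| < r -> cCT (p e + h) -> cCT (z + h).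
  by have /nbhs_ballP[r r0 hr] := ht; exists r => // h hh; apply: hr; rewrite -ball_normE /= sub0r normrN.
(* The point p e may lie on the base; the upward shift by [eta] moves it into the open cylinder. *)
pose eta := Num.min (r / 2) ((T - (p e).2) / 2).
have eta0 : 0 < eta by rewrite lt_min; apply/andP; split; lra.
have eta1 : eta <= r / 2 by rewrite ge_min lexx.
have eta2 : eta <= (T - (p e).2) / 2 by rewrite ge_min lexx orbT.
case: lz => [[[_ nO] _]|[_ zT]]; last first.
  have : cCT (z + (0, eta)).
    apply: ht.
      rewrite prod_normE normr0 gt_max r0 /= gtr0_norm//; lra.
    apply: subset_closure; split; first by rewrite /= addr0.
    by apply/andP; split => /=; rewrite -[X in X + _]/((p e).2); lra.
  move=> /closure_cylinder[_ /andP[_]].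
  change (z.2 + eta <= T -> False); rewrite zT gerDl => h.
  by have := lt_le_trans eta0 h; rewrite ltxx.
apply: nO; apply: (lipschitz_interior_closure lO).
have /nbhs_ballP[r1 /= r10 hr1] : nbhs (p e).1 Omega by apply: open_nbhs_nbhs; split => //; exact: lip_open.
pose r2 := Num.min r r1.
have r20 : 0 < r2 by rewrite lt_min r0.
apply/nbhs_ballP; exists r2 => //= y; rewrite mx_norm_ball /ball_ /= lt_min => /andP[y1 y2].
have : cCT (z + (y - z.1, eta)).
  apply: ht.
    by rewrite prod_normE /= gt_max distrC y1 gtr0_norm//; lra.
  apply: subset_closure; split.
    apply: hr1; rewrite mx_norm_ball /ball_ /= -[X in X + _]/((p e).1).
    by rewrite opprD addrA subrr sub0r opprB.
  by apply/andP; split => /=; rewrite -[X in X + _]/((p e).2); lra.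
by move=> /closure_cylinder[]; rewrite /= addrC subrK.
Qed.

(* Reflection makes the hat function Lipschitz on the whole space, as required
   by [quasi_interpolation]. *)
Definition hat_ext z0 (z : E) : R := hatM z0 (z.1, `|z.2|).

(** The segment is covered by the simplices and by a closed set of parameters [Z] on which the hat
    function vanishes, so [piecewise_lipschitz] applies. The statement stays in the half-space
    because the hat function, extended by 0, may jump across the base. *)
Lemma hat_lip_halfspace z0 z w : z0 \in nodes M -> ~ lateral_boundary Omega T z0 ->
  0 <= z.2 -> 0 <= w.2 -> `|hatM z0 w - hatM z0 z| <= hat_lip * `|w - z|.
Proof.
move=> zN nl z20 w20.
pose pt (s : R) : E := z + s *: (w - z).
have cpt : continuous pt by exact: continuous_line.
have pt0 : pt 0 = z by rewrite /pt scale0r addr0.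
have pt1 : pt 1 = w by rewrite /pt scale1r addrC subrK.
have pt2 s : 0 <= s <= 1 -> 0 <= (pt s).2.
  move=> /andP[s0 s1]; rewrite /pt /=.
  rewrite (_ : _ + _ = (1 - s) * z.2 + s * w.2); last by rewrite /GRing.scale /=; ring.
  by rewrite addr_ge0// mulr_ge0// subr_ge0.
pose Z := closure [set s : R | 0 <= s <= 1 /\ ~ cCT (pt s)].
pose C (i : nat) : set R := if i is j.+1 then [set s | (j < size M)%N /\ hull (nth (head [ffun=> 0] M) M j) (pt s)] else Z.
pose u s := hatM z0 (pt s).
(* A limit of parameters outside the closed cylinder gives a point outside or on the lateral
   boundary: around any other point of the closed cylinder a whole neighbourhood in the half-space
   belongs to it. *)
have Z0 s : Z s -> 0 <= s <= 1 -> u s = 0.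
  move=> Zs hs; have [cs|ncs] := pselect (cCT (pt s)); last exact: hat_out.
  apply: (hat_lateral zN nl); apply: contrapT => nls.
  have [Os /andP[_ sT]] := free_node cs nls.
  have o1 : open [set t : R | Omega (pt t).1 /\ (pt t).2 < T].
    rewrite (_ : [set e | _] = (fun e => (pt e).1) @^-1` Omega `&` (fun e => (pt e).2) @^-1` [set y | y < T])//.
    apply: openI; apply: open_comp.
    - by move=> e _; apply: (@continuous_comp _ _ _ pt fst); [exact: cpt|exact: cvg_fst].
    - exact: lip_open.
    - by move=> e _; apply: (@continuous_comp _ _ _ pt snd); [exact: cpt|exact: cvg_snd].
    - exact: open_lt.
  have [t [[ht nt] [Ot tT]]] := Zs _ (open_nbhs_nbhs (conj o1 (conj Os sT))).
  by apply: nt; rewrite (surjective_pairing (pt t)); apply: base_closure => //; rewrite pt2.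
have Zsub s : Z s -> 0 <= s <= 1.
  move=> Zs; have cl : closed [set t : R | 0 <= t <= 1].
    rewrite (_ : [set t | _] = [set t : R | 0 <= t] `&` [set t | t <= 1]).
      by apply: closedI; [exact: closed_ge|exact: closed_le].
    by apply/seteqP; split => t /=; [move/andP|move=> h; apply/andP].
  have sub : [set s : R | 0 <= s <= 1 /\ ~ cCT (pt s)] `<=` [set t : R | 0 <= t <= 1] by move=> t [].
  by have := closureS sub Zs; rewrite -(closure_id _).1.
have := @piecewise_lipschitz R C u (hat_lip * `|w - z|) (size M).+1 0 1.
rewrite /u pt0 pt1 subr0 mulr1; apply => //.
- by rewrite mulr_ge0// hat_lip_ge0.
- move=> [|j] /=; first exact: closed_closure.
  have [jM|jM] := ltnP j (size M); last first.
    by rewrite (_ : [set s | _] = set0); [exact: closed0|apply/seteqP; split => // s []].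
  have cl : closed (hull (nth (head [ffun=> 0] M) M j)) by apply: hull_closed; apply: nd; exact: mem_nth.
  rewrite (_ : [set s | _] = pt @^-1` (hull (nth (head [ffun=> 0] M) M j))).
    by apply: closed_comp => // s _; exact: cpt.
  by apply/seteqP; split => [s []|s].
- move=> [|j] s t /=.
    move=> hs ht; rewrite -[hatM z0 (pt s)]/(u s) -[hatM z0 (pt t)]/(u t).
    by rewrite (Z0 _ hs (Zsub _ hs)) (Z0 _ ht (Zsub _ ht)) subrr normr0 mulr_ge0// mulr_ge0// hat_lip_ge0.
  move=> [jM hs] [_ ht]; apply: le_trans (hat_lip_hull zN (mem_nth _ jM) hs ht) _.
  rewrite -mulrA; apply: ler_wpM2l; first exact: hat_lip_ge0.
  by rewrite /pt opprD addrACA subrr add0r -scalerBl normrZ mulrC.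
move=> s hs; have [cs|ncs] := pselect (cCT (pt s)); last first.
  by exists 0 => //; apply: subset_closure.
have [K KM hK] := (mesh_cover hM _).1 cs.
exists (index K M).+1; first by rewrite ltnS index_mem.
by split; [rewrite index_mem|rewrite nth_index].
Qed.

Lemma hat_ext_lip z0 z w : z0 \in nodes M -> ~ lateral_boundary Omega T z0 ->
  `|hat_ext z0 w - hat_ext z0 z| <= hat_lip * `|w - z|.
Proof.
move=> zN nl; apply: le_trans (hat_lip_halfspace (z := (z.1, `|z.2|)) (w := (w.1, `|w.2|)) zN nl _ _) _ => //=.
apply: ler_wpM2l; first exact: hat_lip_ge0.
rewrite !prod_normE ge_max !le_max lexx /=; apply/orP; right.
exact: ler_dist_dist.
Qed.

End mesh_analysis.

(** * Hat functions of free nodes belong to H1L *)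

Section hyperplanes.
Context {R : realType}.
Local Notation leb1 := (@lebesgue_measure R).

Lemma measurable_hyperplane n (g : 'rV[R]_n) (c : R) : measurable [set x | dotv g x + c = 0].
Proof.
have mf : measurable_fun [set: 'rV[R]_n] (fun x => dotv g x + c).
  apply: measurable_funD; last exact: measurable_cst.
  by apply: measurable_sum => i; apply: measurable_funM; [exact: measurable_cst|exact: measurable_coord].
have := mf measurableT [set 0%R] (measurable_set1 _).
by rewrite setTI.
Qed.

(** If the first coefficient is nonzero, sections in the first variable are single points. Otherwise
    the order of integration is exchanged and the other sections are hyperplanes of lower
    dimension. *)
Lemma leb_hyperplane n (g : 'rV[R]_n) (c : R) : g != 0 -> leb n [set x | dotv g x + c = 0] = 0%E.
Proof.
elim: n g => [|n ih] g g0; first by rewrite (thinmx0 g) eqxx in g0.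
have mS := measurable_hyperplane g c; set S := [set x | _] in mS *.
have mP : measurable (@cons_rV R n @^-1` S).
  by rewrite -[_ @^-1` _]setTI; apply: measurable_cons_rV.
have SE x y : (@cons_rV R n @^-1` S) (x, y) <->
    g ord0 ord0 * y + (dotv (\row_i g ord0 (lift ord0 i)) x + c) = 0.
  rewrite /S /= /dotv big_ord_recl cons_rV0 /= -addrA.
  by under eq_bigr do rewrite cons_rVS; under [X in _ <-> _ * _ + (X + _) = _]eq_bigr do rewrite mxE.
rewrite /= /pushforward.
have [gz|gz] := eqVneq (g ord0 ord0) 0.
  have -> : (leb n \x leb1)%E (@cons_rV R n @^-1` S) = (leb n \x^ leb1)%E (@cons_rV R n @^-1` S).
    exact: (product_measure_unique (product_measure2E (leb n) leb1)).
  apply: integral0_eq => y _ /=.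
  rewrite (_ : ysection _ _ = [set x | dotv (\row_i g ord0 (lift ord0 i)) x + c = 0]).
    apply: ih; apply: contraNneq g0 => h; apply/eqP/rowP => i.
    rewrite mxE; case: (unliftP ord0 i) => [j ->|-> //].
    by have /rowP/(_ j) := h; rewrite !mxE.
  apply/seteqP; split => x; rewrite /ysection /= inE => h.
    by have := (SE x y).1 h; rewrite gz mul0r add0r.
  by apply/(SE x y); rewrite gz mul0r add0r.
apply: integral0_eq => x _ /=.
rewrite (_ : xsection _ _ = [set - (dotv (\row_i g ord0 (lift ord0 i)) x + c) / g ord0 ord0]).
  exact: lebesgue_measure_set1.
apply/seteqP; split => y; rewrite /xsection /= inE.
  move=> /(SE x y) h; apply: (mulfI gz); rewrite mulrCA divff// mulr1; by apply/eqP; rewrite -addr_eq0; apply/eqP.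
by move=> ->; apply/(SE x _); rewrite mulrCA divff// mulr1 addNr.
Qed.

Lemma vol_hyperplane d (g : 'rV[R]_d * R) (c : R) : g != 0 ->
  @measurable _ ('rV[R]_d * measurableTypeR R)%type [set z | dotp g z + c = 0] /\
  vol d [set z | dotp g z + c = 0] = 0%E.
Proof.
move=> g0; pose S := [set x | dotv (cons_rV g) x + c = 0].
have e : [set z | dotp g z + c = 0] = @cons_rV R d @^-1` S.
  by apply/funext => z; rewrite /S /= dotpE.
split; first by rewrite e -[_ @^-1` _]setTI; apply: measurable_cons_rV => //; exact: measurable_hyperplane.
rewrite e; apply: (@leb_hyperplane d.+1 (cons_rV g) c).
apply: contraNneq g0 => h; apply/eqP; rewrite -(cons_rVK g) h.
by rewrite -[0 in LHS](_ : cons_rV (0 : 'rV[R]_d * R) = 0) ?cons_rVK//; apply/rowP => i; rewrite -[LHS]/(crd i 0) mxE -(scale0r (0 : 'rV[R]_d * R)) crdZ mul0r.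
Qed.

End hyperplanes.

Section dominated.
Context {R : realType} dd (X : measurableType dd) (mu : {measure set X -> \bar R}).
Variables (D : set X) (mD : measurable D) (w : X -> R).
Hypotheses (mw : measurable_fun D w) (w_gt0 : forall z, D z -> 0 < w z).
Hypothesis iw : mu.-integrable D (EFin \o w).

Lemma ip_cvg_dominated (u : nat -> X -> R^o) (v : X -> R^o) (C : R) :
  (forall n, measurable_fun D (u n)) -> measurable_fun D v ->
  (forall n z, D z -> `|u n z - v z| <= C) ->
  {ae mu, forall z, D z -> u n z @[n --> \oo] --> v z} -> form_cvg (ip mu D w) u v.
Proof.
move=> mu_ mv hC hae.
pose f n (z : X) : \bar R := ((u n z - v z) ^+ 2 * w z)%:E.
pose g (z : X) : \bar R := (C ^+ 2 * w z)%:E.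
have mf n : measurable_fun D (f n).
  apply/measurable_EFinP; apply: measurable_funM; last exact: mw.
  by apply: measurable_funX; apply: measurable_funB.
have ig : mu.-integrable D g.
  by have := integrableZl mD (C ^+ 2) iw; apply: eq_integrable => // z _; rewrite /g EFinM.
have hf : {ae mu, forall z, D z -> f n z @[n --> \oo] --> (cst 0%E : X -> \bar R) z}.
  apply: (@filterS _ _ (ae_filter_ringOfSetsType mu) _ _ _ hae) => z hz Cz; have {}hz := hz Cz.
  have h2 : (u n z - v z) ^+ 2 * w z @[n --> \oo] --> ((v z - v z) ^+ 2 * w z : R^o).
    under eq_fun do rewrite expr2; rewrite expr2; apply: cvgM; last exact: cvg_cst.
    by apply: cvgM; apply: cvgB => //; exact: cvg_cst.
  rewrite subrr expr2 !mul0r in h2.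
  exact: cvg_EFin_real h2.
have hfg : {ae mu, forall z n, D z -> (`|f n z| <= g z)%E}.
  apply: aeW => z n Cz; rewrite /f /g /= lee_fin normrM (ger0_norm (ltW (w_gt0 Cz))).
  apply: ler_wpM2r; first exact: ltW (w_gt0 Cz).
  by rewrite normrX ler_sqr ?nnegrE//; [exact: hC|exact: le_trans (hC n z Cz)].
have [_ _ h] := @dominated_convergence _ X R mu D mD f (cst 0%E) g mf (measurable_cst _) hf ig hfg.
rewrite integral0 in h.
move=> e e0; have /fine_cvgP[_ /cvgrPdist_le hfin] := h.
have [N _ hN] := hfin e e0; exists N => n Nn.
have := hN n Nn; rewrite /= sub0r normrN.
apply: le_trans; rewrite /ip /Rintegral; apply: le_trans (ler_norm _) _.
by rewrite le_eqVlt; apply/orP; left; apply/eqP; congr (`|fine _|); apply: eq_integral => z _; rewrite /f expr2.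
Qed.

End dominated.

Section hat_space.
Context {R : realType} (d : nat) (Omega : set 'rV[R]_d) (T a gamma sigma : R)
  (M : seq (simplex (R := R) d)).
Local Notation E := ('rV[R]_d * R)%type.
Local Notation Em := ('rV[R]_d * measurableTypeR R)%type.
Local Notation CT := (cylinder Omega T).
Local Notation H := (mesh_size M).
Local Notation nu := (vol d).
Hypotheses (lO : lipschitz_domain Omega) (T0 : 0 < T) (ha : -1 < a < 1) (hM : triangulates M CT)
  (hreg : shape_regular gamma M) (hqu : quasi_uniform sigma M).
Local Notation nd := (mesh_nondegenerate hM).
Local Notation hatM := (hat Omega T M).
Local Notation hat_extM := (hat_ext Omega T M).
Local Notation oO := (lip_open lO).
Local Notation bO := (lip_bounded lO).
Local Notation Lip := (@hat_lip R d gamma sigma M).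
Local Notation wt := (@wt R d a).
Local Notation L2C := (@l2 R _ Em nu CT wt).
Local Notation ipC_ := (@ip R _ Em nu CT wt).
Local Notation V2 := (V2 Omega T a).
Local Notation vip := (vip Omega T a).
Local Notation wg := (wgrad CT).
Local Notation W := (H1w a CT).
Local Notation mCT := (measurable_cylinder T oO).
Local Notation mwt := (@measurable_wt R d Omega T a).
Local Notation wt_gt0 := (@wt_gt0 R d Omega T a).
Implicit Types (z w p : E) (K : simplex (R := R) d).

Lemma bgrad_neq0 K i : Defs.nondegenerate K -> bgrad K i != 0.
Proof.
move=> nK; apply/eqP => h; have [j ji] : exists j : 'I_d.+2, j != i.
  have [->|i0] := eqVneq i ord0; first by exists ord_max.
  by exists ord0; rewrite eq_sym.
have b0 v : dotp (bgrad K i) v = 0.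
  by rewrite h dotpE big1// => k _; rewrite (_ : crd k 0 = 0) ?mul0r// -(scale0r (0 : E)) crdZ mul0r.
have := bary_vertex i i nK; have := bary_vertex j i nK.
by rewrite !baryE !b0 !add0r eqxx [i == j]eq_sym (negbTE ji) => -> /eqP; rewrite eq_sym oner_eq0.
Qed.

(** The faces of a simplex lie on the hyperplanes where a barycentric coordinate vanishes, and there
    are finitely many of them. *)
Lemma ae_hull_interior : {ae nu, forall z, forall K, K \in M -> hull K z -> forall i, 0 < bary K z i}.
Proof.
apply: (@near_seq R d _ M (almost_everywhere nu) (fun K z => hull K z -> forall i, 0 < bary K z i) (ae_filter_ringOfSetsType nu)) => K KM.
have h : {ae nu, forall z, forall i, i \in enum 'I_d.+2 -> bary K z i != 0}.
  apply: (@near_seq R d _ (enum 'I_d.+2) (almost_everywhere nu) (fun i z => bary K z i != 0) (ae_filter_ringOfSetsType nu)) => i _.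
  have [m1 m2] := vol_hyperplane (bcst K i) (bgrad_neq0 i (nd KM)).
  exists [set z | dotp (bgrad K i) z + bcst K i = 0]; split => // z /=.
  by rewrite baryE => /negP; rewrite negbK => /eqP.
apply: ae_volS h => z h /(hullP _ (nd KM)) hz i.
by rewrite lt_neqAle hz andbT eq_sym h// mem_enum.
Qed.

Section gradient.
Variables (z0 : E).
Hypotheses (zN : z0 \in nodes M) (nl : ~ lateral_boundary Omega T z0).

Definition hull_grad K : E := xget 0 [set g | normp g <= gamma * sigma / H /\
  exists c, forall z, hull K z -> hatM z0 z = dotp g z + c].

Lemma hull_gradP K : K \in M -> normp (hull_grad K) <= gamma * sigma / H /\
  exists c, forall z, hull K z -> hatM z0 z = dotp (hull_grad K) z + c.
Proof.
move=> KM; have [g [c [h1 h2]]] := hat_affine lO T0 hM hreg hqu zN KM.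
have := @xgetPex _ (0 : E) [set g | normp g <= gamma * sigma / H /\
  exists c, forall z, hull K z -> hatM z0 z = dotp g z + c].
by apply; exists g; split => //; exists c.
Qed.

Definition piece_grad (s : seq (simplex (R := R) d)) (z : E) : E :=
  foldr (fun K acc => if `[< hull K z >] then hull_grad K else acc) 0 s.

Lemma piece_grad_hull s z : (exists2 K, K \in s & hull K z) ->
  exists K, [/\ K \in s, hull K z & piece_grad s z = hull_grad K].
Proof.
elim: s => [|L s ih] [K] //= Ks hK.
have [hL|nL] := asboolP (hull L z); first by exists L; split => //; rewrite mem_head.
have [|K' [K's hK' e]] := ih; last by exists K'; split => //; rewrite inE K's orbT.
by exists K => //; move: Ks; rewrite inE => /orP[/eqP eK|//]; rewrite eK in hK.
Qed.

Lemma measurable_piece_grad s i : {subset s <= M} ->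
  @measurable_fun _ _ Em R CT (fun z => crd i (piece_grad s z)).
Proof.
elim: s => [|K s ih] sM; first exact: (@measurable_cst _ _ Em R CT (crd i 0)).
have KM : K \in M by apply: sM; rewrite mem_head.
rewrite (_ : (fun z => _) = (fun z : Em => \1_(hull K) z * crd i (hull_grad K) +
    (1 - \1_(hull K) z) * crd i (piece_grad s z))).
  have mI : @measurable_fun _ _ Em R CT \1_(hull K : set Em).
    by apply: measurable_indic; apply: compact_measurable_E; exact: hull_compact (nd KM).
  apply: measurable_funD; apply: measurable_funM => //.
    by apply: measurable_funB => //; exact: measurable_cst.
  by apply: ih => L Ls; apply: sM; rewrite inE Ls orbT.
apply/funext => z /=; rewrite indicE.
have [h|h] := asboolP (hull K z); first by rewrite mem_set// mul1r subrr mul0r addr0.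
by rewrite memNset// mul0r add0r subr0 mul1r.
Qed.

Lemma crd_piece_grad_le z i : CT z -> `|crd i (piece_grad M z)| <= gamma * sigma / H.
Proof.
move=> Cz; have [K [KM _ ->]] := piece_grad_hull ((mesh_cover hM z).1 (subset_closure Cz)).
apply: le_trans (crd_le_norm _ _) _; apply: le_trans (norm_le_normp _) _.
by have [] := hull_gradP KM.
Qed.

Lemma V2_piece_grad : V2 (piece_grad M).
Proof.
move=> i; apply: (l2_bounded oO bO T0 ha (C := gamma * sigma / H)).
  exact: measurable_piece_grad.
by move=> z; exact: crd_piece_grad_le.
Qed.

Lemma hat_ext_cylinder z : 0 <= z.2 -> hat_extM z0 z = hatM z0 z.
Proof. by move=> h; rewrite /hat_ext ger0_norm// -surjective_pairing. Qed.

Lemma hat_ext_ge0 z : 0 <= hat_extM z0 z.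
Proof. exact: (hat_ge0 hM). Qed.

Lemma hat_ext_affine_near z : CT z -> (forall K, K \in M -> hull K z -> forall i, 0 < bary K z i) ->
  exists2 c, hat_extM z0 z = dotp (piece_grad M z) z + c & exists2 r, 0 < r & forall w, `|w - z| < r ->
    hat_extM z0 w = dotp (piece_grad M z) w + c.
Proof.
move=> Cz hb; have [K [KM hK ->]] := piece_grad_hull ((mesh_cover hM z).1 (subset_closure Cz)).
have [_ [c hc]] := hull_gradP KM.
have [_ /andP[z20 _]] := Cz.
have n1 : \forall w \near z, forall i, i \in enum 'I_d.+2 -> 0 < bary K w i.
  apply: (@near_seq R d _ (enum 'I_d.+2) (nbhs z) (fun i w => 0 < bary K w i)) => i _.
  apply: (@open_nbhs_nbhs _ z [set w | 0 < bary K w i]); split; last exact: hb.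
  by apply: (@open_comp E R (bary K ^~ i) [set r | 0 < r]); [move=> w _; exact: bary_continuous|exact: open_gt].
have n2 : \forall w \near z, 0 < w.2.
  apply: (@open_nbhs_nbhs _ z [set w : E | 0 < w.2]); split => //.
  by apply: (@open_comp E R snd [set r | 0 < r]); [move=> w _; exact: cvg_snd|exact: open_gt].
have key w : (forall i, i \in enum 'I_d.+2 -> 0 < bary K w i) -> 0 < w.2 -> hat_extM z0 w = dotp (hull_grad K) w + c.
  move=> h1 h2; rewrite hat_ext_cylinder ?ltW//; apply: hc; apply/(hullP _ (nd KM)) => i.
  by apply: ltW; apply: h1; rewrite mem_enum.
exists c; first by apply: key => // i _; exact: hb.
have : nbhs z [set w | (forall i, i \in enum 'I_d.+2 -> 0 < bary K w i) /\ 0 < w.2] .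
  exact: (@filterI _ (nbhs z) _ _ _ n1 n2).
move=> /nbhs_ballP[r /= r0 hr]; exists r => // w wz; have [|h1 h2] := hr w; first by rewrite -ball_normE /= distrC.
exact: key.
Qed.

End gradient.

Lemma integrable_wt : nu.-integrable CT (EFin \o wt).
Proof.
have aN1 : -1 < a by case/andP: ha.
exact: (integrable_powR_cylinder oO bO T0 aN1).
Qed.

Lemma form_cvg_vip (F : nat -> E -> E) (G : E -> E) :
  (forall i, form_cvg ipC_ (fun n => (fun z => crd i (F n z)) : E -> R^o) (fun z => crd i (G z))) -> form_cvg vip F G.
Proof.
move=> h e e0.
have /choice[N hN] i : exists N, forall n, (N <= n)%N ->
    ipC_ ((fun z => crd i (F n z)) - (fun z => crd i (G z)) : E -> R^o) ((fun z => crd i (F n z)) - (fun z => crd i (G z)) : E -> R^o) <= e / d.+1%:R.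
  by apply: h; rewrite divr_gt0.
exists (\max_i N i)%N => n hn.
apply: (@le_trans _ _ (\sum_(i < d.+1) (e / d.+1%:R))); last first.
  by rewrite sumr_const card_ord -[X in X <= _]mulr_natr divfK ?lexx// pnatr_eq0.
apply: ler_sum => i _; have := hN i n (leq_trans (leq_bigmax i) hn).
rewrite (_ : (fun z => crd i ((F n - G) z)) = ((fun z => crd i (F n z)) - (fun z => crd i (G z)) : E -> R^o)) //.
by apply/funext => z; rewrite -[(F n - G) z]/(F n z - G z) crdD -scaleN1r crdZ mulN1r.
Qed.

Lemma hat_H1L_trace z0 : z0 \in nodes M -> ~ lateral_boundary Omega T z0 ->
  H1L Omega T a (hatM z0) /\ is_trace Omega T a (hatM z0) (fun x => hatM z0 (x, 0)).
Proof.
move=> zN nl; set F := hat_extM z0; set L := Lip.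
have L0 : 0 <= L by exact: (hat_lip_ge0 lO T0 hM hreg hqu).
have [C C0 hC] := @quasi_interpolation R d.
have [rho1 rho10 hrho1] := cylinder_bounded bO T0.
pose rho := rho1 + 1; have rho0 : 0 < rho by rewrite addr_gt0.
have hrho z : CT z -> `|z| < rho by move=> /hrho1 h; rewrite ltr_pwDr.
have FL z w : `|F w - F z| <= L * `|w - z| by exact: (hat_ext_lip lO T0 hM hreg hqu).
pose de n : R := n.+1%:R^-1.
(* With this step [F] varies by at most [de n] over a stencil of radius 2 e n, so the truncated
   function vanishes on every stencil centred at a zero of [F]. *)
pose e n : R := de n / (2 * (L + 1)).
have de0 n : 0 < de n by rewrite invr_gt0.
have e0 n : 0 < e n by rewrite divr_gt0// mulr_gt0//; lra.
have eL n : L * (2 * e n) <= de n.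
  rewrite /e; set q := de n; have q0 : 0 < q := de0 n.
  rewrite (_ : L * (2 * (q / (2 * (L + 1)))) = q * (L / (L + 1))); last by field; apply: lt0r_neq0; lra.
  by rewrite ger_pMr// ler_pdivrMr; lra.
have ede n : e n <= de n.
  rewrite ler_pdivrMr; last by rewrite mulr_gt0//; lra.
  by rewrite ler_peMr; [|exact: ltW|lra].
have dec : de n @[n --> \oo] --> (0 : R) by exact: cvg_harmonic.
(* Truncating at height [de n] makes the approximation vanish near the lateral
   boundary. *)
pose Fd n z : R := Num.max (F z - de n) 0.
have FdL n z w : `|Fd n w - Fd n z| <= L * `|w - z|.
  apply: le_trans (FL z w); rewrite /Fd ler_norml;
  have h1 := ler_norm (F w - F z); have h2 := ler_norm (F z - F w); rewrite distrC in h2.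
  have h0 := normr_ge0 (F w - F z).
  case: (leP (F w - de n) 0) => a1; case: (leP (F z - de n) 0) => a2; apply/andP; split; lra.
have /choice[phi hphi] n := hC (Fd n) L rho (e n) (e0 n) rho0 L0 (FdL n).
have sphi n : csmooth (phi n) by case: (hphi n).
have FdF n z : `|Fd n z - F z| <= de n.
  have := hat_ext_ge0 zN z; rewrite -/F => Fz; have d0 := de0 n.
  by rewrite /Fd ler_norml; case: (leP (F z - de n) 0) => a1; apply/andP; split; lra.
have phiF n z : `|z| < rho -> `|phi n z - F z| <= (C * L + 1) * de n.
  move=> hz; have [_ _ h3 _ _] := hphi n.
  rewrite (_ : phi n z - F z = (phi n z - Fd n z) + (Fd n z - F z)); last by ring.
  apply: le_trans (ler_normD _ _) _; rewrite mulrDl mul1r; apply: lerD => //.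
  by apply: le_trans (h3 _ hz) _; apply: ler_wpM2l; [exact: mulr_ge0|exact: ede].
have CTF z : CT z -> hatM z0 z = F z.
  by move=> [_ /andP[h _]]; rewrite /F hat_ext_cylinder// ltW.
have de1 n : de n <= 1 by rewrite invf_le1// ler1n.
have cF : continuous F.
  move=> z; apply/cvgrPdist_le => q q0.
  suff : nbhs (z : E) [set w : E | `|F z - F w| <= q] by [].
  apply/nbhs_ballP; exists (q / (L + 1)) => /=; first by rewrite divr_gt0//; lra.
  move=> w; rewrite -ball_normE /= => wz; rewrite distrC; apply: le_trans (FL z w) _.
  have h1 : (L + 1) * `|w - z| <= q by rewrite mulrC -ler_pdivlMr ?ltW 1?distrC//; lra.
  by apply: le_trans h1; apply: ler_wpM2r => //; lra.
have mh : @measurable_fun _ _ Em R CT (hatM z0).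
  have mF : @measurable_fun _ _ Em R CT F by apply: measurable_funTS; exact: continuous_measurable_E.
  by apply: eq_measurable_fun mF => z; rewrite inE => Cz; rewrite CTF.
have l2h : L2C (hatM z0).
  apply: (l2_bounded oO bO T0 ha mh (C := 1)) => z _.
  by rewrite ger0_norm ?hat_ge0 ?hat_le1.
have mphi n : @measurable_fun _ _ Em R CT (phi n).
  by apply: measurable_funTS; apply: continuous_measurable_E; exact: csmooth_continuous.
have c1 : form_cvg ipC_ phi (hatM z0).
  apply: (@ip_cvg_dominated R _ Em nu CT mCT wt mwt wt_gt0 integrable_wt phi (hatM z0) (C * L + 1)) => //.
    move=> n z Cz; rewrite CTF//; apply: le_trans (phiF n z (hrho _ Cz)) _.
    by rewrite ler_piMr// addr_ge0// mulr_ge0.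
  apply: aeW => z Cz; rewrite CTF//; apply/cvgrPdist_le => q q0.
  have /cvgrPdist_le h : (C * L + 1) * de n @[n --> \oo] --> ((C * L + 1) * 0 : R).
    by apply: cvgMr.
  rewrite mulr0 in h; near=> n; rewrite distrC.
  apply: le_trans (phiF n z (hrho _ Cz)) _; apply: le_trans (ler_norm _) _.
  by rewrite -normrN -sub0r; near: n; exact: h.
set G := piece_grad z0 M.
have hG : V2 G by exact: V2_piece_grad.
have gs0 : 0 <= gamma * sigma / H.
  by rewrite divr_ge0 ?mulr_ge0 ?ltW// ?(gamma_gt0 lO T0 hM hreg) ?(sigma_gt0 lO T0 hM hqu) ?(mesh_size_gt0 lO T0 hM).
have c2 : form_cvg vip (fun n => grad (phi n)) G.
  apply: form_cvg_vip => i; apply: (@ip_cvg_dominated R _ Em nu CT mCT wt mwt wt_gt0 integrable_wt _ _ (C * L + gamma * sigma / H)).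
  - move=> n; apply: measurable_funTS; apply: continuous_measurable_E.
    rewrite (_ : (fun z => _) = 'D_(ebas i) (phi n)); last by apply/funext => z; rewrite crd_grad.
    exact: csmooth_continuous (csmooth_derive _ (sphi n)).
  - exact: measurable_piece_grad.
  - move=> n z Cz; apply: le_trans (ler_normB _ _) _; apply: lerD; last exact: crd_piece_grad_le.
    by rewrite crd_grad; have [_ _ _ h _] := hphi n; exact: h (hrho _ Cz).
  apply: ae_volS ae_hull_interior => z hz Cz.
  have [c hc [r r0 hr]] := hat_ext_affine_near zN Cz hz; rewrite -/F -/G in hc hr.
  (* Gradients are eventually exact, not merely convergent: z is interior to an affine piece and the
     stencil fits into it once [de n] is small. *)
  have [q q0 hq] : exists2 q : R, 0 < q & forall n, de n < q -> crd i (grad (phi n) z) = crd i (G z).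
    (* If F z = 0, then z is an interior minimum of a function that is affine around it, so the
       gradient is 0 there. *)
    have := hat_ext_ge0 zN z; rewrite -/F le_eqVlt => /orP[/eqP Fz0|Fz0].
      have Gz : G z = 0.
        apply/eqP; rewrite -normr_eq0; apply/eqP; suff : normp (G z) = 0 by move=> /normp_eq0 ->; rewrite normr0.
        apply/eqP; apply: contrapT => /negP g0.
        have gp : 0 < `|G z|.
          by rewrite normr_gt0; apply: contraNneq g0 => ->; rewrite /normp dotpE big1 ?sqrtr0// => k _; rewrite (_ : crd k 0 = 0) ?mul0r// -(scale0r (0 : E)) crdZ mul0r.
        pose t := r / 2 / `|G z|; have t0 : 0 < t by rewrite !divr_gt0.
        have := hr (z - t *: G z).
        have -> : z - t *: G z - z = - (t *: G z) by rewrite addrAC subrr add0r.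
        rewrite normrN normrZ gtr0_norm// /t divfK ?gt_eqF// -/t => h.
        have {}h := h ltac:(lra); have := hat_ext_ge0 zN (z - t *: G z).
        rewrite -/F h dotpC dotpDl -scaleNr dotpZl -normp_sqr dotpC addrAC -hc -Fz0 add0r mulNr oppr_ge0.
        by rewrite leNgt mulr_gt0// exprn_even_gt0.
      have c00 : c = 0.
        by move: hc; rewrite -Fz0 Gz dotpE big1 ?add0r// => k _; rewrite (_ : crd k 0 = 0) ?mul0r// -(scale0r (0 : E)) crdZ mul0r.
      exists (r / 2); first exact: divr_gt0.
      move=> n nr; rewrite crd_grad; have [_ _ _ _ h] := hphi n.
      apply: (h z (G z) 0 (hrho _ Cz)) => w wz.
      have ww : `|w - z| < r.
        by apply: le_lt_trans wz _; have := ede n; lra.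
      by rewrite /Fd hr// c00 Gz addr0 (_ : dotp 0 w = 0) ?sub0r ?max_r// ?oppr_le0 ?ltW// dotpE big1// => k _; rewrite (_ : crd k 0 = 0) ?mul0r// -(scale0r (0 : E)) crdZ mul0r.
    (* If F z > 0, the truncation is inactive around z and only subtracts the constant [de n]. *)
    exists (Num.min (r / 2) (F z / 2)); first by rewrite lt_min !divr_gt0.
    move=> n; rewrite lt_min => /andP[n1 n2]; rewrite crd_grad; have [_ _ _ _ h] := hphi n.
    apply: (h z (G z) (c - de n) (hrho _ Cz)) => w wz.
    have ww : `|w - z| < r.
      by apply: le_lt_trans wz _; have := ede n; lra.
    have h1 : F z - F w <= de n.
      apply: le_trans (ler_norm _) _; rewrite distrC; apply: le_trans (FL z w) _.
      by apply: le_trans (eL n); apply: ler_wpM2l.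
    by rewrite /Fd max_l ?hr ?addrA//; rewrite -hr//; lra.
  apply: cvg_near_cst; have /cvgrPdist_lt/(_ q q0) := dec.
  by apply: filterS => n; rewrite sub0r normrN gtr0_norm// => /hq ->.
have wgG n := weak_gradient_csmooth oO bO T0 ha (sphi n).
have c3 : form_cvg vip (fun n => wg (phi n)) G.
  move=> q q0; have [N hN] := c2 q q0; exists N => n /hN.
  rewrite (@vip_ae2 R d Omega T a oO (wg (phi n) - G) (grad (phi n) - G))//.
  - by rewrite -scaleN1r addrC; apply: (V2_lin oO) => //; case: (wgG n).
  - by rewrite -scaleN1r addrC; apply: (V2_lin oO) => //; exact: (V2_grad oO bO T0 ha).
  by have [_] := wgG n; apply: ae_volS => z h Cz; rewrite -[LHS]/(wg (phi n) z - G z) h.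
have hw : is_weak_gradient CT (hatM z0) G.
  apply: (weak_gradient_closed oO bO T0 ha _ l2h hG c1 c3) => n.
  exact: (H1w_csmooth oO bO T0 ha).
have Wh : W (hatM z0) by exact: (H1w_of_weak_gradient oO l2h hw hG).
have c4 : form_cvg vip (fun n => grad (phi n)) (wg (hatM z0)).
  have [hV hae] := weak_gradient_wg oO hw hG.
  move=> q q0; have [N hN] := c2 q q0; exists N => n /hN.
  rewrite (@vip_ae2 R d Omega T a oO (grad (phi n) - G) (grad (phi n) - wg (hatM z0)))//.
  - by rewrite -scaleN1r addrC; apply: (V2_lin oO) => //; exact: (V2_grad oO bO T0 ha).
  - by rewrite -scaleN1r addrC; apply: (V2_lin oO) => //; exact: (V2_grad oO bO T0 ha).
  by apply: ae_volS hae => z h Cz; rewrite -[RHS]/(grad (phi n) z - wg (hatM z0) z) h.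
have trF : (fun x => hatM z0 (x, 0)) = tr F.
  by apply/funext => x; rewrite /tr /F hat_ext_cylinder.
split; last first.
  apply/is_traceP; rewrite trF; split; first exact: (l2O_tr oO bO cF).
  exists phi; split; first by apply/(smooth_approxP oO bO T0 ha _ Wh); split; [exact: sphi|exact: c1|exact: c4].
  have mtr (f : E -> R) : continuous f -> measurable_fun Omega (tr f).
    by move=> cf; apply: measurable_funTS; apply: continuous_measurable_rV; exact: continuous_tr.
  have bx x : Omega x -> `|(x, 0) : E| < rho.
    move=> Ox; have : `|(x, 0) : E| <= rho1.
      by apply: (closure_norm_le (A := CT)) => [w|]; [exact: hrho1|apply: base_closure; rewrite ?lexx].
    by move=> h; rewrite ltr_pwDr.
  have i1 : (leb d).-integrable Omega (EFin \o (cst 1 : 'rV[R]_d -> R)).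
    have [_] := l2O_bounded oO bO (C := 1) (measurable_cst (1 : R)) (fun x _ => ltac:(by rewrite normr1)).
    by apply: eq_integrable => [|x _]; [exact: (measurable_Omega oO)|rewrite /= mulr1 expr1n].
  have hdist n x : Omega x -> `|tr (phi n) x - tr F x| <= (C * L + 1) * de n.
    by move=> Ox; exact: phiF (bx x Ox).
  apply: (@ip_cvg_dominated R _ 'rV[R]_d (leb d) Omega (measurable_Omega oO) (cst 1) _ _ i1 _ _ (C * L + 1)).
  - exact: measurable_cst.
  - by [].
  - by move=> n; apply: mtr; exact: csmooth_continuous.
  - exact: mtr.
  - move=> n x Ox; apply: le_trans (hdist n x Ox) _.
    by rewrite ler_piMr// addr_ge0// mulr_ge0.
  apply: aeW => x Ox; apply/cvgrPdist_le => q q0.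
  have /cvgrPdist_le h : (C * L + 1) * de n @[n --> \oo] --> ((C * L + 1) * 0 : R).
    by apply: cvgMr.
  rewrite mulr0 in h; near=> n; rewrite distrC.
  apply: le_trans (hdist n x Ox) _; apply: le_trans (ler_norm _) _.
  by rewrite -normrN -sub0r; near: n; exact: h.
apply/(H1LP oO bO T0 ha); split; first exact: Wh.
exists phi; split; [exact: sphi|exact: c1|exact: c4|].
move=> n z lz; have [_ h _ _ _] := hphi n; apply: h => w wz.
have z20 : 0 <= z.2 by case: lz => [[_ /andP[]]|[_ ->]] //; exact: ltW.
have Fz : F z = 0 by rewrite /F hat_ext_cylinder// (hat_lateral lO hM zN nl lz).
rewrite /Fd max_r// subr_le0; have := FL z w; rewrite Fz subr0 => h1.
apply: le_trans (ler_norm _) _; apply: le_trans h1 _; apply: le_trans (eL n).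
exact: ler_wpM2l.
Unshelve. all: end_near. Qed.

Lemma hat_VH z0 : z0 \in nodes M -> ~ lateral_boundary Omega T z0 -> VH Omega T a M (hatM z0).
Proof. by move=> zN nl; split; [have [] := hat_spec hM zN|have [] := hat_H1L_trace zN nl]. Qed.

End hat_space.

(** * The quasi-interpolation operator *)

Section lebesgue_balls.
Context {R : realType}.

(** A null set contains no ball. *)
Lemma ae_leb_nbhs n (P : 'rV[R]_n -> Prop) (x : 'rV[R]_n) :
  {ae leb n, forall y, P y} -> (\forall y \near x, ~ P y) -> False.
Proof.
move=> [N [mN N0 hN]] /nbhs_ballP[r /= r0 hr].
have : (leb n (ball x r) <= leb n N)%E.
  apply: le_measure; rewrite ?inE//; first exact: measurable_ball_rV.
  by move=> y yx; apply: hN => /= Py; exact: (hr y).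
by rewrite N0 leb_ball// lee_fin leNgt exprn_gt0// mulr_gt0.
Qed.

Lemma ae_vol_nbhs d (P : 'rV[R]_d * R -> Prop) (z : 'rV[R]_d * R) :
  {ae vol d, forall y, P y} -> (\forall y \near z, ~ P y) -> False.
Proof.
move=> [N [mN N0 hN]] /nbhs_ballP[r /= r0 hr].
have : (vol d (ball z r) <= vol d N)%E.
  apply: le_measure; rewrite ?inE//; first exact: measurable_ball_E.
  by move=> y yx; apply: hN => /= Py; exact: (hr y).
by rewrite N0 vol_ball// lee_fin leNgt exprn_gt0// mulr_gt0.
Qed.

End lebesgue_balls.

Section zext.
Context {R : realType} dd (X : measurableType dd) (mu : {measure set X -> \bar R}).
Variables (D : set X) (mD : measurable D) (w : X -> R).
Hypotheses (mw : measurable_fun D w) (w_gt0 : forall z, D z -> 0 < w z).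

(** Extension by zero turns integrals over a patch into inner products over the whole domain, so
    that all local projections live in one space. *)
Definition zext (P : set X) (f : X -> R) : X -> R^o := fun x => \1_P x * f x.

Lemma zextE P f x : P x -> zext P f x = f x.
Proof. by move=> Px; rewrite /zext indicE mem_set// mul1r. Qed.

Lemma zext_out P f x : ~ P x -> zext P f x = 0.
Proof. by move=> Px; rewrite /zext indicE memNset// mul0r. Qed.

Lemma zext_lin P c (f g : X -> R^o) : zext P (c *: f + g) = c *: zext P f + zext P g.
Proof.
apply/funext => x; rewrite -[RHS]/(c * zext P f x + zext P g x) /zext.
by rewrite -[(c *: f + g) x]/(c * f x + g x); ring.
Qed.

Lemma l2_zext P f : measurable P -> l2 mu D w f -> l2 mu D w (zext P f).
Proof.
move=> mP [mf fi]; have mM : measurable_fun D (zext P f).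
  by apply: measurable_funM => //; apply: measurable_indic.
split => //; apply: le_integrable fi => //.
  by apply/measurable_EFinP; apply: measurable_funM => //; exact: measurable_funX.
move=> x Dx; have w0 := ltW (w_gt0 Dx).
have h : zext P f x ^+ 2 <= f x ^+ 2.
  have [Px|Px] := pselect (P x); first by rewrite zextE.
  by rewrite zext_out// expr0n /= sqr_ge0.
have p0 : 0 <= zext P f x ^+ 2 * w x by rewrite mulr_ge0 ?sqr_ge0.
have p1 : 0 <= f x ^+ 2 * w x by rewrite mulr_ge0 ?sqr_ge0.
by rewrite /= lee_fin (ger0_norm p0) (ger0_norm p1); exact: (ler_wpM2r w0 h).
Qed.

Lemma Rintegral_zext (P : set X) (f : X -> R) (u v : X -> R) : P `<=` D ->
  (forall x, P x -> f x = u x * v x * w x) ->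
  \int[mu]_(x in P) f x = ip mu D w u (zext P v).
Proof.
move=> PD h; rewrite /ip /Rintegral; congr fine.
rewrite [LHS]integral_mkcond [RHS]integral_mkcond; apply: eq_integral => x _; rewrite !patchE.
have [Px|Px] := pselect (P x).
  by rewrite !mem_set//; [rewrite h// zextE|exact: PD].
rewrite (memNset Px); case: ifP => // _; by rewrite zext_out// mulr0 mul0r.
Qed.

Lemma ip_zext P u v : ip mu D w (zext P u) (zext P v) = ip mu D w u (zext P v).
Proof.
apply: eq_Rintegral => x _; congr (_ * _).
have [Px|Px] := pselect (P x); first by rewrite !zextE.
by rewrite !(zext_out _ Px) !mulr0.
Qed.

End zext.

(** * Local projections and their Riesz kernels *)

Section projection.
Context {R : realType} dd (X : measurableType dd) (mu : {measure set X -> \bar R}).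
Variables (D : set X) (mD : measurable D) (w : X -> R).
Hypotheses (mw : measurable_fun D w) (w_gt0 : forall z, D z -> 0 < w z).
Variables (V : lmodType R) (W : set V) (ev : seq (V -> R)) (rho : V -> X -> R^o) (l : V -> R).
Hypotheses (W0 : W 0) (WL : forall c u v, W u -> W v -> W (c *: u + v)).
Hypothesis rhoL : forall c u v, rho (c *: u + v) = c *: rho u + rho v.
Hypothesis rho2 : forall u, W u -> l2 mu D w (rho u).
Hypothesis lL : forall c u v, W u -> W v -> l (c *: u + v) = c * l u + l v.
Hypothesis evL : forall i c u v, W u -> W v ->
  nth (fun _ => 0) ev i (c *: u + v) = c * nth (fun _ => 0) ev i u + nth (fun _ => 0) ev i v.
Hypothesis ev0 : forall u, W u -> (forall i, nth (fun _ => 0) ev i u = 0) -> u = 0.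
Hypothesis null : forall u, W u -> {ae mu, forall x, D x -> rho u x = 0} -> l u = 0.
Local Notation b := (fun u v => ip mu D w (rho u) (rho v)).

(** The form is degenerate, since functions may vanish on the patch; it suffices that the functional
    ignores its null vectors. The functionals [ev], later the node values, make the space
    finite-dimensional. *)
Lemma projection_riesz (l' : V -> R) : (forall c u v, W u -> W v -> l' (c *: u + v) = c * l' u + l' v) ->
  (forall u, W u -> b u u = 0 -> l' u = 0) -> exists2 p, W p & forall v, W v -> b p v = l' v.
Proof.
move=> h1 h2; apply: (@finite_riesz R V b W ev l' W0 WL) => //.
- by move=> u v _ _; exact: ipC.
- by move=> c u v v' Wu Wv Wv'; rewrite rhoL; apply: ipL => //; exact: rho2.
- by move=> u _; exact: ip_ge0.
move=> u Wu hu; rewrite (ev0 Wu hu).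
have := ipL mD mw w_gt0 (-1) (rho2 W0) (rho2 W0) (rho2 W0).
by rewrite -rhoL scaler0 addr0 mulN1r addNr.
Qed.

Lemma projection_kernel : exists2 k, W k & forall v, W v -> b k v = l v.
Proof.
apply: projection_riesz => // u Wu h; apply: null => //.
exact: (ip_eq0 mD w_gt0 (rho2 Wu) h).
Qed.

Lemma projection_exists g : l2 mu D w g -> exists2 p, W p & forall v, W v -> b p v = ip mu D w g (rho v).
Proof.
move=> hg; apply: projection_riesz.
  by move=> c u v Wu Wv; rewrite rhoL ipC (ipL mD mw w_gt0 c (rho2 Wu) (rho2 Wv) hg) !(ipC _ _ _ g).
move=> u Wu h; apply/eqP; rewrite -sqrf_eq0 eq_le sqr_ge0 andbT.
by apply: le_trans (ip_cauchy_schwarz mD mw w_gt0 hg (rho2 Wu)) _; rewrite h mulr0.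
Qed.

End projection.

Section interpolation.
Context {R : realType} (d : nat) (Omega : set 'rV[R]_d) (T a gamma sigma : R)
  (M : seq (simplex (R := R) d)).
Local Notation E := ('rV[R]_d * R)%type.
Local Notation Em := ('rV[R]_d * measurableTypeR R)%type.
Local Notation CT := (cylinder Omega T).
Local Notation cCT := (closure CT).
Local Notation nu := (vol d).
Hypotheses (lO : lipschitz_domain Omega) (T0 : 0 < T) (ha : -1 < a < 1) (hM : triangulates M CT)
  (hreg : shape_regular gamma M) (hqu : quasi_uniform sigma M).
Local Notation nd := (mesh_nondegenerate hM).
Local Notation hatM := (hat Omega T M).
Local Notation oO := (lip_open lO).
Local Notation bO := (lip_bounded lO).
Local Notation wt := (@wt R d a).
Local Notation L2C := (@l2 R _ Em nu CT wt).
Local Notation ipC_ := (@ip R _ Em nu CT wt).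
Local Notation L2O := (@l2 R _ 'rV[R]_d (leb d) Omega (cst 1)).
Local Notation ipO := (@ip R _ 'rV[R]_d (leb d) Omega (cst 1)).
Local Notation mCT := (measurable_cylinder T oO).
Local Notation mO := (measurable_Omega oO).
Local Notation mwt := (@measurable_wt R d Omega T a).
Local Notation wt_gt0 := (@wt_gt0 R d Omega T a).
Local Notation SHM := (SH Omega T M).
Local Notation VHM := (VH Omega T a M).
Local Notation L := (H1L Omega T a).
Local Notation tru := (trace Omega T a).
Local Notation eip := (eip Omega T a).
Local Notation nodeO := (node_Omega Omega).
Local Notation nodeI := (node_int Omega T).
Local Notation lat := (lateral_boundary Omega T).
Local Notation patchM := (Defs.patch Omega T M).
Local Notation patchO := (patch_Omega Omega T M).
Implicit Types (z w p : E) (K : simplex (R := R) d) (u v : E -> R^o).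

Lemma SH_measurable v : SHM v -> @measurable_fun _ _ Em R cCT v.
Proof.
move=> [_ aff _].
have mh K : K \in M -> @measurable _ Em (hull K).
  by move=> KM; apply: compact_measurable_E; exact: hull_compact (nd KM).
have key (s : seq (simplex (R := R) d)) : {subset s <= M} ->
    @measurable _ Em (\bigcup_(K in [set` s]) hull K) /\ @measurable_fun _ _ Em R (\bigcup_(K in [set` s]) hull K) v.
  elim: s => [|K s ih] sM.
    rewrite (_ : \bigcup_(K in _) _ = set0); first by split; [exact: measurable0|exact: measurable_fun_set0].
    by apply/seteqP; split => // z [K].
  have KM : K \in M by apply: sM; rewrite mem_head.
  have [m1 m2] := ih (fun L Ls => sM L (mem_behead (s := K :: s) Ls)).
  rewrite (_ : \bigcup_(L in _) _ = hull K `|` \bigcup_(L in [set` s]) hull L); last first.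
    apply/seteqP; split => z.
      by move=> [L /=]; rewrite inE => /orP[/eqP -> hz|Ls hz]; [left|right; exists L].
    move=> [hz|[L Ls hz]]; first by exists K => //=; rewrite mem_head.
    by exists L => //=; rewrite inE Ls orbT.
  split; first by apply: measurableU => //; exact: mh.
  apply/measurable_funU => //; first exact: mh.
  split => //; have [g [c h]] := aff K KM.
  apply: (@eq_measurable_fun _ _ Em R (hull K) (fun z => dotp g z + c)) => [z|].
    by rewrite inE => /h ->.
  by apply: measurable_funTS; apply: continuous_measurable_E; exact: affine_continuous.
have [_] := key M (fun K KM => KM).
by rewrite (_ : cCT = \bigcup_(K in [set` M]) hull K)//; case: hM.
Qed.

Lemma SH_bounded v : SHM v -> exists2 C, 0 <= C & forall z, `|v z| <= C.
Proof.
move=> hv; exists (\sum_(z <- nodes M) `|v z|); first exact: sumr_ge0.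
have nv z : z \in nodes M -> `|v z| <= \sum_(z <- nodes M) `|v z|.
  by move=> zN; rewrite (bigD1_seq z)//= ?undup_uniq// lerDl sumr_ge0.
move=> z; have [Cz|nC] := pselect (cCT z); last first.
  by have [_ _ h] := hv; rewrite h// normr0 sumr_ge0.
have [K KM hK] := (mesh_cover hM z).1 Cz.
rewrite (SH_bary hM hv KM hK); apply: le_trans (ler_norm_sum _ _ _) _.
have [s1 _] := sum_bary z (nd KM); have b0 := (hullP z (nd KM)).1 hK.
rewrite -[X in _ <= X]mul1r -{1}s1 mulr_suml; apply: ler_sum => i _.
by rewrite normrM ger0_norm// ler_wpM2l// nv// mem_nodes.
Qed.

(** Finite element functions are extended by 0 below the base, so continuity at a base point is
    stated along the base. *)
Lemma SH_base_continuous v x : SHM v -> Omega x -> v (y, 0) @[y --> x] --> v (x, 0).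
Proof.
move=> [cv _ _] Ox.
have c0 y : Omega y -> cCT (y, 0) by move=> Oy; apply: base_closure; rewrite ?lexx.
have /(_ (x, 0) (c0 x Ox)) h := (@subspace_continuousP E cCT R^o v).1 cv.
apply: cvg_trans h; move=> B [[B1 B2] /= [h1 h2] hB].
have h3 : nbhs x Omega by apply: open_nbhs_nbhs; split => //; exact: oO.
apply: filterS (filterI h1 h3) => y [y1 y2]; apply: (hB (y, 0)); last exact: c0.
by split => //; exact: nbhs_singleton h2.
Qed.

Lemma SH_cylinder_continuous v z : SHM v -> CT z -> v y @[y --> z] --> v z.
Proof.
move=> [cv _ _] Cz.
have /(_ z (subset_closure Cz)) h := (@subspace_continuousP E cCT R^o v).1 cv.
apply: cvg_trans h; move=> B [[B1 B2] /= h12 hB].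
have h3 : nbhs z CT by apply: open_nbhs_nbhs; split => //; exact: (cylinder_open oO).
have h4 : nbhs z (B1 `*` B2) by exists (B1, B2).
by apply: filterS (filterI h4 h3) => y [y1 y2]; apply: hB => //; exact: subset_closure.
Qed.

Lemma SH_l2 v : SHM v -> L2C v.
Proof.
move=> hv; have [C _ hC] := SH_bounded hv.
apply: (l2_bounded oO bO T0 ha (C := C)) => //.
apply: (@measurable_funS _ _ Em R cCT CT); [|exact: subset_closure|exact: SH_measurable].
by apply: closed_measurable_E; exact: closed_closure.
Qed.

Definition base v : 'rV[R]_d -> R^o := fun x => v (x, 0).

Lemma SH_l2O v : SHM v -> L2O (base v).
Proof.
move=> hv; have [C _ hC] := SH_bounded hv.
apply: (l2O_bounded oO bO (C := C)); last by move=> x _; exact: hC.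
apply: (@measurable_comp _ _ _ 'rV[R]_d Em R cCT v Omega (fun x => (x, 0))).
- by apply: closed_measurable_E; exact: closed_closure.
- by move=> _ [x Ox <-]; apply: base_closure; rewrite ?lexx.
- exact: SH_measurable.
apply: measurable_funTS.
have m1 : @measurable_fun _ _ 'rV[R]_d 'rV[R]_d setT id by exact: measurable_id.
have m2 : @measurable_fun _ _ 'rV[R]_d (measurableTypeR R) setT (cst 0) by exact: measurable_cst.
exact: (measurable_fun_pair m1 m2).
Qed.

Lemma VH_lin c u v : VHM u -> VHM v -> VHM (c *: u + v).
Proof.
move=> [u1 u2] [v1 v2]; split; first exact: (SH_lin hM).
exact: (H1L_lin oO bO T0 ha).
Qed.

Lemma SH0 : SHM (0 : E -> R^o).
Proof.
split => // [|K KM]; first by apply: continuous_subspaceT => z; exact: cvg_cst.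
exists 0, 0 => z _; rewrite addr0 dotpE big1// => i _.
by rewrite (_ : crd i 0 = 0) ?mul0r// -(scale0r (0 : E)) crdZ mul0r.
Qed.

Lemma VH0 : VHM (0 : E -> R^o).
Proof. by split; [exact: SH0|exact: (H1L0 oO bO T0 ha)]. Qed.

Definition node_values : seq ((E -> R^o) -> R) := [seq (fun v => v z) | z <- nodes M].

Lemma node_values_lin i c u v : nth (fun _ => 0) node_values i (c *: u + v) =
  c * nth (fun _ => 0) node_values i u + nth (fun _ => 0) node_values i v.
Proof.
have [iN|iN] := ltnP i (size (nodes M)); first by rewrite !(nth_map (0 : E)).
by rewrite !nth_default ?size_map// mulr0 addr0.
Qed.

Lemma node_values_eq0 u : VHM u -> (forall i, nth (fun _ => 0) node_values i u = 0) -> u = 0.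
Proof.
move=> [hu _] h; apply/funext => z; apply: (SH_nodes_eq0 hM hu) => y yN.
by have := h (index y (nodes M)); rewrite (nth_map (0 : E)) ?index_mem// nth_index.
Qed.

Lemma node_closure z : z \in nodes M -> cCT z.
Proof.
move=> zN; have [K [i [KM <-]]] := nodesP zN.
exact: hull_closure KM (vertex_hull i (nd KM)).
Qed.

Lemma nodeO_free z : nodeO z -> ~ lat z.
Proof.
move=> [Oz z0] [[[_ nO] _]|[_ zT]]; first exact: nO.
by move: T0; rewrite -zT z0 ltxx.
Qed.

Lemma nodeI_cylinder z : z \in nodes M -> nodeI z -> CT z.
Proof.
move=> zN [nl nO]; have [Oz /andP[z0 zT]] := free_node (node_closure zN) nl.
split => //; rewrite zT andbT lt_neqAle z0 andbT; apply/eqP => e.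
by apply: nO; split.
Qed.

Lemma patch_measurable z : @measurable _ Em (patchM z).
Proof.
apply: measurableI; first exact: mCT.
apply: fin_bigcup_measurable.
  by apply: (sub_finite_set _ (finite_seq M)) => K [].
by move=> K [KM _]; apply: compact_measurable_E; exact: hull_compact (nd KM).
Qed.

Lemma patch_Omega_measurable z : measurable (patchO z).
Proof.
by apply: measurableI; [apply: closed_measurable_rV; exact: closed_closure|exact: mO].
Qed.

Lemma patch_self z : z \in nodes M -> CT z -> patchM z z.
Proof.
move=> zN Cz; split => //; have [K [i [KM Ki]]] := nodesP zN; exists K; last first.
  by rewrite -Ki; exact: vertex_hull (nd KM).
by split => //; rewrite -Ki codom_f.
Qed.

Lemma patch_hat z w : z \in nodes M -> CT w -> hatM z w != 0 -> patchM z w.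
Proof.
move=> zN Cw hw; split => //; have [K [i [KM hK Ki _]]] := hat_neq0_hull hM zN hw.
by exists K => //; split => //; rewrite -Ki codom_f.
Qed.

Lemma patch_Omega_hat z x : Omega x -> hatM z (x, 0) != 0 -> patchO z x.
Proof. by move=> Ox hx; split => //; exact: subset_closure. Qed.

Lemma patch_Omega_self z : z \in nodes M -> nodeO z -> patchO z z.1.
Proof.
move=> zN [Oz z0]; apply: patch_Omega_hat => //.
by rewrite -[X in (_, X)]z0 -surjective_pairing; have [_ -> _] := hat_spec hM zN; rewrite oner_eq0.
Qed.

(** The hat function of z is nonzero near z, so the patch contains a neighbourhood of z; a
    continuous function that vanishes almost everywhere there vanishes at z. *)
Lemma int_null z v : z \in nodes M -> CT z -> SHM v ->
  {ae nu, forall y, CT y -> zext (X := Em) (patchM z) v y = 0} -> v z = 0.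
Proof.
move=> zN Cz hv hae; apply: contrapT => /eqP vz.
apply: (ae_vol_nbhs (z := z) hae).
have [hs h1 _] := hat_spec hM zN.
have nz (f : E -> R^o) : f y @[y --> z] --> f z -> f z != 0 -> \forall y \near z, f y != 0.
  by move=> cf fz; apply: (cf [set t | t != 0]); apply: open_nbhs_nbhs; split => //; exact: open_neq.
have n1 := nz _ (SH_cylinder_continuous hv Cz) vz.
have n2 : \forall y \near z, hatM z y != 0.
  by apply: (nz (hatM z)); [exact: SH_cylinder_continuous|rewrite h1 oner_eq0].
have n3 : nbhs z CT by apply: open_nbhs_nbhs; split => //; exact: (cylinder_open oO).
apply: filterS (filterI n1 (filterI n2 n3)) => y [y1 [y2 y3]] /(_ y3).
by rewrite zextE; [exact/eqP|exact: patch_hat].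
Qed.

Lemma Omega_null z v : z \in nodes M -> nodeO z -> SHM v ->
  {ae leb d, forall x, Omega x -> zext (X := 'rV[R]_d) (patchO z) (base v) x = 0} -> v z = 0.
Proof.
move=> zN [Oz z0] hv hae; apply: contrapT => /eqP vz.
have ez : z = (z.1, 0) by rewrite -[X in (_, X)]z0 -surjective_pairing.
apply: (ae_leb_nbhs (x := z.1) hae).
have [hs h1 _] := hat_spec hM zN.
have nz (f : E -> R^o) : SHM f -> f z != 0 -> \forall x \near z.1, f (x, 0) != 0.
  move=> hf fz; have cf := SH_base_continuous hf Oz; rewrite -ez in cf; apply: (cf [set t | t != 0]).
  by apply: open_nbhs_nbhs; split => //; exact: open_neq.
have n1 := nz _ hv vz.
have n2 : \forall x \near z.1, hatM z (x, 0) != 0 by apply: nz => //; rewrite h1 oner_eq0.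
have n3 : nbhs z.1 Omega by apply: open_nbhs_nbhs; split => //; exact: oO.
apply: filterS (filterI n1 (filterI n2 n3)) => x [y1 [y2 y3]] /(_ y3).
by rewrite zextE; [exact/eqP|exact: patch_Omega_hat].
Qed.

(** Evaluation at z is represented by a kernel k on the patch; as k is itself an admissible test
    function, the projected value at z is the inner product of [u] with k. *)
Lemma proj_int_kernel z : z \in nodes M -> nodeI z -> exists2 k : E -> R^o, L2C k &
  (forall v, VHM v -> ipC_ v k = v z) /\ forall u, L2C u -> proj_int Omega T a M z u z = ipC_ u k.
Proof.
move=> zN nI; have Cz := nodeI_cylinder zN nI; have mP := patch_measurable z.
pose rho (v : E -> R^o) : Em -> R^o := zext (X := Em) (patchM z) v.
have rhoL c u v : rho (c *: u + v) = c *: rho u + rho v by exact: zext_lin.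
have rho2 u : VHM u -> L2C (rho u) by move=> [hu _]; apply: (l2_zext mCT mwt wt_gt0 mP); exact: SH_l2.
have null u : VHM u -> {ae nu, forall y, CT y -> rho u y = 0} -> u z = 0.
  by move=> [hu _]; exact: int_null.
have [k' Vk hk] := projection_kernel mCT mwt wt_gt0 VH0 VH_lin rhoL rho2 (l := fun v => v z)
  (fun c u v _ _ => erefl) (fun i c u v _ _ => node_values_lin i c u v) node_values_eq0 null.
exists (rho k'); first exact: rho2.
split; first by move=> v Vv; rewrite -(ip_zext (X := Em)) ipC hk.
move=> u hu.
have [p Vp hp] := projection_exists mCT mwt wt_gt0 VH0 VH_lin rhoL rho2
  (fun i c u v _ _ => node_values_lin i c u v) node_values_eq0 hu.
have sub : patchM z `<=` CT by move=> y [].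
have conv (f v : E -> R^o) : \int[nu]_(y in patchM z) (f y * v y * y.2 `^ a) = ipC_ f (rho v).
  exact: (Rintegral_zext (X := Em)).
have [[v1 Vv1 hv1] h2] : [set p | VH_on Omega T a M (patchM z) p /\
    forall v, VH_on Omega T a M (patchM z) v ->
    \int[vol d]_(z in patchM z) (p z * v z * z.2 `^ a) =
    \int[vol d]_(z in patchM z) (u z * v z * z.2 `^ a)] (proj_int Omega T a M z u).
  apply: xgetPex; exists p; split; first by exists p.
  move=> v [v0 Vv0 hv0].
  have e (f : E -> R^o) : \int[nu]_(y in patchM z) (f y * v y * y.2 `^ a) = \int[nu]_(y in patchM z) (f y * v0 y * y.2 `^ a).
    by apply: eq_Rintegral => y /set_mem Py; rewrite hv0.
  by rewrite !e !conv -hp// (ip_zext (X := Em)).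
rewrite hv1; last exact: patch_self.
rewrite -(hk _ Vv1) ipC (ip_zext (X := Em)) -!conv -h2; last by exists k'.
by apply: eq_Rintegral => y /set_mem Py; rewrite hv1.
Qed.

Lemma proj_Omega_kernel z : z \in nodes M -> nodeO z -> exists2 v0 : E -> R^o, VHM v0 &
  let k : 'rV[R]_d -> R^o := zext (X := 'rV[R]_d) (patchO z) (base v0) in
  [/\ L2O k, forall v, VHM v -> ipO (base v) k = v z &
  forall u, L2O (tru u) -> proj_Omega Omega T a M z u z.1 = ipO (tru u) k].
Proof.
move=> zN nO; have mP := patch_Omega_measurable z.
have [Oz z0] := nO; have ez : z = (z.1, 0) by rewrite -[X in (_, X)]z0 -surjective_pairing.
have m1 : measurable_fun Omega (cst 1 : 'rV[R]_d -> R) by exact: measurable_cst.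
have p1 (x : 'rV[R]_d) : Omega x -> 0 < (cst 1 : 'rV[R]_d -> R) x by [].
pose rho (v : E -> R^o) : 'rV[R]_d -> R^o := zext (X := 'rV[R]_d) (patchO z) (base v).
have rhoL c u v : rho (c *: u + v) = c *: rho u + rho v by exact: zext_lin.
have rho2 u : VHM u -> L2O (rho u) by move=> [hu _]; apply: (l2_zext mO m1 p1 mP); exact: SH_l2O.
have null u : VHM u -> {ae leb d, forall y, Omega y -> rho u y = 0} -> u z = 0.
  by move=> [hu _]; exact: Omega_null.
have [k' Vk hk] := projection_kernel mO m1 p1 VH0 VH_lin rhoL rho2 (l := fun v => v z)
  (fun c u v _ _ => erefl) (fun i c u v _ _ => node_values_lin i c u v) node_values_eq0 null.
exists k' => //= ; rewrite -/(rho k'); split; first exact: rho2.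
  by move=> v Vv; rewrite -(ip_zext (X := 'rV[R]_d)) ipC hk.
move=> u hu.
have [p Vp hp] := projection_exists mO m1 p1 VH0 VH_lin rhoL rho2
  (fun i c u v _ _ => node_values_lin i c u v) node_values_eq0 hu.
have sub : patchO z `<=` Omega by move=> y [].
have conv (f : 'rV[R]_d -> R^o) (v : E -> R^o) : \int[leb d]_(y in patchO z) (f y * base v y) = ipO f (rho v).
  by apply: (Rintegral_zext (X := 'rV[R]_d)) => // x _; rewrite mulr1.
have [[v1 Vv1 hv1] h2] : [set p | VH_trace_on Omega T a M (patchO z) p /\
    forall q, VH_trace_on Omega T a M (patchO z) q ->
    \int[leb d]_(x in patchO z) (p x * q x) =
    \int[leb d]_(x in patchO z) (tru u x * q x)] (proj_Omega Omega T a M z u).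
  apply: xgetPex; exists (base p); split; first by exists p.
  move=> v [v0 Vv0 hv0].
  have e (f : 'rV[R]_d -> R^o) : \int[leb d]_(y in patchO z) (f y * v y) = \int[leb d]_(y in patchO z) (f y * base v0 y).
    by apply: eq_Rintegral => y /set_mem Py; rewrite hv0.
  by rewrite !e !conv -hp// (ip_zext (X := 'rV[R]_d)).
rewrite hv1; last exact: patch_Omega_self.
rewrite -ez -(hk _ Vv1) ipC (ip_zext (X := 'rV[R]_d)) -!conv -h2; last by exists k'.
by apply: eq_Rintegral => y /set_mem Py; rewrite hv1.
Qed.

(** The chosen trace is determined up to a null set, which inner products do not see. *)
Lemma trace_ae u (g : 'rV[R]_d -> R^o) : L u -> is_trace Omega T a u g -> forall k, L2O k -> ipO (tru u) k = ipO g k.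
Proof.
move=> Lu /is_traceP[hg [phi [ap cg]]] k hk; have hu := H1L_H1w Lu.
have [ht ct] := trace_cvg oO bO T0 ha hu ap.
have s n : csmooth (phi n) by have [s _] := ap; exact: s.
have hn n : L2O (tr (phi n)) by apply: (l2O_tr oO bO); exact: csmooth_continuous.
have l2B := form_closedB (l2O_lin oO).
have h0 := form_cvg_unique (l2O_lin oO) (@ipO_sym R d Omega) (ipO_lin oO) (@ipO_ge0 R d Omega) hn ht hg ct cg.
have h1 := form_null_ip (l2O_lin oO) (@ipO_sym R d Omega) (ipO_lin oO) (@ipO_ge0 R d Omega) (l2B _ _ ht hg) hk h0.
apply/eqP; rewrite -subr_eq0 -h1; apply/eqP.
by rewrite (formBl (ipO_lin oO) ht hg hk).
Qed.

Definition coef z u : R := if `[< nodeO z >] then proj_Omega Omega T a M z u z.1 else proj_int Omega T a M z u z.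

(** The algebra of the fine space rests on these three facts about nodal coefficients. The constant
    in the second may depend on the mesh: it serves for the closedness of the fine space and does
    not enter the error bound. *)
Lemma coefP z : z \in nodes M -> ~ lat z ->
  [/\ forall c u v, L u -> L v -> coef z (c *: u + v) = c * coef z u + coef z v,
      exists2 K, 0 <= K & forall u, L u -> coef z u ^+ 2 <= K * eip u u &
      forall z1, z1 \in nodes M -> ~ lat z1 -> coef z (hatM z1) = hatM z1 z].
Proof.
move=> zN nl; rewrite /coef; have [nO|nO] := asboolP (nodeO z).
  have [v0 _ /=] := proj_Omega_kernel zN nO.
  set k := zext _ _ => -[hk k1 k2].
  have lt u : L u -> L2O (tru u) by move=> /(trace_H1L oO bO T0 ha)[].
  have kk : 0 <= ipO k k by exact: (@ipO_ge0 R d Omega).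
  split.
  - move=> c u v Lu Lv; have Luv := H1L_lin oO bO T0 ha c Lu Lv.
    rewrite (k2 _ (lt _ Luv)) (k2 _ (lt _ Lu)) (k2 _ (lt _ Lv)).
    exact: (ip_trace_lin oO bO T0 ha c Lu Lv hk).
  - exists (Cd T a * ipO k k).
      by rewrite mulr_ge0//; exact: (Cd_ge0 T0 ha).
    move=> u Lu; rewrite k2; last exact: lt.
    have m1 : measurable_fun Omega (cst 1 : 'rV[R]_d -> R) by exact: measurable_cst.
    have p1 (x : 'rV[R]_d) : Omega x -> 0 < (cst 1 : 'rV[R]_d -> R) x by [].
    apply: le_trans (ip_cauchy_schwarz mO m1 p1 (lt u Lu) hk) _.
    rewrite mulrAC; apply: ler_wpM2r => //.
    by have [] := trace_H1L oO bO T0 ha Lu.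
  move=> z1 z1N nl1; have Vh := hat_VH lO T0 ha hM hreg hqu z1N nl1.
  have [Lh ht] := hat_H1L_trace lO T0 ha hM hreg hqu z1N nl1.
  by rewrite k2; [rewrite (trace_ae Lh ht hk) k1|exact: lt].
have nI : nodeI z by [].
have [k hk [k1 k2]] := proj_int_kernel zN nI.
have l2u u : L u -> L2C u by move=> /H1L_H1w /(H1w_l2 oO).
have kk : 0 <= ipC_ k k by exact: (@ip_ge0 _ _ Em nu CT wt wt_gt0).
split.
- move=> c u v Lu Lv; have Luv := H1L_lin oO bO T0 ha c Lu Lv.
  rewrite !k2; [|exact: l2u|exact: l2u|exact: l2u].
  exact: (ipL mCT mwt wt_gt0 c (l2u _ Lu) (l2u _ Lv) hk).
- exists (Cp T a * ipC_ k k).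
    by rewrite mulr_ge0//; exact: (Cp_ge0 _ ha).
  move=> u Lu; rewrite k2; last exact: l2u.
  apply: le_trans (ip_cauchy_schwarz mCT mwt wt_gt0 (l2u u Lu) hk) _.
  rewrite mulrAC; apply: ler_wpM2r => //.
  exact: (poincare oO bO T0 ha Lu).
move=> z1 z1N nl1; have Vh := hat_VH lO T0 ha hM hreg hqu z1N nl1.
by have [_ Lh] := Vh; rewrite k2; [exact: k1|exact: l2u].
Qed.

Lemma hat_sum (s : seq E) (c : E -> R) : (forall z, z \in s -> z \in nodes M /\ ~ lat z) ->
  let u : E -> R^o := fun y => \sum_(z <- s) c z * hatM z y in
  VHM u /\ forall z, z \in nodes M -> ~ lat z -> coef z u = u z.
Proof.
elim: s => [|z1 s ih] hs u.
  have -> : u = 0 by apply/funext => y; rewrite /u big_nil.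
  split; first exact: VH0.
  move=> z zN nl; have [h _ _] := coefP zN nl.
  have L0 := H1L0 oO bO T0 ha.
  by have := h (-1) 0 0 L0 L0; rewrite scaler0 addr0 mulN1r addNr.
have [z1N nl1] := hs z1 (mem_head _ _).
have [Vs hsum] := ih (fun z zs => hs z (mem_behead (s := z1 :: s) zs)).
set us : E -> R^o := fun y => \sum_(z <- s) c z * hatM z y in Vs hsum.
have -> : u = c z1 *: (hatM z1 : E -> R^o) + us.
  by apply/funext => y; rewrite /u big_cons.
have Vh := hat_VH lO T0 ha hM hreg hqu z1N nl1.
split; first exact: VH_lin.
move=> z zN nl; have [h _ hh] := coefP zN nl.
by rewrite (h (c z1) _ _ Vh.2 Vs.2) hh// hsum.
Qed.

Lemma IHE u : IH Omega T a M u = fun y => \sum_(z <- [seq z <- nodes M | `[< ~ lat z >]]) coef z u * hatM z y.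
Proof.
apply/funext => y; rewrite big_filter (bigID (fun z => `[< nodeO z >])) /= addrC /IH; congr (_ + _).
  apply: eq_big => [z|z /asboolP nI].
    apply/asboolP/andP => [[h1 h2]|[/asboolP h1 /asboolPn h2]] //.
    by split; [exact/asboolP|exact/asboolPn].
  by rewrite /coef; case: asboolP => // nO; case: nI => _ /(_ nO).
apply: eq_big => [z|z /asboolP nO].
  apply/asboolP/andP => [h|[_ /asboolP]] //.
  by split; apply/asboolP => //; exact: nodeO_free.
by rewrite /coef; case: asboolP.
Qed.

(** The coefficients reproduce the nodal values of hat functions, which are Kronecker deltas; hence
    the interpolant has the coefficients from which it was built. *)
Lemma IH_spec u : VHM (IH Omega T a M u) /\
  forall z, z \in nodes M -> ~ lat z -> coef z (IH Omega T a M u) = coef z u.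
Proof.
have hs z : z \in [seq z <- nodes M | `[< ~ lat z >]] -> z \in nodes M /\ ~ lat z.
  by rewrite mem_filter => /andP[/asboolP].
have [h1 h2] := hat_sum (fun z => coef z u) hs; rewrite -IHE in h1 h2.
split; first exact: h1.
move=> z zN nl; rewrite h2// (bigD1_seq z)/=; last first.
- by rewrite filter_uniq// undup_uniq.
- by rewrite mem_filter zN andbT; exact/asboolP.
rewrite (hat_node hM zN zN) eqxx mulr1 big1_seq ?addr0// => y /andP[yz /hs[yN _]].
by rewrite (hat_node hM yN zN) eq_sym (negbTE yz) mulr0.
Qed.

Lemma VfP u : Vf Omega T a M u <-> L u /\ forall z, z \in nodes M -> ~ lat z -> coef z u = 0.
Proof.
split=> [[Lu h]|[Lu h]]; split => //.
  move=> z zN nl; have [_ e] := IH_spec u; rewrite -e// h.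
  have [hl _ _] := coefP zN nl; have L0 := H1L0 oO bO T0 ha.
  by have := hl (-1) 0 0 L0 L0; rewrite scaler0 addr0 mulN1r addNr.
apply/funext => y; rewrite IHE big1_seq// => z; rewrite mem_filter => /andP[_ /andP[/asboolP nl zN]].
by rewrite h// mul0r.
Qed.

Lemma Vf_lin c u v : Vf Omega T a M u -> Vf Omega T a M v -> Vf Omega T a M (c *: u + v).
Proof.
move=> /VfP[Lu hu] /VfP[Lv hv]; apply/VfP; split; first exact: (H1L_lin oO bO T0 ha).
by move=> z zN nl; have [h _ _] := coefP zN nl; rewrite h// hu// hv// mulr0 addr0.
Qed.

Lemma Vf0 : Vf Omega T a M (0 : E -> R^o).
Proof.
have L0 := H1L0 oO bO T0 ha; apply/VfP; split => // z zN nl; have [hl _ _] := coefP zN nl.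
by have := hl (-1) 0 0 L0 L0; rewrite scaler0 addr0 mulN1r addNr.
Qed.

Lemma Vf_closed (u_ : nat -> E -> R^o) u : (forall n, Vf Omega T a M (u_ n)) -> L u ->
  form_cvg eip u_ u -> Vf Omega T a M u.
Proof.
move=> hu Lu cu; apply/VfP; split => // z zN nl; have [hl [K K0 hK] _] := coefP zN nl.
have Ln n : L (u_ n) by case: (hu n).
have c0 n : coef z (u_ n) = 0 by have [_] := (VfP (u_ n)).1 (hu n); apply.
apply/eqP; rewrite -sqrf_eq0 eq_le sqr_ge0 andbT; apply/ler_addgt0Pr => e e0; rewrite add0r.
have K1 : 0 < K + 1 by lra.
have [N hN] := cu (e / (K + 1)) (divr_gt0 e0 K1).
have LB : L (u_ N - u) := form_closedB (H1L_lin oO bO T0 ha) (Ln N) Lu.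
have eB : coef z (u_ N - u) = - coef z u.
  by rewrite -scaleN1r addrC (hl (-1) u (u_ N) Lu (Ln N)) c0 addr0 mulN1r.
have := hK _ LB; rewrite eB sqrrN => h1; apply: le_trans h1 _.
have h2 := hN _ (leqnn N); have h3 : 0 <= eip (u_ N - u) (u_ N - u) by exact: eip_ge0.
apply: (@le_trans _ _ ((K + 1) * (e / (K + 1)))); last by rewrite mulrCA divff ?mulr1// lt0r_neq0.
by apply: ler_pM => //; lra.
Qed.

End interpolation.

(** * Traces of fine functions *)

Section trace_estimate.
Context {R : realType} (d : nat) (Omega : set 'rV[R]_d) (T a : R).
Local Notation E := ('rV[R]_d * R)%type.
Local Notation CT := (cylinder Omega T).
Hypotheses (lO : lipschitz_domain Omega) (T0 : 0 < T) (ha : -1 < a < 1).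
Local Notation oO := (lip_open lO).
Local Notation bO := (lip_bounded lO).
Local Notation L2O := (@l2 R _ 'rV[R]_d (leb d) Omega (cst 1)).
Local Notation ipO := (@ip R _ 'rV[R]_d (leb d) Omega (cst 1)).
Local Notation mO := (measurable_Omega oO).
Local Notation vip := (vip Omega T a).
Local Notation L := (H1L Omega T a).
Local Notation tru := (trace Omega T a).
Local Notation eip := (eip Omega T a).
Local Notation cut0 := (zext (X := 'rV[R]_d) Omega).
Implicit Types (f g : 'rV[R]_d -> R^o) (x y h : 'rV[R]_d).

Lemma measurable_cut0 f : measurable_fun Omega f -> measurable_fun setT (cut0 f).
Proof.
move=> mf; have := (measurable_restrictT f mO).1 mf.
apply: eq_measurable_fun => x _; rewrite patchE.
have [Ox|nO] := pselect (Omega x); first by rewrite mem_set// zextE.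
by rewrite memNset// zext_out.
Qed.

Lemma integral_cut0_sqr f : L2O f -> (\int[leb d]_x (cut0 f x ^+ 2)%:E = (ipO f f)%:E)%E.
Proof.
move=> hf; rewrite (ipE mO hf) [RHS]integral_mkcond; apply: eq_integral => x _.
rewrite patchE; have [Ox|nO] := pselect (Omega x); first by rewrite mem_set// zextE// mulr1.
by rewrite memNset// zext_out// expr0n.
Qed.

Lemma measurable_add_rV h : measurable_fun setT (fun x : 'rV[R]_d => x + h).
Proof.
apply: (measurable_fun_rV measurableT) => i.
rewrite (_ : (fun x => _) = (fun x : 'rV[R]_d => x ord0 i + h ord0 i)); last by apply/funext => x; rewrite mxE.
by apply: measurable_funD; [exact: measurable_coord|exact: measurable_cst].
Qed.

Lemma integral_shift (F : 'rV[R]_d -> \bar R) h : measurable_fun setT F -> (forall x, (0 <= F x)%E) ->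
  (\int[leb d]_x F (x + h)%R = \int[leb d]_x F x)%E.
Proof.
move=> mF F0; rewrite -[RHS]mul1e -(expr1n _ d) -{1}(@invr1 R).
rewrite -(ge0_integral_leb_affine h ltr01 mF F0).
by apply: eq_integral => x _; rewrite scale1r.
Qed.

(** The quotient of the two constants in [base_translation]. *)
Definition transl (q : R) h : R := 3 * (2 * Kf q a + 4 * dotv h h) / c0 q a.

Lemma transl_ge0 q h : 0 < q -> 0 <= transl q h.
Proof.
move=> q0; rewrite divr_ge0// ?(ltW (c0_gt0 q0 ha))// mulr_ge0// addr_ge0// mulr_ge0//.
  exact: Kf_ge0.
exact: dotv_ge0.
Qed.

(** Passage from smooth approximations to the limit: a sum of three terms costs a factor 3 and the
    comparison of energies a factor 2, whence 6. *)
Lemma trace_translation w q h : L w -> 0 < q -> q <= T ->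
  (\int[leb d]_x ((cut0 (tru w) (x + h) - cut0 (tru w) x) ^+ 2)%:E <= (6 * transl q h * eip w w)%:E)%E.
Proof.
move=> Lw q0 qT; set g := cut0 (tru w).
have [lt _] := trace_H1L oO bO T0 ha Lw.
have /(H1LP oO bO T0 ha)[hw [phi [s1 a1 b1 h1]]] := Lw.
have hp : smooth_approx Omega T a phi w by apply/(smooth_approxP oO bO T0 ha _ hw).
have [_ ct] := trace_cvg oO bO T0 ha hw hp.
have K0 := transl_ge0 h q0; set K := transl q h in K0 *.
have mg : measurable_fun setT g by apply: measurable_cut0; case: lt.
have V2w := H1w_V2 oO hw.
apply/lee_addgt0Pr => e e0; set EN := eip w w.
have EN0 : 0 <= EN by exact: eip_ge0.
have r0 : 0 < 6 + 6 * K by lra.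
pose r := e / (6 + 6 * K); have rp : 0 < r by rewrite divr_gt0.
have [N1 hN1] := ct r rp; have [N2 hN2] := b1 r rp.
pose n := maxn N1 N2.
have := hN1 n (leq_maxl _ _); set D := tr (phi n) - tru w => hD.
have hB := hN2 n (leq_maxr _ _).
have l2n : L2O (tr (phi n)) by apply: (l2O_tr oO bO); exact: csmooth_continuous (s1 n).
have l2D : L2O D by exact: (form_closedB (l2O_lin oO) l2n lt).
pose f := base_cut Omega (phi n).
have fE x : f x - g x = cut0 D x.
  by rewrite /f /g /base_cut /zext -[D x]/(phi n (x, 0) - tru w x) mulrBr.
have mf : measurable_fun setT f by apply: (continuous_base oO); exact: csmooth_continuous (s1 n).
have mD : measurable_fun setT (cut0 D) by apply: measurable_cut0; case: l2D.
have I1 : (\int[leb d]_x (cut0 D x ^+ 2)%:E <= r%:E)%E by rewrite integral_cut0_sqr// lee_fin.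
have mDh : measurable_fun setT (fun x => cut0 D (x + h)).
  by apply: (measurableT_comp mD); exact: measurable_add_rV.
have I2 : (\int[leb d]_x (cut0 D (x + h) ^+ 2)%:E <= r%:E)%E.
  rewrite (integral_shift (F := fun x => (cut0 D x ^+ 2)%:E))//; last by move=> x; rewrite lee_fin sqr_ge0.
  by apply/measurable_EFinP; exact: measurable_funX.
have vg : vip (grad (phi n)) (grad (phi n)) <= 2 * r + 2 * EN.
  have Vg := V2_grad oO bO T0 ha (s1 n).
  have := vip_le2 oO (form_closedB (V2_lin oO) Vg V2w) V2w; rewrite subrK => h2.
  by apply: le_trans h2 _; apply: lerD => //; rewrite ler_pM2l.
have I3 : (\int[leb d]_x ((f (x + h) - f x) ^+ 2)%:E <= (K * (2 * r + 2 * EN))%:E)%E.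
  have := base_translation oO bO T0 ha h (s1 n) (h1 n) q0 qT.
  have c00 := c0_gt0 q0 ha.
  rewrite -lee_pdivlMl// => /le_trans; apply; rewrite -EFinM lee_fin.
  rewrite mulrA (_ : _^-1 * (3 * _) = K); last by rewrite mulrC.
  exact: ler_wpM2l.
have mfh : measurable_fun setT (fun x => f (x + h)).
  by apply: (measurableT_comp mf); exact: measurable_add_rV.
have mgh : measurable_fun setT (fun x => g (x + h)).
  by apply: (measurableT_comp mg); exact: measurable_add_rV.
have m1 : measurable_fun setT (fun x => (cut0 D (x + h) ^+ 2)%:E).
  by apply/measurable_EFinP; exact: measurable_funX.
have m2 : measurable_fun setT (fun x => ((f (x + h) - f x) ^+ 2)%:E).
  by apply/measurable_EFinP; apply: measurable_funX; exact: measurable_funB.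
have m3 : measurable_fun setT (fun x => (cut0 D x ^+ 2)%:E).
  by apply/measurable_EFinP; exact: measurable_funX.
apply: (@le_trans _ _ (\int[leb d]_x (3%:E * ((cut0 D (x + h) ^+ 2)%:E + ((f (x + h) - f x) ^+ 2)%:E + (cut0 D x ^+ 2)%:E)))%E).
  apply: ge0_le_integral => //.
  - by move=> x _; rewrite lee_fin sqr_ge0.
  - by apply/measurable_EFinP; apply: measurable_funX; exact: measurable_funB.
  - apply: emeasurable_funM; first exact: measurable_cst.
    by apply: emeasurable_funD => //; exact: emeasurable_funD.
  move=> x _; rewrite -!EFinD -EFinM lee_fin -!fE.
  move: (f (x + h)) (g (x + h)) (f x) (g x) => x1 x2 x3 x4.
  have := sqr_ge0 ((x1 - x2) - (x3 - x4)); have := sqr_ge0 ((x1 - x2) + (x1 - x3)); have := sqr_ge0 ((x1 - x3) - (x3 - x4)).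
  rewrite (_ : x2 - x4 = - (x1 - x2) + (x1 - x3) + (x3 - x4)); last by ring.
  move: (x1 - x2) (x1 - x3) (x3 - x4) => y1 y2 y3; nra.
rewrite ge0_integralZl//; last 2 first.
- by apply: emeasurable_funD => //; exact: emeasurable_funD.
- by move=> x _; rewrite -!EFinD lee_fin !addr_ge0 ?sqr_ge0.
rewrite ge0_integralD//; last 3 first.
- by move=> x _; rewrite -!EFinD lee_fin !addr_ge0 ?sqr_ge0.
- exact: emeasurable_funD.
- by move=> x _; rewrite lee_fin sqr_ge0.
rewrite ge0_integralD//; last 2 first.
- by move=> x _; rewrite lee_fin sqr_ge0.
- by move=> x _; rewrite lee_fin sqr_ge0.
apply: (@le_trans _ _ (3%:E * (r%:E + (K * (2 * r + 2 * EN))%:E + r%:E))%E).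
  by apply: lee_wpmul2l; [rewrite lee_fin|apply: leeD => //; exact: leeD].
rewrite -!EFinD -EFinM lee_fin.
rewrite (_ : 3 * _ = 6 * K * EN + r * (6 + 6 * K)); last by ring.
by rewrite /r divfK// lt0r_neq0.
Qed.

End trace_estimate.

(** * Pointwise bounds for the trace by its differences *)

Section trace_pointwise.
Context {R : realType} (d : nat) (Omega : set 'rV[R]_d) (T a gamma sigma : R)
  (M : seq (simplex (R := R) d)).
Local Notation E := ('rV[R]_d * R)%type.
Local Notation CT := (cylinder Omega T).
Local Notation cCT := (closure CT).
Hypotheses (lO : lipschitz_domain Omega) (T0 : 0 < T) (ha : -1 < a < 1) (hM : triangulates M CT)
  (hreg : shape_regular gamma M) (hqu : quasi_uniform sigma M).
Local Notation nd := (mesh_nondegenerate hM).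
Local Notation H := (mesh_size M).
Local Notation hatM := (hat Omega T M).
Local Notation oO := (lip_open lO).
Local Notation bO := (lip_bounded lO).
Local Notation L2O := (@l2 R _ 'rV[R]_d (leb d) Omega (cst 1)).
Local Notation ipO := (@ip R _ 'rV[R]_d (leb d) Omega (cst 1)).
Local Notation mO := (measurable_Omega oO).
Local Notation VHM := (VH Omega T a M).
Local Notation SHM := (SH Omega T M).
Local Notation tru := (trace Omega T a).
Local Notation nodeO := (node_Omega Omega).
Local Notation lat := (lateral_boundary Omega T).
Local Notation patchO := (patch_Omega Omega T M).
Local Notation cut0 := (zext (X := 'rV[R]_d) Omega).
Local Notation Hp := (mesh_size_gt0 lO T0 hM).
Implicit Types (z : E) (x y h : 'rV[R]_d) (K : simplex (R := R) d).

Lemma zext_cut0 (P : set 'rV[R]_d) (f : 'rV[R]_d -> R) : P `<=` Omega -> cut0 (zext P f) = zext P f.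
Proof.
move=> sP; apply/funext => x; have [Ox|nO] := pselect (Omega x); first by rewrite zextE.
by rewrite !zext_out// => /sP.
Qed.

(** Half the reciprocal of the Lipschitz constant [hat_lip]: along the base, the hat function of a
    node stays at least 1/2 within this distance. *)
Definition star_radius : R := H / (2 * d.+1%:R * (gamma * sigma)).

Lemma gs_gt0 : 0 < gamma * sigma.
Proof. by rewrite mulr_gt0//; [exact: (gamma_gt0 lO T0 hM hreg)|exact: (sigma_gt0 lO T0 hM hqu)]. Qed.

Lemma star_radius_gt0 : 0 < star_radius.
Proof. by rewrite divr_gt0 ?Hp// mulr_gt0 ?gs_gt0// mulr_gt0. Qed.

Section kernel.
Variables (z : E) (v : E -> R^o).
Hypotheses (zN : z \in nodes M) (nO : nodeO z) (inO : forall y, `|y - z.1| <= H -> Omega y).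
Local Notation k := (zext (X := 'rV[R]_d) (patchO z) (base v)).
Let ez : z = (z.1, 0). Proof. by case: nO => _ z0; rewrite -[X in (_, X)]z0 -surjective_pairing. Qed.
Let nl : ~ lat z := nodeO_free T0 nO.

Lemma star_hull y : `|y| < star_radius -> Omega (z.1 + y) /\ hatM z (z.1 + y, 0) != 0.
Proof.
move=> hy.
have hz : hatM z (z.1 + y, 0) != 0.
  have z2 : 0 <= z.2 by rewrite ez.
  have := hat_lip_halfspace lO T0 hM hreg hqu (z := (z.1 + y, 0)) (w := z) zN nl (lexx 0) z2.
  have -> : hatM z z = 1 by have [_ -> _] := hat_spec hM zN.
  have -> : `|z - (z.1 + y, 0)| = `|y|.
    rewrite [in LHS]ez prod_normE /= subrr normr0 opprD addrA subrr add0r normrN.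
    by apply/max_idPl.
  move=> h1; apply/eqP => h2; move: h1; rewrite h2 subr0 normr1 leNgt => /negP; apply.
  have l0 : 0 < @hat_lip R d gamma sigma M by rewrite mulr_gt0// divr_gt0 ?gs_gt0 ?Hp.
  apply: (@le_lt_trans _ _ (hat_lip gamma sigma M * star_radius)); first by apply: ler_wpM2l; exact: ltW.
  rewrite /hat_lip /star_radius (_ : _ * _ = 2^-1); first by rewrite invf_lt1 ?ltr1n.
  have := Hp; have := gs_gt0; have : 0 < d.+1%:R :> R by [].
  move: (gamma * sigma) H d.+1%:R => p q r r0 p0 q0.
  by field; rewrite !lt0r_neq0.
split => //; apply: inO; have [K [i [KM hK Ki _]]] := hat_neq0_hull hM zN hz.
have := hull_dist KM hK (vertex_hull i (nd KM)); rewrite Ki.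
by apply: le_trans; rewrite prod_normE le_max lexx.
Qed.

(* [v] is affine on the segment from [z] to [z + (y, 0)]; the other values of
   [v] that occur are those at its midpoint and its end. *)
Lemma star_affine y : SHM v -> `|y| < star_radius -> v z = 2 * k (2^-1 *: y + z.1) - k (y + z.1).
Proof.
move=> [_ aff _] hy; have [Oy hz] := star_hull hy.
have y0 := normr_ge0 y.
have [Oy2 hz2] : Omega (z.1 + 2^-1 *: y) /\ hatM z (z.1 + 2^-1 *: y, 0) != 0.
  by apply: star_hull; rewrite normrZ gtr0_norm ?invr_gt0//; lra.
rewrite ![_ + z.1]addrC !zextE; [|exact: patch_Omega_hat|exact: patch_Omega_hat].
have [K [i [KM hK Ki _]]] := hat_neq0_hull hM zN hz.
have [g [c hg]] := aff K KM.
have hKz : hull K z by rewrite -Ki; exact: vertex_hull (nd KM).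
have mid : (z.1 + 2^-1 *: y, 0) = (1 - 2^-1) *: z + 2^-1 *: (z.1 + y, 0) :> E.
  rewrite [in RHS]ez; congr (_, _).
    rewrite /= scalerDr scalerBl scale1r addrA subrK //.
  by rewrite /= !scaler0 addr0.
have hmid : hull K (z.1 + 2^-1 *: y, 0).
  by rewrite mid; apply: hull_convex => //; rewrite invr_ge0 ler0n /= invf_le1// ler1n.
rewrite /base !hg// mid [dotp g (_ + _)]dotpC dotpDl !dotpZl !(dotpC _ g).
by field.
Qed.

(** Let m be the value of v at z. Extrapolation gives m = 2 k(mid) - k(end), hence m^2 <= 8 k(mid)^2
    + 2 k(end)^2. Integrating over the ball of radius r = [star_radius] bounds m^2 (2 r)^d by a
    multiple of the squared norm of k, which is m itself; then one factor m is divided out. *)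
Lemma kernel_bound : VHM v -> L2O k -> ipO k k = v z ->
  v z * (2 * star_radius) ^+ d <= 8 * 2 ^+ d + 2.
Proof.
move=> [hv _] hk kk; have m0 : 0 <= v z by rewrite -kk; exact: (@ipO_ge0 R d Omega).
set m := v z in kk m0 *; set r := star_radius.
have r0 : 0 < r := star_radius_gt0.
have sP : patchO z `<=` Omega by move=> x [].
pose F x : \bar R := (k x ^+ 2)%:E.
have F0 x : (0 <= F x)%E by rewrite lee_fin sqr_ge0.
have mk : measurable_fun setT k.
  by rewrite -(zext_cut0 _ sP); apply: (measurable_cut0 lO); case: hk.
have mF : measurable_fun setT F by apply/measurable_EFinP; exact: measurable_funX.
have IF : (\int[leb d]_x F x = m%:E)%E.
  by rewrite -kk -(integral_cut0_sqr lO hk) (zext_cut0 _ sP).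
have half0 : 0 < 2^-1 :> R by rewrite invr_gt0.
have I1 := ge0_integral_leb_affine z.1 half0 mF F0.
have I2 := integral_shift z.1 mF F0.
have mB : measurable (ball (0 : 'rV[R]_d) r) by exact: measurable_ball_rV.
have ma (c : R) : measurable_fun setT (fun x : 'rV[R]_d => c *: x + z.1).
  apply: (measurable_fun_rV measurableT) => i.
  rewrite (_ : (fun x => _) = (fun x : 'rV[R]_d => c * x ord0 i + z.1 ord0 i)); last by apply/funext => x; rewrite !mxE.
  apply: measurable_funD; last exact: measurable_cst.
  by apply: measurable_funM; [exact: measurable_cst|exact: measurable_coord].
have mF1 : measurable_fun setT (fun x => F (2^-1 *: x + z.1)) by apply: (measurableT_comp mF); exact: ma.
have mF2 : measurable_fun setT (fun x => F (x + z.1)).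
  by apply: (measurableT_comp mF); exact: measurable_add_rV.
have key : ((m ^+ 2 * (2 * r) ^+ d)%:E <= (8 * 2 ^+ d * m + 2 * m)%:E)%E.
  rewrite EFinM -(leb_ball (0 : 'rV[R]_d) r0) -integral_cst//.
  apply: (@le_trans _ _ (\int[leb d]_(x in ball 0%R r) (8%:E * F (2^-1 *: x + z.1)%R + 2%:E * F (x + z.1)%R))%E).
    apply: ge0_le_integral => //.
    - by move=> x _; rewrite lee_fin sqr_ge0.
    - apply: measurable_funTS; apply: emeasurable_funD; apply: emeasurable_funM => //; exact: measurable_cst.
    move=> x; rewrite mx_norm_ball /ball_ /= sub0r normrN => hx.
    rewrite /F -!EFinM -EFinD lee_fin /m (star_affine hv hx).
    move: (k (_ + _)) (k (_ + _)) => p q.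
    by rewrite -subr_ge0 (_ : _ - _ = (2 * p + q) ^+ 2) ?sqr_ge0//; ring.
  apply: (@le_trans _ _ (\int[leb d]_x (8%:E * F (2^-1 *: x + z.1)%R + 2%:E * F (x + z.1)%R))%E).
    apply: ge0_subset_integral => //.
    - apply: emeasurable_funD; apply: emeasurable_funM => //; exact: measurable_cst.
    by move=> x _; rewrite adde_ge0// mule_ge0.
  rewrite ge0_integralD//; last 4 first.
  - by move=> x _; rewrite mule_ge0.
  - by apply: emeasurable_funM => //; exact: measurable_cst.
  - by move=> x _; rewrite mule_ge0.
  - by apply: emeasurable_funM => //; exact: measurable_cst.
  rewrite !ge0_integralZl// I1 I2 IF invrK -!EFinM -EFinD lee_fin.
  by rewrite mulrA.
move: key; rewrite lee_fin => key.
move: m0; rewrite le_eqVlt => /orP[/eqP <-|mp]; first by rewrite mul0r addr_ge0// mulr_ge0// exprn_ge0.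
rewrite -(ler_pM2l mp); apply: le_trans (_ : _ <= 8 * 2 ^+ d * m + 2 * m) _; last by rewrite le_eqVlt; apply/orP; left; apply/eqP; ring.
by rewrite mulrA -expr2.
Qed.

End kernel.
(** Heights are nonnegative, so a convex combination of them vanishes only if every height with
    positive weight does. *)
Lemma vertex_bottom K i (y : E) : K \in M -> hull K y -> y.2 = 0 -> 0 < bary K y i -> (K i).2 = 0.
Proof.
move=> KM hK y2 bi.
have h2 (w : E) : dotp (0, 1) w + 0 = w.2.
  by rewrite addr0 /dotp /= mul1r /dotv big1 ?add0r// => j _; rewrite mxE mul0r.
have e := affine_bary y (0, 1) 0 (nd KM).
rewrite h2 y2 (eq_bigr (fun j => bary K y j * (K j).2)) in e; last by move=> j _; rewrite h2.
have K2 j : 0 <= (K j).2.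
  by have [_ /andP[]] := closure_cylinder (hull_closure hM KM (vertex_hull j (nd KM))).
have b0 := (hullP y (nd KM)).1 hK.
have /eqP := esym e; rewrite psumr_eq0; last by move=> j _; rewrite mulr_ge0.
by move=> /allP/(_ i (mem_index_enum _)); rewrite mulf_eq0 gt_eqF //= => /eqP.
Qed.

Lemma bary_pos K (y : E) : K \in M -> hull K y -> exists i, 0 < bary K y i.
Proof.
move=> KM hK; have [s1 _] := sum_bary y (nd KM); have b0 := (hullP y (nd KM)).1 hK.
apply: contrapT => h; have : \sum_i bary K y i = 0.
  apply: big1 => i _; apply/eqP; rewrite eq_le b0 andbT leNgt; apply/negP => bi.
  by apply: h; exists i.
by rewrite s1 => /eqP; rewrite oner_eq0.
Qed.

Definition free_nodes : seq E := [seq z <- nodes M | `[< ~ lat z >]].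
(** Stands in for the constant 1, which violates the Dirichlet condition: it equals 1 wherever only
    free vertices carry weight. *)
Definition ones : E -> R^o := fun y : E => \sum_(z <- free_nodes) 1 * hatM z y.

Lemma ones_VH : VHM ones.
Proof.
have hs z : z \in free_nodes -> z \in nodes M /\ ~ lat z.
  by rewrite mem_filter => /andP[/asboolP].
by have [] := hat_sum lO T0 ha hM hreg hqu (fun _ => 1) hs.
Qed.

Lemma ones_node z : z \in nodes M -> ~ lat z -> ones z = 1.
Proof.
move=> zN nl; rewrite /ones (bigD1_seq z)/=; last first.
- by rewrite filter_uniq// undup_uniq.
- by rewrite mem_filter zN andbT; exact/asboolP.
rewrite (hat_node hM zN zN) eqxx mulr1 big1_seq ?addr0// => y /andP[yz].
rewrite mem_filter => /andP[_ yN].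
by rewrite (hat_node hM yN zN) eq_sym (negbTE yz) mulr0.
Qed.

Lemma ones_hull K (y : E) : K \in M -> hull K y -> (forall i, 0 < bary K y i -> ~ lat (K i)) -> ones y = 1.
Proof.
move=> KM hK h; have [hs _] := ones_VH; rewrite (SH_bary hM hs KM hK).
have [s1 _] := sum_bary y (nd KM); rewrite -[RHS]s1; apply: eq_bigr => i _.
have := (hullP y (nd KM)).1 hK i; rewrite le_eqVlt => /orP[/eqP <-|bi]; first by rewrite mul0r.
by rewrite ones_node ?mulr1//; [exact: mem_nodes|exact: h].
Qed.

Lemma patch_Omega_dist z x : z \in nodes M -> nodeO z -> patchO z x -> `|x - z.1| <= H.
Proof.
move=> zN nO [cx _]; apply/ler_addgt0Pr => e e0.
have [y [/= hy xy]] := cx _ (nbhsx_ballx x e e0).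
have [K [i [KM hK Ki _]]] := hat_neq0_hull hM zN hy.
have : `|y - z.1| <= H.
  have := hull_dist KM hK (vertex_hull i (nd KM)); rewrite Ki.
  by apply: le_trans; rewrite prod_normE le_max lexx.
move=> h; rewrite (_ : x - z.1 = (y - z.1) + (x - y)); last by rewrite [RHS]addrC subrKA.
apply: le_trans (ler_normD _ _) _; apply: lerD => //; apply: ltW.
by move: xy; rewrite mx_norm_ball.
Qed.

Local Notation gap w x := (fun h : 'rV[R]_d => ((cut0 (tru w) (x + h) - cut0 (tru w) x) ^+ 2)%:E).

Lemma measurable_gap w x : L2O (tru w) -> measurable_fun setT (gap w x).
Proof.
move=> [mw _]; apply/measurable_EFinP; apply: measurable_funX; apply: measurable_funB; last exact: measurable_cst.
apply: (measurableT_comp (measurable_cut0 lO mw)).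
rewrite (_ : +%R x = (fun h => h + x)); first exact: measurable_add_rV.
by apply/funext => h; rewrite addrC.
Qed.

(** The bound of [kernel_bound] times H^d / (2 [star_radius])^d. *)
Definition interior_const : R := (8 * 2 ^+ d + 2) * (d.+1%:R * (gamma * sigma)) ^+ d.

(** The distance 3 H has three parts: from x to the node z, from z to a point of its patch, and from
    there to the vertices of a simplex around that point. All vertices that carry weight are
    therefore free, and [ones] is 1 on the patch. *)
Lemma interior_pointwise w x : Vf Omega T a M w -> (forall y, `|y - x| <= 3 * H -> Omega y) ->
  ((H ^+ d * cut0 (tru w) x ^+ 2)%:E <= interior_const%:E * \int[leb d]_(h in ball 0%R (6 * H)) gap w x h)%E.
Proof.
move=> Vw inO; have H0 := Hp.
have Ox : Omega x by apply: inO; rewrite subrr normr0 mulr_ge0// ltW.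
have /(VfP lO T0 ha hM hreg hqu)[Lw c0] := Vw.
have [lt _] := trace_H1L oO bO T0 ha Lw.
have cx : cCT (x, 0) by apply: base_closure; rewrite ?lexx.
have [K KM hK] := (mesh_cover hM _).1 cx.
have [i bi] := bary_pos KM hK.
pose z := K i; have zN : z \in nodes M by exact: mem_nodes.
have z2 : z.2 = 0 by exact: (vertex_bottom KM hK _ bi).
have hz : `|z.1 - x| <= H.
  have := hull_dist KM (vertex_hull i (nd KM)) hK.
  by apply: le_trans; rewrite prod_normE le_max lexx.
have Oz y : `|y - z.1| <= H -> Omega y.
  move=> hy; apply: inO; rewrite (_ : y - x = (y - z.1) + (z.1 - x)); last by rewrite subrKA.
  by apply: le_trans (ler_normD _ _) _; lra.
have nO : nodeO z by split => //; apply: inO; apply: le_trans hz _; lra.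
have nl := nodeO_free T0 nO.
have [v Vv /=] := proj_Omega_kernel lO T0 ha hM zN nO.
set k := zext _ _ => -[hk k1 k2].
(* The kernel is the restriction of [v], so pairing it with itself evaluates [v] at z. *)
have kk : ipO k k = v z by rewrite ip_zext k1.
have w0 : ipO (tru w) k = 0.
  by rewrite -k2// -(c0 z zN nl) /coef; case: asboolP.
set c : R := cut0 (tru w) x.
have ce : c = tru w x by rewrite /c zextE.
have Pin y : patchO z y -> `|y - x| <= 2 * H.
  move=> Py; have := patch_Omega_dist zN nO Py => hy.
  rewrite (_ : y - x = (y - z.1) + (z.1 - x)); last by rewrite subrKA.
  by apply: le_trans (ler_normD _ _) _; lra.
have on1 y : patchO z y -> ones (y, 0) = 1.
  move=> Py; have [_ Oy] := Py; have yx := Pin y Py.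
  have cy : cCT (y, 0) by apply: base_closure; rewrite ?lexx.
  have [K' KM' hK'] := (mesh_cover hM _).1 cy.
  apply: (ones_hull KM' hK') => j bj; apply: (nodeO_free T0).
  split; last exact: (vertex_bottom KM' hK' _ bj).
  have hj : `|(K' j).1 - y| <= H.
    have := hull_dist KM' (vertex_hull j (nd KM')) hK'.
    by apply: le_trans; rewrite prod_normE le_max lexx.
  apply: inO; rewrite (_ : _ - x = ((K' j).1 - y) + (y - x)); last by rewrite subrKA.
  by apply: le_trans (ler_normD _ _) _; lra.
have one2 : L2O (base ones) by apply: (SH_l2O lO T0 hM); case: ones_VH.
have one_k : ipO (base ones) k = 1 by rewrite (k1 _ ones_VH) (ones_node zN nl).
(* On the patch [f] is the difference of the trace to its value c at x; its pairing with the kernel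
   is -c, since that of [tru w] is 0 and that of [ones] is 1. *)
pose f : 'rV[R]_d -> R^o := (- c) *: base ones + tru w.
have f2 : L2O f by exact: (l2O_lin oO).
have fk : ipO f k = - c by rewrite (ipO_lin oO _ one2 lt hk) one_k w0 addr0 mulr1.
have m1 : measurable_fun Omega (cst 1 : 'rV[R]_d -> R) by exact: measurable_cst.
have p1 (b : 'rV[R]_d) : Omega b -> 0 < (cst 1 : 'rV[R]_d -> R) b by [].
have sP : patchO z `<=` Omega by move=> y [].
have mP := patch_Omega_measurable T M lO z.
have Pf2 : L2O (zext (patchO z) f) by exact: (l2_zext mO m1 p1 mP f2).
have Pk2 : L2O k := hk.
have cs : c ^+ 2 <= ipO (zext (patchO z) f) (zext (patchO z) f) * v z.
  have := ip_cauchy_schwarz mO m1 p1 Pf2 hk; rewrite kk.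
  have -> : ipO (zext (patchO z) f) k = ipO f k by exact: ip_zext.
  by rewrite fk sqrrN.
have Pm : measurable_fun setT (zext (patchO z) f).
  by rewrite -(zext_cut0 _ sP); apply: (measurable_cut0 lO); case: Pf2.
have I1 : ((ipO (zext (patchO z) f) (zext (patchO z) f))%:E <= \int[leb d]_(h in ball 0%R (6 * H)) gap w x h)%E.
  rewrite -(integral_cut0_sqr lO Pf2) (zext_cut0 _ sP).
  rewrite -(integral_shift x (F := fun y => (zext (patchO z) f y ^+ 2)%:E)); last 2 first.
  - by apply/measurable_EFinP; exact: measurable_funX.
  - by move=> y; rewrite lee_fin sqr_ge0.
  rewrite [leRHS]integral_mkcond; apply: ge0_le_integral => //.
  - by move=> y _; rewrite lee_fin sqr_ge0.
  - apply/measurable_EFinP; apply: measurable_funX; apply: (measurableT_comp Pm); exact: measurable_add_rV.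
  - apply: (measurable_restrictT _ _).1; first exact: measurable_ball_rV.
    by apply: measurable_funTS; exact: measurable_gap.
  move=> y _; rewrite patchE; have [Py|nP] := pselect (patchO z (y + x)); last first.
    by rewrite zext_out// expr0n /=; case: ifP => // _; rewrite lee_fin sqr_ge0.
  have yH := Pin _ Py; rewrite addrK in yH.
  have yb : ball 0 (6 * H) y by rewrite mx_norm_ball /ball_ /= sub0r normrN; lra.
  rewrite mem_set// zextE// lee_fin [x + y]addrC (zextE _ (sP _ Py)) -/c.
  rewrite -[f (y + x)]/(- c * ones (y + x, 0) + tru w (y + x)) on1// mulr1.
  by rewrite addrC.
have vb := kernel_bound zN nO Oz Vv hk kk.
have vz0 : 0 <= v z by rewrite -kk; exact: (@ipO_ge0 R d Omega).
have gs := gs_gt0.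
have Hd : H ^+ d = (2 * star_radius) ^+ d * (d.+1%:R * (gamma * sigma)) ^+ d.
  rewrite -exprMn; congr (_ ^+ _); rewrite /star_radius; move: gs; have : 0 < d.+1%:R :> R by [].
  move: (gamma * sigma) d.+1%:R H => p q r q0 p0.
  by field; rewrite !lt0r_neq0.
apply: (@le_trans _ _ (interior_const%:E * (ipO (zext (patchO z) f) (zext (patchO z) f))%:E)%E); last first.
  apply: lee_wpmul2l => //; rewrite lee_fin mulr_ge0// ?addr_ge0// ?mulr_ge0// ?exprn_ge0//.
  by rewrite mulr_ge0// ltW.
rewrite -EFinM lee_fin -/c Hd /interior_const.
have D0 : 0 <= (d.+1%:R * (gamma * sigma)) ^+ d by rewrite exprn_ge0// mulr_ge0// ltW.
have i0 : 0 <= ipO (zext (patchO z) f) (zext (patchO z) f) by exact: (@ipO_ge0 R d Omega).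
have s0 : 0 <= (2 * star_radius) ^+ d by rewrite exprn_ge0// mulr_ge0// ltW// star_radius_gt0.
move: cs vb vz0 D0 i0 s0; move: (ipO _ _) (v z) (_ ^+ d) (_ ^+ d) (8 * _ + 2) => p q r t u cs vb q0 r0 p0 t0.
apply: (@le_trans _ _ (t * r * (p * q))).
  by apply: ler_wpM2l => //; exact: mulr_ge0.
rewrite (_ : t * r * (p * q) = (q * t) * (r * p)); last by ring.
by rewrite -[u * r * p]mulrA; apply: ler_wpM2r => //; exact: mulr_ge0.
Qed.

(** The segment from x to y leaves Omega at a boundary point within 3 H of x. Near it there is an
    exterior ball of radius proportional to [t], where the extended trace vanishes and the gap is
    the squared value at x. The form of [t] makes it proportional to H and, as H <= D, at most the
    admissible scale 1/(n+1). *)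
Lemma boundary_pointwise w x y n (D t : R) : 0 < D -> H <= D -> L2O (tru w) -> Omega x -> ~ Omega y -> `|y - x| <= 3 * H ->
  (forall x, (closure Omega `\` Omega) x -> exterior_at Omega n x) ->
  t = H * (n.+1%:R^-1 / (D + 1)) ->
  ((cut0 (tru w) x ^+ 2 * (2 * (n.+1%:R^-1 * t)) ^+ d)%:E <=
    \int[leb d]_(h in ball 0%R (6 * H)) gap w x h)%E.
Proof.
move=> D0 HD lt Ox nOy hy hext te; have H0 := Hp.
have n0 : 0 < n.+1%:R^-1 :> R by rewrite invr_gt0.
have n1 : n.+1%:R^-1 <= 1 :> R by rewrite invf_le1// ler1n.
have D1 : 0 < D + 1 by lra.
have t0 : 0 < t by rewrite te mulr_gt0// divr_gt0.
have tH : t <= H.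
  rewrite te -[X in _ <= X]mulr1; apply: ler_wpM2l; first exact: ltW.
  by rewrite ler_pdivrMr//; move: n1 D0; move: (n.+1%:R^-1) => p p1 D0; lra.
have tn : t <= n.+1%:R^-1.
  rewrite te mulrCA -[X in _ <= X]mulr1; apply: ler_wpM2l; first exact: ltW.
  by rewrite ler_pdivrMr//; lra.
have [xb [bx dx]] : exists xb, (closure Omega `\` Omega) xb /\ `|xb - x| <= 3 * H.
  (* [first_exit] concerns open sets of the product space, so Omega is replaced by Omega x R. *)
  pose Dm : set E := [set u | Omega u.1].
  have oD : open Dm by apply: (@open_comp E 'rV[R]_d fst Omega) => //; [move=> u _; exact: cvg_fst|exact: oO].
  have nD : ~ Dm ((x, 0) + (y - x, 0)) by rewrite /Dm /= addrC subrK.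
  have [s [s01 nDs hs]] := first_exit oD (Ox : Dm (x, 0)) nD.
  have /andP[s0 s1] := s01; pose b r := x + r *: (y - x).
  have yx0 : 0 < `|y - x| + 1 by have := normr_ge0 (y - x); lra.
  exists (b s); split; last first.
    rewrite /b addrAC subrr add0r normrZ gtr0_norm//; apply: le_trans hy.
    by rewrite ler_piMl.
  split => // B /nbhs_ballP[e /= e0 hB].
  pose r := Num.max 0 (s - e / (`|y - x| + 1)).
  have e1 : 0 < e / (`|y - x| + 1) by rewrite divr_gt0.
  have r0 : 0 <= r by rewrite le_max lexx.
  have rs : r < s by rewrite gt_max s0 /=; lra.
  have sr : s - r <= e / (`|y - x| + 1).
    have : s - e / (`|y - x| + 1) <= r by rewrite le_max lexx orbT.
    lra.
  exists (b r); split; first by apply: (hs r); rewrite r0.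
  apply: hB; rewrite mx_norm_ball /ball_ /= /b opprD addrACA subrr add0r -scalerBl normrZ gtr0_norm ?subr_gt0//.
  have h1 : (s - r) * (`|y - x| + 1) <= e by rewrite -ler_pdivlMr.
  have : 0 < s - r by rewrite subr_gt0.
  lra.
have [_ nb] := bx.
have [y' [hy' ho]] := hext xb bx nb t (introT andP (conj t0 tn)).
set r := n.+1%:R^-1 * t in ho *; have r0 : 0 < r by rewrite mulr_gt0.
have rt : r <= t by rewrite ler_piMl// ltW.
have sub : ball (y' - x) r `<=` ball (0 : 'rV[R]_d) (6 * H).
  move=> h; rewrite !mx_norm_ball /ball_ /= sub0r normrN => hh.
  rewrite (_ : h = (y' - xb) + (xb - x) - (y' - x - h)); last by rewrite subrKA opprB addrC subrK.
  apply: le_lt_trans (ler_normB _ _) _.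
  apply: le_lt_trans (lerD (ler_normD _ _) (lexx _)) _; lra.
have mg := measurable_gap x lt.
apply: (@le_trans _ _ (\int[leb d]_(h in ball (y' - x)%R r) gap w x h)%E); last first.
  apply: ge0_subset_integral => //; [exact: measurable_ball_rV|exact: measurable_ball_rV|exact: measurable_funTS|].
  by move=> h _; rewrite lee_fin sqr_ge0.
rewrite EFinM -(leb_ball (y' - x) r0) -integral_cst; last exact: measurable_ball_rV.
rewrite le_eqVlt; apply/orP; left; apply/eqP; apply: eq_integral => h /set_mem.
rewrite mx_norm_ball /ball_ /= => hh.
rewrite [zext Omega (tru w) (x + h)]zext_out ?sub0r ?sqrrN//.
have e2 : y' + (x + h - y') = x + h by rewrite addrC subrK.
by rewrite -e2; apply: ho; rewrite -normrN opprB opprD addrA ltW.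
Qed.

End trace_pointwise.

(** * The trace inequality on the fine space *)

Section trace_Vf.
Context {R : realType} (d : nat) (Omega : set 'rV[R]_d) (T a gamma sigma : R).
Local Notation E := ('rV[R]_d * R)%type.
Local Notation CT := (cylinder Omega T).
Hypotheses (lO : lipschitz_domain Omega) (T0 : 0 < T) (ha : -1 < a < 1).
Local Notation ipO := (@ip R _ 'rV[R]_d (leb d) Omega (cst 1)).
Local Notation tru := (trace Omega T a).
Local Notation eip := (eip Omega T a).
Local Notation cut0 := (zext (X := 'rV[R]_d) Omega).

(** Simplices lie in the closed cylinder. The bound matters because exterior balls and horizontal
    layers are available only up to a fixed scale. *)
Lemma mesh_size_bounded : exists2 D : R, 0 < D & forall M : seq (simplex (R := R) d), triangulates M CT -> mesh_size M <= D.
Proof.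
have [r r0 hr] := cylinder_bounded (lip_bounded lO) T0.
have D0 : 0 < d.+1%:R * (r + r) by rewrite mulr_gt0// addr_gt0.
exists (d.+1%:R * (r + r)) => // M hM.
have hc z : closure CT z -> `|z| <= r by apply: closure_norm_le.
rewrite /mesh_size big_seq; apply: bigmax_le => [|K KM]; first exact: ltW.
have nK := mesh_nondegenerate hM KM.
apply: ge_sup.
  by exists (normp (K ord0 - K ord0)), (K ord0); [exact: vertex_hull|exists (K ord0) => //; exact: vertex_hull].
move=> _ [z hz [w hw <-]]; apply: le_trans (normp_le_norm _) _.
apply: ler_wpM2l => //; apply: le_trans (ler_normB _ _) _.
by apply: lerD; apply: hc; exact: (hull_closure hM KM).
Qed.

Definition transl_const (kap : R) : R :=
  kap `^ (1 - a) * ((6 / ((1 - a) * (a + 1)) + 12 * (d.+1%:R * 36) * kap^-1 ^+ 2) / ((1 - 2^-1 `^ (a + 1)) / (a + 1))).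

(** For q = kap r and |h| <= 6 r, both [Kf q a] and the square of h are of order r^2, while [c0 q a]
    is of order r^(1+a). *)
Lemma transl_le (kap r : R) (h : 'rV[R]_d) : 0 < kap -> 0 < r -> `|h| <= 6 * r ->
  transl a (kap * r) h <= transl_const kap * r `^ (1 - a).
Proof.
move=> k0 r0 hh; have /andP[a1 a2] := ha.
have p1 : 0 < 1 - a by lra.
have p2 : 0 < a + 1 by lra.
set q := kap * r; have q0 : 0 < q by exact: mulr_gt0.
have dh : dotv h h <= d.+1%:R * 36 * kap^-1 ^+ 2 * (q `^ (1 - a) * q `^ (a + 1)).
  rewrite -powRD; last by rewrite (gt_eqF q0) implybT.
  rewrite (_ : 1 - a + (a + 1) = 2%:R); last by ring.
  rewrite (powR_mulrn _ (ltW q0)); have := dotv_abs_le hh hh.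
  move=> /(le_trans (ler_norm _)) /le_trans; apply.
  rewrite le_eqVlt; apply/orP; left; apply/eqP; rewrite /q.
  by move: d.+1%:R => D; field; rewrite lt0r_neq0.
have cc0 : 0 < (1 - 2^-1 `^ (a + 1)) / (a + 1) by rewrite divr_gt0// subr_gt0 powR_half_lt1.
have qa0 : 0 < q `^ (a + 1) by exact: powR_gt0.
have qb0 : 0 < q `^ (1 - a) by exact: powR_gt0.
have rb : q `^ (1 - a) = kap `^ (1 - a) * r `^ (1 - a) by rewrite powRM// ltW.
rewrite /transl /c0 /Kf ler_pdivrMr; last exact: mulr_gt0.
apply: (@le_trans _ _ (3 * (2 * (q `^ (1 - a) / (1 - a) * (q `^ (a + 1) / (a + 1))) +
   4 * (d.+1%:R * 36 * kap^-1 ^+ 2 * (q `^ (1 - a) * q `^ (a + 1)))))).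
  by apply: ler_wpM2l => //; apply: lerD => //; exact: ler_wpM2l.
rewrite /transl_const rb le_eqVlt; apply/orP; left; apply/eqP.
have c2 : 1 - 2^-1 `^ (a + 1) != 0.
  by apply/lt0r_neq0; rewrite subr_gt0 powR_half_lt1.
move: (kap `^ (1 - a)) (r `^ (1 - a)) (q `^ (a + 1)) d.+1%:R c2.
move: (2^-1 `^ (a + 1)) => u v1 v2 v3 D c2.
by field; rewrite c2 !lt0r_neq0.
Qed.

Lemma measurable_gap_joint (g : 'rV[R]_d -> R) : measurable_fun setT g ->
  measurable_fun [set: 'rV[R]_d * 'rV[R]_d] (fun p => (g (p.1 + p.2) - g p.1) ^+ 2).
Proof.
move=> mg; apply: measurable_funX; apply: measurable_funB; last by apply: (measurableT_comp mg); exact: measurable_fst.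
apply: (measurableT_comp mg); apply: (measurable_fun_rV measurableT) => i.
rewrite (_ : (fun p => _) = (fun p : 'rV[R]_d * 'rV[R]_d => p.1 ord0 i + p.2 ord0 i)); last by apply/funext => p; rewrite mxE.
apply: measurable_funD.
  by apply: (measurableT_comp (measurable_coord i)); exact: measurable_fst.
by apply: (measurableT_comp (measurable_coord i)); exact: measurable_snd.
Qed.

Lemma trace_Vf_le : exists2 C : R, 0 < C & forall M : seq (simplex (R := R) d),
  triangulates M CT -> shape_regular gamma M -> quasi_uniform sigma M ->
  forall w, Vf Omega T a M w ->
  ipO (tru w) (tru w) <= C * mesh_size M `^ (1 - a) * eip w w.
Proof.
have [n hn] := exterior_uniform lO.
have [D D0 hD] := mesh_size_bounded.
pose p : R := n.+1%:R^-1; have p0 : 0 < p by rewrite invr_gt0.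
have D1 : 0 < D + 1 by lra.
pose kap := p / (D + 1); have kap0 : 0 < kap by rewrite divr_gt0.
(* The layer has height [kap2 * r], which is at most T because r <= D. *)
pose kap2 := T / (D + 1); have kap20 : 0 < kap2 by rewrite divr_gt0.
(* [C1] covers the interior and the boundary bound. The absolute value appears because the constant
   is fixed before any mesh, when the signs of [gamma] and [sigma] are unknown. *)
pose C1 : R := `|interior_const d gamma sigma| + ((2 * (p * kap)) ^+ d)^-1.
have pk : 0 < (2 * (p * kap)) ^+ d by apply: exprn_gt0; apply: mulr_gt0 => //; exact: mulr_gt0.
have C10 : 0 <= C1 by rewrite addr_ge0// invr_ge0 ltW.
pose C2 : R := `|transl_const kap2|.
have C20 : 0 <= C2 by exact: normr_ge0.
exists (C1 * 12 ^+ d * (6 * C2) + 1).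
  apply: ltr_pwDr => //; apply: mulr_ge0; last by rewrite mulr_ge0.
  by apply: mulr_ge0 => //; exact: exprn_ge0.
move=> M hM hreg hqu w Vw; set r := mesh_size M.
have r0 : 0 < r := mesh_size_gt0 lO T0 hM.
have rD : r <= D := hD M hM.
have /(VfP lO T0 ha hM hreg hqu)[Lw _] := Vw.
have [lt _] := trace_H1L (lip_open lO) (lip_bounded lO) T0 ha Lw.
set g := cut0 (tru w); set EN := eip w w.
have EN0 : 0 <= EN by exact: eip_ge0.
have mg : measurable_fun setT g by apply: (measurable_cut0 lO); case: lt.
pose I x := (\int[leb d]_(h in ball 0%R (6 * r)) ((g (x + h) - g x) ^+ 2)%:E)%E.
have I0 x : (0 <= I x)%E by apply: integral_ge0 => h _; rewrite lee_fin sqr_ge0.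
have pw x : ((r ^+ d * g x ^+ 2)%:E <= C1%:E * I x)%E.
  have [Ox|nO] := pselect (Omega x); last first.
    by rewrite /g zext_out// expr0n mulr0 mule_ge0.
  have [inO|] := pselect (forall y, `|y - x| <= 3 * r -> Omega y).
    apply: le_trans (interior_pointwise lO T0 ha hM hreg hqu Vw inO) _.
    apply: lee_wpmul2r; first exact: I0.
    by rewrite lee_fin (le_trans (ler_norm _))// lerDl invr_ge0 ltW.
  move=> /existsNP[y /not_implyP[yx nOy]].
  have h1 := boundary_pointwise lO T0 hM D0 rD lt Ox nOy yx hn erefl.
  apply: (@le_trans _ _ (((2 * (p * kap)) ^+ d)^-1%:E * I x)%E); last first.
    by apply: lee_wpmul2r; rewrite ?I0// lee_fin lerDr.
  rewrite -lee_pdivrMl ?invr_gt0// invrK -EFinM; apply: le_trans h1.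
  rewrite lee_fin le_eqVlt; apply/orP; left; apply/eqP.
  rewrite -/p -/kap -/r (_ : 2 * (p * (r * kap)) = r * (2 * (p * kap))); last by ring.
  by rewrite [(r * _) ^+ d]exprMn -/g mulrC -mulrA [RHS]mulrCA.
have mG := measurable_gap_joint mg.
pose G (q : 'rV[R]_d * 'rV[R]_d) : \bar R := ((\1_(ball 0%R (6 * r)) q.2)%:E * ((g (q.1 + q.2) - g q.1) ^+ 2)%:E)%E.
have mGG : measurable_fun setT G.
  apply: emeasurable_funM; last exact/measurable_EFinP.
  have mi : measurable_fun setT (\1_(ball 0 (6 * r)) : 'rV[R]_d -> R).
    by apply: measurable_indic; exact: measurable_ball_rV.
  apply/measurable_EFinP; apply: (@measurableT_comp _ _ _ ('rV[R]_d * 'rV[R]_d)%type 'rV[R]_d R _ _ snd mi).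
  exact: measurable_snd.
have G0 q : (0 <= G q)%E by rewrite mule_ge0// lee_fin ?sqr_ge0// indicE ler0n.
have IG x : I x = (\int[leb d]_h G (x, h))%E.
  rewrite /I integral_mkcond; apply: eq_integral => h _; rewrite patchE /G indicE /=.
  by case: ifP => _; rewrite ?mul1e ?mul0e.
have mI : measurable_fun setT I.
  rewrite (_ : I = fubini_F (leb d) G); last by apply/funext => x; rewrite IG.
  exact: measurable_fun_fubini_tonelli_F.
have q0 : 0 < kap2 * r by rewrite mulr_gt0.
have qT : kap2 * r <= T.
  rewrite /kap2 mulrAC ler_pdivrMr//; apply: ler_wpM2l; first exact: ltW.
  lra.
have r1 : 0 <= r `^ (1 - a) by exact: powR_ge0.
have bound h : (\int[leb d]_x G (x, h) <= (\1_(ball 0%R (6 * r)) h)%:E * (6 * (C2 * r `^ (1 - a)) * EN)%:E)%E.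
  rewrite /G /= ge0_integralZl//; last 2 first.
  - apply/measurable_EFinP; apply: measurable_funX; apply: measurable_funB => //.
    by apply: (measurableT_comp mg); exact: measurable_add_rV.
  - by move=> x _; rewrite lee_fin sqr_ge0.
  rewrite indicE; have [hb|hb] := boolP (h \in _); last by rewrite !mul0e.
  rewrite !mul1e; apply: le_trans (trace_translation lO T0 ha h Lw q0 qT) _.
  rewrite lee_fin; apply: ler_wpM2r => //; apply: ler_wpM2l => //.
  move: hb => /set_mem; rewrite mx_norm_ball /ball_ /= sub0r normrN => /ltW hb.
  apply: le_trans (transl_le kap20 r0 hb) _; apply: ler_wpM2r => //; exact: ler_norm.
(* The pointwise bound is integrated over x and the integrals are exchanged; the volume (12 r)^d of
   the ball of radius 6 r compensates the factor r^d on the left. *)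
have key : ((r ^+ d * ipO (tru w) (tru w))%:E <= C1%:E * ((12 * r) ^+ d * (6 * (C2 * r `^ (1 - a)) * EN))%:E)%E.
  rewrite EFinM -(integral_cut0_sqr lO lt) -ge0_integralZl//; last 3 first.
  - by apply/measurable_EFinP; exact: measurable_funX.
  - by move=> x _; rewrite lee_fin sqr_ge0.
  - by rewrite lee_fin exprn_ge0// ltW.
  apply: (@le_trans _ _ (\int[leb d]_x (C1%:E * I x))%E).
    apply: ge0_le_integral => //.
    - by move=> x _; rewrite -EFinM lee_fin mulr_ge0 ?sqr_ge0// exprn_ge0// ltW.
    - by apply: emeasurable_funM; [exact: measurable_cst|apply/measurable_EFinP; exact: measurable_funX].
    - by apply: emeasurable_funM => //; exact: measurable_cst.
    by move=> x _; rewrite -EFinM; exact: pw.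
  rewrite ge0_integralZl//; apply: lee_wpmul2l => //.
  have -> : (\int[leb d]_x I x = \int[leb d]_h \int[leb d]_x G (x, h))%E.
    rewrite (eq_integral _ _ (fun x _ => IG x)).
    have e0 := @fubini_tonelli _ _ _ _ R (leb d) (leb d) G mGG G0; exact e0.
  have b0 : 0 <= 6 * (C2 * r `^ (1 - a)) * EN by rewrite mulr_ge0// mulr_ge0// mulr_ge0.
  apply: (@le_trans _ _ (\int[leb d]_h ((\1_(ball 0%R (6 * r)) h)%:E * (6 * (C2 * r `^ (1 - a)) * EN)%:E))%E).
    apply: ge0_le_integral => //.
    - by move=> h _; apply: integral_ge0.
    - have m0 := @measurable_fun_fubini_tonelli_G _ _ 'rV[R]_d 'rV[R]_d R (leb d) G mGG G0; exact m0.
    - apply: emeasurable_funM; last exact: measurable_cst.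
      by apply/measurable_EFinP; apply: measurable_indic; exact: measurable_ball_rV.
  rewrite ge0_integralZr//; last first.
    by apply/measurable_EFinP; apply: measurable_indic; exact: measurable_ball_rV.
  rewrite integral_indic ?setIT//; last exact: measurable_ball_rV.
  have r6 : 0 < 6 * r by rewrite mulr_gt0.
  rewrite [leRHS]EFinM; apply: lee_wpmul2r; first by rewrite lee_fin.
  rewrite (_ : 12 * r = 2 * (6 * r)); last by ring.
  by rewrite -(leb_ball (0 : 'rV[R]_d) r6).
move: key; rewrite -EFinM lee_fin exprMn => key.
have rd : 0 < r ^+ d by rewrite exprn_gt0.
rewrite -(ler_pM2l rd); apply: le_trans key _.
rewrite [X in X <= _](_ : _ = r ^+ d * (C1 * 12 ^+ d * (6 * C2) * r `^ (1 - a) * EN)); last first.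
  by move: (C1) (C2) (12 ^+ d) (r ^+ d) (r `^ (1 - a)) => u1 u2 u3 u4 u5; ring.
apply: ler_wpM2l; first exact: ltW.
by apply: ler_wpM2r => //; apply: ler_wpM2r => //; rewrite lerDl.
Qed.

End trace_Vf.

(** * The multiscale error *)

Section energy_algebra.
Context {R : realType}.

(** The chain X^2 <= K t <= K C q <= K C X / k, divided by X. *)
Lemma energy_bound (X K t C q k : R) : 0 < k -> 0 <= X -> 0 <= K -> 0 <= C ->
  X ^+ 2 <= K * t -> t <= C * q -> k * q <= X -> X <= K * C / k.
Proof.
move=> k0 X0 K0 C0 h1 h2 h3.
have h4 : X ^+ 2 <= K * C / k * X.
  apply: le_trans h1 _; rewrite -!mulrA; apply: ler_wpM2l => //.
  apply: le_trans h2 _; apply: ler_wpM2l => //.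
  by rewrite mulrC ler_pdivlMr// mulrC.
move: X0; rewrite le_eqVlt => /orP[/eqP <-|Xp]; first by rewrite divr_ge0 ?mulr_ge0// ltW.
by rewrite -(ler_pM2r Xp) -expr2.
Qed.

Lemma error_constant_sqr (c k C N : R) : 0 < k -> 0 <= C ->
  (`|c| / k * Num.sqrt C * N) ^+ 2 = c ^+ 2 * N ^+ 2 * C / k / k.
Proof.
move=> k0 C0; rewrite !exprMn sqr_sqrtr// real_normK ?num_real//.
by field; rewrite lt0r_neq0.
Qed.

Lemma error_constant_ge0 (c k C N : R) : 0 < k -> 0 <= N -> 0 <= `|c| / k * Num.sqrt C * N.
Proof. by move=> k0 N0; rewrite mulr_ge0// mulr_ge0 ?sqrtr_ge0// divr_ge0// ltW. Qed.

End energy_algebra.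

Section multiscale_estimate.
Context {R : realType} (d : nat) (Omega : set 'rV[R]_d) (T a alpha beta : R) (A : 'rV[R]_d -> 'M[R]_d).
Local Notation E := ('rV[R]_d * R)%type.
Local Notation Em := ('rV[R]_d * measurableTypeR R)%type.
Local Notation CT := (cylinder Omega T).
Local Notation nu := (vol d).
Hypotheses (lO : lipschitz_domain Omega) (T0 : 0 < T) (ha : -1 < a < 1).
Hypotheses (al0 : 0 < alpha) (hA : elliptic Omega alpha beta A).
Local Notation oO := (lip_open lO).
Local Notation bO := (lip_bounded lO).
Local Notation wt := (@wt R d a).
Local Notation ipO := (@ip R _ 'rV[R]_d (leb d) Omega (cst 1)).
Local Notation mCT := (measurable_cylinder T oO).
Local Notation mO := (measurable_Omega oO).
Local Notation mwt := (@measurable_wt R d Omega T a).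
Local Notation wt_gt0 := (@wt_gt0 R d Omega T a).
Local Notation V2 := (V2 Omega T a).
Local Notation vip := (vip Omega T a).
Local Notation wg := (wgrad CT).
Local Notation W := (H1w a CT).
Local Notation L := (H1L Omega T a).
Local Notation tru := (trace Omega T a).
Local Notation eip := (eip Omega T a).
Local Notation bf := (bform Omega T a A).
Implicit Types (p q : E) (F G : E -> E) (u v w : E -> R^o).

(** The ellipticity constants of the block matrix diag(A, 1) are those of A, cut off at 1. *)
Definition coerc : R := Num.min alpha 1.
Definition cont : R := Num.max beta 1.

Lemma coerc_gt0 : 0 < coerc. Proof. by rewrite lt_min al0 ltr01. Qed.
Lemma cont_gt0 : 0 < cont. Proof. by rewrite lt_max ltr01 orbT. Qed.

Lemma dotvE (x y : 'rV[R]_d) : dotv x y = (x *m y^T) ord0 ord0.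
Proof. by rewrite mxE; apply: eq_bigr => i _; rewrite mxE. Qed.

Lemma Bmul_sym z p q : CT z -> dotp (Bmul (A z.1) p) q = dotp (Bmul (A z.1) q) p.
Proof.
move=> [Oz _]; have [_ _ /(_ _ Oz) hs _] := hA.
rewrite /dotp /Bmul /= [q.2 * _]mulrC; congr (_ + _).
have e (x : 'M[R]_1) : x ord0 ord0 = x^T ord0 ord0 by rewrite mxE.
by rewrite !dotvE hs [LHS]e !trmx_mul trmxK hs mulmxA.
Qed.

Lemma Bmul_linl (z : E) c p q (r : E) : dotp (Bmul (A z.1) (c *: p + q)) r = c * dotp (Bmul (A z.1) p) r + dotp (Bmul (A z.1) q) r.
Proof.
rewrite -dotpZl -dotpDl; congr dotp.
by rewrite /Bmul; congr (_, _); rewrite /= mulmxDl -scalemxAl.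
Qed.

Lemma Bmul_bounds z p : CT z -> coerc * dotp p p <= dotp (Bmul (A z.1) p) p <= cont * dotp p p.
Proof.
move=> [Oz _]; have [_ _ _ /(_ _ Oz p.1)/andP[h1 h2]] := hA.
have d0 := dotv_ge0 p.1; have s0 := sqr_ge0 p.2; rewrite expr2 in s0.
have c1 : coerc <= alpha by rewrite ge_min lexx.
have c2 : coerc <= 1 by rewrite ge_min lexx orbT.
have c3 : beta <= cont by rewrite le_max lexx.
have c4 : 1 <= cont by rewrite le_max lexx orbT.
rewrite /dotp /Bmul /= !mulrDr; apply/andP; split; apply: lerD.
- by apply: le_trans h1; exact: ler_wpM2r.
- by rewrite -[X in _ <= X]mul1r; exact: ler_wpM2r.
- by apply: le_trans h2 _; exact: ler_wpM2r.
- by rewrite -[X in X <= _]mul1r; exact: ler_wpM2r.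
Qed.

(** Polarization: the quadratic form is nonnegative at p + q and at q - p, which bounds the mixed
    term by the diagonal ones. *)
Lemma Bmul_abs_le z p q : CT z -> `|dotp (Bmul (A z.1) p) q| <= cont * (dotp p p + dotp q q).
Proof.
move=> Cz; have h1 := Bmul_bounds p Cz; have h2 := Bmul_bounds q Cz.
have h3 := Bmul_bounds (1 *: p + q) Cz; have h4 := Bmul_bounds ((-1) *: p + q) Cz.
have c0 := coerc_gt0; have c1 := cont_gt0.
have nn (r : E) : 0 <= coerc * dotp r r by rewrite mulr_ge0 ?dotp_ge0// ltW.
have B3 := le_trans (nn _) (proj1 (andP h3)); have B4 := le_trans (nn _) (proj1 (andP h4)).
have expand c : dotp (Bmul (A z.1) (c *: p + q)) (c *: p + q) =
    c ^+ 2 * dotp (Bmul (A z.1) p) p + 2 * c * dotp (Bmul (A z.1) p) q + dotp (Bmul (A z.1) q) q.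
  rewrite Bmul_linl (Bmul_sym p (c *: p + q) Cz) (Bmul_sym q (c *: p + q) Cz) !Bmul_linl.
  by rewrite (Bmul_sym q p Cz); ring.
rewrite !expand in B3 B4; move/andP: h1 => [_ b1]; move/andP: h2 => [_ b2].
have n1 : 0 <= cont * dotp p p by rewrite mulr_ge0 ?dotp_ge0// ltW.
have n2 : 0 <= cont * dotp q q by rewrite mulr_ge0 ?dotp_ge0// ltW.
rewrite mulrDr; move: (dotp (Bmul _ p) p) (dotp (Bmul _ p) q) (dotp (Bmul _ q) q) (cont * _) (cont * _) B3 B4 b1 b2 n1 n2.
by move=> x y r s t B3 B4 b1 b2 n1 n2; rewrite ler_norml; apply/andP; split; lra.
Qed.

Definition Bip F G : R := \int[nu]_(z in CT) (dotp (Bmul (A z.1) (F z)) (G z) * z.2 `^ a).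

Lemma measurable_Bmul F G : V2 F -> V2 G ->
  @measurable_fun _ _ Em R CT (fun z => dotp (Bmul (A z.1) (F z)) (G z)).
Proof.
move=> hF hG; have mF i : @measurable_fun _ _ Em R CT (fun z => crd i (F z)) by case: (hF i).
have mG i : @measurable_fun _ _ Em R CT (fun z => crd i (G z)) by case: (hG i).
have c1 (p : E) (i : 'I_d) : crd (lift ord0 i) p = p.1 ord0 i by case: p => x t; rewrite /crd cons_rVS.
have c2 (p : E) : crd ord0 p = p.2 by rewrite /crd cons_rV0.
have mA i j : @measurable_fun _ _ Em R CT (fun z => A z.1 i j).
  have [mA _ _ _] := hA.
  apply: (@measurable_comp _ _ _ Em 'rV[R]_d R Omega (fun x => A x i j) CT fst); first exact: mO.
  - by move=> _ [z [Oz _] <-].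
  - exact: mA.
  - by apply: measurable_funTS; exact: measurable_fst.
rewrite (_ : (fun z => _) = (fun z => \sum_i (\sum_j crd (lift ord0 j) (F z) * A z.1 i j) * crd (lift ord0 i) (G z) + crd ord0 (F z) * crd ord0 (G z))).
  apply: measurable_funD; last exact: measurable_funM.
  apply: measurable_sum => i; apply: measurable_funM => //.
  by apply: measurable_sum => j; exact: measurable_funM.
apply/funext => z; rewrite /dotp /Bmul /= !c2; congr (_ + _); apply: eq_bigr => i _.
by rewrite c1 mxE; congr (_ * _); apply: eq_bigr => j _; rewrite c1 mxE.
Qed.

Lemma Bip_integrable F G : V2 F -> V2 G ->
  nu.-integrable CT (EFin \o (fun z => dotp (Bmul (A z.1) (F z)) (G z) * wt z)).
Proof.
move=> hF hG; have [i1 _] := vipE oO hF hF; have [i2 _] := vipE oO hG hG.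
have i3 := integrableZl mCT cont (integrableD mCT i1 i2).
apply: le_integrable i3; first exact: mCT.
  by apply/measurable_EFinP; apply: measurable_funM; [exact: measurable_Bmul|exact: mwt].
move=> z Cz; have w0 := ltW (wt_gt0 Cz); have c0 := ltW cont_gt0.
have h : `|dotp (Bmul (A z.1) (F z)) (G z) * wt z| <=
    `|cont * (dotp (F z) (F z) * wt z + dotp (G z) (G z) * wt z)|.
  rewrite normrM (ger0_norm w0) -mulrDl mulrA.
  rewrite [leRHS]ger0_norm; last by rewrite mulr_ge0// mulr_ge0// addr_ge0// dotp_ge0.
  by apply: ler_wpM2r => //; exact: Bmul_abs_le.
exact h.
Qed.

Lemma Bip_lin c F F' G : V2 F -> V2 F' -> V2 G -> Bip (c *: F + F') G = c * Bip F G + Bip F' G.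
Proof.
move=> h1 h2 h3; rewrite /Bip -(Rintegral_lin mCT c (Bip_integrable h1 h3) (Bip_integrable h2 h3)).
apply: eq_Rintegral => z _; rewrite -[(c *: F + F') z]/(c *: F z + F' z) Bmul_linl -[wt z]/(z.2 `^ a).
by rewrite mulrDl mulrA.
Qed.

Lemma Bip_sym F G : Bip F G = Bip G F.
Proof. by apply: eq_Rintegral => z /set_mem Cz; rewrite Bmul_sym. Qed.

Lemma Bip_ae F F' G : V2 F -> V2 F' -> V2 G -> {ae nu, forall z, CT z -> F z = F' z} -> Bip F G = Bip F' G.
Proof.
move=> h1 h2 h3 h; rewrite /Bip /Rintegral; congr fine.
have [m1 _] := integrableP _ _ _ (Bip_integrable h1 h3).
have [m2 _] := integrableP _ _ _ (Bip_integrable h2 h3).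
apply: ae_eq_integral; [exact: mCT|exact: m1|exact: m2|].
by apply: ae_volS h => z h Cz; rewrite /= h.
Qed.

Lemma Bip_bounds F : V2 F -> coerc * vip F F <= Bip F F <= cont * vip F F.
Proof.
move=> hF; have [i1 e1] := vipE oO hF hF; rewrite e1; have i2 := Bip_integrable hF hF.
rewrite -!RintegralZl//; [|exact: mCT|exact: mCT].
have iZ c : nu.-integrable CT (EFin \o (fun z => c * (dotp (F z) (F z) * wt z))).
  by have := integrableZl mCT c i1; apply: (@eq_integrable _ Em _ nu CT mCT) => z _; rewrite /= EFinM.
apply/andP; split; apply: le_Rintegral => //; try exact: mCT; try exact: iZ; try exact: i2.
- move=> z Cz; have w0 := ltW (wt_gt0 Cz); rewrite mulrA; apply: ler_wpM2r => //.
  by have /andP[] := Bmul_bounds (F z) Cz.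
- move=> z Cz; have w0 := ltW (wt_gt0 Cz); rewrite mulrA; apply: ler_wpM2r => //.
  by have /andP[] := Bmul_bounds (F z) Cz.
Qed.

Lemma bformE u v : bf u v = Bip (wg u) (wg v). Proof. by []. Qed.

Lemma bform_lin c u v w : W u -> W v -> W w -> bf (c *: u + v) w = c * bf u w + bf v w.
Proof.
move=> hu hv hw; rewrite !bformE; have [h1 h2 h3] := wg_lin oO c hu hv.
have Vu := H1w_V2 oO hu; have Vv := H1w_V2 oO hv; have Vw := H1w_V2 oO hw.
have V := V2_lin oO c Vu Vv.
by rewrite (Bip_ae h2 V Vw h3) Bip_lin.
Qed.

Lemma bform_sym u v : bf u v = bf v u. Proof. exact: Bip_sym. Qed.

Lemma bform_bounds u : W u -> coerc * eip u u <= bf u u <= cont * eip u u.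
Proof. by move=> hu; rewrite bformE; exact: (Bip_bounds (H1w_V2 oO hu)). Qed.

Lemma bform_ge0 u : W u -> 0 <= bf u u.
Proof.
move=> hu; have /andP[h _] := bform_bounds hu; apply: le_trans h.
by rewrite mulr_ge0 ?(ltW coerc_gt0)//; exact: eip_ge0.
Qed.

Lemma L2w_vnorm_sqr F : V2 F -> L2w_vnorm a CT F ^+ 2 = vip F F.
Proof.
move=> hF; have [_ ->] := vipE oO hF hF; rewrite /L2w_vnorm sqr_sqrtr; first by [].
by apply: Rintegral_ge0 => z _; apply: mulr_ge0; [exact: dotp_ge0|exact: powR_ge0].
Qed.

Lemma load_sqr_le c (f : 'rV[R]_d -> R^o) w : L2 Omega f -> L w ->
  load Omega T a c f w ^+ 2 <= c ^+ 2 * L2_norm Omega f ^+ 2 * ipO (tru w) (tru w).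
Proof.
move=> /L2P hf Lw; have [lt _] := trace_H1L oO bO T0 ha Lw.
have m1 : measurable_fun Omega (cst 1 : 'rV[R]_d -> R) by exact: measurable_cst.
have p1 (x : 'rV[R]_d) : Omega x -> 0 < (cst 1 : 'rV[R]_d -> R) x by [].
have ifl := l2_prod mO m1 p1 hf lt.
have -> : load Omega T a c f w = c * ipO f (tru w).
  rewrite /load /ip -RintegralZl//; last exact: mO.
  by apply: eq_Rintegral => x _; rewrite mulr1 mulrA.
rewrite L2_norm_sqr exprMn -mulrA; apply: ler_wpM2l; first exact: sqr_ge0.
exact: (ip_cauchy_schwarz mO m1 p1 hf lt).
Qed.

Section mesh.
Variables (gamma sigma : R) (M : seq (simplex (R := R) d)).
Hypotheses (hM : triangulates M CT) (hreg : shape_regular gamma M) (hqu : quasi_uniform sigma M).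
Local Notation VfM := (Vf Omega T a M).
Local Notation VmsM := (Vms Omega T a M A).

Lemma Vf_H1L w : VfM w -> L w. Proof. by case. Qed.

(** The Riesz theorem on the fine space, which is complete for the energy: it is closed in [H1L],
    and the energy form is equivalent to the Dirichlet form. *)
Lemma corrector_exists v : L v -> exists q : E -> R^o, is_corrector Omega T a M A v q.
Proof.
move=> Lv; have hv := H1L_H1w Lv.
have W1 w : VfM w -> W w by move=> /Vf_H1L/H1L_H1w.
have VL c (u w : E -> R^o) : VfM u -> VfM w -> VfM (c *: u + w) := @Vf_lin R d Omega T a gamma sigma M lO T0 ha hM hreg hqu c u w.
have V0 : VfM (0 : E -> R^o) := Vf0 lO T0 ha hM hreg hqu.
have bC u w : VfM u -> VfM w -> bf u w = bf w u by move=> _ _; exact: bform_sym.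
have bL c u w w' : VfM u -> VfM w -> VfM w' -> bf (c *: u + w) w' = c * bf u w' + bf w w'.
  by move=> /W1 h1 /W1 h2 /W1 h3; exact: bform_lin.
have b0 u : VfM u -> 0 <= bf u u by move=> /W1; exact: bform_ge0.
have VB := form_closedB VL.
have complete (u_ : nat -> E -> R^o) : (forall n, VfM (u_ n)) -> form_cauchy bf u_ -> exists2 p, VfM p & form_cvg bf u_ p.
  move=> hu cau.
  have [|p Lp cp] := H1L_complete oO bO T0 ha (fun n => Vf_H1L (hu n)).
    move=> e e0; have [N hN] := cau (coerc * e) (mulr_gt0 coerc_gt0 e0); exists N => n m Nn Nm.
    have /andP[h _] := bform_bounds (W1 _ (VB _ _ (hu n) (hu m))).
    by have := le_trans h (hN n m Nn Nm); rewrite ler_pM2l// coerc_gt0.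
  have Vp := Vf_closed lO T0 ha hM hreg hqu hu Lp cp.
  exists p => // e e0; have [N hN] := cp (e / cont) (divr_gt0 e0 cont_gt0); exists N => n Nn.
  have /andP[_ h] := bform_bounds (W1 _ (VB _ _ (hu n) Vp)).
  by apply: le_trans h _; rewrite mulrC -ler_pdivlMr ?cont_gt0//; exact: hN.
have lL c (u w : E -> R^o) : VfM u -> VfM w -> bf v (c *: u + w) = c * bf v u + bf v w.
  by move=> /W1 h1 /W1 h2; rewrite bform_sym (bform_lin c h1 h2 hv) !(bform_sym v).
have WL c (u w : E -> R^o) : W u -> W w -> W (c *: u + w) by exact: (H1w_lin oO c).
have CS w : VfM w -> bf v w ^+ 2 <= bf v v * bf w w.
  move=> /W1 hw.
  exact: (form_cauchy_schwarz WL (fun u w _ _ => bform_sym u w) bform_lin bform_ge0 hv hw).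
have [q Vq hq] := form_riesz V0 VL bC bL b0 complete lL CS.
by exists q; split.
Qed.

Lemma corrector_lin c v1 v2 (q1 q2 : E -> R^o) : L v1 -> L v2 -> is_corrector Omega T a M A v1 q1 -> is_corrector Omega T a M A v2 q2 ->
  is_corrector Omega T a M A (c *: v1 + v2) (c *: q1 + q2).
Proof.
move=> L1 L2' [V1 h1] [V2' h2]; split; first exact: (Vf_lin lO T0 ha hM hreg hqu).
move=> w Vw; have Ww := H1L_H1w (Vf_H1L Vw).
rewrite (bform_lin c (H1L_H1w (Vf_H1L V1)) (H1L_H1w (Vf_H1L V2')) Ww).
by rewrite (bform_lin c (H1L_H1w L1) (H1L_H1w L2') Ww) (h1 w Vw) (h2 w Vw).
Qed.

(** By definition of the corrector, a finite element function and its corrector have the same energy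
    product with every fine function. *)
Lemma Vms_orthogonal v w : VmsM v -> VfM w -> L v /\ bf v w = 0.
Proof.
move=> [vH [q [[_ LH] [Vq hq] ev]]] Vw.
have -> : v = (-1) *: (q : E -> R^o) + (vH : E -> R^o).
  by apply/funext => z; rewrite ev -[RHS]/(-1 * q z + vH z) mulN1r addrC.
have Lq := Vf_H1L Vq; split; first exact: (H1L_lin oO bO T0 ha).
rewrite (bform_lin _ (H1L_H1w Lq) (H1L_H1w LH) (H1L_H1w (Vf_H1L Vw))) hq// mulN1r addNr //.
Qed.

Lemma Vms_lin c v w : VmsM v -> VmsM w -> VmsM (c *: v + w).
Proof.
move=> [v1 [q1 [Vv1 c1 ->]]] [v2 [q2 [Vv2 c2 ->]]].
exists (c *: (v1 : E -> R^o) + (v2 : E -> R^o)), (c *: (q1 : E -> R^o) + (q2 : E -> R^o)); split.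
- exact: (VH_lin lO T0 ha hM).
- by apply: corrector_lin => //; [exact: Vv1.2|exact: Vv2.2].
apply/funext => z; rewrite -[LHS]/(c * (v1 z - q1 z) + (v2 z - q2 z)).
by rewrite -[RHS]/(c * v1 z + v2 z - (c * q1 z + q2 z)); ring.
Qed.

(* The coefficients of [u - (IH u - Q (IH u))] vanish because the
   quasi-interpolant is a projection onto its range. *)
Lemma fine_part u : L u -> exists2 v : E -> R^o, VmsM v & VfM (u - v).
Proof.
move=> Lu; have [Vi hi] := IH_spec lO T0 ha hM hreg hqu u.
have [_ Li] := Vi; have [q hq] := corrector_exists Li; have [Vq _] := hq.
have Lq := Vf_H1L Vq.
pose v : E -> R^o := (-1) *: q + (IH Omega T a M u : E -> R^o).
have Vv : VmsM v.
  exists (IH Omega T a M u), q; split => //.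
  by apply/funext => z; rewrite -[LHS]/(-1 * q z + IH Omega T a M u z) mulN1r addrC.
exists v; first exact: Vv.
have Lv : L v := H1L_lin oO bO T0 ha (-1) Lq Li.
apply/(VfP lO T0 ha hM hreg hqu); split; first exact: (form_closedB (H1L_lin oO bO T0 ha) Lu Lv).
move=> z zN nl; have [cl _ _] := coefP lO T0 ha hM hreg hqu zN nl.
have /(VfP lO T0 ha hM hreg hqu)[_ q0] := Vq.
rewrite -scaleN1r addrC (cl (-1) v u Lv Lu) (cl (-1) q _ Lq Li) q0// hi// mulr0 add0r mulN1r addNr //.
Qed.

Lemma multiscale_error c f u ums C :
  0 <= C -> (forall w, VfM w -> ipO (tru w) (tru w) <= C * eip w w) ->
  L2 Omega f -> L u -> (forall psi, L psi -> bf u psi = load Omega T a c f psi) ->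
  VmsM ums -> (forall v, VmsM v -> bf ums v = load Omega T a c f v) ->
  L2w_vnorm a CT (fun z => wgrad CT u z - wgrad CT ums z) <=
    `|c| / coerc * Num.sqrt C * L2_norm Omega f.
Proof.
move=> C0 hC hf Lu hu Vms_u hms.
have [v Vv Vw] := fine_part Lu; set w := (u : E -> R^o) - v in Vw.
have Lw := Vf_H1L Vw.
have [Lv _] := Vms_orthogonal Vv Vw; have [Lm _] := Vms_orthogonal Vms_u Vw.
have LB := form_closedB (H1L_lin oO bO T0 ha).
pose e : E -> R^o := u - (ums : E -> R^o).
have Le : L e by exact: (LB _ _ Lu Lm).
(* [eta] is an element of [Vms]: the error e is orthogonal to it by Galerkin orthogonality, and w
   because it is a fine function. *)
pose eta : E -> R^o := (-1) *: (ums : E -> R^o) + v.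
have Ve : VmsM eta by exact: Vms_lin.
have [Leta _] := Vms_orthogonal Ve Vw.
have ew : e = 1 *: w + eta.
  apply/funext => z; rewrite -[LHS]/(u z - ums z) -[RHS]/(1 * (u z - v z) + (-1 * ums z + v z)).
  by ring.
have Wf x : L x -> W x by exact: H1L_H1w.
have bW := form_closedB (H1w_lin oO).
have bB x y r : L x -> L y -> L r -> bf (x - y) r = bf x r - bf y r.
  move=> Lx Ly Lr; rewrite -scaleN1r addrC (bform_lin _ (Wf _ Ly) (Wf _ Lx) (Wf _ Lr)) mulN1r addrC //.
have e_eta : bf e eta = 0 by rewrite bB// hu// hms// subrr.
have eta_w : bf eta w = 0 by have [] := Vms_orthogonal Ve Vw.
have e_w : bf e w = load Omega T a c f w.
  by rewrite bB// hu//; have [_ ->] := Vms_orthogonal Vms_u Vw; rewrite subr0.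
have w_w : bf w w = load Omega T a c f w.
  by rewrite -e_w ew (bform_lin 1 (Wf _ Lw) (Wf _ Leta) (Wf _ Lw)) mul1r eta_w addr0.
(* Since e - w = eta is orthogonal to e, the energy of e is bf e w, which equals the load of w and
   hence the energy of w. *)
have e_e : bf e e = bf w w.
  rewrite {2}ew bform_sym (bform_lin 1 (Wf _ Lw) (Wf _ Leta) (Wf _ Le)) mul1r !(bform_sym _ e).
  by rewrite e_eta addr0 e_w.
have cg := coerc_gt0.
set X := bf w w in w_w e_e.
have X0 : 0 <= X by apply: bform_ge0; exact: Wf.
have N0 : 0 <= L2_norm Omega f by exact: sqrtr_ge0.
have hX : X <= c ^+ 2 * L2_norm Omega f ^+ 2 * C / coerc.
  have := load_sqr_le c hf Lw; rewrite -w_w => h1.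
  have /andP[h2 _] := bform_bounds (Wf _ Lw).
  have K0 : 0 <= c ^+ 2 * L2_norm Omega f ^+ 2 := mulr_ge0 (sqr_ge0 _) (sqr_ge0 _).
  exact: (energy_bound cg X0 K0 C0 h1 (hC _ Vw) h2).
have he : eip e e <= (`|c| / coerc * Num.sqrt C * L2_norm Omega f) ^+ 2.
  have /andP[h2 _] := bform_bounds (Wf _ Le); rewrite e_e in h2.
  rewrite (error_constant_sqr _ _ cg C0) (ler_pdivlMr _ _ cg) mulrC.
  exact: le_trans h2 hX.
have nn := error_constant_ge0 c C cg N0.
have Vu := H1w_V2 oO (Wf _ Lu); have Vm := H1w_V2 oO (Wf _ Lm).
have VB : V2 (wg u - wg ums) by exact: (form_closedB (V2_lin oO) Vu Vm).
apply: (ler_of_sqr nn); apply: le_trans he.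
have -> : L2w_vnorm a CT (fun z => wgrad CT u z - wgrad CT ums z) ^+ 2 = vip (wg u - wg ums) (wg u - wg ums).
  exact: (L2w_vnorm_sqr VB).
rewrite le_eqVlt; apply/orP; left; apply/eqP; apply: (vip_ae2 oO VB).
  exact: (H1w_V2 oO (Wf _ Le)).
have [_ _ hae] := wg_lin oO (-1) (Wf _ Lm) (Wf _ Lu).
have ee : e = (-1) *: (ums : E -> R^o) + u.
  by apply/funext => z; rewrite -[LHS]/(u z - ums z) -[RHS]/(-1 * ums z + u z); ring.
apply: ae_volS hae => z h Cz; have {}h := h Cz; rewrite ee h.
by rewrite -[LHS]/(wg u z - wg ums z) -[RHS]/(-1 *: wg ums z + wg u z) scaleN1r addrC.
Qed.

End mesh.
End multiscale_estimate.

Theorem theorem5p1 (R : realType) (d : nat) (Omega : set 'rV[R]_d)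
    (T s alpha beta gamma sigma : R) :
  (0 < d)%N -> lipschitz_domain Omega -> 0 < T -> 0 < s < 1 ->
  0 < alpha -> 0 < beta ->
  let a := 1 - 2 * s in
  let CT := cylinder Omega T in
  exists C : R, 0 < C /\
  forall (A : 'rV[R]_d -> 'M[R]_d) (M : seq (simplex (R := R) d))
    (f : 'rV[R]_d -> R) (u ums : 'rV[R]_d * R -> R),
  elliptic Omega alpha beta A ->
  triangulates M CT -> shape_regular gamma M -> quasi_uniform sigma M ->
  L2 Omega f ->
  H1L Omega T a u ->
  (forall psi, H1L Omega T a psi ->
     bform Omega T a A u psi = load Omega T a (c_frac s) f psi) ->
  Vms Omega T a M A ums ->
  (forall v, Vms Omega T a M A v ->
     bform Omega T a A ums v = load Omega T a (c_frac s) f v) ->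
  L2w_vnorm a CT (fun z => wgrad CT u z - wgrad CT ums z)
    <= C * mesh_size M `^ s * L2_norm Omega f.
Proof.
move=> d0 lO T0 /andP[s0 s1] al0 be0 a CT.
have ha : -1 < a < 1 by rewrite /a; apply/andP; split; lra.
have [C C0 hC] := trace_Vf_le gamma sigma lO T0 ha.
have cg := coerc_gt0 al0.
(* The summand 1 secures positivity whatever the value of [c_frac s]. *)
exists (`|c_frac s| / coerc alpha * Num.sqrt C + 1); split.
  by rewrite ltr_wpDl// mulr_ge0 ?sqrtr_ge0// divr_ge0// ltW.
move=> A M f u ums hA hM hreg hqu hf Lu hu hms hums.
have H0 : 0 < mesh_size M by exact: (mesh_size_gt0 lO T0 hM).
(* As 1 - a = 2 s, the square root of the trace constant yields the power s of the mesh size. *)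
have Hs : mesh_size M `^ (1 - a) = (mesh_size M `^ s) ^+ 2.
  rewrite -powR_mulrn ?powR_ge0// -powRrM; congr (_ `^ _).
  by rewrite /a; ring.
have hw w : Vf Omega T a M w -> ip (leb d) Omega (cst 1) (trace Omega T a w) (trace Omega T a w) <=
    (C * mesh_size M `^ (1 - a)) * eip Omega T a w w by exact: hC.
have CH0 : 0 <= C * mesh_size M `^ (1 - a) by rewrite mulr_ge0 ?powR_ge0// ltW.
have key := multiscale_error lO T0 ha al0 hA hM hreg hqu CH0 hw hf Lu hu hms hums.
apply: le_trans key _.
apply: ler_wpM2r; first exact: sqrtr_ge0.
rewrite Hs (sqrtrM _ (ltW C0)) sqrtr_sqr (ger0_norm (powR_ge0 _ _)) mulrA; apply: ler_wpM2r; first exact: powR_ge0.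
by rewrite lerDl.
Qed.
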